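(* Let $f\colon\mathbb{C}\to\mathbb{C}$ be a transcendental entire function and let $U$ be an invariant Fatou component of $f$ such that $\infty$ is accessible from $U$. Let $\varphi\colon\mathbb{D}\to U$ be a Riemann map and let $g=\varphi^{-1}\circ f\circ\varphi$ be the corresponding associated inner function. Assume that $U$ is postsingularly separated (PS). Then the following hold. (a) Let $e^{i\theta}\in\partial\mathbb{D}$. If $e^{i\theta}\in\Theta_{\mathbb{C}}$, then $e^{i\theta}$ is not a singularity of $g$ and $g(e^{i\theta})\in\Theta_{\mathbb{C}}$. In particular, if for some $n\ge1$ the point $e^{i\theta}\in\partial\mathbb{D}$ is a singularity of $g^n$, then $e^{i\theta}\in\Theta_\infty$. (b) For Lebesgue-almost every $e^{i\theta}\in\partial\mathbb{D}$ there exists $r=r(e^{i\theta})>0$ such that $g$ is holomorphic in $D(e^{i\theta},r)$. In particular, the set $\mathrm{Sing}(g)$ has zero Lebesgue measure. (c) For Lebesgue-almost every $e^{i\theta}\in\partial\mathbb{D}$ there exists $r=r(e^{i\theta})>0$ such that, for all $n\ge0$, all branches $G_n$ of $g^{-n}$ are well-defined in $D(e^{i\theta},r)$. Moreover, for every $n\ge1$ there exists $\rho=\rho(e^{i\theta},n)>0$ such that $g^n$ is holomorphic in $D(e^{i\theta},\rho)$. (d) Let $e^{i\theta}\in\partial\mathbb{D}$ be a singularity of $g$ and assume that the radial limit $g^*(e^{i\theta})$ exists. Then either $g^*(e^{i\theta})\in\mathbb{D}$ and $\varphi(g^*(e^{i\theta}))\in U$ is an asymptotic value of $f$; or $g^*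(e^{i\theta})\in\Theta_\infty$.
   Context: A Fatou component $U$ is invariant if $f(U)\subset U$; for transcendental entire $f$ it is then simply connected. $\infty$ is accessible from $U$ if there is a curve $\gamma\colon[0,1)\to U$ with $\gamma(t)\to\infty$ as $t\to1^-$. $SV(f)$ is the set of singular values of $f$ (points of $\mathbb{C}$ around which not every branch of $f^{-1}$ is locally well-defined), and $P(f)=\overline{\bigcup_{s\in SV(f)}\bigcup_{n\ge0}f^n(s)}$ is the postsingular set (closure in $\mathbb{C}$). $U$ is postsingularly separated (PS) if there is a domain $V$ with $\overline V\subset U$ (closure in $\mathbb{C}$) and $P(f)\cap U\subset V$. Radial limits: $\varphi^*(e^{i\theta})=\lim_{r\to1^-}\varphi(re^{i\theta})\in\widehat{\mathbb{C}}$ and $g^*(e^{i\theta})=\lim_{r\to1^-}g(re^{i\theta})$, when they exist. $\Theta_\infty=\{e^{i\theta}\in\partial\mathbb{D}:\varphi^*(e^{i\theta})=\infty\}$ and $\Theta_{\mathbb{C}}=\partial\mathbb{D}\smallsetminus\Theta_\infty$ (for points of $\Theta_{\mathbb{C}}$ the radial limit need not exist). $g$ is an inner function: a holomorphic self-map of $\mathbb{D}$ with $g^*(e^{i\theta})\in\partial\mathbb{D}$ for almost every $\theta$. A point $e^{i\theta}\in\partial\mathbb{D}$ is a singularity of an inner function $h$ if $h$ cannot be continued analytically to a neighbourhood of $e^{i\theta}$; $\mathrm{Sing}(h)$ is the set of singularities. $g$ is always considered in its maximal extension $g\colon\widehat{\mathbb{C}}\smallsetminus\mathrm{Sing}(g)\to\widehat{\mathbb{C}}$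 (by reflection to $\widehat{\mathbb{C}}\smallsetminus\overline{\mathbb{D}}$ and by analytic continuation to $\partial\mathbb{D}\smallsetminus\mathrm{Sing}(g)$). $D(a,r)$ is the Euclidean disk of centre $a$ and radius $r$. An asymptotic value of $f$ is a point $a\in\mathbb{C}$ such that $f(\gamma(t))\to a$ as $t\to1^-$ for some curve $\gamma\colon[0,1)\to\mathbb{C}$ with $\gamma(t)\to\infty$. *)

(* Defs.v *)
From HB Require Import structures.
From mathcomp Require Import all_boot all_order all_algebra.
From mathcomp Require Import complex.
From mathcomp Require Import all_classical all_reals all_analysis.

Set Implicit Arguments.
Unset Strict Implicit.
Unset Printing Implicit Defensive.

Import Order.TTheory GRing.Theory Num.Theory.
Import numFieldNormedType.Exports.

Local Open Scope classical_set_scope.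
Local Open Scope ring_scope.

(* The complex plane is R[i], in MathComp-Analysis.  It gets the usual structures
   of a numClosedFieldType over itself; its ball
   topology is the Euclidean one. *)
HB.instance Definition _ (R : realType) := GRing.ComAlgebra.copy R[i] R[i]^o.
HB.instance Definition _ (R : realType) := Vector.copy R[i] R[i]^o.
HB.instance Definition _ (R : realType) := NormedModule.copy R[i] R[i]^o.

(* The Riemann sphere; [None] is the point at infinity. *)
Notation Chat R := (one_point_compactification R[i]).

Section ComplexPlane.
Context {R : realType}.
Implicit Types (z w zeta : R[i]) (r : R) (A : set R[i]).

Definition fin z : Chat R := Some z.
Definition infty : Chat R := None.

Definition cmod z : R := complex.Re `|z|.

Definition disk z r : set R[i] := [set w | cmod (w - z) < r].
Definition unit_disk : set R[i] := disk 0 1.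
Definition unit_circle : set R[i] := [set z | cmod z = 1].

Definition cis (t : R) : R[i] := Complex (cos t) (sin t).

Definition domain A : Prop := [/\ open A, A !=set0 & connected A].

(* Meant for open [A]: [derivable h z 1] is then complex differentiability. *)
Definition holomorphic_on A (h : R[i] -> R[i]) : Prop :=
  forall z, A z -> derivable h z 1.

Definition sphere_inv (x : Chat R) : Chat R :=
  match x with
  | None => fin 0
  | Some z => if z == 0 then infty else fin z^-1
  end.

(* Holomorphic maps from an open subset of the plane to the Riemann sphere:
   locally [H] or [1 / H] is a complex-valued holomorphic function. *)
Definition sphere_holomorphic_on A (H : R[i] -> Chat R) : Prop :=
  forall z, A z -> exists h : R[i] -> R[i],
    (\forall w \near z, derivable h w 1 /\ H w = fin (h w)) \/
    (\forall w \near z, derivable h w 1 /\ H w = sphere_inv (fin (h w))).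

Definition chordal (x y : Chat R) : R :=
  match x, y with
  | Some a, Some b =>
      2 * cmod (a - b) /
        (Num.sqrt (1 + cmod a ^+ 2) * Num.sqrt (1 + cmod b ^+ 2))
  | Some a, None | None, Some a => 2 / Num.sqrt (1 + cmod a ^+ 2)
  | None, None => 0
  end.

Definition circle_negligible A : Prop :=
  (@lebesgue_measure R).-negligible (`[0, 2 * pi[%classic `&` cis @^-1` A).

Definition ae_circle (P : R[i] -> Prop) : Prop :=
  circle_negligible [set zeta | ~ P zeta].

Definition curve_to_infty (gamma : R -> R[i]) : Prop :=
  {within `[0, 1[%classic, continuous gamma} /\
  fin (gamma t) @[t --> (1 : R)^'-] --> infty.

Definition infty_accessible (U : set R[i]) : Prop :=
  exists gamma : R -> R[i],
    curve_to_infty gamma /\ forall t, `[0, 1[%classic t -> U (gamma t).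

Definition radial_limit (h : R[i] -> R[i]) zeta (l : Chat R) : Prop :=
  fin (h (real_complex R r * zeta)) @[r --> (1 : R)^'-] --> l.

End ComplexPlane.

Section Dynamics.
Context {R : realType}.
Implicit Types (f : R[i] -> R[i]) (U : set R[i]).

Definition transcendental_entire f : Prop :=
  holomorphic_on setT f /\ ~ exists p : {poly R[i]}, forall z, f z = p.[z].

Definition locally_uniform_cvg (W : set R[i]) (u : nat -> R[i] -> R[i])
    (l : R[i] -> Chat R) : Prop :=
  forall K : set R[i], compact K -> K `<=` W -> forall e : R, 0 < e ->
    \forall n \near \oo, forall z, K z -> chordal (fin (u n z)) (l z) < e.

Definition normal_family (W : set R[i]) (F : set (R[i] -> R[i])) : Prop :=
  forall u : nat -> R[i] -> R[i], (forall n, F (u n)) ->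
    exists2 s : nat -> nat, {homo s : m n / (m < n)%N} &
      exists l : R[i] -> Chat R, locally_uniform_cvg W (u \o s) l.

Definition fatou_set f : set R[i] :=
  [set z | exists W : set R[i],
    [/\ open W, W z & normal_family W (range (fun n => iter n f))]].

Definition fatou_component f U : Prop :=
  exists2 z, fatou_set f z & U = connected_component (fatou_set f) z.

Definition invariant_component f U : Prop := f @` U `<=` U.

(* For a map [F] defined on a subset [X] of the sphere: all branches of the
   inverse of [F] are well-defined in [D], i.e. every preimage of every point
   of [D] lies on a holomorphic branch of the inverse defined on all of [D]. *)
Definition inverse_branches_defined (X : set (Chat R))
    (F : Chat R -> Chat R) (D : set R[i]) : Prop :=
  forall x w, X x -> D w -> F x = fin w ->
    exists G : R[i] -> Chat R,
      [/\ sphere_holomorphic_on D G,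
          forall v, D v -> X (G v) /\ F (G v) = fin v &
          G w = x].

Definition singular_values f : set R[i] :=
  [set v | ~ exists2 r : R, 0 < r &
    inverse_branches_defined (range fin) (omap f) (disk v r)].

Definition postsingular_set f : set R[i] :=
  closure (\bigcup_n (iter n f @` singular_values f)).

Definition postsingularly_separated f U : Prop :=
  exists V : set R[i],
    [/\ domain V, closure V `<=` U & postsingular_set f `&` U `<=` V].

Definition asymptotic_value f (a : R[i]) : Prop :=
  exists gamma : R -> R[i],
    curve_to_infty gamma /\ f (gamma t) @[t --> (1 : R)^'-] --> a.

Definition riemann_map U (phi : R[i] -> R[i]) : Prop :=
  holomorphic_on unit_disk phi /\ set_bij unit_disk U phi.

(* Only the values in the unit disk are meaningful. *)
Definition associated_map f (phi : R[i] -> R[i]) : R[i] -> R[i] :=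
  'pinv_(fun=> 0) unit_disk phi \o f \o phi.

Definition Theta_infty (phi : R[i] -> R[i]) : set R[i] :=
  [set zeta | unit_circle zeta /\ radial_limit phi zeta infty].

Definition Theta_C (phi : R[i] -> R[i]) : set R[i] :=
  unit_circle `\` Theta_infty phi.

End Dynamics.

(* Inner functions, given as maps [h] of which only the values in the unit
   disk are used, and their maximal extensions. *)
Section Inner.
Context {R : realType}.
Implicit Types (h H : R[i] -> R[i]) (zeta : R[i]).

Definition continues_at h zeta H : Prop :=
  exists2 r : R, 0 < r &
    holomorphic_on (disk zeta r) H /\
    forall z, disk zeta r z -> unit_disk z -> H z = h z.

Definition Sing h : set R[i] :=
  [set zeta | unit_circle zeta /\ ~ exists H, continues_at h zeta H].

Definition reflection (x : Chat R) : Chat R :=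
  sphere_inv (omap (@conjc R) x).

(* The set is a singleton when [zeta] is a point of the circle that is not a
   singularity of [h]. *)
Definition boundary_value h zeta : R[i] :=
  xget 0 [set H zeta | H in continues_at h zeta].

Definition maximal_domain h : set (Chat R) := ~` (fin @` Sing h).

(* On [fin @` Sing h] the value is irrelevant. *)
Definition maximal_extension h (x : Chat R) : Chat R :=
  match x with
  | Some z =>
      if cmod z < 1 then fin (h z)
      else if cmod z == 1 then fin (boundary_value h z)
      else reflection (omap h (reflection x))
  | None => reflection (omap h (reflection x))
  end.

Definition extension_holomorphic_on h (A : set R[i]) : Prop :=
  exists2 H, holomorphic_on A H &
    forall z, A z ->
      maximal_domain h (fin z) /\ maximal_extension h (fin z) = fin (H z).

End Inner.

(* Main.v *)
Require Import Defs.
From mathcomp Require Import all_boot all_order all_algebra.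
From mathcomp Require Import complex.
From mathcomp Require Import all_classical all_reals all_analysis.
From mathcomp Require Import measurable_realfun.
From mathcomp Require Import ring lra.

Import Order.TTheory GRing.Theory Num.Theory.
Import numFieldNormedType.Exports.

Local Open Scope classical_set_scope.
Local Open Scope ring_scope.

Local Notation "x %:C" := (real_complex _ x) : ring_scope.

(* The Riemann map [phi] omits a value, hence there is a positive harmonic function
   [V = Re F] on the disk which is large exactly where [phi] is large; a point of the
   circle is in [Theta_infty] iff [V] tends to infinity along its radius.  This set is
   null by Fatou's lemma, the circle means of [V] being constant.

   Let [W] be the preimage by [phi] of the separating domain.  Separation means that [V]
   tends to infinity at the circle along [W].  If a connected set with this property
   accumulates at [zeta], then [V] also tends to infinity radially at [zeta] (an integral
   along a path in that set and its mirror image); so [W] stays away from [Theta_C], and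
   the property passes from [W] to the set where a gauge of [W] is at most 1, and then to
   the preimage of this set under [g].  If [g] took values in [disk 0 (1 / 2)] at points
   accumulating at [zeta], then sliding [g z] radially to [gauge <= 1], a motion that
   avoids the postsingular set and so lifts through [g], would give connected subsets of
   this preimage accumulating at [zeta], and [zeta] would be in [Theta_infty].

   Hence [1 / 2 < |g|] near a point of [Theta_C]; there, a barrier argument gives
   [1 - |g z| = O(1 - |z|)] (where the limit of [|g|] may fail to be 1, [V] is infinite),
   [g] is Lipschitz by the Schwarz-Pick lemma, and extends by reflection.  The image of the
   point is in [Theta_C] by Harnack's inequality.  A branch of [g^-n] on the part in the
   unit disk of a disk missing [W] extends across the circle in the same way, and by Hopf's
   lemma its extension is locally invertible there, which makes [g^n] continue
   analytically to the boundary values of the branch. *)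

Set Implicit Arguments.
Unset Strict Implicit.
Unset Printing Implicit Defensive.

(** * Modulus, derivatives, exponential *)

(** Everything known at the circle is expressed by the growth of [V]. The bridge from dynamics to
    growth is that a boundary point of [U] cannot be mapped into [U]: a finite limit of [phi] along
    the preimage by [g] of an escaping set would be such a point, so the preimage escapes as well.
    Applied to [disk 0 (expR (- e))], which does not reach the circle, this gives
    [- ln |g| <= e * (1 + V)] near a point where [g] is bounded away from 0. As [V] is finite
    inside, the maximum principle followed by [e -> 0] removes the right side. The gauge is there
    because the radial slide needs a continuous target. It is less than 1 on [W], so points where it
    is at least 1 avoid the postsingular set, and it is Lipschitz because every cone contains the
    whole disk of radius 1/2. That disk also explains the threshold 1/2 for [|g|]: values in it are
    not moved by the slide. The radius in (c) does not depend on [n] because the postsingular set is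
    forward invariant: a disk that misses [W] carries the branches of all [g^-n]. *)

Section Cmod.
Context {R : realType}.
Implicit Types (z w : R[i]) (r : R).

Lemma normC_cmod z : `|z| = (cmod z)%:C.
Proof. by rewrite /cmod normc_def. Qed.

Lemma cmodE z : cmod z = Num.sqrt (complex.Re z ^+ 2 + complex.Im z ^+ 2).
Proof. by rewrite /cmod normc_def. Qed.

Lemma cmod_normc z : cmod z = Normc.normc z.
Proof. by rewrite cmodE; case: z. Qed.

Lemma cmod_ge0 z : 0 <= cmod z.
Proof. by rewrite cmodE sqrtr_ge0. Qed.

Lemma cmodM z w : cmod (z * w) = cmod z * cmod w.
Proof. by rewrite !cmod_normc Normc.normcM. Qed.

Lemma cmod0 : cmod (0 : R[i]) = 0.
Proof. by rewrite cmodE /= expr0n /= addr0 sqrtr0. Qed.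

Lemma cmod1 : cmod (1 : R[i]) = 1.
Proof. by rewrite cmodE /= expr1n expr0n /= addr0 sqrtr1. Qed.

Lemma cmodD z w : cmod (z + w) <= cmod z + cmod w.
Proof. by rewrite !cmod_normc; apply: complex.le_normcD. Qed.

Lemma cmodN z : cmod (- z) = cmod z.
Proof. by rewrite !cmodE /=; case: z => a b /=; rewrite !sqrrN. Qed.

Lemma cmodBC z w : cmod (z - w) = cmod (w - z).
Proof. by rewrite -cmodN opprB. Qed.

Lemma cmodB z w : cmod (z - w) <= cmod z + cmod w.
Proof. by rewrite -(cmodN w) cmodD. Qed.

Lemma cmodV z : cmod z^-1 = (cmod z)^-1.
Proof. by rewrite !cmod_normc Normc.normcV. Qed.

Lemma cmodf z w : cmod (z / w) = cmod z / cmod w.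
Proof. by rewrite cmodM cmodV. Qed.

Lemma cmodX z n : cmod (z ^+ n) = cmod z ^+ n.
Proof. by elim: n => [|n IH]; rewrite ?expr0 ?cmod1 // !exprS cmodM IH. Qed.

Lemma cmod_eq0 z : (cmod z == 0) = (z == 0).
Proof.
apply/eqP/eqP => [|->]; last exact: cmod0.
by rewrite cmod_normc => /Normc.eq0_normc.
Qed.

Lemma cmod_gt0 z : (0 < cmod z) = (z != 0).
Proof. by rewrite lt_def cmod_ge0 andbT cmod_eq0. Qed.

Lemma cmod_conj z : cmod (conjc z) = cmod z.
Proof. by rewrite !cmodE; case: z => a b /=; rewrite sqrrN. Qed.

Lemma cmod_real r : cmod (r%:C) = `|r|.
Proof. by rewrite cmodE /= expr0n /= addr0 sqrtr_sqr. Qed.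

Lemma cmod_real0 r : 0 <= r -> cmod (r%:C) = r.
Proof. by move=> r0; rewrite cmod_real ger0_norm. Qed.

Lemma normRe_le z : `|complex.Re z| <= cmod z.
Proof. by rewrite cmodE -sqrtr_sqr ler_wsqrtr // lerDl sqr_ge0. Qed.

Lemma normIm_le z : `|complex.Im z| <= cmod z.
Proof. by rewrite cmodE -sqrtr_sqr ler_wsqrtr // lerDr sqr_ge0. Qed.

Lemma Re_le_cmod z : complex.Re z <= cmod z.
Proof. exact: le_trans (ler_norm _) (normRe_le z). Qed.

Lemma Im_le_cmod z : complex.Im z <= cmod z.
Proof. exact: le_trans (ler_norm _) (normIm_le z). Qed.

Lemma cmod_sqr z : cmod z ^+ 2 = complex.Re z ^+ 2 + complex.Im z ^+ 2.
Proof. by rewrite cmodE sqr_sqrtr // addr_ge0 // sqr_ge0. Qed.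

Lemma cmod_le_add z : cmod z <= `|complex.Re z| + `|complex.Im z|.
Proof.
rewrite -(@ler_pXn2r _ 2) ?nnegrE ?addr_ge0 ?cmod_ge0 //.
rewrite cmod_sqr sqrrD !real_normK ?num_real //.
rewrite -addrA lerD2l lerDr mulrn_wge0 // mulr_ge0 //.
Qed.

Lemma cmod_triang z w x : cmod (z - x) <= cmod (z - w) + cmod (w - x).
Proof. by have := cmodD (z - w) (w - x); rewrite addrA subrK. Qed.

Lemma cmod_sub_ge z w : cmod z - cmod w <= cmod (z - w).
Proof. by rewrite lerBlDr; have := cmodD (z - w) w; rewrite subrK. Qed.

Lemma cmod_le_subD z w : cmod z <= cmod (z - w) + cmod w.
Proof. by have := cmodD (z - w) w; rewrite subrK. Qed.

Lemma cmod_dist z w : `|cmod z - cmod w| <= cmod (z - w).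
Proof.
rewrite ler_norml cmod_sub_ge andbT lerNl opprB cmodBC.
exact: cmod_sub_ge.
Qed.

Lemma conjcM_cmod z : z * conjc z = (cmod z ^+ 2)%:C.
Proof.
rewrite cmod_sqr; case: z => a b; apply/eqP; rewrite eq_complex /=.
by apply/andP; split; apply/eqP; ring.
Qed.

Lemma conjcR r : conjc (r%:C) = r%:C.
Proof. by apply/eqP; rewrite eq_complex /= oppr0 !eqxx. Qed.

Lemma conjcN z : conjc (- z) = - conjc z.
Proof. by case: z. Qed.

Lemma realC_eq0 r : (r%:C == 0) = (r == 0).
Proof. by rewrite eq_complex /= eqxx andbT. Qed.

Lemma disk_center z r : 0 < r -> disk z r z.
Proof. by move=> r0; rewrite /disk /= subrr cmod0. Qed.

Lemma disk_ball z r : disk z r = ball z (r%:C).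
Proof.
apply/seteqP; split => w; rewrite /disk -ball_normE /= distrC normC_cmod ltcR //.
Qed.

Lemma nbhs_diskP z (A : set R[i]) :
  nbhs z A <-> exists2 r, 0 < r & disk z r `<=` A.
Proof.
split=> [/nbhs_ballP[e /= e0 eA]|[r r0 rA]].
  have [e1 e2] : 0 < complex.Re e /\ e = (complex.Re e)%:C.
    by move: e0; case: (e) => a b; rewrite ltcE /= => /andP[/eqP -> ->].
  by exists (complex.Re e) => //; rewrite disk_ball -e2.
apply/nbhs_ballP; exists r%:C => /=; first by rewrite ltcR.
by rewrite -disk_ball.
Qed.

Lemma disk_open z r : open (disk z r).
Proof.
rewrite openE => w wr; apply/nbhs_diskP.
exists (r - cmod (w - z)); first by rewrite subr_gt0.
move=> x; rewrite /disk /= ltrBrDr => xw.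
exact: le_lt_trans (cmod_triang x w z) xw.
Qed.

Lemma open_diskP (A : set R[i]) :
  open A <-> forall z, A z -> exists2 r, 0 < r & disk z r `<=` A.
Proof.
split=> [|H]; first by rewrite openE => oA z /oA /nbhs_diskP.
by rewrite openE => z /H /nbhs_diskP.
Qed.

Lemma near_diskP z (P : R[i] -> Prop) :
  (\forall w \near z, P w) <-> exists2 r, 0 < r & forall w, disk z r w -> P w.
Proof. exact: nbhs_diskP. Qed.

Lemma closure_diskP (A : set R[i]) z :
  closure A z <-> forall r, 0 < r -> exists2 w, A w & disk z r w.
Proof.
split=> [clA r r0|H B /nbhs_diskP[r r0 rB]].
  have [|w [Aw wr]] := clA (disk z r); last by exists w.
  by apply/nbhs_diskP; exists r.
by have [w Aw wr] := H _ r0; exists w; split => //; exact: rB.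
Qed.

Lemma sub_disk z r r' : r <= r' -> disk z r `<=` disk z r'.
Proof. by move=> rr' w /lt_le_trans; apply. Qed.

Lemma disk_sub z w r r' : cmod (w - z) + r' <= r -> disk w r' `<=` disk z r.
Proof.
move=> H x; rewrite /disk /= => xw; apply: le_lt_trans (cmod_triang x w z) _.
by apply: lt_le_trans H; rewrite addrC ltrD2l.
Qed.

Definition ccont (f : R[i] -> R[i]) z :=
  forall e : R, 0 < e -> exists2 d, 0 < d &
    forall w, cmod (w - z) < d -> cmod (f w - f z) < e.

Lemma ccontP f z : ccont f z <-> {for z, continuous f}.
Proof.
split => [H B /nbhs_diskP[r r0 rB]|H e e0].
  have [d d0 dH] := H _ r0; apply/nbhs_diskP; exists d => // w wd.
  by apply: rB; exact: dH.
have : nbhs (f z) (disk (f z) e) by apply/nbhs_diskP; exists e.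
by move=> /H /nbhs_diskP[d d0 dH]; exists d.
Qed.

(** The derivative as a first-order expansion: without a quotient, [w = z] needs no exclusion and
    error terms simply add up. *)
Definition cder (f : R[i] -> R[i]) z (l : R[i]) :=
  forall e : R, 0 < e -> exists2 d, 0 < d &
    forall w, cmod (w - z) < d ->
      cmod (f w - f z - l * (w - z)) <= e * cmod (w - z).

Lemma cder_derivable f z l : cder f z l -> derivable f z (1 : R[i]).
Proof.
move=> H; apply/cvg_ex; exists l.
apply/cvgrPdist_le => e e0.
have [e1 e2] : 0 < complex.Re e /\ e = (complex.Re e)%:C.
  by move: e0; case: (e) => a b; rewrite ltcE /= => /andP[/eqP -> ->].
have [d d0 dH] := H _ e1.
rewrite /dnbhs /within /=; apply/near_diskP; exists d => // w.
rewrite /disk /= subr0 => wd w0.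
rewrite e2 normC_cmod lecR.
have := dH (z + w); rewrite addrAC subrr add0r => /(_ wd).
move=> K; rewrite -[X in X <= _](mulfK (_ : cmod w != 0)) ?cmod_eq0 //.
rewrite ler_pdivrMr ?cmod_gt0 //; apply: le_trans K.
rewrite -cmodM.
have -> : w *: (1 : R[i]) = w by exact: mulr1.
rewrite -cmodN [X in cmod X <= _](_ : _ = f (z + w) - f z - l * w) // mulrBl opprB.
congr (_ - _); rewrite -[_ *: _]/(w^-1 * _) mulrAC mulVf // mul1r.
by rewrite [w + z]addrC.
Qed.

Lemma derivable_cder f z : derivable f z (1 : R[i]) -> exists l, cder f z l.
Proof.
move=> /cvg_ex[l /cvgrPdist_le H]; exists l => e e0.
have := H e%:C; rewrite ltcR => /(_ e0).
rewrite /dnbhs /within /= => /near_diskP[d d0 dH]; exists d => // w wd.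
have [->|wz] := eqVneq w z.
  by rewrite !subrr mulr0 subrr cmod0 mulr0.
have w0 : w - z != 0 by rewrite subr_eq0.
have := dH (w - z); rewrite /disk /= subr0 => /(_ wd w0).
have -> : (w - z) *: (1 : R[i]) = w - z by exact: mulr1.
rewrite subrK normC_cmod lecR => K.
rewrite -ler_pdivrMr ?cmod_gt0 // -cmodf; apply: le_trans K.
rewrite cmodBC mulrBl mulfK //.
by rewrite /GRing.scale /= mulrC.
Qed.

Lemma cderivableP f z : derivable f z (1 : R[i]) <-> exists l, cder f z l.
Proof. by split => [/derivable_cder//|[l /cder_derivable]]. Qed.

End Cmod.

(** * Derivatives of complex-valued paths *)

Section RealCalculus.
Context {R : realType}.
Implicit Types (z w l : R[i]) (r t s : R).

Lemma rder_is_derive (u : R -> R) t (l : R) :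
  (forall e : R, 0 < e -> exists2 d, 0 < d & forall s, `|s - t| < d ->
      `|u s - u t - l * (s - t)| <= e * `|s - t|) <-> is_derive t (1 : R) u l.
Proof.
split => [H|[du ul]].
  have K : (fun h => h^-1 *: (u (h *: (1 : R) + t) - u t)) @ 0^' --> l.
    apply/cvgrPdist_le => e e0; have [d d0 dH] := H _ e0.
    rewrite /dnbhs /within /=; apply/nbhs_ballP; exists d => //= h.
    rewrite -ball_normE /= sub0r normrN => hd h0.
    have := dH (t + h); rewrite addrAC subrr add0r => /(_ hd) K.
    rewrite -[X in X <= _](mulfK (_ : `|h| != 0)) ?normr_eq0 //.
    rewrite ler_pdivrMr ?normr_gt0 //; apply: le_trans K.
    rewrite -normrM -normrN mulrBl opprB.
    rewrite [_ *: (1 : R)]mulr1 [h + t]addrC.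
    by rewrite -[_ *: _]/(h^-1 * _) mulrAC mulVf // mul1r.
  split; first by apply/cvg_ex; exists l.
  exact: cvg_lim K.
move=> e e0; move: du; rewrite /derivable => cu.
have {cu ul} : (fun h => h^-1 *: (u (h *: (1 : R) + t) - u t)) @ 0^' --> l.
  by rewrite -ul; exact: cu.
move=> /cvgrPdist_le /(_ _ e0); rewrite /dnbhs /within /= => /nbhs_ballP[d /= d0 dH].
exists d => // s sd; have [->|st] := eqVneq s t.
  by rewrite !subrr mulr0 subrr normr0 mulr0.
have st0 : s - t != 0 by rewrite subr_eq0.
have := dH (s - t); rewrite -ball_normE /= sub0r normrN => /(_ sd st0).
rewrite [_ *: (1 : R)]mulr1 subrK => K.
rewrite -ler_pdivrMr ?normr_gt0 // -normfV -normrM.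
by apply: le_trans K; rewrite distrC mulrBl mulfK // [_ *: _]mulrC.
Qed.

(** [R[i]] is used as a normed module over itself, not over [R], so the derivative of a path is
    spelled out; [rcder_is_derive] reduces it to the two real components. *)
Definition rcder (h : R -> R[i]) t l :=
  forall e : R, 0 < e -> exists2 d, 0 < d & forall s, `|s - t| < d ->
      cmod (h s - h t - l * (s - t)%:C) <= e * `|s - t|.

Lemma rcder_is_derive h t l : rcder h t l <->
  is_derive t (1 : R) (fun s => complex.Re (h s)) (complex.Re l) /\
  is_derive t (1 : R) (fun s => complex.Im (h s)) (complex.Im l).
Proof.
have reE s : complex.Re (h s - h t - l * (s - t)%:C) =
   complex.Re (h s) - complex.Re (h t) - complex.Re l * (s - t).
  case: (h s) (h t) l => [a b] [a' b'] [c d] /=; ring.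
have imE s : complex.Im (h s - h t - l * (s - t)%:C) =
   complex.Im (h s) - complex.Im (h t) - complex.Im l * (s - t).
  case: (h s) (h t) {reE} l => [a b] [a' b'] [c d] /=; ring.
split => [H|[/rder_is_derive H1 /rder_is_derive H2] e e0].
  split; apply/rder_is_derive => e e0; have [d d0 dH] := H _ e0; exists d => // s sd.
    by rewrite -reE; apply: le_trans (normRe_le _) (dH _ sd).
  by rewrite -imE; apply: le_trans (normIm_le _) (dH _ sd).
have e20 : 0 < e / 2 by rewrite divr_gt0.
have [d1 d10 dH1] := H1 _ e20; have [d2 d20 dH2] := H2 _ e20.
exists (Num.min d1 d2) => [|s]; first by rewrite lt_min d10.
rewrite lt_min => /andP[s1 s2]; apply: le_trans (cmod_le_add _) _.
rewrite reE imE; apply: le_trans (lerD (dH1 _ s1) (dH2 _ s2)) _.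
by rewrite -mulrDl -splitr.
Qed.

Lemma rcder_comp (f : R[i] -> R[i]) h t l m :
  cder f (h t) l -> rcder h t m -> rcder (f \o h) t (l * m).
Proof.
move=> Hf Hh e e0.
(* [K] bounds the difference quotients of [h] near [t]. Half of [e] pays for the error of [f] at
   distance [K * q], the other half for the error of [h] multiplied by [cmod l]. *)
pose K := cmod m + 1.
have K0 : 0 < K by rewrite ltr_wpDl ?cmod_ge0.
have e1 : 0 < e / 2 / K by rewrite !divr_gt0.
have [d1 d10 dH1] := Hf _ e1.
have L0 : 0 < cmod l + 1 by rewrite ltr_wpDl ?cmod_ge0.
have e2 : 0 < Num.min 1 (e / 2 / (cmod l + 1)) by rewrite lt_min ltr01 !divr_gt0.
have [d2 d20 dH2] := Hh _ e2.
exists (Num.min d2 (d1 / K)) => [|s]; first by rewrite lt_min d20 divr_gt0.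
rewrite lt_min => /andP[s1]; rewrite ltr_pdivlMr // => s2.
have A := dH2 _ s1; set q := `|s - t| in A s2 s1 *.
have q0 : 0 <= q by rewrite /q.
have B : cmod (h s - h t) <= K * q.
  apply: le_trans (cmod_le_subD _ (m * (s - t)%:C)) _; rewrite /K mulrDl mul1r addrC cmodM cmod_real lerD2l.
  by apply: le_trans A _; rewrite -[leRHS]mul1r ler_wpM2r // ge_min lexx.
have C := dH1 (h s) (le_lt_trans B _).
rewrite mulrC in s2; have {}C := C s2 => /=.
have -> : f (h s) - f (h t) - l * m * (s - t)%:C =
  (f (h s) - f (h t) - l * (h s - h t)) + l * (h s - h t - m * (s - t)%:C) by ring.
apply: le_trans (cmodD _ _) _; rewrite [e]splitr mulrDl lerD //.
  apply: le_trans C _; apply: le_trans (ler_wpM2l _ B) _; first exact: ltW.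
  by rewrite mulrA divfK // gt_eqF.
rewrite cmodM; apply: le_trans (ler_wpM2l (cmod_ge0 _) A) _.
rewrite mulrA ler_wpM2r //.
apply: (@le_trans _ _ (cmod l * (e / 2 / (cmod l + 1)))).
  by rewrite ler_wpM2l ?cmod_ge0 // ge_min lexx orbT.
rewrite mulrA ler_pdivrMr // mulrC ler_wpM2l ?lerDl //.
by rewrite ltW // divr_gt0.
Qed.

Lemma rcder_cont h t l : rcder h t l ->
  forall e : R, 0 < e -> exists2 d, 0 < d & forall s, `|s - t| < d -> cmod (h s - h t) < e.
Proof.
move=> H e e0; have [d d0 dH] := H _ (@ltr01 R).
pose K := cmod l + 1.
have K0 : 0 < K by rewrite ltr_wpDl ?cmod_ge0.
exists (Num.min d (e / K)) => [|s]; first by rewrite lt_min d0 divr_gt0.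
rewrite lt_min => /andP[s1]; rewrite ltr_pdivlMr // mulrC; apply: le_lt_trans.
apply: le_trans (cmod_le_subD _ (l * (s - t)%:C)) _; rewrite /K mulrDl mul1r addrC cmodM cmod_real lerD2l.
by have := dH _ s1; rewrite mul1r.
Qed.

Lemma rcderD h k t l m : rcder h t l -> rcder k t m ->
  rcder (fun s => h s + k s) t (l + m).
Proof.
move=> H K e e0; have e20 : 0 < e / 2 by rewrite divr_gt0.
have [d1 d10 dH1] := H _ e20; have [d2 d20 dH2] := K _ e20.
exists (Num.min d1 d2) => [|s]; first by rewrite lt_min d10.
rewrite lt_min => /andP[s1 s2].
have -> : h s + k s - (h t + k t) - (l + m) * (s - t)%:C =
  (h s - h t - l * (s - t)%:C) + (k s - k t - m * (s - t)%:C) by ring.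
apply: le_trans (cmodD _ _) _; apply: le_trans (lerD (dH1 _ s1) (dH2 _ s2)) _.
by rewrite -mulrDl -splitr.
Qed.

Lemma rcderZ c h t l : rcder h t l -> rcder (fun s => c * h s) t (c * l).
Proof.
move=> H e e0; have K0 : 0 < cmod c + 1 by rewrite ltr_wpDl ?cmod_ge0.
have e1 : 0 < e / (cmod c + 1) by rewrite divr_gt0.
have [d d0 dH] := H _ e1; exists d => // s sd.
have -> : c * h s - c * h t - c * l * (s - t)%:C = c * (h s - h t - l * (s - t)%:C) by ring.
rewrite cmodM; apply: le_trans (ler_wpM2l (cmod_ge0 _) (dH _ sd)) _.
rewrite mulrA ler_wpM2r // mulrA ler_pdivrMr // mulrC ler_wpM2l ?lerDl //.
exact: ltW.
Qed.

Lemma rcder_cst c t : rcder (fun=> c) t 0.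
Proof.
by move=> e e0; exists 1 => // s _; rewrite mul0r subr0 subrr cmod0 mulr_ge0 // ltW.
Qed.

Lemma rcder_ext (h k : R -> R[i]) t l (d : R) : 0 < d ->
  (forall s, `|s - t| < d -> h s = k s) -> rcder h t l -> rcder k t l.
Proof.
move=> d0 hk H e e0; have [d' d'0 dH] := H _ e0.
exists (Num.min d d') => [|s]; first by rewrite lt_min d0.
rewrite lt_min => /andP[s1 s2]; rewrite -!hk ?subrr ?normr0 //; exact: dH.
Qed.

(* Applying the real mean value theorem to the component of [h] along
   [h b - h a] gives the sharp constant. *)
Lemma rcder_bound (h dh : R -> R[i]) (a b M : R) : a <= b ->
  (forall t, a <= t <= b -> rcder h t (dh t)) ->
  (forall t, a <= t <= b -> cmod (dh t) <= M) ->
  cmod (h b - h a) <= M * (b - a).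
Proof.
move=> ab H HM.
have M0 : 0 <= M by apply: le_trans (cmod_ge0 _) (HM a _); rewrite lexx.
have [->|D0] := eqVneq (cmod (h b - h a)) 0; first by rewrite mulr_ge0 // subr_ge0.
have {}D0 : 0 < cmod (h b - h a) by rewrite lt_def D0 cmod_ge0.
pose c := conjc (h b - h a).
have [||x xab E] := @MVT_segment R (fun s => complex.Re (c * h s))
    (fun s => complex.Re (c * dh s)) a b ab.
- move=> x /[!in_itv] /= /andP[ax xb].
  have xab : a <= x <= b by rewrite !ltW.
  by have [] := (rcder_is_derive _ _ _).1 (@rcderZ c _ _ _ (H x xab)).
- apply: derivable_within_continuous => x /[!in_itv] /= xab.
  by have [[]] := (rcder_is_derive _ _ _).1 (@rcderZ c _ _ _ (H x xab)).
move: xab; rewrite in_itv /= => xab.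
have -> : cmod (h b - h a) = complex.Re (c * h b - c * h a) / cmod (h b - h a).
  rewrite -mulrBr [c * _]mulrC /c conjcM_cmod /= expr2 mulfK //.
  by rewrite gt_eqF.
rewrite (_ : complex.Re _ = complex.Re (c * h b) - complex.Re (c * h a)); last first.
  by case: (c * h b) (c * h a) => [? ?] [? ?].
rewrite E mulrAC ler_wpM2r ?subr_ge0 // ler_pdivrMr //.
apply: le_trans (Re_le_cmod _) _; rewrite cmodM /c cmod_conj mulrC.
by rewrite ler_wpM2r ?cmod_ge0 // HM.
Qed.

Lemma rcder0_cst (h : R -> R[i]) (a b : R) :
  (forall t, Num.min a b <= t <= Num.max a b -> rcder h t 0) -> h a = h b.
Proof.
wlog ab : a b / a <= b => [W H|].
  by case: (leP a b) => [/W->//|/ltW /W -> // t]; rewrite minC maxC; exact: H.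
rewrite min_l ?max_r // => H; apply/eqP; rewrite eq_sym -subr_eq0 -cmod_eq0.
rewrite eq_le cmod_ge0 andbT.
have := @rcder_bound h (fun=> 0) a b 0 ab H; rewrite mul0r; apply => t _.
by rewrite cmod0.
Qed.

End RealCalculus.

(** * Rules for complex derivatives *)

Section ComplexDerivative.
Context {R : realType}.
Implicit Types (f g h : R[i] -> R[i]) (z w l m : R[i]).

Lemma cder_is_derive f z l : cder f z l <-> is_derive z (1 : R[i]) f l.
Proof.
split => [H|[df fl]].
  have df := cder_derivable H.
  split => //.
  have K : (fun x => x^-1 *: (f (x *: (1 : R[i]) + z) - f z)) @ 0^' --> l.
    apply/cvgrPdist_le => e e0.
    have [e1 e2] : 0 < complex.Re e /\ e = (complex.Re e)%:C.
      by move: e0; case: (e) => a b; rewrite ltcE /= => /andP[/eqP -> ->].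
    have [d d0 dH] := H _ e1.
    rewrite /dnbhs /within /=; apply/near_diskP; exists d => // w.
    rewrite /disk /= subr0 => wd w0; rewrite e2 normC_cmod lecR.
    have := dH (z + w); rewrite addrAC subrr add0r => /(_ wd) K.
    rewrite -[X in X <= _](mulfK (_ : cmod w != 0)) ?cmod_eq0 //.
    rewrite ler_pdivrMr ?cmod_gt0 //; apply: le_trans K; rewrite -cmodM.
    have -> : w *: (1 : R[i]) = w by exact: mulr1.
    rewrite -cmodN [X in cmod X <= _](_ : _ = f (z + w) - f z - l * w) // mulrBl opprB.
    congr (_ - _); rewrite -[_ *: _]/(w^-1 * _) mulrAC mulVf // mul1r.
    by rewrite [w + z]addrC.
  exact: cvg_lim K.
move=> e e0.
have : (fun x => x^-1 *: (f (x *: (1 : R[i]) + z) - f z)) @ 0^' --> l.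
  by rewrite -fl; exact: df.
move=> /cvgrPdist_le H.
have := H e%:C; rewrite ltcR => /(_ e0).
rewrite /dnbhs /within /= => /near_diskP[d d0 dH]; exists d => // w wd.
have [->|wz] := eqVneq w z.
  by rewrite !subrr mulr0 subrr cmod0 mulr0.
have w0 : w - z != 0 by rewrite subr_eq0.
have := dH (w - z); rewrite /disk /= subr0 => /(_ wd w0).
have -> : (w - z) *: (1 : R[i]) = w - z by exact: mulr1.
rewrite subrK normC_cmod lecR => K.
rewrite -ler_pdivrMr ?cmod_gt0 // -cmodf; apply: le_trans K.
rewrite cmodBC mulrBl mulfK //.
by rewrite /GRing.scale /= mulrC.
Qed.

Lemma cder_unique f z l m : cder f z l -> cder f z m -> l = m.
Proof. by move=> /cder_is_derive[_ <-] /cder_is_derive[_ <-]. Qed.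

Lemma cder_cst c z : cder (fun=> c) z 0.
Proof. by apply/cder_is_derive; exact: is_derive_cst. Qed.

Lemma cder_id z : cder id z 1.
Proof. by apply/cder_is_derive; exact: is_derive_id. Qed.

Lemma cderD f g z l m : cder f z l -> cder g z m -> cder (fun w => f w + g w) z (l + m).
Proof.
move=> /cder_is_derive H /cder_is_derive K; by apply/cder_is_derive.
Qed.

Lemma cderN f z l : cder f z l -> cder (fun w => - f w) z (- l).
Proof.
by move=> /cder_is_derive H; apply/cder_is_derive.
Qed.

Lemma cderB f g z l m : cder f z l -> cder g z m -> cder (fun w => f w - g w) z (l - m).
Proof. by move=> H K; apply: cderD => //; exact: cderN. Qed.

Lemma cderM f g z l m : cder f z l -> cder g z m ->
  cder (fun w => f w * g w) z (l * g z + f z * m).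
Proof.
move=> /(cder_is_derive f z l).1 H /(cder_is_derive g z m).1 K.
apply/(cder_is_derive (fun w => f w * g w)).
have := @is_deriveM _ _ f g z 1 l m H K.
have -> : f z *: m + g z *: l = l * g z + f z * m by rewrite /GRing.scale /=; ring.
by [].
Qed.

Lemma cderZ c f z l : cder f z l -> cder (fun w => c * f w) z (c * l).
Proof. by move=> H; have := cderM (cder_cst c z) H; rewrite mul0r add0r. Qed.

Lemma cderX f z l n : cder f z l ->
  cder (fun w => f w ^+ n) z (n%:R * f z ^+ n.-1 * l).
Proof.
move=> /cder_is_derive H; apply/cder_is_derive.
have := @is_deriveX _ _ f n z 1 l H.
have -> : f ^+ n = (fun w => f w ^+ n).
  by apply/funext => w; elim: n {H} => [|n IH]; rewrite ?expr0 // !exprS -IH.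
have -> : (n%:R * f z ^+ n.-1) *: l = n%:R * f z ^+ n.-1 * l by [].
by [].
Qed.

Lemma cder_comp f g z l m : cder g (f z) m -> cder f z l ->
  cder (g \o f) z (m * l).
Proof.
move=> Hf Hh e e0.
pose K := cmod l + 1.
have K0 : 0 < K by rewrite ltr_wpDl ?cmod_ge0.
have e1 : 0 < e / 2 / K by rewrite !divr_gt0.
have [d1 d10 dH1] := Hf _ e1.
have L0 : 0 < cmod m + 1 by rewrite ltr_wpDl ?cmod_ge0.
have e2 : 0 < Num.min 1 (e / 2 / (cmod m + 1)) by rewrite lt_min ltr01 !divr_gt0.
have [d2 d20 dH2] := Hh _ e2.
exists (Num.min d2 (d1 / K)) => [|s]; first by rewrite lt_min d20 divr_gt0.
rewrite lt_min => /andP[s1]; rewrite ltr_pdivlMr // => s2.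
have A := dH2 _ s1; set q := cmod (s - z) in A s2 s1 *.
have q0 : 0 <= q by rewrite /q cmod_ge0.
have B : cmod (f s - f z) <= K * q.
  apply: le_trans (cmod_le_subD _ (l * (s - z))) _; rewrite /K mulrDl mul1r addrC cmodM lerD2l.
  by apply: le_trans A _; rewrite -[leRHS]mul1r ler_wpM2r // ge_min lexx.
have C := dH1 (f s) (le_lt_trans B _).
rewrite mulrC in s2; have {}C := C s2 => /=.
have -> : g (f s) - g (f z) - m * l * (s - z) =
  (g (f s) - g (f z) - m * (f s - f z)) + m * (f s - f z - l * (s - z)) by ring.
apply: le_trans (cmodD _ _) _; rewrite [e]splitr mulrDl lerD //.
  apply: le_trans C _; apply: le_trans (ler_wpM2l _ B) _; first exact: ltW.
  by rewrite mulrA divfK // gt_eqF.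
rewrite cmodM; apply: le_trans (ler_wpM2l (cmod_ge0 _) A) _.
rewrite mulrA ler_wpM2r //.
apply: (@le_trans _ _ (cmod m * (e / 2 / (cmod m + 1)))).
  by rewrite ler_wpM2l ?cmod_ge0 // ge_min lexx orbT.
rewrite mulrA ler_pdivrMr // mulrC ler_wpM2l ?lerDl //.
by rewrite ltW // divr_gt0.
Qed.

Lemma cder_cont f z l : cder f z l -> ccont f z.
Proof.
move=> H e e0; have [d d0 dH] := H _ (@ltr01 R).
pose K := cmod l + 1.
have K0 : 0 < K by rewrite ltr_wpDl ?cmod_ge0.
exists (Num.min d (e / K)) => [|s]; first by rewrite lt_min d0 divr_gt0.
rewrite lt_min => /andP[s1]; rewrite ltr_pdivlMr // mulrC; apply: le_lt_trans.
apply: le_trans (cmod_le_subD _ (l * (s - z))) _.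
rewrite /K mulrDl mul1r addrC cmodM lerD2l.
by have := dH _ s1; rewrite mul1r.
Qed.

Lemma cder_ext f g z l (d : R) : 0 < d ->
  (forall w, disk z d w -> f w = g w) -> cder f z l -> cder g z l.
Proof.
move=> d0 fg H e e0; have [d' d'0 dH] := H _ e0.
exists (Num.min d d') => [|s]; first by rewrite lt_min d0.
rewrite lt_min => /andP[s1 s2]; rewrite -!fg //; first exact: dH.
exact: disk_center.
Qed.

Lemma cder_inv z : z != 0 -> cder (fun w => w^-1) z (- z ^- 2).
Proof.
move=> z0.
have D : derivable (id : R[i] -> R[i]) z (1 : R[i]) by exact: derivable_id.
apply/cder_is_derive; split; first exact: (@derivableV _ _ id).
rewrite (@deriveV _ _ id) //.
by rewrite derive_id; exact: mulr1.
Qed.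

Lemma cderV f z l : f z != 0 -> cder f z l -> cder (fun w => (f w)^-1) z (- l / f z ^+ 2).
Proof.
move=> f0 H; have := cder_comp (cder_inv f0) H.
by rewrite mulNr [_ * l]mulrC -mulNr.
Qed.

Lemma cder_div f g z l m : g z != 0 -> cder f z l -> cder g z m ->
  cder (fun w => f w / g w) z ((l * g z - f z * m) / g z ^+ 2).
Proof.
move=> g0 Hf Hg; have := cderM Hf (cderV g0 Hg).
by congr cder; field.
Qed.

Lemma cder_conj f z l : cder f (conjc z) l ->
  cder (fun w => conjc (f (conjc w))) z (conjc l).
Proof.
move=> H e e0; have [d d0 dH] := H _ e0; exists d => // w wd.
rewrite -(rmorphB (@conjc R)) -{2}[w]conjcK -{2}[z]conjcK.
rewrite -(rmorphB (@conjc R)) -(rmorphM (@conjc R)) -(rmorphB (@conjc R)) cmod_conj.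
by rewrite -(cmod_conj (w - z)) rmorphB; apply: dH; rewrite -rmorphB cmod_conj.
Qed.

Lemma ccont_comp f g z : ccont f z -> ccont g (f z) -> ccont (g \o f) z.
Proof.
move=> Hf Hg e /Hg[d d0 dH]; have [d' d'0 dH'] := Hf _ d0.
by exists d' => // w /dH'/dH.
Qed.

Lemma ccont_cst (c : R[i]) z : ccont (fun=> c) z.
Proof. exact: cder_cont (cder_cst _ _). Qed.

Lemma ccontB f g z : ccont f z -> ccont g z -> ccont (fun w => f w - g w) z.
Proof. by move=> /ccontP F /ccontP G; apply/ccontP; apply: cvgB F G. Qed.

Lemma ccontM f g z : ccont f z -> ccont g z -> ccont (fun w => f w * g w) z.
Proof. by move=> /ccontP F /ccontP G; apply/ccontP; apply: cvgM F G. Qed.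

End ComplexDerivative.

(** * The complex exponential *)

Section Cexp.
Context {R : realType}.
Implicit Types (z w : R[i]) (t : R).

Lemma cisD (s t : R) : cis (s + t) = cis s * cis t.
Proof. by apply/eqP; rewrite eq_complex /= cosD sinD eqxx addrC eqxx. Qed.

Lemma cis0 : cis (0 : R) = 1.
Proof. by rewrite /cis cos0 sin0. Qed.

Lemma cmod_cis t : cmod (cis t) = 1.
Proof. by rewrite cmodE /= cos2Dsin2 sqrtr1. Qed.

Lemma rcder_cis t : rcder (@cis R) t (Complex 0 1 * cis t).
Proof.
apply/rcder_is_derive; rewrite /cis /=; split.
  by apply: is_derive_eq => /=; ring.
by apply: is_derive_eq => /=; ring.
Qed.

Lemma cis_surj z : cmod z = 1 -> exists t, cis t = z.
Proof.
move=> z1; have E := cmod_sqr z; rewrite z1 expr1n in E.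
case: z E {z1} => a b /= E.
have a1 : -1 <= a <= 1 by rewrite -ler_norml -(@ler_pXn2r _ 2) ?nnegrE // real_normK ?num_real // expr1n E lerDl sqr_ge0.
have s2 : Num.sqrt (1 - a ^+ 2) = `|b|.
  by rewrite E addrAC subrr add0r sqrtr_sqr.
have [b0|b0] := leP 0 b.
  by exists (acos a); rewrite /cis acosK ?in_itv // sin_acos // s2 ger0_norm.
exists (- acos a); rewrite /cis cosN sinN acosK ?in_itv // sin_acos // s2.
by rewrite ltr0_norm // opprK.
Qed.

Definition cexp z : R[i] := (expR (complex.Re z))%:C * cis (complex.Im z).

Lemma cexpD z w : cexp (z + w) = cexp z * cexp w.
Proof.
rewrite /cexp; case: z w => [a b] [c d] /=; rewrite expRD cisD rmorphM /=.
by rewrite mulrACA.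
Qed.

Lemma cexp0 : cexp 0 = 1.
Proof. by rewrite /cexp /= expR0 cis0 mulr1. Qed.

Lemma cmod_cexp z : cmod (cexp z) = expR (complex.Re z).
Proof. by rewrite /cexp cmodM cmod_cis mulr1 cmod_real0 // expR_ge0. Qed.

Lemma cexp_neq0 z : cexp z != 0.
Proof. by rewrite -cmod_gt0 cmod_cexp expR_gt0. Qed.

Lemma cexpN z : cexp (- z) = (cexp z)^-1.
Proof.
apply: (mulIf (cexp_neq0 z)); rewrite -cexpD addNr cexp0 mulVf //.
exact: cexp_neq0.
Qed.

Lemma cexpB z w : cexp (z - w) = cexp z / cexp w.
Proof. by rewrite cexpD cexpN. Qed.

Lemma cexp_surj w : w != 0 -> exists z, cexp z = w.
Proof.
move=> w0; have m0 : 0 < cmod w by rewrite cmod_gt0.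
have mC0 : (cmod w)%:C != 0 by rewrite realC_eq0 gt_eqF.
have [|t tE] := @cis_surj (w / (cmod w)%:C).
  by rewrite cmodf cmod_real0 ?cmod_ge0 // divff // gt_eqF.
exists (Complex (ln (cmod w)) t); rewrite /cexp /= lnK ?posrE //.
by rewrite tE mulrC divfK.
Qed.

(** At 0 the expansion is the product of those of [expR] and [cis]; the functional equation [cexpD]
    then carries it to every other point. *)
Lemma cder_cexp0 : cder cexp 0 1.
Proof.
have Ec := rcder_cis 0; rewrite cis0 mulr1 in Ec.
have Er : is_derive (0 : R) (1 : R) (@expR R) 1.
  by have := is_derive_expR (0 : R); rewrite expR0.
move=> e e0.
(* The three error terms [T1], [T2], [T3] below add up to [6 * e' * cmod z], which the factor 8
   covers. *)
have [e' [e'0 e'1 e'8]] : exists e' : R, [/\ 0 < e', e' <= 1 & e' * 8 <= e].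
  exists (Num.min 1 (e / 8)); split; first by rewrite lt_min ltr01 divr_gt0.
    by rewrite ge_min lexx.
  by rewrite -ler_pdivlMr // ge_min lexx orbT.
have [d1 d10 dH1] := Ec _ e'0.
have [d2 d20 dH2] := (rder_is_derive _ _ _).2 Er _ e'0.
exists (Num.min e' (Num.min d1 d2)) => [|z]; first by rewrite !lt_min e'0 d10.
rewrite !lt_min subr0 => /and3P[z0 z1 z2].
have a2 := dH2 (complex.Re z); have b1 := dH1 (complex.Im z).
rewrite !subr0 in a2 b1.
have {a2} := a2 (le_lt_trans (normRe_le _) z2).
have {b1} := b1 (le_lt_trans (normIm_le _) z1).
rewrite expR0 mul1r cis0.
set a := complex.Re z; set b := complex.Im z => B A.
have zE : z = a%:C + Complex 0 1 * b%:C.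
  by rewrite /a /b; case: (z) => x y; apply/eqP; rewrite eq_complex /=; apply/andP; split; apply/eqP; ring.
rewrite cexp0 mul1r /cexp -/a -/b.
have -> : (expR a)%:C * cis b - 1 - z = (expR a)%:C * (cis b - 1 - Complex 0 1 * b%:C)
   + (expR a - 1 - a)%:C + (Complex 0 1 * b%:C) * (expR a - 1)%:C.
  by rewrite {1}zE !rmorphB /= rmorph1; ring.
have am : `|a| <= cmod z := normRe_le z; have bm : `|b| <= cmod z := normIm_le z.
have m0 := cmod_ge0 z; set q := cmod z in am bm m0 z0 z1 z2 *.
have E1 : `|expR a - 1| <= 2 * q.
  have -> : expR a - 1 = (expR a - 1 - a) + a by ring.
  apply: le_trans (ler_normD _ _) _; rewrite mulrDl mul1r lerD //.
  apply: le_trans A _; rewrite -[leRHS]mul1r; apply: ler_pM => //; exact: ltW.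
have E2 : `|expR a| <= 3.
  have -> : expR a = (expR a - 1) + 1 by ring.
  apply: le_trans (ler_normD _ _) _; rewrite normr1.
  have : q <= 1 by apply: ltW; apply: lt_le_trans z0 e'1.
  by move: E1; lra.
apply: le_trans (cmodD _ _) _; apply: le_trans (lerD (cmodD _ _) (lexx _)) _.
rewrite !cmodM !cmod_real.
have -> : cmod (Complex (0:R) 1) = 1 by rewrite cmodE /= expr0n expr1n /= add0r sqrtr1.
rewrite mul1r.
have T1 : `|expR a| * cmod (cis b - 1 - Complex 0 1 * b%:C) <= 3 * (e' * q).
  apply: ler_pM => //; first exact: cmod_ge0.
  by apply: le_trans B _; rewrite ler_wpM2l // ltW.
have T2 : `|expR a - 1 - a| <= e' * q by apply: le_trans A _; rewrite ler_wpM2l // ltW.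
have T3 : `|b| * `|expR a - 1| <= e' * (2 * q).
  apply: ler_pM => //; apply: le_trans bm (ltW _) => //.
apply: le_trans (lerD (lerD T1 T2) T3) _.
have -> : 3 * (e' * q) + e' * q + e' * (2 * q) = (e' * 6) * q by ring.
by rewrite ler_wpM2r //; move: e'0 e'8; lra.
Qed.

Lemma cder_cexp z : cder cexp z (cexp z).
Proof.
have H : cder (fun w => w - z) z 1.
  by have := cderB (cder_id z) (cder_cst z z); rewrite subr0.
have E : cexp = (fun w => cexp z * cexp (w - z)).
  by apply/funext => w; rewrite -cexpD addrC subrK.
have K : cder (cexp \o (fun w => w - z)) z (1 * 1).
  by apply: cder_comp => //; rewrite subrr; exact: cder_cexp0.
have := cderZ (cexp z) K; rewrite !mulr1.
by rewrite -[fun w => _]/(fun w => cexp z * cexp (w - z)) -E.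
Qed.

End Cexp.

(** * Complex integrals and Goursat's theorem *)

Section ComplexIntegral.
Context {R : realType}.
Implicit Types (h k P : R -> R[i]) (a b t s : R).

Definition rccont h t := forall e : R, 0 < e -> exists2 d, 0 < d &
  forall s, `|s - t| < d -> cmod (h s - h t) < e.

Definition between a b t := Num.min a b <= t <= Num.max a b.

Lemma betweenP a b t : a <= b -> between a b t = (a <= t <= b).
Proof. by move=> ab; rewrite /between min_l // max_r. Qed.

Lemma betweenC a b t : between a b t = between b a t.
Proof. by rewrite /between minC maxC. Qed.

Lemma between_l a b : between a b a.
Proof. by rewrite /between ge_min le_max lexx. Qed.

Lemma between_r a b : between a b b.
Proof. by rewrite betweenC between_l. Qed.

Lemma between_dist a b t : between a b t -> `|t - a| <= `|b - a|.
Proof.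
rewrite /between; case: (leP a b) => ab /andP[at1 tb].
  by rewrite !ger0_norm ?subr_ge0 // lerD2r.
by rewrite !ler0_norm ?subr_le0 ?(ltW ab) // lerN2 lerD2r.
Qed.

Definition iprim h a b P := forall t, between a b t -> rcder P t (h t).

(** The integral is the increment of a primitive, so that additivity and estimates reduce to the
    mean value inequality. If there is no primitive, the default is a constant function and the
    integral is 0. *)
Definition cint h a b : R[i] :=
  let P := xget (fun=> 0) [set P | iprim h a b P] in P b - P a.

Lemma cint_prim h a b P : iprim h a b P -> cint h a b = P b - P a.
Proof.
move=> HP; rewrite /cint; case: xgetP => [Q _ /= HQ|/(_ P)//].
apply/eqP; rewrite -subr_eq0; apply/eqP.
have E : (Q a - P a) = (Q b - P b).
  apply: (@rcder0_cst _ (fun t => Q t - P t)) => t tab.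
  have := rcderD (HQ t tab) (@rcderZ _ (-1) _ _ _ (HP t tab)).
  by rewrite mulN1r subrr; apply: rcder_ext ltr01 _ => s _; rewrite mulN1r.
have -> : Q b - Q a - (P b - P a) = (Q b - P b) - (Q a - P a) by ring.
by rewrite E subrr.
Qed.

Lemma cintN h a b : cint h b a = - cint h a b.
Proof.
rewrite /cint opprB; have -> : [set P | iprim h b a P] = [set P | iprim h a b P] => //.
by apply/seteqP; split => P /= HP t; rewrite betweenC; exact: HP.
Qed.

Lemma cint_prim_exists h a b : (forall t, between a b t -> rccont h t) ->
  exists P, iprim h a b P.
Proof.
wlog ab : a b / a <= b => [W H|].
  case: (leP a b) => [/W|/ltW /W W']; first by apply.
  have [|P HP] := W'; first by move=> t; rewrite betweenC; exact: H.
  by exists P => t; rewrite betweenC; exact: HP.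
(* Clamping to [[a, b]] extends [h] continuously to the whole line, so that the fundamental theorem
   of calculus also applies at the end points. *)
move=> hc; pose cl s := Num.min b (Num.max a s).
have cl_in s : a <= cl s <= b by rewrite /cl le_min ab le_max lexx ge_min lexx.
have cl_id s : a <= s <= b -> cl s = s.
  by move=> /andP[as1 sb]; rewrite /cl max_r // min_r.
have cl_lip s t : `|cl s - cl t| <= `|s - t|.
  have N1 := ler_norm (s - t); have N2 := ler_norm (t - s); rewrite distrC in N2.
  have L x y : x - y <= `|s - t| -> y - x <= `|s - t| ->
     Num.max a x - Num.max a y <= `|s - t|.
    by rewrite !maxEle; do !case: ifPn; rewrite -?ltNge => *; lra.
  have L' x y : x - y <= `|s - t| -> y - x <= `|s - t| ->
     Num.min b x - Num.min b y <= `|s - t|.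
    by rewrite !minEle; do !case: ifPn; rewrite -?ltNge => *; lra.
  by rewrite ler_norml lerNl opprB; apply/andP; split; apply: L'; apply: L.
have FT (u : R -> R) : (forall t (e : R), 0 < e -> exists2 d, 0 < d & forall s,
    `|s - t| < d -> `|u s - u t| < e) ->
    exists F, forall t, a <= t <= b -> is_derive t (1 : R) F (u t).
  move=> uc.
  have cu : continuous u.
    move=> t; apply/cvgrPdist_lt => e /(uc t)[d d0 dH].
    apply/nbhs_ballP; exists d => //= s; rewrite /ball /= => sd.
    by rewrite distrC; apply: dH; rewrite distrC.
  (* The unit margin makes [a] and [b] interior points of the interval of integration. *)
  have iu : (@lebesgue_measure R).-integrable `[a - 1, b + 1] (EFin \o u).
    apply: continuous_compact_integrable; first exact: segment_compact.
    exact/continuous_subspaceT/cu.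
  exists (fun x => \int[@lebesgue_measure R]_(t in [set` `[(a - 1), x]]) u t)%R => t /andP[at1 tb].
  have [||d1 d2] := continuous_FTC1_closed (x := t) _ iu _ (cu t).
  - by lra.
  - by lra.
  - by split; [exact: d1|rewrite -derive1E; exact: d2].
have kc t (e : R) : 0 < e -> exists2 d, 0 < d & forall s, `|s - t| < d ->
    cmod (h (cl s) - h (cl t)) < e.
  move=> e0; have [|d d0 dH] := hc (cl t) _ _ e0; first by rewrite betweenP.
  by exists d => // s sd; apply: dH; apply: le_lt_trans sd.
have [|F HF] := FT (fun s => complex.Re (h (cl s))).
  move=> t e /(kc t)[d d0 dH]; exists d => // s /dH; apply: le_lt_trans.
  have := normRe_le (h (cl s) - h (cl t)).
  by case: (h (cl s)) (h (cl t)) => [? ?] [? ?].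
have [|G HG] := FT (fun s => complex.Im (h (cl s))).
  move=> t e /(kc t)[d d0 dH]; exists d => // s /dH; apply: le_lt_trans.
  have := normIm_le (h (cl s) - h (cl t)).
  by case: (h (cl s)) (h (cl t)) => [? ?] [? ?].
exists (fun t => Complex (F t) (G t)) => t; rewrite betweenP // => tab.
apply/rcder_is_derive => /=.
by have := HF t tab; have := HG t tab; rewrite cl_id.
Qed.

Lemma cint_add h a b c : (forall t, between a b t -> rccont h t) ->
  (forall t, between b c t -> rccont h t) ->
  cint h a b + cint h b c = cint h a c.
Proof.
move=> Hab Hbc; pose m := Num.min a (Num.min b c); pose M := Num.max a (Num.max b c).
have mM : m <= M by rewrite /m ge_min /M !le_max lexx.
have [|P HP] := @cint_prim_exists h m M.
  move=> t; rewrite betweenP // /m /M !ge_min !le_max => /andP[T1 T2].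
  have [/Hab//|] := boolP (between a b t); rewrite /between => N1.
  apply: Hbc; move: N1; rewrite /between !ge_min !le_max negb_and => N1.
  move: T1 T2 N1; case: (leP a t) => ?; case: (leP b t) => ?; case: (leP c t) => ?;
  case: (leP t a) => ?; case: (leP t b) => ?; case: (leP t c) => ? //=; lra.
have I x y : m <= x <= M -> m <= y <= M -> iprim h x y P.
  move=> /andP[x1 x2] /andP[y1 y2] t; rewrite /between ge_min le_max => T; apply: HP.
  by rewrite betweenP //; case/andP: T => /orP[] ? /orP[] ?; apply/andP; split; lra.
have am : m <= a <= M by rewrite /m /M ge_min le_max lexx.
have bm : m <= b <= M by rewrite /m /M !ge_min !le_max lexx !orbT.
have cm : m <= c <= M by rewrite /m /M !ge_min !le_max lexx !orbT.
rewrite !(cint_prim (I _ _ _ _)) //; ring.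
Qed.

Lemma cint_dist h k a b (M : R) : (forall t, between a b t -> rccont h t) ->
  (forall t, between a b t -> rccont k t) ->
  (forall t, between a b t -> cmod (h t - k t) <= M) ->
  cmod (cint h a b - cint k a b) <= M * `|b - a|.
Proof.
move=> /cint_prim_exists[P HP] /cint_prim_exists[Q HQ] HM.
rewrite (cint_prim HP) (cint_prim HQ).
wlog ab : a b HP HQ HM / a <= b => [W|].
  case: (leP a b) => [|/ltW] ba; first exact: W.
  have := W b a; rewrite distrC => W'.
  rewrite -cmodN; have -> : - (P b - P a - (Q b - Q a)) = P a - P b - (Q a - Q b) by ring.
  by apply: W' => // t; rewrite betweenC; [exact: HP|exact: HQ|exact: HM].
rewrite ger0_norm ?subr_ge0 //.
have -> : P b - P a - (Q b - Q a) = (P b - Q b) - (P a - Q a) by ring.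
apply: (@rcder_bound _ (fun t => P t - Q t) (fun t => h t - k t)) => // t tab.
  have tab' : between a b t by rewrite betweenP.
  have := rcderD (HP t tab') (@rcderZ _ (-1) _ _ _ (HQ t tab')).
  by rewrite mulN1r; apply: rcder_ext ltr01 _ => s _; rewrite mulN1r.
by apply: HM; rewrite betweenP.
Qed.

End ComplexIntegral.

(** * Contour integrals over rectangles *)

Section Goursat.
Context {R : realType}.
Implicit Types (f g : R[i] -> R[i]) (z w l : R[i]) (x y a b c : R).

Definition hint f y a b := cint (fun t => f (Complex t y)) a b.
Definition vint f x a b := Complex 0 1 * cint (fun t => f (Complex x t)) a b.
(** Contour integral around the rectangle, counterclockwise when [x1 <= x2] and [y1 <= y2]; other
    orders only change the sign. *)
Definition rbd f x1 x2 y1 y2 :=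
  hint f y1 x1 x2 + vint f x2 y1 y2 - hint f y2 x1 x2 - vint f x1 y1 y2.

Definition crect x1 x2 y1 y2 : set R[i] :=
  [set z | between x1 x2 (complex.Re z) /\ between y1 y2 (complex.Im z)].

Lemma cmod_horiz a b y : cmod (Complex a y - Complex b y) = `|a - b|.
Proof.
rewrite -[LHS]/(cmod (Complex (a - b) (y - y))) subrr.
by rewrite -[Complex _ _]/((a - b)%:C) cmod_real.
Qed.

Lemma cmod_vert a b x : cmod (Complex x a - Complex x b) = `|a - b|.
Proof.
rewrite -[LHS]/(cmod (Complex (x - x) (a - b))) subrr cmodE /= expr0n /= add0r.
by rewrite sqrtr_sqr.
Qed.

Lemma ccont_horiz f a y : ccont f (Complex a y) -> rccont (fun t => f (Complex t y)) a.
Proof.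
by move=> H e /H[d d0 dH]; exists d => // s sd; apply: dH; rewrite cmod_horiz.
Qed.

Lemma ccont_vert f x a : ccont f (Complex x a) -> rccont (fun t => f (Complex x t)) a.
Proof.
by move=> H e /H[d d0 dH]; exists d => // s sd; apply: dH; rewrite cmod_vert.
Qed.

Lemma rcder_horiz (F : R[i] -> R[i]) l a y : cder F (Complex a y) l ->
  rcder (fun t => F (Complex t y)) a l.
Proof.
move=> H e /H[d d0 dH]; exists d => // s sd.
rewrite -(cmod_horiz s a y); have := dH (Complex s y); rewrite cmod_horiz => /(_ sd).
congr (cmod (_ - _ * _) <= _).
by apply/eqP; rewrite eq_complex /= subrr !eqxx.
Qed.

Lemma rcder_vert (F : R[i] -> R[i]) l x a : cder F (Complex x a) l ->
  rcder (fun t => F (Complex x t)) a (Complex 0 1 * l).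
Proof.
move=> H e /H[d d0 dH]; exists d => // s sd.
rewrite -(cmod_vert s a x); have := dH (Complex x s); rewrite cmod_vert => /(_ sd).
congr (cmod (_ - _) <= _); rewrite mulrAC [RHS]mulrC; congr (_ * _).
by apply/eqP; rewrite eq_complex /=; apply/andP; split; apply/eqP; ring.
Qed.

Lemma hint_prim f (F : R[i] -> R[i]) y a b :
  (forall t, between a b t -> cder F (Complex t y) (f (Complex t y))) ->
  hint f y a b = F (Complex b y) - F (Complex a y).
Proof.
move=> H; rewrite /hint (@cint_prim _ _ _ _ (fun t => F (Complex t y))) // => t tab.
exact/rcder_horiz/H.
Qed.

Lemma vint_prim f (F : R[i] -> R[i]) x a b :
  (forall t, between a b t -> cder F (Complex x t) (f (Complex x t))) ->
  vint f x a b = F (Complex x b) - F (Complex x a).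
Proof.
move=> H; rewrite /vint (@cint_prim _ _ _ _ (fun t => - (Complex 0 1 * F (Complex x t)))).
  have i2 : Complex (0 : R) 1 * Complex 0 1 = -1.
    by apply/eqP; rewrite eq_complex /=; apply/andP; split; apply/eqP; ring.
  set u := F _; set v := F _.
  have -> : Complex 0 1 * (- (Complex 0 1 * u) - - (Complex 0 1 * v)) =
    - (Complex 0 1 * Complex 0 1) * (u - v) by ring.
  by rewrite i2; ring.
move=> t /H /rcder_vert /(@rcderZ _ (- Complex 0 1)).
rewrite mulrA mulNr.
have -> : - (Complex (0 : R) 1 * Complex 0 1) = 1.
  by apply/eqP; rewrite eq_complex /=; apply/andP; split; apply/eqP; ring.
by rewrite mul1r; apply: rcder_ext ltr01 _ => s _; rewrite mulNr.
Qed.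

Lemma rbd_prim f (F : R[i] -> R[i]) x1 x2 y1 y2 :
  (forall z, crect x1 x2 y1 y2 z -> cder F z (f z)) -> rbd f x1 x2 y1 y2 = 0.
Proof.
move=> H; rewrite /rbd !(hint_prim (F := F)) ?(vint_prim (F := F)).
- by ring.
all: by move=> t T; apply: H; split; rewrite ?T ?between_l ?between_r.
Qed.

Lemma vint_dist f g x a b (M : R) : (forall t, between a b t -> ccont f (Complex x t)) ->
  (forall t, between a b t -> ccont g (Complex x t)) ->
  (forall t, between a b t -> cmod (f (Complex x t) - g (Complex x t)) <= M) ->
  cmod (vint f x a b - vint g x a b) <= M * `|b - a|.
Proof.
move=> Hf Hg HM; rewrite /vint -mulrBr cmodM.
have -> : cmod (Complex (0:R) 1) = 1 by rewrite cmodE /= expr0n expr1n /= add0r sqrtr1.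
by rewrite mul1r; apply: cint_dist => // t T; apply: ccont_vert; [apply: Hf|apply: Hg].
Qed.

Lemma hint_dist f g y a b (M : R) : (forall t, between a b t -> ccont f (Complex t y)) ->
  (forall t, between a b t -> ccont g (Complex t y)) ->
  (forall t, between a b t -> cmod (f (Complex t y) - g (Complex t y)) <= M) ->
  cmod (hint f y a b - hint g y a b) <= M * `|b - a|.
Proof.
move=> Hf Hg HM.
by apply: cint_dist => // t T; apply: ccont_horiz; [apply: Hf|apply: Hg].
Qed.

Lemma rbd_dist f g x1 x2 y1 y2 (M : R) :
  (forall z, crect x1 x2 y1 y2 z -> ccont f z) ->
  (forall z, crect x1 x2 y1 y2 z -> ccont g z) ->
  (forall z, crect x1 x2 y1 y2 z -> cmod (f z - g z) <= M) ->
  cmod (rbd f x1 x2 y1 y2 - rbd g x1 x2 y1 y2) <= 2 * M * (`|x2 - x1| + `|y2 - y1|).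
Proof.
move=> Hf Hg HM; rewrite /rbd.
set A := hint f _ _ _; set B := vint f _ _ _; set C := hint f _ _ _; set D := vint f _ _ _.
set A' := hint g _ _ _; set B' := vint g _ _ _; set C' := hint g _ _ _; set D' := vint g _ _ _.
have -> : A + B - C - D - (A' + B' - C' - D') = (A - A') + (B - B') - (C - C') - (D - D') by ring.
have hA : cmod (A - A') <= M * `|x2 - x1|.
  by apply: hint_dist => t T; [apply: Hf|apply: Hg|apply: HM]; split; rewrite ?T ?between_l ?between_r.
have hC : cmod (C - C') <= M * `|x2 - x1|.
  by apply: hint_dist => t T; [apply: Hf|apply: Hg|apply: HM]; split; rewrite ?T ?between_l ?between_r.
have hB : cmod (B - B') <= M * `|y2 - y1|.
  by apply: vint_dist => t T; [apply: Hf|apply: Hg|apply: HM]; split; rewrite ?T ?between_l ?between_r.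
have hD : cmod (D - D') <= M * `|y2 - y1|.
  by apply: vint_dist => t T; [apply: Hf|apply: Hg|apply: HM]; split; rewrite ?T ?between_l ?between_r.
have := cmodB (A - A' + (B - B') - (C - C')) (D - D').
have := cmodB (A - A' + (B - B')) (C - C').
have := cmodD (A - A') (B - B').
have -> : 2 * M * (`|x2 - x1| + `|y2 - y1|) = 2 * (M * `|x2 - x1|) + 2 * (M * `|y2 - y1|) by ring.
lra.
Qed.

Lemma rbd_swapx f x1 x2 y1 y2 : rbd f x2 x1 y1 y2 = - rbd f x1 x2 y1 y2.
Proof. by rewrite /rbd /hint !(cintN _ x1); ring. Qed.

Lemma rbd_swapy f x1 x2 y1 y2 : rbd f x1 x2 y2 y1 = - rbd f x1 x2 y1 y2.
Proof. by rewrite /rbd /vint !(cintN _ y1); ring. Qed.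

Lemma hint_add f y a b c : (forall t, between a b t -> ccont f (Complex t y)) ->
  (forall t, between b c t -> ccont f (Complex t y)) ->
  hint f y a b + hint f y b c = hint f y a c.
Proof.
by move=> H K; apply: cint_add => t T; apply: ccont_horiz; [apply: H|apply: K].
Qed.

Lemma vint_add f x a b c : (forall t, between a b t -> ccont f (Complex x t)) ->
  (forall t, between b c t -> ccont f (Complex x t)) ->
  vint f x a b + vint f x b c = vint f x a c.
Proof.
by move=> H K; rewrite /vint -mulrDr; congr (_ * _); apply: cint_add => t T;
   apply: ccont_vert; [apply: H|apply: K].
Qed.

Lemma rbd_quarter f x1 x2 x3 y1 y2 y3 : x1 <= x2 <= x3 -> y1 <= y2 <= y3 ->
  (forall z, crect x1 x3 y1 y3 z -> ccont f z) ->
  rbd f x1 x3 y1 y3 = rbd f x1 x2 y1 y2 + rbd f x2 x3 y1 y2 +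
                      rbd f x1 x2 y2 y3 + rbd f x2 x3 y2 y3.
Proof.
move=> /andP[x12 x23] /andP[y12 y23] H.
have x13 := le_trans x12 x23; have y13 := le_trans y12 y23.
have K x y : x1 <= x <= x3 -> y1 <= y <= y3 -> ccont f (Complex x y).
  by move=> xx yy; apply: H; split; rewrite /= betweenP.
have hh y : y1 <= y <= y3 -> hint f y x1 x3 = hint f y x1 x2 + hint f y x2 x3.
  by move=> yy; rewrite hint_add // => t; rewrite betweenP // => /andP[? ?]; apply: K => //; apply/andP; split; lra.
have vv x : x1 <= x <= x3 -> vint f x y1 y3 = vint f x y1 y2 + vint f x y2 y3.
  by move=> xx; rewrite vint_add // => t; rewrite betweenP // => /andP[? ?]; apply: K => //; apply/andP; split; lra.
rewrite /rbd !hh ?vv ?lexx ?x12 ?x13 ?y13 ?y12 ?x23 ?y23 //.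
have := hh y2; have := vv x2; rewrite x12 x23 y12 y23 => /(_ isT) E1 /(_ isT) E2.
ring.
Qed.

End Goursat.

(** * The theorems of Goursat and Morera *)

Section GoursatTheorem.
Context {R : realType}.
Implicit Types (f g : R[i] -> R[i]) (z w l : R[i]) (x y a b c : R).

Lemma nested_point (u v : nat -> R) :
  (forall n, u n <= u n.+1) -> (forall n, v n.+1 <= v n) -> (forall n, u n <= v n) ->
  exists x, forall n, u n <= x <= v n.
Proof.
move=> ui vd uv.
have um n m : (n <= m)%N -> u n <= u m.
  by move=> /subnK <-; elim: (m - n)%N => // k IH; rewrite addSn; apply: le_trans (ui _).
have vm n m : (n <= m)%N -> v m <= v n.
  by move=> /subnK <-; elim: (m - n)%N => // k IH; rewrite addSn; apply: le_trans (vd _) _.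
have uvn n m : u n <= v m.
  case: (leqP n m) => nm; first exact: le_trans (um _ _ nm) (uv _).
  exact: le_trans (uv _) (vm _ _ (ltnW nm)).
exists (sup (range u)) => n; apply/andP; split.
  apply: ub_le_sup; last by exists n.
  by exists (v 0%N) => _ [m _ <-].
by apply: ge_sup; [exists (u 0%N), 0%N|move=> _ [m _ <-]].
Qed.

Lemma dependent_choice_seq (T : pointedType) (P : T -> Prop) (Q : T -> T -> Prop) (p0 : T) :
  P p0 -> (forall p, P p -> exists p', P p' /\ Q p p') ->
  exists u : nat -> T, [/\ u 0%N = p0, forall n, P (u n) & forall n, Q (u n) (u n.+1)].
Proof.
move=> P0 step; pose F p := xget p0 [set p' | P p' /\ Q p p'].
have HF p : P p -> P (F p) /\ Q p (F p).
  by move=> /step[p' Hp']; rewrite /F; case: xgetP => [q _ //|/(_ p')].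
exists (fun n => iter n F p0).
have HP n : P (iter n F p0) by elim: n => //= n /HF[].
by split => // n /=; have [] := HF _ (HP n).
Qed.

Lemma itv_weaken (x1 x2 x y t : R) : x1 <= x -> y <= x2 -> x <= t <= y -> x1 <= t <= x2.
Proof. by move=> ? ? /andP[? ?]; apply/andP; split; lra. Qed.

Lemma half_itv (x1 x2 x s a : R) : 0 <= s / 2 * a -> x1 <= x -> x + s * a <= x2 ->
  [/\ x1 <= x + s / 2 * a, x + s / 2 * a <= x2, x + s / 2 * a <= x + s * a &
      x + s / 2 * a + s / 2 * a = x + s * a].
Proof.
move=> h1 h2 h3; have E : s * a = s / 2 * a + s / 2 * a by field.
by split; rewrite ?E; lra.
Qed.

(** Bisection: one of the four quarters always carries at least a quarter of the integral. At the
    common point of the nested rectangles the first-order expansion makes the integral small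
    compared with the square of the scale. *)
Lemma goursat_le f x1 x2 y1 y2 : x1 <= x2 -> y1 <= y2 ->
  (forall z, crect x1 x2 y1 y2 z -> exists l, cder f z l) -> rbd f x1 x2 y1 y2 = 0.
Proof.
move=> x12 y12 Hf; apply/eqP/negPn/negP => N0.
pose a := x2 - x1; pose b := y2 - y1.
have a0 : 0 <= a by rewrite subr_ge0.
have b0 : 0 <= b by rewrite subr_ge0.
(* A triple [(x, y, s)] stands for the rectangle with lower left corner [(x, y)] and sides [s * a]
   and [s * b]. *)
pose mu (p : R * R * R) := cmod (rbd f p.1.1 (p.1.1 + p.2 * a) p.1.2 (p.1.2 + p.2 * b)).
pose e := cmod (rbd f x1 x2 y1 y2).
have e0 : 0 < e by rewrite cmod_gt0.
pose inv (p : R * R * R) := [/\ 0 < p.2, x1 <= p.1.1 /\ p.1.1 + p.2 * a <= x2,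
  y1 <= p.1.2 /\ p.1.2 + p.2 * b <= y2 & e * p.2 ^+ 2 <= mu p].
pose nxt (p q : R * R * R) := [/\ q.2 = p.2 / 2,
   p.1.1 <= q.1.1 /\ q.1.1 + q.2 * a <= p.1.1 + p.2 * a &
   p.1.2 <= q.1.2 /\ q.1.2 + q.2 * b <= p.1.2 + p.2 * b].
have fc z : crect x1 x2 y1 y2 z -> ccont f z by move=> /Hf[l /cder_cont].
have inv0 : inv (x1, y1, 1).
  split => //=; rewrite ?mul1r ?lexx.
  - by split => //; rewrite /a addrC subrK.
  - by split => //; rewrite /b addrC subrK.
  - by rewrite expr1n mulr1 /mu /= !mul1r /a /b ![_ + (_ - _)]addrC !subrK.
have [|u [u0 Iu Nu]] := @dependent_choice_seq _ inv nxt _ inv0.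
  move=> [[x y] s] [/= s0 [xx1 xx2] [yy1 yy2] M].
  have s20 : 0 < s / 2 by rewrite divr_gt0.
  have sa : 0 <= s / 2 * a by rewrite mulr_ge0 // ltW.
  have sb : 0 <= s / 2 * b by rewrite mulr_ge0 // ltW.
  have sE c : s * c = s / 2 * c + s / 2 * c by field.
  pose q1 := (x, y, s / 2); pose q2 := (x + s / 2 * a, y, s / 2).
  pose q3 := (x, y + s / 2 * b, s / 2); pose q4 := (x + s / 2 * a, y + s / 2 * b, s / 2).
  have SUM : mu (x, y, s) <= mu q1 + mu q2 + mu q3 + mu q4.
    rewrite /mu /= (sE a) (sE b) !addrA (@rbd_quarter _ f x (x + s / 2 * a) _ y (y + s / 2 * b)).
    - apply: le_trans (cmodD _ _) _; rewrite lerD2r.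
      by apply: le_trans (cmodD _ _) _; rewrite lerD2r cmodD.
    - by rewrite !lerDl sa.
    - by rewrite !lerDl sb.
    - move=> z [zx zy]; apply: fc; move: zx zy; rewrite /crect /= !betweenP //; [|lra..].
      by rewrite -!addrA -sE -(sE b) => h1 h2; split; [exact: itv_weaken h1|exact: itv_weaken h2].
  have [q [qq qm]] : exists q, (q = q1 \/ q = q2 \/ q = q3 \/ q = q4) /\ e * (s / 2) ^+ 2 <= mu q.
    have [h1|h1] := leP (e * (s / 2) ^+ 2) (mu q1); first by exists q1; split; auto.
    have [h2|h2] := leP (e * (s / 2) ^+ 2) (mu q2); first by exists q2; split; auto.
    have [h3|h3] := leP (e * (s / 2) ^+ 2) (mu q3); first by exists q3; split; auto.
    have [h4|h4] := leP (e * (s / 2) ^+ 2) (mu q4); first by exists q4; split; auto.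
    have E : e * s ^+ 2 = 4 * (e * (s / 2) ^+ 2) by field.
    by exfalso; move: M; rewrite E; lra.
  have [ha1 ha2 ha3 ha4] := half_itv sa xx1 xx2; have [hb1 hb2 hb3 hb4] := half_itv sb yy1 yy2.
  exists q; rewrite /inv /nxt.
  by case: qq qm => [->|[->|[->|->]]] qm /=; rewrite ?ha4 ?hb4; (split; split => //=);
     rewrite ?lerDl.
have uE n : (u n).2 = 2 ^- n.
  elim: n => [|n IH]; first by rewrite u0 /= expr0 invr1.
  by have [-> _ _] := Nu n; rewrite IH exprS invfM mulrC.
have [X HX] := @nested_point (fun n => (u n).1.1) (fun n => (u n).1.1 + (u n).2 * a)
  (fun n => let: And3 _ (conj h _) _ := Nu n in h)
  (fun n => let: And3 _ (conj _ h) _ := Nu n in h)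
  (fun n => let: And4 h _ _ _ := Iu n in ltac:(by rewrite lerDl mulr_ge0 // ltW)).
have [Y HY] := @nested_point (fun n => (u n).1.2) (fun n => (u n).1.2 + (u n).2 * b)
  (fun n => let: And3 _ _ (conj h _) := Nu n in h)
  (fun n => let: And3 _ _ (conj _ h) := Nu n in h)
  (fun n => let: And4 h _ _ _ := Iu n in ltac:(by rewrite lerDl mulr_ge0 // ltW)).
have [l Hl] : exists l, cder f (Complex X Y) l.
  apply: Hf; split; rewrite /= betweenP //.
    by have := HX 0%N; rewrite u0 /= mul1r /a addrC subrK.
  by have := HY 0%N; rewrite u0 /= mul1r /b addrC subrK.
pose K := a + b + 1.
have K0 : 0 < K by rewrite ltr_wpDl // addr_ge0.
(* Chosen so that on the rectangle of scale [s] the first-order remainder contributes less than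
   [e * s ^+ 2] to the integral. *)
pose ep := e / (4 * K ^+ 2).
have ep0 : 0 < ep by rewrite divr_gt0 // mulr_gt0 // exprn_gt0.
have [d d0 dH] := Hl _ ep0.
have [n nd] : exists n, 2 ^- n * K < d.
  have : (2 ^- n : R) @[n --> \oo] --> (0 : R).
    rewrite (_ : (fun n => 2 ^- n) = (fun n => 2^-1 ^+ n)); last by apply/funext => n; rewrite exprVn.
    apply: cvg_expr; rewrite ger0_norm ?invr_ge0 //; lra.
  move=> /cvgrPdist_lt /(_ (d / K)); rewrite divr_gt0 // => /(_ isT)[n _ /(_ n (leqnn n))].
  rewrite sub0r normrN ger0_norm ?invr_ge0 ?exprn_ge0 // => /= h.
  by exists n; rewrite -ltr_pdivlMr.
have [/= s0 [xx1 xx2] [yy1 yy2] M] := Iu n; rewrite uE in s0 xx2 yy2 M.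
have HXn := HX n; have HYn := HY n; rewrite /= uE in HXn HYn.
set x := (u n).1.1 in xx1 xx2 HXn; set y := (u n).1.2 in yy1 yy2 HYn.
set s := 2 ^- n in s0 nd xx2 yy2 M HXn HYn.
rewrite /mu uE -/x -/y -/s in M.
pose z0 := Complex X Y.
(* The affine part has the primitive [F], so its contour integral vanishes and only the remainder
   counts. *)
pose lin w := f z0 + l * (w - z0).
pose F w := f z0 * w + (l / 2) * (w - z0) ^+ 2.
have HF z : cder F z (lin z).
  have D1 : cder (fun w => w - z0) z 1 by have := cderB (cder_id z) (cder_cst z0 z); rewrite subr0.
  have := cderD (cderZ (f z0) (cder_id z)) (cderZ (l / 2) (cderX 2 D1)).
  by congr cder; rewrite /lin /= expr1; field.
have sa : 0 <= s * a by rewrite mulr_ge0 // ltW.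
have sb : 0 <= s * b by rewrite mulr_ge0 // ltW.
have inR z : crect x (x + s * a) y (y + s * b) z -> crect x1 x2 y1 y2 z.
  rewrite /crect /= !betweenP ?lerDl // => -[h1 h2].
  by split; [exact: itv_weaken h1|exact: itv_weaken h2].
have B : cmod (rbd f x (x + s * a) y (y + s * b)) <=
  2 * (ep * (s * K)) * (`|x + s * a - x| + `|y + s * b - y|).
  rewrite -[rbd f _ _ _ _]subr0 -(@rbd_prim _ lin F x (x + s * a) y (y + s * b)) //.
  apply: rbd_dist => [z /inR /fc //|z _|z].
    have := cderD (cder_cst (f z0) z) (cderZ l (cderB (cder_id z) (cder_cst z0 z))).
    by move=> /cder_cont.
  rewrite /crect /= !betweenP ?lerDl // => -[/andP[h1 h2] /andP[h3 h4]].
  case/andP: HXn => h5 h6; case/andP: HYn => h7 h8.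
  have dz : cmod (z - z0) <= s * K.
    apply: le_trans (cmod_le_add _) _.
    have -> : complex.Re (z - z0) = complex.Re z - X by case: (z).
    have -> : complex.Im (z - z0) = complex.Im z - Y by case: (z).
    have : `|complex.Re z - X| <= s * a by rewrite ler_norml; apply/andP; split; lra.
    have : `|complex.Im z - Y| <= s * b by rewrite ler_norml; apply/andP; split; lra.
    have -> : s * K = s * a + s * b + s by rewrite /K; ring.
    by move: s0; lra.
  have := dH z (le_lt_trans dz nd); rewrite /lin opprD addrA => /le_trans; apply.
  by rewrite ler_wpM2l // ltW.
have E1 : x + s * a - x = s * a by ring.
have E2 : y + s * b - y = s * b by ring.
rewrite E1 E2 !ger0_norm // in B.
have := le_trans M B.
have -> : 2 * (ep * (s * K)) * (s * a + s * b) = (2 * ep * K * (a + b)) * s ^+ 2 by ring.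
rewrite ler_pM2r ?exprn_gt0 // => h.
have : 2 * ep * K * (a + b) < e.
  have -> : e = ep * (4 * K ^+ 2) by rewrite /ep divfK // gt_eqF // mulr_gt0 // exprn_gt0.
  have -> : 2 * ep * K * (a + b) = ep * (K * (2 * (a + b))) by ring.
  have -> : 4 * K ^+ 2 = K * (4 * K) by ring.
  by rewrite ltr_pM2l // ltr_pM2l //; move: a0 b0; rewrite /K; clear; lra.
by rewrite ltNge h.
Qed.

Lemma goursat f x1 x2 y1 y2 :
  (forall z, crect x1 x2 y1 y2 z -> exists l, cder f z l) -> rbd f x1 x2 y1 y2 = 0.
Proof.
wlog x12 : x1 x2 / x1 <= x2 => [W H|].
  case: (leP x1 x2) => [/W|/ltW /W W']; first exact.
  rewrite rbd_swapx W' ?oppr0 // => z [zx zy]; apply: H; split => //.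
  by rewrite betweenC.
wlog y12 : y1 y2 / y1 <= y2 => [W H|].
  case: (leP y1 y2) => [/W|/ltW /W W']; first exact.
  rewrite rbd_swapy W' ?oppr0 // => z [zx zy]; apply: H; split => //.
  by rewrite betweenC.
exact: goursat_le.
Qed.

(** The horizontal-then-vertical path from [z0] to a point of [A] then stays in [A], together with
    the rectangle it spans; both disks and the whole plane qualify. *)
Definition boxed (A : set R[i]) z0 := forall z, A z ->
  crect (complex.Re z0) (complex.Re z) (complex.Im z0) (complex.Im z) `<=` A.

(** The primitive is the integral along the horizontal-then-vertical path from [z0]. Its increment
    from [z] to [w] differs from the integral along the short path between them by a rectangle
    integral, which is 0. *)
Lemma morera_boxed f (A : set R[i]) z0 : open A -> boxed A z0 ->
  (forall z, A z -> ccont f z) ->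
  (forall x1 x2 y1 y2, crect x1 x2 y1 y2 `<=` A -> rbd f x1 x2 y1 y2 = 0) ->
  exists F : R[i] -> R[i], forall z, A z -> cder F z (f z).
Proof.
move=> /open_diskP oA bA fc rbd0.
pose c := complex.Re z0; pose d := complex.Im z0.
pose F z := hint f d c (complex.Re z) + vint f (complex.Re z) d (complex.Im z).
exists F => z Az e e0.
have e20 : 0 < e / 2 by rewrite divr_gt0.
have [d1 d10 dA] := oA z Az.
have [d2 d20 dfc] := fc z Az _ e20.
exists (Num.min d1 d2) => [|w]; first by rewrite lt_min d10.
rewrite lt_min => /andP[wd1 wd2].
have cE (v : R[i]) : v = Complex (complex.Re v) (complex.Im v) by case: v.
move: dA dfc Az wd1 wd2; rewrite (cE z) (cE w) /F /=.
move: (complex.Re z) (complex.Im z) (complex.Re w) (complex.Im w) => x y x' y' dA dfc Az wd1 wd2.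
have near u v : between x x' u -> between y y' v ->
    cmod (Complex u v - Complex x y) <= cmod (Complex x' y' - Complex x y).
  move=> /between_dist ux /between_dist vy; rewrite !cmodE ler_wsqrtr //=.
  by apply: lerD; rewrite -(real_normK (num_real (_ - _))) -[leRHS]real_normK ?num_real //
     lerXn2r ?nnegrE.
have inA u v : between x x' u -> between d y v -> A (Complex u v).
  move=> hu hv; apply: (bA (Complex u y)); last by split => //=; exact: between_r.
  by apply: dA; apply: le_lt_trans wd1; apply: near => //; exact: between_l.
have inA' u v : between x x' u -> between y y' v -> A (Complex u v).
  by move=> hu hv; apply: dA; apply: le_lt_trans wd1; apply: near.
have inA0 u : between c x u -> A (Complex u d).
  by move=> hu; apply: (bA (Complex x y)) => //; split => //=; exact: between_l.
have G : rbd f x x' d y = 0 by apply: rbd0 => -[u v] [/= ? ?]; exact: inA.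
have T1 : hint f d c x + hint f d x x' = hint f d c x'.
  by apply: hint_add => t ht; apply: fc; [exact: inA0|apply: inA => //; exact: between_l].
have T2 : vint f x' d y + vint f x' y y' = vint f x' d y'.
  apply: vint_add => t ht; apply: fc; [apply: inA => //; exact: between_r|].
  by apply: inA' => //; exact: between_r.
rewrite -T1 -T2.
have -> : hint f d c x + hint f d x x' + (vint f x' d y + vint f x' y y') -
   (hint f d c x + vint f x d y) - f (Complex x y) * (Complex x' y' - Complex x y) =
   rbd f x x' d y + (hint f y x x' - f (Complex x y) * (x' - x)%:C) +
   (vint f x' y y' - f (Complex x y) * (Complex 0 1 * (y' - y)%:C)).
  have -> : Complex x' y' - Complex x y = (x' - x)%:C + Complex 0 1 * (y' - y)%:C.
    by apply/eqP; rewrite eq_complex /=; apply/andP; split; apply/eqP; ring.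
  by rewrite /rbd; ring.
rewrite G add0r.
pose k (_ : R[i]) := f (Complex x y).
have HK (z' : R[i]) : cder (fun w => f (Complex x y) * w) z' (k z').
  by have := cderZ (f (Complex x y)) (cder_id z'); rewrite mulr1.
have kc z' : ccont k z' by have := cder_cont (cder_cst (f (Complex x y)) z').
have hk : hint k y x x' = f (Complex x y) * (x' - x)%:C.
  rewrite (hint_prim (F := fun w => f (Complex x y) * w)) // -mulrBr; congr (_ * _).
  by apply/eqP; rewrite eq_complex /= subrr !eqxx.
have vk : vint k x' y y' = f (Complex x y) * (Complex 0 1 * (y' - y)%:C).
  rewrite (vint_prim (F := fun w => f (Complex x y) * w)) // -mulrBr; congr (_ * _).
  by apply/eqP; rewrite eq_complex /=; apply/andP; split; apply/eqP; ring.
rewrite -hk -vk.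
have dz : `|x' - x| <= cmod (Complex x' y' - Complex x y) := normRe_le (Complex x' y' - Complex x y).
have dy : `|y' - y| <= cmod (Complex x' y' - Complex x y) := normIm_le (Complex x' y' - Complex x y).
apply: le_trans (cmodD _ _) _; rewrite [e]splitr mulrDl lerD //.
  apply: le_trans (@hint_dist _ f k y x x' (e / 2) _ _ _) _ => [t ht|t ht|t ht|].
  - by apply: fc; apply: inA => //; exact: between_r.
  - exact: kc.
  - by apply/ltW/dfc; apply: le_lt_trans wd2; apply: near => //; exact: between_l.
  - by rewrite ler_wpM2l // ltW.
apply: le_trans (@vint_dist _ f k x' y y' (e / 2) _ _ _) _ => [t ht|t ht|t ht|].
- by apply: fc; apply: inA' => //; exact: between_r.
- exact: kc.
- by apply/ltW/dfc; apply: le_lt_trans wd2; apply: near => //; exact: between_r.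
- by rewrite ler_wpM2l // ltW.
Qed.

Lemma primitive_boxed f (A : set R[i]) z0 : open A -> boxed A z0 ->
  (forall z, A z -> exists l, cder f z l) ->
  exists F : R[i] -> R[i], forall z, A z -> cder F z (f z).
Proof.
move=> oA bA Hf; apply: (@morera_boxed _ _ z0) => // [z /Hf[l /cder_cont] //|x1 x2 y1 y2 sA].
by apply: goursat => z /sA /Hf.
Qed.

Lemma boxed_disk z r : boxed (disk z r) z.
Proof.
move=> w wr v [vx vy]; apply: le_lt_trans wr.
rewrite !cmodE ler_wsqrtr //; case: z w v vx vy => [? ?] [? ?] [? ?] /= vx vy.
by apply: lerD; rewrite -(real_normK (num_real (_ - _))) -[leRHS]real_normK ?num_real //
  lerXn2r ?nnegrE // between_dist.
Qed.

Lemma primitive_disk f z r : (forall w, disk z r w -> exists l, cder f w l) ->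
  exists F : R[i] -> R[i], forall w, disk z r w -> cder F w (f w).
Proof. by move=> H; apply: (@primitive_boxed _ _ z) => //; [exact: disk_open|exact: boxed_disk]. Qed.

End GoursatTheorem.

(** * Circle means and differentiability of the derivative *)

Section CauchyTheory.
Context {R : realType}.
Implicit Types (f g k D : R[i] -> R[i]) (z w c l a b : R[i]) (r s t M : R).

Definition cseg a b t := a + t%:C * (b - a).

Lemma rcder_cseg a b t : rcder (cseg a b) t (b - a).
Proof.
move=> e e0; exists 1 => // s _; rewrite /cseg.
have -> : a + s%:C * (b - a) - (a + t%:C * (b - a)) - (b - a) * (s - t)%:C = 0.
  by rewrite rmorphB; ring.
by rewrite cmod0 mulr_ge0 // ltW.
Qed.

Lemma disk_cseg c r a b t : disk c r a -> disk c r b -> 0 <= t <= 1 -> disk c r (cseg a b t).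
Proof.
rewrite /disk /= => ac bc /andP[t0 t1].
have -> : cseg a b t - c = (1 - t)%:C * (a - c) + t%:C * (b - c).
  by rewrite /cseg rmorphB rmorph1; ring.
apply: le_lt_trans (cmodD _ _) _; rewrite !cmodM !cmod_real0 ?subr_ge0 //.
have [->|t1'] := eqVneq t 1; first by rewrite subrr mul0r add0r mul1r.
have t1'' : 0 < 1 - t by rewrite subr_gt0 lt_neqAle t1' t1.
have -> : r = (1 - t) * r + t * r by ring.
apply: ltr_leD; first by rewrite ltr_pM2l.
by rewrite ler_wpM2l // ltW.
Qed.

(** Subtracting the linear map of slope [l] lets one inequality serve both for Lipschitz bounds,
    with [l = 0], and for second-order remainders, with [l = D a]. *)
Lemma cseg_bound f D a b l M :
  (forall t, 0 <= t <= 1 -> cder f (cseg a b t) (D (cseg a b t))) ->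
  (forall t, 0 <= t <= 1 -> cmod (D (cseg a b t) - l) <= M) ->
  cmod (f b - f a - l * (b - a)) <= M * cmod (b - a).
Proof.
move=> HD HM.
have := @rcder_bound _ (fun t => f (cseg a b t) + (-1) * (l * (b - a) * t%:C))
   (fun t => D (cseg a b t) * (b - a) + (-1) * (l * (b - a))) 0 1 (M * cmod (b - a)) ler01.
have e0 : cseg a b 0 = a by rewrite /cseg mul0r addr0.
have e1 : cseg a b 1 = b by rewrite /cseg mul1r addrC subrK.
rewrite subr0 mulr1 e0 e1.
have -> : f b + -1 * (l * (b - a) * 1%:C) - (f a + -1 * (l * (b - a) * 0%:C)) =
   f b - f a - l * (b - a) by rewrite rmorph1 rmorph0; ring.
apply => t t01.
  apply: rcderD; first by apply: rcder_comp (HD t t01) (rcder_cseg a b t).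
  apply: rcderZ => e e0'; exists 1 => // s _.
  have -> : l * (b - a) * s%:C - l * (b - a) * t%:C - l * (b - a) * (s - t)%:C = 0.
    by rewrite rmorphB; ring.
  by rewrite cmod0 mulr_ge0 // ltW.
have -> : D (cseg a b t) * (b - a) + -1 * (l * (b - a)) = (D (cseg a b t) - l) * (b - a) by ring.
by rewrite cmodM ler_wpM2r ?cmod_ge0 // HM.
Qed.

Definition circ c r t := c + r%:C * cis t.

Lemma circ_dist c r t : 0 <= r -> cmod (circ c r t - c) = r.
Proof. by move=> r0; rewrite /circ addrAC subrr add0r cmodM cmod_cis mulr1 cmod_real0. Qed.

Lemma circ_rccont c r t e : 0 < e -> exists2 d, 0 < d &
  forall s, `|s - t| < d -> cmod (circ c r s - circ c r t) < e.
Proof.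
move=> e0; have H := rcderD (rcder_cst c t) (rcderZ (r%:C) (rcder_cis t)).
exact: (rcder_cont H e0).
Qed.

Lemma rccont_circ k c r t : ccont k (circ c r t) -> rccont (fun s => k (circ c r s)) t.
Proof.
move=> H e /H[d /(circ_rccont c r t)[d' d'0 dH'] dH]; exists d' => // s /dH'.
exact: dH.
Qed.

(** Integration against the angle and not against [dz]: [2 * pi] times the mean over the circle. *)
Definition circint k c r := cint (fun t => k (circ c r t)) 0 (2 * pi).

Let pi2 : 0 <= 2 * pi :> R.
Proof. by rewrite mulr_ge0 // pi_ge0. Qed.

Lemma circint_dist k g c r M :
  (forall t, ccont k (circ c r t)) -> (forall t, ccont g (circ c r t)) ->
  (forall t, cmod (k (circ c r t) - g (circ c r t)) <= M) ->
  cmod (circint k c r - circint g c r) <= M * (2 * pi).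
Proof.
move=> kc gc H; apply: le_trans (@cint_dist _ _ _ _ _ M _ _ _) _ => [t _|t _|t _|].
- exact: rccont_circ.
- exact: rccont_circ.
- exact: H.
- by rewrite subr0 ger0_norm.
Qed.

Lemma circint_cst l c r : circint (fun=> l) c r = l * (2 * pi)%:C.
Proof.
rewrite /circint (@cint_prim _ _ _ _ (fun t => l * t%:C)) ?rmorph0 ?mulr0 ?subr0 // => t _ e e0.
exists 1 => // s _; rewrite -mulrBr -rmorphB subrr cmod0 mulr_ge0 // ltW //.
Qed.

Lemma cexp_circ (x t : R) : cexp (Complex x t) = (expR x)%:C * cis t.
Proof. by []. Qed.

(* Goursat's theorem on a rectangle of height [2 * pi] in the logarithmic
   coordinate. *)
Lemma circint_radius k c r0 r1 r2 : 0 < r1 -> r1 <= r2 -> r2 < r0 ->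
  (forall z, disk c r0 z -> z != c -> exists l, cder k z l) ->
  circint k c r1 = circint k c r2.
Proof.
move=> r10 r12 r20 Hk.
have r2_0 := lt_le_trans r10 r12.
pose G w := k (c + cexp w).
have GE x t : 0 < x -> G (Complex (ln x) t) = k (circ c x t).
  by move=> x0; rewrite /G cexp_circ lnK.
have := @goursat _ G (ln r1) (ln r2) 0 (2 * pi).
have l12 : ln r1 <= ln r2 by rewrite ler_ln ?posrE.
move=> /(_ _)/wrap[].
  move=> [x t] [/=]; rewrite betweenP // => /andP[x1 x2] _.
  have xr : disk c r0 (c + cexp (Complex x t)).
    rewrite /disk /= addrAC subrr add0r cmod_cexp /=; apply: le_lt_trans r20.
    by rewrite -[leRHS]lnK ?posrE // ler_expR.
  have [|l Hl] := Hk _ xr.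
    by rewrite -subr_eq0 addrAC subrr add0r cexp_neq0.
  exists (l * (0 + cexp (Complex x t))).
  have := cder_comp (f := fun w => c + cexp w) (g := k) Hl.
  by apply; apply: cderD; [exact: cder_cst|exact: cder_cexp].
rewrite /rbd.
have -> : hint G (2 * pi) (ln r1) (ln r2) = hint G 0 (ln r1) (ln r2).
  rewrite /hint; congr cint; apply/funext => x; rewrite /G !cexp_circ.
  by rewrite /cis cos0 sin0 mulr_natl cos2pi sin2pi.
rewrite /vint; have E0 : forall u v w : R[i], u + v - u - w = 0 -> w = v.
  by move=> u v w /eqP; rewrite subr_eq0 addrAC subrr add0r => /eqP.
have E x : 0 < x -> (fun t => k (circ c x t)) = (fun t => G (Complex (ln x) t)).
  by move=> x0; apply/funext => t; rewrite GE.
move=> /E0 EE; rewrite /circint (E r1 r10) (E r2 r2_0).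
by apply: (mulfI _) EE; rewrite eq_complex /= oner_eq0 andbF.
Qed.

(** The circle mean does not depend on the radius, which can therefore shrink to 0. Only the limit
    [l] at [c] matters, so that difference quotients, undefined at [c], are allowed. *)
Lemma mean_value k c r0 l r : 0 < r -> r < r0 ->
  (forall z, disk c r0 z -> z != c -> exists m, cder k z m) ->
  (forall e, 0 < e -> exists2 d, 0 < d & forall z, z != c -> disk c d z -> cmod (k z - l) <= e) ->
  circint k c r = l * (2 * pi)%:C.
Proof.
move=> r00 rr0 Hk Hl; apply/eqP; rewrite -subr_eq0 -cmod_eq0 eq_le cmod_ge0 andbT.
apply/ler_addgt0Pl => e e0; rewrite addr0.
have p1 : 0 < 2 * pi + 1 :> R by rewrite ltr_wpDl.
have e1 : 0 < e / (2 * pi + 1) by rewrite divr_gt0.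
have [d d0 dH] := Hl _ e1.
pose s := Num.min r (d / 2).
have s0 : 0 < s by rewrite lt_min r00 divr_gt0.
have sr : s <= r by rewrite ge_min lexx.
have sd : s < d by rewrite gt_min ltr_pdivrMr // ltr_pMr // ltr1n orbT.
rewrite -(circint_radius s0 sr rr0 Hk) -(circint_cst l c s).
have nc t : circ c s t != c by rewrite -subr_eq0 -cmod_eq0 circ_dist ?gt_eqF // ltW.
apply: le_trans (@circint_dist k (fun=> l) c s (e / (2 * pi + 1)) _ _ _) _ => [t|t|t|].
- have [|m /cder_cont//] := Hk (circ c s t) _ (nc t).
  by rewrite /disk /= circ_dist ?ltW //; lra.
- exact: cder_cont (cder_cst _ _).
- by apply: dH => //; rewrite /disk /= circ_dist ?ltW.
rewrite mulrAC ler_pdivrMr //; apply: ler_wpM2l; first exact: ltW.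
by rewrite lerDl.
Qed.

Lemma deriv_mean_value f D c r0 r : 0 < r -> r < r0 ->
  (forall z, disk c r0 z -> cder f z (D z)) ->
  circint (fun z => (f z - f c) / (z - c)) c r = D c * (2 * pi)%:C.
Proof.
move=> r00 rr0 Hf; apply: (@mean_value _ _ r0) => // [z zr zc|e e0].
  have zc' : z - c != 0 by rewrite subr_eq0.
  eexists; exact: (@cder_div _ (fun w => f w - f c) (fun w => w - c) z _ _ zc'
    (cderB (Hf z zr) (cder_cst (f c) z)) (cderB (cder_id z) (cder_cst c z))).
have [|d d0 dH] := Hf c _ e e0; first exact: disk_center (lt_trans r00 rr0).
exists d => // z zc zd; have := dH z zd.
have zc' : z - c != 0 by rewrite subr_eq0.
rewrite -ler_pdivrMr ?cmod_gt0 // -cmodf; apply: le_trans.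
by rewrite [(f z - f c - _) / _]mulrBl mulfK.
Qed.

Lemma cauchy_mean f c r0 r : 0 < r -> r < r0 ->
  (forall z, disk c r0 z -> exists l, cder f z l) ->
  circint f c r = f c * (2 * pi)%:C.
Proof.
move=> r00 rr0 Hf; apply: (@mean_value _ _ r0) => // [z zr zc|e e0]; first exact: Hf.
have [|l /cder_cont/(_ e e0)[d d0 dH]] := Hf c; first exact: disk_center (lt_trans r00 rr0).
by exists d => // z _ /dH /ltW.
Qed.

Let pi2_gt0 : 0 < 2 * pi :> R.
Proof. by rewrite mulr_gt0 // pi_gt0. Qed.

(* The derivatives at [a] and [b] are both means over circles of radius [r]. *)
Lemma deriv_dist f g D E a b r0 r M : 0 < r -> r < r0 ->
  (forall z, disk a r0 z -> cder f z (D z)) ->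
  (forall z, disk b r0 z -> cder g z (E z)) ->
  (forall w, cmod w = r -> cmod ((f (a + w) - f a) - (g (b + w) - g b)) <= M) ->
  cmod (D a - E b) <= M / r.
Proof.
move=> r00 rr0 Hf Hg HM.
have Hf' := deriv_mean_value r00 rr0 Hf; have Hg' := deriv_mean_value r00 rr0 Hg.
rewrite -(ler_pM2r pi2_gt0) -[X in _ * X <= _]cmod_real0 // -cmodM mulrBl -Hf' -Hg'.
have cE t : cmod (r%:C * cis t) = r by rewrite cmodM cmod_cis mulr1 cmod_real0 // ltW.
have cn t : r%:C * cis t != 0 by rewrite -cmod_gt0 cE.
apply: le_trans (@cint_dist _ _ _ _ _ (M / r) _ _ _) _ => [t _|t _|t _|].
- apply: (@rccont_circ (fun z => (f z - f a) / (z - a))); have zc : circ a r t - a != 0 by rewrite /circ addrAC subrr add0r.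
  have zr : disk a r0 (circ a r t) by rewrite /disk /= circ_dist // ltW.
  exact: cder_cont (@cder_div _ (fun w => f w - f a) (fun w => w - a) _ _ _ zc
    (cderB (Hf _ zr) (cder_cst (f a) _)) (cderB (cder_id _) (cder_cst a _))).
- apply: (@rccont_circ (fun z => (g z - g b) / (z - b))); have zc : circ b r t - b != 0 by rewrite /circ addrAC subrr add0r.
  have zr : disk b r0 (circ b r t) by rewrite /disk /= circ_dist // ltW.
  exact: cder_cont (@cder_div _ (fun w => g w - g b) (fun w => w - b) _ _ _ zc
    (cderB (Hg _ zr) (cder_cst (g b) _)) (cderB (cder_id _) (cder_cst b _))).
- have Ea x : circ x r t - x = r%:C * cis t by rewrite /circ; ring.
  rewrite !Ea -mulrBl cmodf cE ler_pM2r ?invr_gt0 //.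
  exact: HM.
by rewrite subr0 ger0_norm.
Qed.

(** Three uses of circle means of difference quotients: they bound [D] by [L], so [f] is Lipschitz;
    the same estimate for differences makes [D] Lipschitz with constant [L2]; the resulting
    second-order expansions of [f] then yield the derivative of [D] with a quadratic error. *)
Lemma cder_deriv f D (A : set R[i]) : open A -> (forall z, A z -> cder f z (D z)) ->
  forall c, A c -> exists l, cder D c l.
Proof.
move=> /open_diskP oA Hf c Ac.
have [r1 r10 r1A] := oA c Ac.
have [r2 r20 r2f] := cder_cont (Hf c Ac) (@ltr01 R).
have [r [r0 r1' r2']] : exists r, [/\ 0 < r, 4 * r <= r1 & 4 * r <= r2].
  exists (Num.min r1 r2 / 4); split; first by rewrite divr_gt0 // lt_min r10.
    by rewrite mulrC divfK // ge_min lexx.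
  by rewrite mulrC divfK // ge_min lexx orbT.
pose M := cmod (f c) + 1.
have M0 : 0 < M by rewrite ltr_wpDl // cmod_ge0.
have HD z : disk c (4 * r) z -> cder f z (D z) by move=> /(sub_disk r1') /r1A /Hf.
have fM z : disk c (4 * r) z -> cmod (f z) <= M.
  move=> /(sub_disk r2') /r2f /ltW zz; apply: le_trans (cmod_le_subD _ (f c)) _.
  by rewrite /M addrC lerD2l.
pose L := 2 * M / r.
have L0 : 0 <= L by apply: divr_ge0; [apply: mulr_ge0 => //|]; exact: ltW.
have r2r : r < 2 * r by lra.
have DL z : disk c (2 * r) z -> cmod (D z) <= L.
  move=> zr.
  have sub : disk z (2 * r) `<=` disk c (4 * r).
    by apply: disk_sub; move: zr; rewrite /disk /=; lra.
  rewrite -[D z]subr0.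
  apply: (@deriv_dist f (fun=> 0) D (fun=> 0) z z (2 * r) r (2 * M) r0 r2r) =>
    [w /sub/HD//|w _|w wr]; first exact: cder_cst.
  rewrite subrr subr0; apply: le_trans (cmodB _ _) _; rewrite mulr_natl mulr2n.
  apply: lerD; apply/fM/sub; rewrite /disk /= ?subrr ?cmod0 ?mulr_gt0 //.
  by rewrite addrAC subrr add0r wr.
have fL a b : disk c (2 * r) a -> disk c (2 * r) b -> cmod (f b - f a) <= L * cmod (b - a).
  move=> ar br; rewrite -[f b - f a]subr0 -[X in _ - X](mul0r (b - a)).
  apply: (@cseg_bound f D a b 0 L) => t t01.
    by apply: HD; apply: (@sub_disk _ c (2 * r)); [lra|exact: disk_cseg].
  by rewrite subr0; apply: DL; exact: disk_cseg.
have rh0 : 0 < r / 2 by rewrite divr_gt0.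
have rhr : r / 2 < r by lra.
pose L2 := 4 * L / r.
have L20 : 0 <= L2 by apply: divr_ge0; [exact: mulr_ge0|exact: ltW].
have DL2 a b : disk c r a -> disk c r b -> cmod (D b - D a) <= L2 * cmod (b - a).
  move=> ar br.
  have sub a' : disk c r a' -> disk a' r `<=` disk c (2 * r).
    by move=> a'r; apply: disk_sub; move: a'r; rewrite /disk /=; lra.
  have sub' : disk c (2 * r) `<=` disk c (4 * r) by apply: sub_disk; lra.
  have := @deriv_dist f f D D b a r (r / 2) (2 * (L * cmod (b - a))) rh0 rhr.
  have -> : 2 * (L * cmod (b - a)) / (r / 2) = L2 * cmod (b - a).
    by rewrite /L2; field; rewrite gt_eqF.
  apply => [z /(sub _ br)/sub'/HD//|z /(sub _ ar)/sub'/HD//|w wr].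
  have -> : f (b + w) - f b - (f (a + w) - f a) = (f (b + w) - f (a + w)) - (f b - f a) by ring.
  apply: le_trans (cmodB _ _) _; rewrite mulr_natl mulr2n; apply: lerD; last first.
    by apply: fL; apply: (@sub_disk _ _ r) => //; lra.
  have -> : cmod (b - a) = cmod (b + w - (a + w)) by congr cmod; ring.
  by apply: fL; [apply: (sub _ ar)|apply: (sub _ br)]; rewrite /disk /= addrAC subrr add0r wr.
(* The derivative of [D] at [c] must be this mean, by [deriv_mean_value] applied to [D]. *)
pose X := circint (fun z => (D z - D c) / (z - c)) c (r / 2) / (2 * pi)%:C.
have key h : cmod h < r / 2 -> cmod (D (c + h) - D c - h * X) <= 4 * L2 / r * cmod h ^+ 2.
  move=> hr.
  have T a : disk c r a -> disk c r (a + h) ->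
      cmod (f (a + h) - f a - D a * h) <= L2 * cmod h ^+ 2.
    move=> ar ahr; have := @cseg_bound f D a (a + h) (D a) (L2 * cmod h).
    rewrite (addrAC a h (- a)) subrr add0r -mulrA -expr2; apply => t t01.
      by apply: HD; apply: (@sub_disk _ c r); [lra|exact: disk_cseg].
    apply: le_trans (DL2 _ _ ar (disk_cseg ar ahr t01)) _; rewrite ler_wpM2l //.
    rewrite /cseg (addrAC a h (- a)) subrr add0r addrAC subrr add0r cmodM.
    case/andP: t01 => t0 t1; rewrite cmod_real0 // -[leRHS]mul1r ler_wpM2r //.
    exact: cmod_ge0.
  have pC : (2 * pi : R)%:C != 0 by rewrite realC_eq0 gt_eqF.
  have rr : r / 2 < r by lra.
  have ch : disk c r (c + h) by rewrite /disk /= addrAC subrr add0r; lra.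
  have Hc z : disk c r z -> cder f z (D z) by move=> zr; apply: HD; apply: sub_disk zr; lra.
  have Hch z : disk c r z -> disk c (4 * r) (z + h).
    move=> zr; rewrite /disk /= addrAC; apply: le_lt_trans (cmodD _ _) _.
    by move: zr; rewrite /disk /=; lra.
  pose F z := f (z + h).
  have HF z : disk c r z -> cder F z (D (z + h)).
    move=> zr; have := cder_comp (f := fun z => z + h) (g := f) (HD _ (Hch z zr))
      (cderD (cder_id z) (cder_cst h z)).
    by rewrite addr0 mulr1.
  have E1 := deriv_mean_value rh0 rr HF; have E2 := deriv_mean_value rh0 rr Hc.
  rewrite -(ler_pM2r pi2_gt0) -[X in _ * X <= _]cmod_real0 // -cmodM.
  have Dc z : disk c r z -> ccont D z.
    move=> zr e e0; have L21 : 0 < L2 + 1 by rewrite ltr_wpDl.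
    exists (Num.min (e / (L2 + 1)) (r - cmod (z - c))).
      by rewrite lt_min divr_gt0 //= subr_gt0.
    move=> w; rewrite lt_min ltr_pdivlMr // => /andP[w1 w2].
    have wr : disk c r w.
      by rewrite /disk /=; apply: le_lt_trans (cmod_triang w z c) _; lra.
    apply: le_lt_trans (DL2 _ _ zr wr) _; apply: le_lt_trans w1.
    by rewrite mulrC ler_wpM2l ?cmod_ge0 // lerDl.
  (* Written as one circle integral, the integrand becomes the difference of the second-order
     remainders of [f] at [z] and at [c], divided by [z - c]; [T] bounds both. *)
  have -> : (D (c + h) - D c - h * X) * (2 * pi)%:C =
     circint (fun z => (F z - F c) / (z - c)) c (r / 2) -
     (circint (fun z => (f z - f c) / (z - c)) c (r / 2) +
      h * circint (fun z => (D z - D c) / (z - c)) c (r / 2)).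
    by rewrite E1 E2 /X; move: ((2 * pi)%:C) pC => P pC; field.
  have cr t : disk c r (circ c (r / 2) t) by rewrite /disk /= circ_dist // ltW.
  have cn t : circ c (r / 2) t - c != 0 by rewrite -cmod_gt0 circ_dist // ltW.
  have C0 t : ccont (fun z => (z - c)^-1) (circ c (r / 2) t).
    exact: cder_cont (@cderV _ (fun w => w - c) _ _ (cn t) (cderB (cder_id _) (cder_cst c _))).
  have Cq (k : R[i] -> R[i]) t : ccont k (circ c (r / 2) t) ->
     rccont (fun s => (k (circ c (r / 2) s) - k c) / (circ c (r / 2) s - c)) t.
    move=> kc; apply: (@rccont_circ (fun z => (k z - k c) / (z - c))).
    exact: ccontM (ccontB kc (ccont_cst (k c) _)) (C0 t).
  have [P HP] := @cint_prim_exists _ (fun s => (F (circ c (r / 2) s) - F c) / (circ c (r / 2) s - c))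
     0 (2 * pi) (fun t _ => Cq F t (cder_cont (HF _ (cr t)))).
  have [Q HQ] := @cint_prim_exists _ (fun s => (f (circ c (r / 2) s) - f c) / (circ c (r / 2) s - c))
     0 (2 * pi) (fun t _ => Cq f t (cder_cont (Hc _ (cr t)))).
  have [S HS] := @cint_prim_exists _ (fun s => (D (circ c (r / 2) s) - D c) / (circ c (r / 2) s - c))
     0 (2 * pi) (fun t _ => Cq D t (Dc _ (cr t))).
  rewrite /circint (cint_prim HP) (cint_prim HQ) (cint_prim HS).
  have -> : P (2 * pi) - P 0 - (Q (2 * pi) - Q 0 + h * (S (2 * pi) - S 0)) =
    (P (2 * pi) + (-1) * (Q (2 * pi) + h * S (2 * pi))) - (P 0 + (-1) * (Q 0 + h * S 0)) by ring.
  have -> : 4 * L2 / r * cmod h ^+ 2 * (2 * pi) = 4 * L2 / r * cmod h ^+ 2 * (2 * pi - 0) by rewrite subr0.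
  apply: (@rcder_bound _ (fun t => P t + (-1) * (Q t + h * S t))) => // t t2;
    have tb : between 0 (2 * pi) t by rewrite betweenP.
    exact: rcderD (HP t tb) (rcderZ (-1) (rcderD (HQ t tb) (rcderZ h (HS t tb)))).
  set z := circ c (r / 2) t.
  have zc : cmod (z - c) = r / 2 by rewrite /z circ_dist // ltW.
  have -> : (F z - F c) / (z - c) + -1 * ((f z - f c) / (z - c) + h * ((D z - D c) / (z - c))) =
    ((f (z + h) - f z - D z * h) - (f (c + h) - f c - D c * h)) / (z - c).
    by rewrite /F; field; exact: cn.
  rewrite cmodf zc ler_pdivrMr //.
  have -> : 4 * L2 / r * cmod h ^+ 2 * (r / 2) = L2 * cmod h ^+ 2 + L2 * cmod h ^+ 2.
    by field; rewrite gt_eqF.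
  apply: le_trans (cmodB _ _) _; apply: lerD; apply: T => //.
  - exact: cr.
  - rewrite /disk /= addrAC; apply: le_lt_trans (cmodD _ _) _.
    by rewrite zc; lra.
  - exact: disk_center.
exists X => e e0.
pose K := 4 * L2 / r + 1.
have K0 : 0 < K by rewrite ltr_wpDl //; apply: divr_ge0; [exact: mulr_ge0|exact: ltW].
exists (Num.min (r / 2) (e / K)) => [|w]; first by rewrite lt_min rh0 divr_gt0.
rewrite lt_min => /andP[w1]; rewrite ltr_pdivlMr // => w2.
have := key _ w1; rewrite [c + _]addrC subrK [(w - c) * X]mulrC => /le_trans; apply.
have -> : 4 * L2 / r * cmod (w - c) ^+ 2 = (cmod (w - c) * (K - 1)) * cmod (w - c).
  by rewrite /K; ring.
rewrite ler_wpM2r ?cmod_ge0 //; apply: le_trans (ltW w2).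
by rewrite ler_wpM2l ?cmod_ge0 // gerBl.
Qed.

End CauchyTheory.

(** * Holomorphic functions *)

Section Compactness.
Context {R : realType}.
Implicit Types (z w c : R[i]) (r M : R).

Definition cdisk c r : set R[i] := [set z | cmod (z - c) <= r].

Lemma cdisk_compact0 r : compact (cdisk 0 r).
Proof.
pose h (p : R * R) : R[i] := Complex p.1 p.2.
have ch : continuous h.
  move=> p B /nbhs_diskP[e e0 eB].
  have e20 : 0 < e / 2 by rewrite divr_gt0.
  exists (ball p.1 (e / 2), ball p.2 (e / 2)).
    by split; apply: nbhsx_ballx.
  move=> q [/= q1 q2]; apply: eB; rewrite /disk /=.
  apply: le_lt_trans (cmod_le_add _) _ => /=; rewrite [e]splitr.
  by apply: ltrD; rewrite distrC.
have cK : compact (h @` (`[- r, r]%classic `*` `[- r, r]%classic)).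
  apply: continuous_compact; first exact: continuous_subspaceT.
  by apply: compact_setX; exact: segment_compact.
apply: (subclosed_compact _ cK).
  rewrite closedE => z /= H; rewrite /cdisk /= leNgt; apply/negP => zr.
  apply: H; apply/nbhs_diskP; exists (cmod (z - 0) - r); first by rewrite subr_gt0.
  move=> w /= wz; rewrite /cdisk /= => wr.
  have := cmod_triang z w 0; rewrite (cmodBC z w).
  by move: wz wr; rewrite /disk /=; lra.
move=> z; rewrite /cdisk /= subr0 => zr; exists (complex.Re z, complex.Im z).
  split; rewrite /= in_itv /= -ler_norml.
    exact: le_trans (normRe_le z) zr.
  exact: le_trans (normIm_le z) zr.
by rewrite /h; case: z {zr}.
Qed.

Lemma closed_bounded_compact (A : set R[i]) r : closed A -> A `<=` cdisk 0 r -> compact A.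
Proof. by move=> cA; apply: subclosed_compact => //; exact: cdisk_compact0. Qed.

Lemma closed_diskP (A : set R[i]) :
  closed A <-> forall z, (forall r, 0 < r -> exists2 w, A w & disk z r w) -> A z.
Proof.
split=> [cA z H|H z /closure_diskP]; last exact: H.
by apply: cA; apply/closure_diskP.
Qed.

Lemma compact_max (A : set R[i]) (u : R[i] -> R) : compact A -> A !=set0 ->
  (forall z, A z -> forall e : R, 0 < e -> exists2 d, 0 < d & forall w, disk z d w -> `|u w - u z| < e) ->
  exists2 z, A z & forall w, A w -> u w <= u z.
Proof.
move=> cA A0 uc.
have [|z /set_mem Az H] := @compact_EVT_max _ _ u A A0 cA.
  apply: continuous_in_subspaceT => z /set_mem Az B /nbhs_ballP[e /= e0 eB].
  have [d d0 dH] := uc z Az e e0.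
  apply/nbhs_diskP; exists d => // w /dH wz; apply: eB.
  by rewrite /ball /= distrC.
by exists z => // w Aw; apply: H; exact/mem_set.
Qed.

(** A cluster point met at arbitrarily late indices, which spares the extraction of a
    subsequence. *)
Lemma bounded_cluster (u : nat -> R[i]) M : (forall n, cmod (u n) <= M) ->
  exists p, forall r N, 0 < r -> exists2 n, (N <= n)%N & disk p r (u n).
Proof.
move=> uM; have [|p [_ Hp]] := @cdisk_compact0 M (u @ \oo).
  by exists 0%N => // n _ /=; rewrite /cdisk /= subr0.
exists p => r N r0.
have [||w [[n Nn <-] wr]] := Hp (u @` [set n | (N <= n)%N]) (disk p r).
- by exists N => // n Nn; exists n.
- by apply/nbhs_diskP; exists r.
- by exists n.
Qed.

End Compactness.

(** * Holomorphic functions, divided differences and the maximum principle *)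

Section Holomorphic.
Context {R : realType}.
Implicit Types (f g k F : R[i] -> R[i]) (z w c l a b : R[i]) (r s t M : R) (A : set R[i]).

Definition hol A f := forall z, A z -> exists l, cder f z l.

Lemma holP A f : holomorphic_on A f <-> hol A f.
Proof. by split => H z /H /cderivableP. Qed.

Definition dv f z := xget 0 [set l | cder f z l].

Lemma dvP f z l : cder f z l -> cder f z (dv f z).
Proof. by move=> H; rewrite /dv; case: xgetP => // /(_ l). Qed.

Lemma dvE f z l : cder f z l -> dv f z = l.
Proof. by move=> H; apply: cder_unique (dvP H) H. Qed.

Lemma hol_dv A f z : hol A f -> A z -> cder f z (dv f z).
Proof. by move=> H /H[l /dvP]. Qed.

Lemma dv_hol A f : open A -> hol A f -> hol A (dv f).
Proof. by move=> oA H c Ac; apply: (cder_deriv oA) Ac => z; exact: hol_dv. Qed.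

Lemma hol_cont A f z : hol A f -> A z -> ccont f z.
Proof. by move=> H /H[l /cder_cont]. Qed.

Lemma hol_sub A B f : A `<=` B -> hol B f -> hol A f.
Proof. by move=> AB H z /AB /H. Qed.

Lemma hol_cst A c : hol A (fun=> c).
Proof. by move=> z _; exists 0; exact: cder_cst. Qed.

Lemma hol_id A : hol A id.
Proof. by move=> z _; exists 1; exact: cder_id. Qed.

Lemma holD A f g : hol A f -> hol A g -> hol A (fun z => f z + g z).
Proof. by move=> H K z Az; have [l ?] := H z Az; have [m ?] := K z Az; exists (l + m); exact: cderD. Qed.

Lemma holN A f : hol A f -> hol A (fun z => - f z).
Proof. by move=> H z Az; have [l ?] := H z Az; exists (- l); exact: cderN. Qed.

Lemma holB A f g : hol A f -> hol A g -> hol A (fun z => f z - g z).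
Proof. by move=> H K z Az; have [l ?] := H z Az; have [m ?] := K z Az; exists (l - m); exact: cderB. Qed.

Lemma holM A f g : hol A f -> hol A g -> hol A (fun z => f z * g z).
Proof. by move=> H K z Az; have [l ?] := H z Az; have [m ?] := K z Az; exists (l * g z + f z * m); exact: cderM. Qed.

Lemma holX A f n : hol A f -> hol A (fun z => f z ^+ n).
Proof. by move=> H z Az; have [l ?] := H z Az; exists (n%:R * f z ^+ n.-1 * l); exact: cderX. Qed.

Lemma holV A f : hol A f -> (forall z, A z -> f z != 0) -> hol A (fun z => (f z)^-1).
Proof. by move=> H f0 z Az; have [l ?] := H z Az; exists (- l / f z ^+ 2); apply: cderV => //; exact: f0. Qed.

Lemma hol_div A f g : hol A f -> hol A g -> (forall z, A z -> g z != 0) ->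
  hol A (fun z => f z / g z).
Proof. by move=> H K g0; apply: holM => //; exact: holV. Qed.

Lemma hol_comp A B f g : hol A f -> hol B g -> (forall z, A z -> B (f z)) ->
  hol A (g \o f).
Proof.
move=> H K AB z Az; have [l ?] := H z Az; have [m ?] := K _ (AB _ Az).
by exists (m * l); exact: cder_comp.
Qed.

Lemma hol_cexp A f : hol A f -> hol A (fun z => cexp (f z)).
Proof.
move=> H; apply: (@hol_comp A setT f cexp) => // z _.
by exists (cexp z); exact: cder_cexp.
Qed.

Lemma hol_ext A f g : open A -> (forall z, A z -> f z = g z) -> hol A f -> hol A g.
Proof.
move=> /open_diskP oA fg H z Az; have [r r0 rA] := oA z Az.
by have [l Hl] := H z Az; exists l; apply: (cder_ext r0) Hl => w /rA /fg.
Qed.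

Definition dq f c z := if z == c then dv f c else (f z - f c) / (z - c).

Lemma dqE f c z : f z - f c = dq f c z * (z - c).
Proof.
rewrite /dq; have [->|zc] := eqVneq z c; first by rewrite !subrr mulr0.
by rewrite divfK // subr_eq0.
Qed.

(** Removable singularity by hand: at [c] the derivative is half the second derivative of [f], as
    [cseg_bound] shows for [f] minus its quadratic term. *)
Lemma dq_hol A f c : open A -> A c -> hol A f -> hol A (dq f c).
Proof.
move=> oA Ac Hf z Az; have [->|zc] := eqVneq z c; last first.
  have zc0 : z - c != 0 by rewrite subr_eq0.
  have [l Hl] := Hf z Az.
  have := @cder_div _ (fun w => f w - f c) (fun w => w - c) z _ _ zc0
    (cderB Hl (cder_cst (f c) z)) (cderB (cder_id z) (cder_cst c z)).
  move=> H; eexists; apply: (@cder_ext _ _ _ _ _ (cmod (z - c)) _ _ H).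
    by rewrite cmod_gt0.
  move=> w wz; rewrite /dq ifN //; apply/eqP => wc.
  by move: wz; rewrite /disk /= wc cmodBC ltxx.
have [m Hm] := dv_hol oA Hf Ac.
exists (m / 2) => e e0.
move/open_diskP: oA => /(_ c Ac)[r r0 rA].
have [d d0 dH] := Hm e e0.
exists (Num.min r d) => [|w]; first by rewrite lt_min r0.
rewrite lt_min => /andP[wr wd].
have [->|wc] := eqVneq w c; first by rewrite !subrr mulr0 subrr cmod0 mulr0.
have wc0 : w - c != 0 by rewrite subr_eq0.
pose k z := f z - m / 2 * (z - c) ^+ 2.
have D1 x : cder (fun w => w - c) x 1.
  by have := cderB (cder_id x) (cder_cst c x); rewrite subr0.
have := @cseg_bound _ k (fun x => dv f x - m * (x - c)) c w (dv f c) (e * cmod (w - c)).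
have cs t : 0 <= t <= 1 -> cmod (cseg c w t - c) <= cmod (w - c).
  move=> /andP[t0 t1]; rewrite /cseg addrAC subrr add0r cmodM cmod_real0 //.
  by rewrite ler_piMl ?cmod_ge0.
have -> : k w - k c - dv f c * (w - c) = (dq f c w - dq f c c - m / 2 * (w - c)) * (w - c).
  rewrite mulrBl [(dq _ _ _ - _) * _]mulrBl -dqE /k /dq eqxx subrr.
  by ring.
rewrite cmodM ler_pM2r ?cmod_gt0 //; apply => t t01.
  have At : A (cseg c w t) by apply: rA; rewrite /disk /=; exact: le_lt_trans (cs t t01) wr.
  have := cderB (hol_dv Hf At) (cderZ (m / 2) (cderX 2 (D1 (cseg c w t)))).
  by congr cder; rewrite /= expr1; field.
have -> : dv f (cseg c w t) - m * (cseg c w t - c) - dv f c =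
  dv f (cseg c w t) - dv f c - m * (cseg c w t - c) by ring.
apply: le_trans (dH _ (le_lt_trans (cs t t01) wd)) _.
by rewrite ler_pM2l // cs.
Qed.

(** The boundary condition is a limsup, so [f] need not extend to the closure. It makes the sets
    where [cmod (f z)] is at least some [m > M] compact, so a value above [M] forces a maximum
    inside, which contradicts the mean value property. *)
Lemma max_principle A f M r0 : open A -> A `<=` cdisk 0 r0 -> hol A f ->
  (forall z, closure A z -> ~ A z -> forall e : R, 0 < e -> exists2 d, 0 < d &
     forall w, A w -> disk z d w -> cmod (f w) <= M + e) ->
  forall z, A z -> cmod (f z) <= M.
Proof.
move=> oA Ab Hf Hb a Aa; rewrite leNgt; apply/negP => Ma.
have oA' := (open_diskP A).1 oA.
pose m0 := (M + cmod (f a)) / 2.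
have Mm0 : M < m0 by rewrite /m0; lra.
have m0a : m0 <= cmod (f a) by rewrite /m0; lra.
have ucf z : A z -> forall e : R, 0 < e -> exists2 d, 0 < d &
    forall w, disk z d w -> `|cmod (f w) - cmod (f z)| < e.
  move=> Az e e0; have [d d0 dH] := hol_cont Hf Az e0.
  by exists d => // w /dH; apply: le_lt_trans (cmod_dist _ _).
have lev m : M < m -> compact [set z | A z /\ m <= cmod (f z)].
  move=> Mm; apply: (@closed_bounded_compact _ _ r0); last by move=> z [/Ab].
  apply/closed_diskP => z Hz.
  have Az : A z.
    apply: contrapT => nAz; have [||d d0 dH] := Hb z _ nAz ((m - M) / 2).
    - by apply/closure_diskP => r /Hz[w [Aw _] wr]; exists w.
    - by rewrite divr_gt0 // subr_gt0.
    have [w [Aw wm] wd] := Hz d d0.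
    by have := dH w Aw wd; move: wm Mm; clear; lra.
  split => //; rewrite leNgt; apply/negP => zm.
  have [|d d0 dH] := ucf z Az (m - cmod (f z)); first by rewrite subr_gt0.
  have [w [Aw wm] wd] := Hz d d0.
  by have := dH w wd; rewrite ltr_norml => /andP[_]; lra.
have [|z1 [Az1 z1m] z1max] := compact_max (lev _ Mm0) _ (fun z h => ucf z h.1).
  by exists a.
pose M1 := cmod (f z1).
have MM1 : M < M1 by apply: lt_le_trans z1m.
have fM1 z : A z -> cmod (f z) <= M1.
  move=> Az; have [h|h] := leP m0 (cmod (f z)); first exact: z1max.
  exact: le_trans (ltW h) z1m.
(* Among the maximum points take a rightmost one: on a circle around it the rightmost point has
   strictly smaller modulus, which replaces an argument by connectedness. *)
have [||z2 [Az2 z2m] z2max] := @compact_max _ _ (@complex.Re R) (lev _ MM1).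
- by exists z1.
- move=> z _ e e0; exists e => // w; apply: le_lt_trans.
  by have := normRe_le (w - z); case: (w) (z) => [? ?] [? ?].
have {}z2m : cmod (f z2) = M1 by apply/le_anti; rewrite z2m fM1.
have [r r00 rA] := oA' z2 Az2.
have rh0 : 0 < r / 2 by rewrite divr_gt0.
have rhr : r / 2 < r by lra.
have cA t : A (circ z2 (r / 2) t) by apply: rA; rewrite /disk /= circ_dist // ltW.
have E := cauchy_mean rh0 rhr (hol_sub rA Hf).
have [P HP] := @cint_prim_exists _ (fun t => f (circ z2 (r / 2) t)) 0 (2 * pi)
  (fun t _ => rccont_circ (hol_cont Hf (cA t))).
have p0 : 0 < 2 * pi :> R by rewrite mulr_gt0 // pi_gt0.
rewrite /circint (cint_prim HP) in E.
have lt1 : cmod (f (circ z2 (r / 2) 0)) < M1.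
  rewrite lt_neqAle fM1 // andbT; apply/eqP => h.
  have := z2max (circ z2 (r / 2) 0) (conj (cA 0) _); rewrite h => /(_ (lexx _)).
  rewrite /circ cis0 mulr1; case: (z2) => x y /=; lra.
pose e := (M1 - cmod (f (circ z2 (r / 2) 0))) / 2.
have e0 : 0 < e by rewrite divr_gt0 // subr_gt0.
have b0 : between 0 (2 * pi) (0 : R) by exact: between_l.
have [d d0 dH] := HP 0 b0 e e0.
(* Over the arc [[0, s]] the integral is at most [(M1 - e) * s], so the integral over the full
   circle falls short of [M1 * (2 * pi)]. *)
have [s [s0 sp sd]] : exists s : R, [/\ 0 < s, s <= 2 * pi & s < d].
  exists (Num.min (d / 2) (2 * pi)); split.
  - by rewrite lt_min p0 divr_gt0.
  - by rewrite ge_min lexx orbT.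
  - by apply: (@le_lt_trans _ _ (d / 2)); [rewrite ge_min lexx|move: d0; clear; lra].
have B1 := dH s; rewrite subr0 gtr0_norm // in B1; have {}B1 := B1 sd.
have B2 : cmod (P (2 * pi) - P s) <= M1 * (2 * pi - s).
  apply: (@rcder_bound _ _ (fun t => f (circ z2 (r / 2) t)) _ _ _ sp) => [t /andP[t1 t2]|t _]; last exact: fM1.
  by apply: HP; rewrite betweenP ?(ltW p0) // t2 (le_trans _ t1) // ltW.
have B3 : cmod (P (2 * pi) - P 0) = M1 * (2 * pi).
  by rewrite E cmodM cmod_real0 ?(ltW p0) // z2m.
have B4 : cmod (P s - P 0) <= (M1 - e) * s.
  apply: le_trans (cmod_le_subD _ (f (circ z2 (r / 2) 0) * s%:C)) _.
  apply: le_trans (lerD B1 (lexx _)) _; rewrite cmodM cmod_real0 ?(ltW s0) // -mulrDl.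
  by rewrite ler_pM2r // /e; lra.
have := cmod_triang (P (2 * pi)) (P s) (P 0); rewrite B3.
have := mulr_gt0 e0 s0; move: B2 B4; rewrite !mulrBr mulrBl; lra.
Qed.

End Holomorphic.

(** * Schwarz's lemma and Harnack's inequality *)

Section Schwarz.
Context {R : realType}.
Implicit Types (f g k F : R[i] -> R[i]) (z w c l a b : R[i]) (r s t M : R) (A : set R[i]).

Local Notation DD := (@unit_disk R).

Lemma unit_diskE z : DD z <-> cmod z < 1.
Proof. by rewrite /unit_disk /disk /= subr0. Qed.

Lemma unit_disk_open : open DD.
Proof. exact: disk_open. Qed.

Lemma disk_bounded c r : disk c r `<=` cdisk 0 (cmod c + r).
Proof.
move=> z; rewrite /disk /cdisk /= subr0 => zr.
apply: le_trans (cmod_le_subD z c) _; rewrite addrC lerD2l; exact: ltW.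
Qed.

Lemma schwarz f : hol DD f -> (forall z, DD z -> cmod (f z) <= 1) -> f 0 = 0 ->
  forall z, DD z -> cmod (f z) <= cmod z.
Proof.
move=> Hf f1 f0 z Dz.
have D0 : DD 0 by apply/unit_diskE; rewrite cmod0 ltr01.
have K : forall z, DD z -> cmod (dq f 0 z) <= 1.
  apply: (@max_principle _ DD _ _ 1) => //.
  - exact: unit_disk_open.
  - by move=> w /unit_diskE; rewrite /cdisk /= subr0 => /ltW.
  - by apply: dq_hol => //; exact: unit_disk_open.
  move=> w clw nDw e e0.
  have e1 : 0 < 1 + e by rewrite addr_gt0.
  have w1 : 1 <= cmod w by rewrite leNgt; apply/negP => /unit_diskE.
  exists (1 - (1 + e)^-1); first by rewrite subr_gt0 invf_lt1 // ltrDl.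
  move=> v Dv; rewrite /disk /= => vw.
  have vm : (1 + e)^-1 <= cmod v by have := cmod_sub_ge w v; rewrite cmodBC; lra.
  have v0 : 0 < cmod v by apply: lt_le_trans vm; rewrite invr_gt0.
  rewrite /dq ifN -?cmod_gt0 // f0 !subr0 cmodf ler_pdivrMr //.
  apply: le_trans (f1 _ Dv) _; apply: (@le_trans _ _ ((1 + e) * (1 + e)^-1)).
    by rewrite mulfV // gt_eqF.
  by rewrite ler_pM2l.
have := dqE f 0 z; rewrite f0 !subr0 => ->; rewrite cmodM.
by rewrite -[leRHS]mul1r ler_wpM2r ?cmod_ge0 // K.
Qed.

(** [G] is [F] followed by the Cayley map of the right half-plane onto the disk that sends [F 0] to
    0; Schwarz's lemma for [G] is the inequality. If the real part of [F 0] is 0 the Cayley map is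
    degenerate, but the bound is trivial. *)
Lemma harnack0 F : hol DD F -> (forall z, DD z -> 0 <= complex.Re (F z)) ->
  forall z, DD z -> (1 - cmod z) / (1 + cmod z) * complex.Re (F 0) <= complex.Re (F z).
Proof.
move=> HF F0 z Dz.
have D0 : DD 0 by apply/unit_diskE; rewrite cmod0 ltr01.
have [a0|a0] := eqVneq (complex.Re (F 0)) 0; first by rewrite a0 mulr0 F0.
have {}a0 : 0 < complex.Re (F 0) by rewrite lt_def a0 F0.
pose G z := (F z - F 0) / (F z + conjc (F 0)).
have ReE w : complex.Re (F w + conjc (F 0)) = complex.Re (F w) + complex.Re (F 0).
  by case: (F w) (F 0) => [? ?] [? ?].
have ReB w : complex.Re (F w - F 0) = complex.Re (F w) - complex.Re (F 0).
  by case: (F w) (F 0) => [? ?] [? ?].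
have ImE w : complex.Im (F w + conjc (F 0)) = complex.Im (F w - F 0).
  by case: (F w) (F 0) => [? ?] [? ?].
have den w : DD w -> F w + conjc (F 0) != 0.
  move=> /F0 w0; apply/eqP => E; have := ReE w; rewrite E /=; lra.
have HG : hol DD G by apply: hol_div => //; [apply: holB|apply: holD] => //; exact: hol_cst.
have G1 w : DD w -> cmod (G w) <= 1.
  move=> Dw; rewrite /G cmodf ler_pdivrMr ?cmod_gt0 ?den // mul1r.
  rewrite -(@ler_pXn2r _ 2) ?nnegrE ?cmod_ge0 // !cmod_sqr ReE ReB ImE lerD2r.
  have := mulr_ge0 (F0 w Dw) (ltW a0); rewrite sqrrB sqrrD; lra.
have := schwarz HG G1 _ Dz; rewrite {1}/G subrr mul0r => /(_ erefl).
have z1 : cmod z < 1 by apply/unit_diskE.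
have z0 := cmod_ge0 z.
rewrite /G cmodf ler_pdivrMr ?cmod_gt0 ?den //.
rewrite -(@ler_pXn2r _ 2) ?nnegrE ?cmod_ge0 ?mulr_ge0 ?cmod_ge0 //.
rewrite exprMn !cmod_sqr ReE ReB ImE -(cmod_sqr z).
set x := complex.Re (F z); set y := complex.Re (F 0); set v := complex.Im _.
set q := cmod z => h.
have x0 : 0 <= x := F0 z Dz.
have h2 : (x - y) ^+ 2 <= (q * (x + y)) ^+ 2.
  rewrite exprMn.
  have : q ^+ 2 * v ^+ 2 <= v ^+ 2.
    by rewrite ler_piMl ?sqr_ge0 // expr_le1 // ltW.
  move=> h'; apply: (@le_trans _ _ (q ^+ 2 * ((x + y) ^+ 2 + v ^+ 2) - v ^+ 2)).
    by rewrite lerBrDr.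
  by rewrite mulrDr lerBlDr lerD2l.
have xy : 0 <= q * (x + y) by rewrite mulr_ge0 // addr_ge0 // ltW.
have h3 : `|x - y| <= q * (x + y).
  by rewrite -(@ler_pXn2r _ 2) ?nnegrE // real_normK ?num_real.
move: h3; rewrite ler_norml => /andP[h3 _].
have p0 : 0 < 1 + q by rewrite ltr_pwDl // cmod_ge0.
have -> : (1 - q) / (1 + q) * y = (1 - q) * y / (1 + q) by rewrite mulrAC.
rewrite ler_pdivrMr //.
rewrite -subr_ge0; have -> : x * (1 + q) - (1 - q) * y = (x - y) - - (q * (x + y)) by ring.
by rewrite subr_ge0.
Qed.

Definition mob z w := (w + z) / (1 + conjc z * w).

Lemma mob_den z w : cmod z < 1 -> cmod w <= 1 -> 1 + conjc z * w != 0.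
Proof.
move=> z1 w1; rewrite -cmod_gt0.
have := cmod_sub_ge 1 (- (conjc z * w)); rewrite opprK cmod1 cmodN cmodM cmod_conj.
apply: lt_le_trans; rewrite subr_gt0; apply: le_lt_trans z1.
by rewrite ler_piMr ?cmod_ge0.
Qed.

Lemma mob_den_sqr z w : cmod (1 + conjc z * w) ^+ 2 - cmod (w + z) ^+ 2 =
  (1 - cmod z ^+ 2) * (1 - cmod w ^+ 2).
Proof. by rewrite !cmod_sqr; case: z w => [a b] [c d] /=; ring. Qed.

Lemma mob_norm z w : cmod z < 1 -> cmod w <= 1 ->
  1 - cmod (mob z w) ^+ 2 = (1 - cmod z ^+ 2) * (1 - cmod w ^+ 2) / cmod (1 + conjc z * w) ^+ 2.
Proof.
move=> z1 w1; have d0 := mob_den z1 w1.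
rewrite /mob cmodf -mob_den_sqr exprMn exprVn mulrBl divff //.
by rewrite expf_eq0 /= cmod_eq0.
Qed.

Lemma mob_disk z w : cmod z < 1 -> cmod w < 1 -> cmod (mob z w) < 1.
Proof.
move=> z1 w1; have d0 := mob_den z1 (ltW w1).
have lt1 (x : R[i]) : cmod x < 1 -> 0 < 1 - cmod x ^+ 2.
  by move=> x1; rewrite subr_gt0 expr_lt1 ?cmod_ge0.
have : 0 < 1 - cmod (mob z w) ^+ 2.
  rewrite mob_norm ?(ltW w1) //; apply: divr_gt0; first by apply: mulr_gt0; exact: lt1.
  by rewrite exprn_gt0 // cmod_gt0.
by rewrite subr_gt0 expr_lt1 ?cmod_ge0.
Qed.

Lemma mobN z w : cmod z < 1 -> cmod w < 1 -> mob z (mob (- z) w) = w.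
Proof.
move=> z1 w1.
have d1 : 1 - conjc z * w != 0.
  by have := @mob_den (- z) w; rewrite cmodN rmorphN mulNr; apply => //; exact: ltW.
have d2 : 1 - conjc z * z != 0.
  by have := @mob_den (- z) z; rewrite cmodN rmorphN mulNr; apply => //; exact: ltW.
have d3 : 1 + conjc z * mob (- z) w != 0.
  by apply: mob_den => //; apply: ltW; apply: mob_disk; rewrite ?cmodN.
rewrite /mob -/(mob (- z) w); apply: (mulIf d3); rewrite divfK //.
have E : mob (- z) w * (1 - conjc z * w) = w - z by rewrite /mob rmorphN mulNr divfK.
apply: (mulIf d1); move: (mob (- z) w) (conjc z) E => u c E.
have -> : (u + z) * (1 - c * w) = u * (1 - c * w) + z * (1 - c * w) by ring.
have -> : w * (1 + c * u) * (1 - c * w) = w * (1 - c * w) + w * c * (u * (1 - c * w)) by ring.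
by rewrite E; ring.
Qed.

Lemma hol_mob z : cmod z < 1 -> hol DD (mob z).
Proof.
move=> z1; apply: hol_div.
- by apply: holD; [exact: hol_id|exact: hol_cst].
- by apply: holD; [exact: hol_cst|apply: holM; [exact: hol_cst|exact: hol_id]].
- by move=> w /unit_diskE w1; apply: mob_den => //; exact: ltW.
Qed.

Lemma harnack F : hol DD F -> (forall z, DD z -> 0 <= complex.Re (F z)) ->
  forall z w, DD z -> DD w ->
  (1 - cmod (mob (- z) w)) / (1 + cmod (mob (- z) w)) * complex.Re (F z) <= complex.Re (F w).
Proof.
move=> HF F0 z w /unit_diskE z1 /unit_diskE w1.
have mD u : DD u -> DD (mob z u) by move=> /unit_diskE u1; apply/unit_diskE; exact: mob_disk.
have HG : hol DD (F \o mob z) by apply: (@hol_comp _ DD DD) => //; exact: hol_mob.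
have Du : DD (mob (- z) w) by apply/unit_diskE; apply: mob_disk => //; rewrite cmodN.
have := harnack0 HG (fun u Du => F0 _ (mD u Du)) Du; rewrite /= mobN //.
by have -> : mob z 0 = z by rewrite /mob mulr0 addr0 add0r divr1.
Qed.

(* Two points at comparable distance to the circle, and at no larger mutual
   distance, are at bounded hyperbolic distance. *)
Lemma harnack_comparable (c C : R) : 0 < c -> 0 < C -> exists2 k : R, 0 < k &
  forall F, hol DD F -> (forall z, DD z -> 0 <= complex.Re (F z)) ->
  forall z w d, 0 < d -> c * d <= 1 - cmod z -> c * d <= 1 - cmod w ->
    1 - cmod z <= C * d -> cmod (w - z) <= C * d ->
    k * complex.Re (F z) <= complex.Re (F w).
Proof.
move=> c0 C0.
(* In [mob_norm], [3 * C * d] bounds the denominator from above and [c * d] bounds both factors of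
   the numerator from below, so [q] is a lower bound of [1 - cmod (mob (- z) w) ^+ 2]. *)
have [q [q0 qE]] : exists q, 0 < q /\ q * (3 * C) ^+ 2 = c ^+ 2.
  have C3 : 0 < (3 * C) ^+ 2 by rewrite exprn_gt0 // mulr_gt0.
  by exists (c ^+ 2 / (3 * C) ^+ 2); rewrite divfK ?gt_eqF // divr_gt0 // exprn_gt0.
exists (q / 4); first by rewrite divr_gt0.
move=> F HF F0 z w d d0 cz cw zC wz.
have cd : 0 < c * d by rewrite mulr_gt0.
have z1 : cmod z < 1 by move: cd cz; lra.
have w1 : cmod w < 1 by move: cd cw; lra.
apply: le_trans (harnack HF F0 (z := z) (w := w) _ _); try exact/unit_diskE.
apply: ler_wpM2r; first exact/F0/unit_diskE.
have nz1 : cmod (- z) < 1 by rewrite cmodN.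
have m1 := mob_disk nz1 w1; have m0 := cmod_ge0 (mob (- z) w).
have E := mob_norm nz1 (ltW w1).
have D1 : cmod (1 + conjc (- z) * w) <= 3 * C * d.
  have -> : 1 + conjc (- z) * w = (1 - cmod z ^+ 2)%:C + conjc z * (z - w).
    by rewrite rmorphB rmorph1 /= -conjcM_cmod rmorphN; ring.
  apply: le_trans (cmodD _ _) _; rewrite cmodM cmod_conj.
  have z2 : cmod z ^+ 2 <= 1 by rewrite expr_le1 ?cmod_ge0 // ltW.
  rewrite cmod_real0 ?subr_ge0 // (cmodBC z w).
  have h1 : cmod z * cmod (w - z) <= C * d.
    apply: le_trans wz; rewrite ler_piMl ?cmod_ge0 //; exact: ltW.
  have h2 : 1 - cmod z ^+ 2 <= 2 * (C * d).
    have -> : 1 - cmod z ^+ 2 = (1 + cmod z) * (1 - cmod z) by ring.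
    apply: ler_pM; rewrite ?subr_ge0 ?addr_ge0 ?cmod_ge0 ?(ltW z1) //.
    by move: z1; clear; lra.
  by rewrite -mulrA; move: h1 h2; clear; lra.
have D0 : 0 < cmod (1 + conjc (- z) * w) by rewrite cmod_gt0 mob_den // ltW.
have q1 : q <= 1 - cmod (mob (- z) w) ^+ 2.
  rewrite E cmodN ler_pdivlMr ?exprn_gt0 //.
  apply: (@le_trans _ _ (q * (3 * C * d) ^+ 2)).
    by rewrite ler_pM2l // lerXn2r ?nnegrE ?(ltW D0) // ltW // !mulr_gt0.
  have -> : q * (3 * C * d) ^+ 2 = (c * d) * (c * d).
    transitivity (q * (3 * C) ^+ 2 * d ^+ 2); first by ring.
    by rewrite qE; ring.
  have g (x : R[i]) : cmod x < 1 -> c * d <= 1 - cmod x -> c * d <= 1 - cmod x ^+ 2.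
    move=> x1 /le_trans; apply; rewrite lerD2l lerN2 expr2 ler_piMl ?cmod_ge0 //.
    exact: ltW.
  by apply: ler_pM; rewrite ?(ltW cd) ?g.
rewrite ler_pdivlMr; last by rewrite ltr_wpDr.
set x := cmod (mob _ _) in m0 m1 q1 *.
have -> : 1 - x = (1 - x ^+ 2) / (1 + x) by field; move: m0; lra.
rewrite ler_pdivlMr; last by rewrite ltr_wpDr.
apply: le_trans q1; rewrite -mulrA; apply: (@le_trans _ _ (q / 4 * (2 * 2))).
  by rewrite ler_pM2l ?divr_gt0 //; apply: ler_pM; move: m0 m1; lra.
by have -> : q / 4 * (2 * 2) = q by field.
Qed.

(** Harnack's inequality for [1 - om * g], where the rotation [om] makes [om * g z] real and
    nonnegative at the point [z] considered. A self-map of the disk thus brings points closer to the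
    circle by at most a constant factor. *)
Lemma one_sub_norm_lower g : hol DD g -> (forall z, DD z -> DD (g z)) ->
  exists2 k : R, 0 < k & forall z, DD z -> k * (1 - cmod z) <= 1 - cmod (g z).
Proof.
move=> Hg gD.
have D0 : DD 0 by apply/unit_diskE; rewrite cmod0 ltr01.
have g0 : cmod (g 0) < 1 by apply/unit_diskE/gD.
exists ((1 - cmod (g 0)) / 2); first by rewrite divr_gt0 // subr_gt0.
move=> z Dz; have z1 : cmod z < 1 by apply/unit_diskE.
have gz1 : cmod (g z) < 1 by apply/unit_diskE/gD.
pose om := conjc (g z) / (cmod (g z))%:C.
have om1 : cmod om <= 1.
  rewrite /om cmodf cmod_conj cmod_real0 ?cmod_ge0 //.
  by have [->|n0] := eqVneq (cmod (g z)) 0; [rewrite mul0r|rewrite divff].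
pose F w := 1 - om * g w.
have ReF w : complex.Re (F w) = 1 - complex.Re (om * g w).
  by rewrite /F; case: (om * g w).
have HF : hol DD F by apply: holB; [exact: hol_cst|apply: holM => //; exact: hol_cst].
have Rle w : complex.Re (om * g w) <= cmod (g w).
  by apply: le_trans (Re_le_cmod _) _; rewrite cmodM ler_piMl ?cmod_ge0.
have F0 w : DD w -> 0 <= complex.Re (F w).
  move=> /gD/unit_diskE w1; rewrite ReF subr_ge0; exact: le_trans (Rle w) (ltW w1).
have := harnack0 HF F0 Dz; rewrite [in X in _ <= X -> _]ReF.
have -> : complex.Re (om * g z) = cmod (g z).
  rewrite /om mulrAC [conjc _ * _]mulrC conjcM_cmod -fmorphV -rmorphM /=.
  have [->|n0] := eqVneq (cmod (g z)) 0; first by rewrite expr0n mul0r.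
  by rewrite expr2 mulfK.
apply: le_trans; rewrite ReF.
have q0 := cmod_ge0 z.
have h : 1 - cmod (g 0) <= 1 - complex.Re (om * g 0) by rewrite lerD2l lerN2 Rle.
have a0 : 0 < 1 - cmod (g 0) by rewrite subr_gt0.
move: (1 - cmod (g 0)) (1 - complex.Re (om * g 0)) h a0 => a b ab a0.
have p0 : 0 <= 1 - cmod z by rewrite subr_ge0 ltW.
apply: (@le_trans _ _ ((1 - cmod z) / 2 * b)).
  have -> : a / 2 * (1 - cmod z) = (1 - cmod z) / 2 * a by ring.
  by rewrite ler_wpM2l // divr_ge0.
apply: ler_wpM2r; first exact: le_trans (ltW a0) ab.
apply: ler_wpM2l => //; rewrite lef_pV2 ?posrE //; move: z1 q0; clear; lra.
Qed.

End Schwarz.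

(** * Injective maps, Liouville's theorem and logarithms *)

Section Injective.
Context {R : realType}.
Implicit Types (f g k F K : R[i] -> R[i]) (z w c l a b : R[i]) (r s t M : R) (A : set R[i]).

Lemma cmod_cont_hol A f z : hol A f -> A z -> forall e : R, 0 < e -> exists2 d, 0 < d &
  forall w, disk z d w -> `|cmod (f w) - cmod (f z)| < e.
Proof.
move=> Hf Az e e0; have [d d0 dH] := hol_cont Hf Az e0.
by exists d => // w /dH; apply: le_lt_trans (cmod_dist _ _).
Qed.

(** The maximum principle for [1 / f]. The factor 1/2 leaves room for comparing values near the
    circle with values on it by continuity. *)
Lemma min_principle_disk A f c r m : disk c (2 * r) `<=` A -> 0 < r -> 0 < m -> hol A f ->
  (forall z, disk c (2 * r) z -> f z != 0) ->
  (forall z, cmod (z - c) = r -> m <= cmod (f z)) -> m / 2 <= cmod (f c).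
Proof.
move=> dA r0 m0 Hf f0 fm.
have r2 : r < 2 * r by lra.
have sub : disk c r `<=` disk c (2 * r) by apply: sub_disk; lra.
have cr : disk c r c by exact: disk_center.
suff : forall z, disk c r z -> cmod (f z)^-1 <= 2 / m.
  move=> /(_ c cr); rewrite cmodV -(invf_div m) lef_pV2 ?posrE ?divr_gt0 //.
  by rewrite cmod_gt0; apply/f0/sub.
apply: (@max_principle _ _ _ _ (cmod c + r)); first exact: disk_open.
- exact: disk_bounded.
- by apply: holV => [z /sub/dA/Hf|z /sub/f0].
move=> z clz nz e e0.
have zr : cmod (z - c) = r.
  apply/le_anti; rewrite (leNgt r) (_ : (cmod (z - c) < r) = false) ?andbT; last first.
    by apply/negbTE/negP => h; apply: nz.
  apply/ler_addgt0Pl => e' e'0; have [w wr wz] := (closure_diskP _ _).1 clz _ e'0.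
  have := cmod_triang z w c; rewrite (cmodBC z w).
  by move: wr wz; rewrite /disk /=; lra.
have zA : A z by apply: dA; rewrite /disk /= zr.
have m20 : 0 < m / 2 by rewrite divr_gt0.
have [d d0 dH] := cmod_cont_hol Hf zA m20.
exists d => // w wr wd; have := dH w wd; rewrite ltr_norml => /andP[h _].
have fw : m / 2 <= cmod (f w) by have := fm z zr; move: h; clear; lra.
rewrite cmodV; apply: (@le_trans _ _ (2 / m)); last by rewrite lerDl ltW.
by rewrite -(invf_div m) lef_pV2 ?posrE //; exact: lt_le_trans fw.
Qed.

(** On a small circle about [c], injectivity keeps [f] at distance at least [m] from [f c]. If [w]
    within [m / 4] of [f c] were omitted, [1 / (f - w)] would be at most [2 / m] inside the circle,
    yet it exceeds [4 / m] at [c]. *)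
Lemma injective_open A f : open A -> hol A f -> (forall z w, A z -> A w -> f z = f w -> z = w) ->
  forall c, A c -> forall e, 0 < e -> exists2 d, 0 < d &
    forall w, disk (f c) d w -> exists2 z, A z /\ disk c e z & f z = w.
Proof.
move=> /open_diskP oA Hf inj c Ac e e0.
have [r1 r10 r1A] := oA c Ac.
pose r := Num.min e r1 / 4.
have r0 : 0 < r by rewrite divr_gt0 // lt_min e0.
have re : r <= e.
  have : Num.min e r1 <= e by rewrite ge_min lexx.
  by move: r0; rewrite /r; lra.
have rr1 : 2 * r <= r1.
  have : Num.min e r1 <= r1 by rewrite ge_min lexx orbT.
  by move: r10; rewrite /r; lra.
move: (r) r0 re rr1 => {}r r0 re rr1.
have dA : disk c (2 * r) `<=` A by move=> z /(sub_disk rr1) /r1A.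
pose S := [set z | cmod (z - c) = r].
have cS : compact S.
  apply: (@closed_bounded_compact _ _ (cmod c + r)).
    apply/closed_diskP => z Hz; rewrite /S /=; apply/eqP; rewrite -subr_eq0 -normr_eq0.
    rewrite eq_le normr_ge0 andbT; apply/ler_addgt0Pl => e' /Hz[w wr wz]; rewrite addr0.
    rewrite -wr; apply: le_trans (cmod_dist _ _) _.
    have -> : z - c - (w - c) = z - w by ring.
    by apply: ltW; rewrite cmodBC; exact: wz.
  by move=> z zr; rewrite /cdisk /= subr0; apply: le_trans (cmod_le_subD z c) _; rewrite zr addrC.
have SA z : S z -> A z by move=> zr; apply: dA; rewrite /disk /= zr; lra.
have HB w : hol A (fun z => f z - w) by apply: holB => //; exact: hol_cst.
have [||z0 Sz0 z0min] := @compact_max _ S (fun z => - cmod (f z - f c)) cS.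
- by exists (c + r%:C); rewrite /S /= addrAC subrr add0r cmod_real0 // ltW.
- move=> z Sz e' e'0; have [d d0 dH] := cmod_cont_hol (HB (f c)) (SA _ Sz) e'0.
  exists d => // w /dH; rewrite -opprD normrN; exact: id.
pose m := cmod (f z0 - f c).
have m0 : 0 < m.
  rewrite cmod_gt0 subr_eq0; apply/eqP => /inj h.
  have E := h (SA _ Sz0) Ac; move: Sz0; rewrite /S /= E subrr cmod0; lra.
have fcm z : S z -> m <= cmod (f z - f c) by move=> /z0min; rewrite lerN2.
clearbody m.
exists (m / 4); first by rewrite divr_gt0.
move=> w wm; apply: contrapT => nw.
have f0 z : disk c (2 * r) z -> f z - w != 0 \/ r <= cmod (z - c).
  move=> zr; have [h|h] := leP r (cmod (z - c)); [by right|left].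
  apply/eqP => E; apply: nw; exists z; last by apply/eqP; rewrite -subr_eq0 E.
  by split; [exact: dA|exact: lt_le_trans h re].
have key : forall z, disk c r z -> cmod (f z - w)^-1 <= 2 / m.
  have sub : disk c r `<=` disk c (2 * r) by apply: sub_disk; lra.
  apply: (@max_principle _ _ _ _ (cmod c + r)); first exact: disk_open.
  - exact: disk_bounded.
  - apply: holV => [z /sub/dA/HB//|z zr].
    by case: (f0 z (sub _ zr)) => // h; move: zr; rewrite /disk /= ltNge h.
  move=> z clz nz e' e'0.
  have zr : cmod (z - c) = r.
    apply/le_anti; rewrite (leNgt r) (_ : (cmod (z - c) < r) = false) ?andbT; last first.
      by apply/negbTE/negP => h; apply: nz.
    apply/ler_addgt0Pl => e1 e10; have [v vr vz] := (closure_diskP _ _).1 clz _ e10.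
    have := cmod_triang z v c; rewrite (cmodBC z v).
    by move: vr vz; rewrite /disk /=; lra.
  have m40 : 0 < m / 4 by rewrite divr_gt0.
  have [d d0 dH] := cmod_cont_hol (HB w) (SA _ zr) m40.
  exists d => // v vr vd; have := dH v vd; rewrite ltr_norml => /andP[h _].
  have h2 := fcm z zr.
  have h3 := cmod_triang (f z) w (f c).
  have fw : m / 2 <= cmod (f v - w).
    by move: h h2 h3 wm; rewrite /disk /=; clear; lra.
  rewrite cmodV; apply: (@le_trans _ _ (2 / m)); last by rewrite lerDl ltW.
  rewrite -(invf_div m) lef_pV2 ?posrE ?divr_gt0 //.
  by apply: lt_le_trans fw; rewrite divr_gt0.
have := key c (disk_center c r0).
have fcw : f c - w != 0.
  have cr : disk c (2 * r) c by apply: disk_center; lra.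
  by case: (f0 c cr) => //; rewrite subrr cmod0; move: r0; clear; lra.
rewrite cmodV -(invf_div m) lef_pV2 ?posrE ?divr_gt0 ?cmod_gt0 //.
by move: wm m0; rewrite /disk /= (cmodBC w); clear; lra.
Qed.

Lemma hol_deriv0_cst f c r : 0 < r -> hol (disk c r) f ->
  (forall z, disk c r z -> dv f z = 0) -> forall z, disk c r z -> f z = f c.
Proof.
move=> r0 Hf f0 z zr; apply/eqP; rewrite -subr_eq0 -cmod_eq0 eq_le cmod_ge0 andbT.
have cr := disk_center c r0.
have := @cseg_bound _ f (dv f) c z 0 0; rewrite mul0r subr0 mul0r; apply => t t01.
  by apply: hol_dv Hf _; exact: disk_cseg.
by rewrite f0 ?subrr ?cmod0 //; exact: disk_cseg.
Qed.

(** Suppose the derivative vanishes at [c]. For [w] near [c] with nonzero derivative, injectivity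
    leaves [dq f w] without zeros, and the minimum principle bounds it below at [c] by [L]; but the
    vanishing derivative makes [dq f w c] smaller than that. So the derivative is 0 near [c] and [f]
    is constant there. *)
Lemma injective_dv A f : open A -> hol A f -> (forall z w, A z -> A w -> f z = f w -> z = w) ->
  forall c, A c -> dv f c != 0.
Proof.
move=> oA Hf inj c Ac; apply/eqP => fc0.
have [r1 r10 r1A] := (open_diskP A).1 oA c Ac.
pose r := r1 / 2.
have r0 : 0 < r by rewrite divr_gt0.
have dA : disk c (2 * r) `<=` A by rewrite /r mulrC divfK.
pose S := [set z | cmod (z - c) = r].
have cS : compact S.
  apply: (@closed_bounded_compact _ _ (cmod c + r)).
    apply/closed_diskP => z Hz; rewrite /S /=; apply/eqP; rewrite -subr_eq0 -normr_eq0.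
    rewrite eq_le normr_ge0 andbT; apply/ler_addgt0Pl => e' /Hz[w wr wz]; rewrite addr0.
    rewrite -wr; apply: le_trans (cmod_dist _ _) _.
    have -> : z - c - (w - c) = z - w by ring.
    by apply: ltW; rewrite cmodBC; exact: wz.
  by move=> z zr; rewrite /cdisk /= subr0; apply: le_trans (cmod_le_subD z c) _; rewrite zr addrC.
have SA z : S z -> A z by move=> zr; apply: dA; rewrite /disk /= zr; lra.
have HB w : hol A (fun z => f z - w) by apply: holB => //; exact: hol_cst.
have [||z0 Sz0 z0min] := @compact_max _ S (fun z => - cmod (f z - f c)) cS.
- by exists (c + r%:C); rewrite /S /= addrAC subrr add0r cmod_real0 // ltW.
- move=> z Sz e' e'0; have [d d0 dH] := cmod_cont_hol (HB (f c)) (SA _ Sz) e'0.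
  exists d => // w /dH; rewrite -opprD normrN; exact: id.
pose m := cmod (f z0 - f c).
have m0 : 0 < m.
  rewrite cmod_gt0 subr_eq0; apply/eqP => /inj h.
  have E := h (SA _ Sz0) Ac; move: Sz0; rewrite /S /= E subrr cmod0; lra.
have fcm z : S z -> m <= cmod (f z - f c) by move=> /z0min; rewrite lerN2.
clearbody m.
pose L := m / 2 / (2 * r) / 2.
have L0 : 0 < L by rewrite !divr_gt0 // mulr_gt0.
have HD := hol_dv Hf Ac; rewrite fc0 in HD.
have L20 : 0 < L / 2 by rewrite divr_gt0.
have [d1 d10 dH1] := HD _ L20.
have m20 : 0 < m / 2 by rewrite divr_gt0.
have [d2 d20 dH2] := hol_cont Hf Ac m20.
pose d := Num.min r (Num.min d1 d2).
have d0 : 0 < d by rewrite !lt_min r0 d10.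
have [dr dd1 dd2] : [/\ d <= r, d <= d1 & d <= d2] by rewrite /d !ge_min !lexx !orbT.
move: (d) d0 dr dd1 dd2 => {}d d0 dr dd1 dd2.
have sub : disk c d `<=` disk c (2 * r) by apply: sub_disk; move: dr r0; clear; lra.
have f'0 w : disk c d w -> dv f w = 0.
  move=> wd; have [->//|wc] := eqVneq w c.
  apply/eqP; apply: contraT => fw0; exfalso.
  have Aw : A w by apply/dA/sub.
  have wc0 : 0 < cmod (w - c) by rewrite cmod_gt0 subr_eq0.
  have q0 z : disk c (2 * r) z -> dq f w z != 0.
    move=> /dA Az; rewrite /dq; have [//|zw] := eqVneq z w.
    by rewrite mulf_neq0 ?invr_eq0 ?subr_eq0 //; apply: contra zw => /eqP/inj ->.
  have := @min_principle_disk A (dq f w) c r (m / 2 / (2 * r)) dA r0 _ (dq_hol oA Aw Hf) q0 _.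
  have E : L = m / 2 / (2 * r) / 2 by [].
  rewrite -E => H.
  have {H}H : L <= cmod (dq f w c).
    apply: H => [|z zr]; first by rewrite !divr_gt0 // mulr_gt0.
    have zw : z != w.
      by apply/eqP => zw; move: wd; rewrite /disk /= -zw zr; move: dr; clear; lra.
    rewrite /dq ifN // cmodf ler_pM //.
    - by rewrite ltW.
    - by rewrite invr_ge0 mulr_ge0 // ltW.
    - have := fcm z zr; have := cmod_triang (f z) (f w) (f c).
      by have := dH2 w (lt_le_trans wd dd2); clear; lra.
    rewrite lef_pV2 ?posrE ?mulr_gt0 ?cmod_gt0 ?subr_eq0 //.
    have := cmod_triang z c w; rewrite zr (cmodBC c).
    by move: wd dr; rewrite /disk /=; clear; lra.
  have := dqE f w c; move=> /(congr1 (@cmod R)); rewrite cmodM cmodBC (cmodBC c w) => E2.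
  have := dH1 w (lt_le_trans wd dd1); rewrite mul0r subr0 E2 ler_pM2r //.
  by move: H L0; clear; lra.
have E := hol_deriv0_cst d0 (hol_sub (fun z h => dA _ (sub _ h)) Hf) f'0.
pose w := c + (d / 2)%:C.
have wd : disk c d w.
  by rewrite /disk /= /w addrAC subrr add0r cmod_real0 ?ltW // ?divr_gt0 //; move: d0; clear; lra.
have := inj w c (dA _ (sub _ wd)) Ac (E w wd).
move=> /eqP; rewrite -subr_eq0 /w addrAC subrr add0r realC_eq0.
by apply/negP; rewrite gt_eqF // divr_gt0.
Qed.

Lemma inverse_cder A f K : open A -> hol A f ->
  (forall z w, A z -> A w -> f z = f w -> z = w) -> (forall z, A z -> K (f z) = z) ->
  forall c, A c -> cder K (f c) (dv f c)^-1.
Proof.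
move=> oA Hf inj KK c Ac e e0.
have f'0 := injective_dv oA Hf inj Ac.
set D := dv f c in f'0 *.
have HD := hol_dv Hf Ac; rewrite -/D in HD.
have D0 : 0 < cmod D by rewrite cmod_gt0.
pose e1 := Num.min (cmod D / 2) (e * (cmod D) ^+ 2 / 2).
have [e10 e1D e1e] : [/\ 0 < e1, e1 <= cmod D / 2 & e1 <= e * cmod D ^+ 2 / 2].
  by rewrite /e1 lt_min !divr_gt0 // ?mulr_gt0 ?exprn_gt0 // !ge_min !lexx orbT.
move: (e1) e10 e1D e1e => {}e1 e10 e1D e1e.
have [d1 d10 dH1] := HD _ e10.
have [d d0 dH] := injective_open oA Hf inj Ac d10.
exists d => // w /dH[z [Az zd] <-]; rewrite !KK //.
have h := dH1 z zd.
have zf : cmod (z - c) * cmod D <= 2 * cmod (f z - f c).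
  have := cmod_le_subD (D * (z - c)) (f z - f c).
  rewrite (cmodBC (D * _)) cmodM [cmod D * _]mulrC => h2.
  have h3 : e1 * cmod (z - c) <= cmod (z - c) * cmod D / 2.
    by rewrite mulrC -mulrA ler_wpM2l ?cmod_ge0.
  by move: h h2 h3; clear; lra.
have -> : z - c - D^-1 * (f z - f c) = - (D^-1 * (f z - f c - D * (z - c))).
  by field.
rewrite cmodN cmodM cmodV mulrC ler_pdivrMr //; apply: le_trans h _.
apply: (@le_trans _ _ (e * cmod D / 2 * (cmod (z - c) * cmod D))).
  apply: le_trans (ler_wpM2r (cmod_ge0 _) e1e) _.
  by rewrite le_eqVlt; apply/orP; left; apply/eqP; ring.
apply: le_trans (ler_wpM2l _ zf) _; first by rewrite divr_ge0 // mulr_ge0 // ltW.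
by rewrite le_eqVlt; apply/orP; left; apply/eqP; field.
Qed.

Lemma liouville f M : hol setT f -> (forall z, cmod (f z) <= M) -> forall z, f z = f 0.
Proof.
move=> Hf fM.
have M0 : 0 <= M by apply: le_trans (fM 0); exact: cmod_ge0.
have f'0 z : dv f z = 0.
  apply/eqP; rewrite -cmod_eq0 eq_le cmod_ge0 andbT; apply/ler_addgt0Pl => e e0; rewrite addr0.
  pose r := 2 * M / e + 1.
  have r0 : 0 < r by rewrite ltr_wpDl // divr_ge0 ?mulr_ge0 // ltW.
  have rr : r < r + 1 by rewrite ltrDl.
  rewrite -[dv f z]subr0.
  apply: le_trans (@deriv_dist _ f (fun=> 0) (dv f) (fun=> 0) z z (r + 1) r (2 * M) r0 rr _ _ _) _ => [w _|w _|w _|].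
  - exact: hol_dv Hf _.
  - exact: cder_cst.
  - rewrite subrr subr0; apply: le_trans (cmodB _ _) _; rewrite mulr_natl mulr2n.
    exact: lerD.
  rewrite ler_pdivrMr // /r.
  have -> : e * (2 * M / e + 1) = 2 * M + e by field; rewrite gt_eqF.
  by rewrite lerDl ltW.
move=> z; apply: (@hol_deriv0_cst f 0 (cmod z + 1)) => //.
- by rewrite ltr_wpDl ?cmod_ge0.
- exact: hol_sub Hf.
- by rewrite /disk /= subr0 ltrDl.
Qed.

Lemma log_disk f c r : 0 < r -> hol (disk c r) f -> (forall z, disk c r z -> f z != 0) ->
  exists2 L, hol (disk c r) L & forall z, disk c r z -> cexp (L z) = f z.
Proof.
move=> r0 Hf f0; have cr := disk_center c r0.
have [|P HP] := @primitive_disk _ (fun z => dv f z / f z) c r.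
  by apply: hol_div => //; apply: dv_hol => //; exact: disk_open.
have [l0 El0] := cexp_surj (f0 c cr).
pose L z := P z + (l0 - P c).
have HL z : disk c r z -> cder L z (dv f z / f z).
  by move=> zr; have := cderD (HP z zr) (cder_cst (l0 - P c) z); rewrite addr0.
exists L => [z zr|z zr]; first by eexists; exact: HL.
pose G z := f z * cexp (- L z).
have HG w : disk c r w -> cder G w 0.
  move=> wr; have := cderM (hol_dv Hf wr) (cder_comp (cder_cexp _) (cderN (HL w wr))).
  congr cder; have := f0 w wr => fw /=; field.
  exact: fw.
have EG : forall w, disk c r w -> G w = G c.
  apply: hol_deriv0_cst => // [w wr|w wr]; first by eexists; exact: HG.
  exact: dvE (HG w wr).
have := EG z zr; rewrite /G /L [P c + _]addrC subrK !cexpN El0 mulfV ?f0 //.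
by move=> /(congr1 (fun x => x * cexp (P z + (l0 - P c)))); rewrite mul1r divfK ?cexp_neq0.
Qed.

End Injective.

(** * Integrals along connected sets *)

Section Crossing.
Context {R : realType}.
Implicit Types (f g k F K : R[i] -> R[i]) (z w c a b : R[i]) (r s t M : R) (A O S : set R[i]).

Local Notation DD := (@unit_disk R).

(** Induction along a connected set: if [P] spreads within small disks, the points of [S] with [P]
    form a relatively open and closed part. It takes the place of paths, which a connected set need
    not contain. *)
Lemma connected_chain S (P : R[i] -> Prop) a b : connected S ->
  (forall z, S z -> exists2 r, 0 < r &
     forall x y, S x -> S y -> disk z r x -> disk z r y -> P x -> P y) ->
  S a -> S b -> P a -> P b.
Proof.
move=> cS HP Sa Sb Pa.
suff E : S `&` [set z | P z] = S by move: Sb; rewrite -E => -[].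
have HP' z : S z -> exists2 r, 0 < r & forall y, S y -> disk z r y -> P z <-> P y.
  move=> Sz; have [r r0 H] := HP z Sz; exists r => // y Sy yr.
  by split; apply: H => //; exact: disk_center.
apply: cS.
- by exists a.
- exists [set z | exists2 s, S s & exists2 r, disk s r z & forall y, S y -> disk s r y -> P y].
    apply/open_diskP => z [s Ss [r zr H]].
    exists (r - cmod (z - s)); first by rewrite subr_gt0.
    move=> w wz; exists s => //; exists r => //; apply: disk_sub wz.
    by rewrite addrC subrK.
  apply/seteqP; split => z [Sz].
    move=> zP; split => //; exists z => //; have [r r0 H] := HP' z Sz.
    by exists r => [|y Sy yr]; [exact: disk_center|apply/(H y Sy yr)].
  by move=> [s Ss [r zr H]]; split => //; exact: H.
exists (closure (S `&` [set z | P z])); first exact: closed_closure.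
apply/seteqP; split => z [Sz zP]; split => //; first by apply: subset_closure.
have [r r0 H] := HP' z Sz.
have [y [Sy Py] yr] := (closure_diskP _ _).1 zP r r0.
by apply/(H y Sy yr).
Qed.

Lemma star_connected A c : (forall z t, A z -> 0 <= t <= 1 -> A (cseg c z t)) -> connected A.
Proof.
move=> H.
have E : A = \bigcup_(z in A) (cseg c z @` `[0, 1]%classic).
  apply/seteqP; split => [z Az|w [z Az [t t01 <-]]].
    exists z => //; exists 1; first by rewrite /= in_itv /= ler01 lexx.
    by rewrite /cseg mul1r addrC subrK.
  by apply: H => //; rewrite /= in_itv in t01.
rewrite E; apply: bigcup_connected.
  exists c => z Az; exists 0; first by rewrite /= in_itv /= ler01 lexx.
  by rewrite /cseg mul0r addr0.
move=> z Az; apply: connected_continuous_connected; first exact: segment_connected.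
apply: continuous_subspaceT => t B /nbhs_diskP[e e0 eB].
have [d d0 dH] := rcder_cont (rcder_cseg c z t) e0.
apply/nbhs_ballP; exists d => //= s; rewrite /ball /= distrC => /dH.
exact: eB.
Qed.

Lemma convex_connected A : (forall z w t, A z -> A w -> 0 <= t <= 1 -> A (cseg z w t)) ->
  connected A.
Proof.
move=> H; have [->|/set0P[c Ac]] := eqVneq A set0; first exact: connected0.
by apply: (@star_connected A c) => z t Az; exact: H.
Qed.

Lemma primitive_unique f F G c r : (forall z, disk c r z -> cder F z (f z)) ->
  (forall z, disk c r z -> cder G z (f z)) ->
  forall x y, disk c r x -> disk c r y -> F y - F x = G y - G x.
Proof.
move=> HF HG x y xr yr; apply/eqP; rewrite -subr_eq0 -cmod_eq0 eq_le cmod_ge0 andbT.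
have := @cseg_bound _ (fun z => F z - G z) (fun z => f z - f z) x y 0 0.
rewrite mul0r subr0 mul0r.
have -> : F y - F x - (G y - G x) = F y - G y - (F x - G x) by ring.
apply => t t01; last by rewrite subrr subr0 cmod0.
by apply: cderB; [apply: HF|apply: HG]; exact: disk_cseg.
Qed.

(* [path_functional O a b I C]: [I] behaves like integration along some path
   from [a] to [b] of length at most [C] in [O]. *)
Definition path_functional O a b (I : (R[i] -> R[i]) -> R[i]) (C : R) :=
  [/\ 0 <= C,
      forall f g l, hol O f -> hol O g -> I (fun z => f z - l * g z) = I f - l * I g,
      forall F f, (forall z, O z -> cder F z (f z)) -> I f = F b - F a,
      forall f M, hol O f -> (forall z, O z -> cmod (f z) <= M) -> cmod (I f) <= C * M &
      cexp (I (fun z => z^-1)) = b / a].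

(** Each link of a chain of disks adds the increment of a primitive on that disk, so connectedness
    of [S] suffices. The last clause follows since [z * cexp (- P z)] is constant for a primitive
    [P] of [1 / z]. *)
Lemma path_functional_exists S O a b : open O -> connected S -> S `<=` O ->
  (forall z, O z -> z != 0) -> S a -> S b -> exists I C, path_functional O a b I C.
Proof.
move=> /open_diskP oO cS SO O0 Sa Sb.
apply: (connected_chain (P := fun b => exists I C, path_functional O a b I C) cS _ Sa Sb).
  move=> z0 /SO Oz0; have [r r0 rO] := oO z0 Oz0; exists r => // x y _ _ xr yr [I [C [C0 Il Ie Ib Ix]]].
  pose P f := xget (fun=> 0) [set F : R[i] -> R[i] | forall z, disk z0 r z -> cder F z (f z)].
  have HP f : hol O f -> forall z, disk z0 r z -> cder (P f) z (f z).
    move=> Hf; have [|F HF] := @primitive_disk _ f z0 r; first by move=> z /rO /Hf.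
    by rewrite /P; case: xgetP => // /(_ F).
  have Hinv : hol O (fun z => z^-1) by apply: holV => //; exact: hol_id.
  exists (fun f => I f + (P f y - P f x)), (C + 2 * r); split.
  - by rewrite addr_ge0 // mulr_ge0 // ltW.
  - move=> f g l Hf Hg; rewrite Il //.
    have -> : P (fun z => f z - l * g z) y - P (fun z => f z - l * g z) x =
        P f y - l * P g y - (P f x - l * P g x).
      apply: (@primitive_unique (fun z => f z - l * g z) _ (fun z => P f z - l * P g z) z0 r)
        => // z zr.
        by apply: HP => //; apply: holB => //; apply: holM => //; exact: hol_cst.
      by apply: cderB; [exact: HP|apply: cderZ; exact: HP].
    by ring.
  - move=> F f HF; rewrite (Ie F) //.
    have Hf : hol (disk z0 r) f.
      apply: (@hol_ext _ _ (dv F)); first exact: disk_open.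
        by move=> z /rO /HF /dvE.
      by apply: dv_hol; [exact: disk_open|move=> z /rO /HF h; eexists; exact: h].
    have PP z : disk z0 r z -> cder (P f) z (f z).
      have [G HG] := @primitive_disk _ f z0 r Hf.
      by rewrite /P; case: xgetP => [Q _|/(_ G)//]; exact.
    rewrite -(@primitive_unique f F (P f) z0 r _ PP x y xr yr); last by move=> z /rO /HF.
    by ring.
  - move=> f M Hf fM; apply: le_trans (cmodD _ _) _; rewrite mulrDl lerD //; first exact: Ib.
    have Oz : O z0 by apply: rO; exact: disk_center.
    have M0 : 0 <= M := le_trans (cmod_ge0 _) (fM _ Oz).
    have := @cseg_bound _ (P f) f x y 0 M; rewrite mul0r subr0 => H.
    apply: le_trans (H _ _) _ => [t t01|t t01|].
    + by apply: HP => //; exact: disk_cseg.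
    + by rewrite subr0; apply/fM/rO; exact: disk_cseg.
    rewrite mulrC ler_wpM2r //; have := cmod_triang y z0 x; rewrite (cmodBC z0).
    by move: xr yr; rewrite /disk /=; lra.
  rewrite cexpD Ix.
  have x0 : x != 0 by apply/O0/rO.
  have y0 : y != 0 by apply/O0/rO.
  have a0 : a != 0 by apply/O0/SO.
  suff -> : cexp (P (fun z => z^-1) y - P (fun z => z^-1) x) = y / x.
    by field; rewrite x0 a0.
  pose G z := z * cexp (- P (fun z => z^-1) z).
  have HG z : disk z0 r z -> cder G z 0.
    move=> zr; have := cderM (cder_id z) (cder_comp (cder_cexp _) (cderN (HP _ Hinv z zr))).
    have z0' : z != 0 by apply/O0/rO.
    by congr cder => /=; field.
  have : G y = G x.
    have := @primitive_unique (fun=> 0) G (fun=> 0) z0 r HG (fun z _ => cder_cst 0 z) x y xr yr.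
    by rewrite subrr => /eqP; rewrite subr_eq0 => /eqP.
  rewrite /G !cexpN cexpB => E.
  apply: (mulfI (_ : (cexp (P (fun z => z^-1) y))^-1 * x != 0)).
    by rewrite mulf_neq0 // invr_eq0 cexp_neq0.
  have := cexp_neq0 (P (fun z => z^-1) y); have := cexp_neq0 (P (fun z => z^-1) x).
  move: E; move: (cexp (P (fun z => z^-1) y)) (cexp (P (fun z => z^-1) x)) => v w E w0 v0.
  have -> : v^-1 * x * (v / w) = x / w by field; rewrite w0 v0.
  have -> : v^-1 * x * (y / x) = y / v by field; rewrite x0 v0.
  by rewrite E.
have a0 : a != 0 by apply/O0/SO.
exists (fun=> 0), 0; split => //.
- by move=> *; rewrite mulr0 subrr.
- by move=> *; rewrite subrr.
- by move=> *; rewrite cmod0 mul0r.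
- by rewrite cexp0 divff.
Qed.

Lemma le_of_powers (h q C : R) : 0 <= h -> 0 < q ->
  (forall n, h ^+ n <= C * q ^+ n) -> h <= q.
Proof.
move=> h0 q0 H; rewrite leNgt; apply/negP => qh.
have h1 : 0 < h := lt_trans q0 qh.
have : (q / h) ^+ n @[n --> \oo] --> (0 : R).
  by apply: cvg_expr; rewrite ger0_norm ?divr_ge0 // ?ltW // ltr_pdivrMr // mul1r.
have C0 : 0 < C by have := H 0%N; rewrite !expr0 mulr1; apply: lt_le_trans.
move=> /cvgrPdist_lt /(_ C^-1); rewrite invr_gt0 => /(_ C0)[n _ /(_ n (leqnn n))].
rewrite /= sub0r normrN ger0_norm ?exprn_ge0 ?divr_ge0 ?(ltW q0) ?(ltW h1) //.
rewrite exprMn exprVn ltr_pdivrMr ?exprn_gt0 // mulrC ltr_pdivlMr //.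
by rewrite mulrC ltNge H.
Qed.

(* If a connected set joins neighbourhoods of [-1] and [1] and a bounded
   holomorphic [psi] is small on it, then [psi 0] is small.  The product [H] of
   [psi], its reflection and a power of [1 - z ^+ 2] is small on a path from
   [-9/10] to [9/10] and real on the real axis; comparing the integrals of
   [H ^+ n / z] and [(H 0) ^+ n / z] along that path bounds [H 0]. *)
Lemma crossing (psi : R[i] -> R[i]) (k : nat) S x y :
  hol DD psi -> (forall z, DD z -> cmod (psi z) <= 1) ->
  connected S -> S `<=` DD -> S x -> S y ->
  disk (-1) (1 / 5) x -> disk 1 (1 / 5) y ->
  (forall z, S z -> [\/ cmod (psi z) < 4 ^- k, disk (-1) (1 / 5) z | disk 1 (1 / 5) z]) ->
  cmod (psi 0) ^+ 2 <= 2 ^- k.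
Proof.
move=> Hpsi psi1 cS SD Sx Sy x5 y5 HS.
have D0 : DD 0 by apply/unit_diskE; rewrite cmod0 ltr01.
have k4 : 0 < 4 ^- k :> R by rewrite invr_gt0 exprn_gt0.
have k2 : 0 < 2 ^- k :> R by rewrite invr_gt0 exprn_gt0.
have k42 : 4 ^- k * 2 ^+ k = 2 ^- k :> R.
  have -> : 4 = 2 * 2 :> R by ring.
  by rewrite exprMn invfM -mulrA mulVf ?mulr1 // expf_neq0.
have k42' : 4 ^- k <= 2 ^- k :> R.
  by rewrite -k42 ler_peMr ?(ltW k4) // exprn_ege1 // ler1n.
(* Unless the conclusion is immediate, [psi 0] is too large for 0 to be near [O], so [1 / z] is
   holomorphic and bounded on [O]. *)
have [small|big] := leP (cmod (psi 0)) (4 ^- k).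
  apply: le_trans k42'; apply: le_trans small.
  by rewrite expr2 ler_piMl ?cmod_ge0 // psi1.
pose O := DD `&` [set z | [\/ cmod (psi z) < 4 ^- k, disk (-1) (1 / 5) z | disk 1 (1 / 5) z]].
have oO : open O.
  apply/open_diskP => z [Dz zO].
  have [r1 r10 r1D] := (open_diskP DD).1 unit_disk_open z Dz.
  have [r r0 rO] : exists2 r : R, 0 < r & forall w, disk z r w -> DD w ->
     [\/ cmod (psi w) < 4 ^- k, disk (-1) (1 / 5) w | disk 1 (1 / 5) w].
    case: zO => zO.
    - have e0 : 0 < 4 ^- k - cmod (psi z) by rewrite subr_gt0.
      have [d d0 dH] := cmod_cont_hol Hpsi Dz e0; exists d => // w /dH.
      by rewrite ltr_norml => /andP[_ h] _; apply: Or31; move: h; lra.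
    - have [d d0 dH] := (open_diskP _).1 (@disk_open _ (-1) (1 / 5)) z zO.
      by exists d => // w /dH h _; apply: Or32.
    - have [d d0 dH] := (open_diskP _).1 (@disk_open _ 1 (1 / 5)) z zO.
      by exists d => // w /dH h _; apply: Or33.
  exists (Num.min r r1); first by rewrite lt_min r0.
  move=> w wr; have wD : DD w by apply: r1D; apply: sub_disk wr; rewrite ge_min lexx orbT.
  by split => //; apply: rO => //; apply: sub_disk wr; rewrite ge_min lexx.
have [dl [dl0 dl2 dlO]] : exists dl : R, [/\ 0 < dl, dl <= 1 / 2 & forall z, O z -> dl <= cmod z].
  have e0 : 0 < cmod (psi 0) - 4 ^- k by rewrite subr_gt0.
  have [d d0 dH] := cmod_cont_hol Hpsi D0 e0.
  exists (Num.min d (1 / 2)); split; first by rewrite lt_min d0 divr_gt0.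
    by rewrite ge_min lexx orbT.
  move=> z [_ zO]; rewrite leNgt; apply/negP; rewrite lt_min => /andP[z1 z2].
  case: zO.
  - have := dH z; rewrite /disk /= subr0 => /(_ z1); rewrite ltr_norml => /andP[h _].
    by move: h; lra.
  - rewrite /disk /= cmodBC => h; have := cmod_le_subD (-1) z; rewrite cmodN cmod1.
    by move: h z2; lra.
  - rewrite /disk /= cmodBC => h; have := cmod_le_subD 1 z; rewrite cmod1.
    by move: h z2; lra.
have O0 z : O z -> z != 0 by move=> /dlO h; rewrite -cmod_gt0; exact: lt_le_trans h.
pose u : R := 9 / 10.
have u0 : 0 <= u by rewrite /u; lra.
have lobe e : connected (DD `&` disk e (1 / 5)).
  apply: convex_connected => z w t [z1 z2] [w1 w2] t01.
  by split; exact: disk_cseg.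
have uD : DD u%:C by apply/unit_diskE; rewrite cmod_real0 // /u; lra.
have NuD : DD (- u%:C) by apply/unit_diskE; rewrite cmodN cmod_real0 // /u; lra.
have um : disk (-1) (1 / 5) (- u%:C).
  rewrite /disk /= -opprD cmodN.
  have -> : u%:C + -1 = (u - 1)%:C by rewrite rmorphB rmorph1.
  by rewrite cmod_real ler0_norm /u; lra.
have up : disk 1 (1 / 5) u%:C.
  rewrite /disk /=; have -> : u%:C - 1 = (u - 1)%:C by rewrite rmorphB rmorph1.
  by rewrite cmod_real ler0_norm /u; lra.
pose T := ((DD `&` disk (-1) (1 / 5)) `|` S) `|` (DD `&` disk 1 (1 / 5)).
have cT : connected T.
  apply: connectedU (lobe 1).
    by exists y; split; [right|split => //; exact: SD].
  apply: connectedU cS => //.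
    by exists x; split => //; split => //; exact: SD.
have TO : T `<=` O.
  move=> z [[[Dz z5]|Sz]|[Dz z5]]; split => //.
  - exact: Or32.
  - exact: SD.
  - exact: HS.
  - exact: Or33.
have [I [C [C0 Il Ie Ib Ix]]] := @path_functional_exists T O (- u%:C) u%:C oO cT TO O0
  (or_introl (or_introl (conj NuD um))) (or_intror (conj uD up)).
have conjD z : DD z -> DD (conjc z) by move=> /unit_diskE h; apply/unit_diskE; rewrite cmod_conj.
(* The last factor is at most [2 ^- k] in the two end disks. Elsewhere on [O] it is at most
   [2 ^+ k], which the bound [4 ^- k] on [psi] absorbs. *)
pose H z := psi z * conjc (psi (conjc z)) * (1 - z ^+ 2) ^+ k.
have HH : hol DD H.
  apply: holM; first apply: holM => //.
    move=> z Dz; have [l Hl] := Hpsi _ (conjD z Dz).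
    by exists (conjc l); exact: cder_conj.
  by apply: holX; apply: holB; [exact: hol_cst|apply: holX; exact: hol_id].
have Hc z : H (conjc z) = conjc (H z).
  by rewrite /H !rmorphM rmorphXn rmorphB rmorph1 rmorphXn /= !conjcK [psi (conjc z) * _]mulrC.
have H0E : H 0 = (cmod (psi 0) ^+ 2)%:C.
  by rewrite /H rmorph0 expr0n subr0 expr1n mulr1 conjcM_cmod.
have HO z : O z -> cmod (H z) <= 2 ^- k.
  move=> [Dz zO]; rewrite /H !cmodM cmod_conj cmodX.
  have p1 := psi1 _ Dz; have p2 := psi1 _ (conjD _ Dz).
  have z1 : cmod z < 1 by apply/unit_diskE.
  have sm (v : R[i]) : cmod (v - 1) < 1 / 5 -> cmod v <= 1 -> cmod (1 - v ^+ 2) <= 2^-1.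
    move=> v1 v2; have -> : 1 - v ^+ 2 = (1 - v) * (1 + v) by ring.
    rewrite cmodM; have := cmodD 1 v; rewrite cmod1 => v3.
    apply: (@le_trans _ _ (1 / 5 * 2)); last by lra.
    apply: ler_pM; rewrite ?cmod_ge0 //; first by rewrite cmodBC ltW.
    by move: v3 v2; lra.
  have pp : cmod (psi z) * cmod (psi (conjc z)) <= 1 by rewrite mulr_ile1 ?cmod_ge0.
  have pp0 : 0 <= cmod (psi z) * cmod (psi (conjc z)) by rewrite mulr_ge0 ?cmod_ge0.
  have lob : cmod (1 - z ^+ 2) <= 2^-1 ->
      cmod (psi z) * cmod (psi (conjc z)) * cmod (1 - z ^+ 2) ^+ k <= 2 ^- k.
    move=> h; rewrite -[leRHS]mul1r; apply: ler_pM => //; first by rewrite exprn_ge0 ?cmod_ge0.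
    by rewrite -exprVn lerXn2r ?nnegrE ?cmod_ge0.
  case: zO => zO.
  - rewrite -k42; apply: ler_pM => //; first by rewrite exprn_ge0 ?cmod_ge0.
      rewrite -[leRHS]mulr1; apply: ler_pM; rewrite ?cmod_ge0 //; exact: ltW.
    rewrite lerXn2r ?nnegrE ?cmod_ge0 //.
    have := cmodB 1 (z ^+ 2); rewrite cmod1 cmodX => /le_trans; apply.
    have : cmod z ^+ 2 <= 1 by rewrite expr_le1 ?cmod_ge0 // ltW.
    by lra.
  - apply: lob; rewrite -sqrrN; apply: sm; last by rewrite cmodN ltW.
    by move: zO; rewrite /disk /= -cmodN opprD opprK.
  - by apply: lob; apply: sm => //; exact: ltW.
have Hinv : hol O (fun z => z^-1) by apply: holV => //; exact: hol_id.
have OD : O `<=` DD by move=> z [].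
have a0 : - u%:C != 0 by apply/O0/TO; left; left.
have ub : u%:C / - u%:C = -1 by rewrite invrN mulrN divff // -oppr_eq0.
pose io := complex.Im (I (fun z => z^-1)).
(* The end points are opposite, so the exponential of the integral of [1 / z] is [-1], which a real
   exponent cannot give. *)
have io0 : io != 0.
  apply/eqP => E; move: Ix; rewrite ub.
  rewrite /cexp -/io E cis0 mulr1 => /(congr1 (@complex.Re R)) /=.
  by have := expR_gt0 (complex.Re (I (fun z => z^-1))); lra.
pose h := cmod (psi 0) ^+ 2.
have h0 : 0 <= h by rewrite exprn_ge0 ?cmod_ge0.
(* The path length [C] is not controlled; powers of [H] are used because such a constant disappears
   when [n]-th roots are taken. *)
apply: (@le_of_powers h _ (C / dl / `|io|)) => // n.
pose q := dq (fun z => H z ^+ n) 0.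
have Hq : hol DD q by apply: dq_hol => //; [exact: unit_disk_open|exact: holX].
have [Q HQ] := @primitive_disk _ q 0 1 Hq.
have qO z : O z -> q z = H z ^+ n / z - H 0 ^+ n * z^-1.
  move=> Oz; rewrite /q /dq ifN ?O0 // subr0; ring.
have IQ : I (fun z => H z ^+ n / z - H 0 ^+ n * z^-1) = Q u%:C - Q (- u%:C).
  by apply: Ie => z Oz; rewrite -qO //; apply/HQ/OD.
have qc z : DD z -> q (conjc z) = conjc (q z).
  move=> Dz; rewrite /q /dq conjc_eq0; case: eqVneq => z0.
    have D0' := hol_dv (holX n HH) D0.
    have : cder (fun z => conjc (H (conjc z) ^+ n)) 0 (conjc (dv (fun z => H z ^+ n) 0)).
      by have := @cder_conj _ (fun z => H z ^+ n) 0 (dv (fun z => H z ^+ n) 0); rewrite rmorph0; apply.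
    have -> : (fun z => conjc (H (conjc z) ^+ n)) = (fun z => H z ^+ n).
      by apply/funext => v; rewrite Hc rmorphXn /= conjcK.
    by move=> /dvE.
  by rewrite Hc !subr0 fmorph_div rmorphB /= !(rmorphXn (@conjc R)) /= H0E conjcR.
(* [q] commutes with conjugation, so its primitive has a real increment between real points; what
   remains of the imaginary part is [h ^+ n * io]. *)
have QI : complex.Im (Q u%:C - Q (- u%:C)) = 0.
  have HQc z : disk 0 1 z -> cder (fun z => conjc (Q (conjc z))) z (q z).
    move=> Dz; rewrite -[q z]conjcK -qc //; apply: (@cder_conj _ Q); apply: HQ; exact: conjD.
  have := @primitive_unique q Q (fun z => conjc (Q (conjc z))) 0 1 HQ HQc _ _ NuD uD.
  have E1 : conjc (- u%:C) = - u%:C by apply/eqP; rewrite eq_complex /= !oppr0 !eqxx.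
  rewrite E1 (conjcR u) -(rmorphB (@conjc R)).
  move: (Q _ - Q _) => [p1 p2] /(congr1 (@complex.Im R)) /=.
  by clear; lra.
have HHn : hol O (fun z => H z ^+ n / z) by apply: holM => //; apply: hol_sub OD _; exact: holX.
have := congr1 (@complex.Im R) IQ; rewrite QI Il //.
rewrite H0E -rmorphXn /= => E.
have E2 : complex.Im (I (fun z => H z ^+ n / z)) = h ^+ n * io.
  by move: E; rewrite /io; case: (I _) (I _) => [p1 p2] [p3 p4] /=; rewrite /h; lra.
have B : cmod (I (fun z => H z ^+ n / z)) <= C * (2 ^- k ^+ n / dl).
  apply: Ib => // z Oz; rewrite cmodf cmodX; apply: ler_pM.
  - by rewrite exprn_ge0 ?cmod_ge0.
  - by rewrite invr_ge0 cmod_ge0.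
  - by rewrite lerXn2r ?nnegrE ?cmod_ge0 ?HO // ltW.
  - by rewrite lef_pV2 ?posrE ?dlO // cmod_gt0 O0.
have := le_trans (normIm_le _) B; rewrite E2 normrM ger0_norm; last exact: exprn_ge0.
rewrite -ler_pdivlMr ?normr_gt0 // => /le_trans; apply.
by rewrite le_eqVlt; apply/orP; left; apply/eqP; ring.
Qed.

End Crossing.

(** * Lifting through an entire map *)

Section Lifting.
Context {R : realType}.
Implicit Types (f g h k F G K : R[i] -> R[i]) (z w c v a b : R[i]) (r s t e M : R)
  (A O S N : set R[i]).

(** Branches in [inverse_branches_defined] take values in the sphere; those of an entire map stay in
    [range fin], so they can be read as plane-valued holomorphic maps. *)
Lemma regular_branch f v : ~ singular_values f v -> exists2 r, 0 < r &
  forall x w, disk v r w -> f x = w -> exists G,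
    [/\ hol (disk v r) G, forall u, disk v r u -> f (G u) = u & G w = x].
Proof.
move=> /contrapT[r r0 H]; exists r => // x w wr fx.
have [G [Gh Gv Gw]] := H (fin x) w (ex_intro2 _ _ x I erefl) wr (congr1 fin fx).
pose G0 u : R[i] := if G u is Some z then z else 0.
have GE u : disk v r u -> G u = fin (G0 u).
  by move=> /Gv[[z _ E] _]; rewrite /G0 -E.
exists G0; split.
- move=> u ur; have [h] := Gh u ur.
  have [r1 r10 r1D] := (open_diskP _).1 (@disk_open _ v r) u ur.
  case=> /near_diskP[d d0 dH].
    have [/cderivableP[l Hl] _] := dH u (disk_center u d0).
    exists l; apply: (@cder_ext _ h _ _ _ (Num.min d r1)) Hl; first by rewrite lt_min d0.
    move=> z zr; have [|_ E] := dH z; first by apply: sub_disk zr; rewrite ge_min lexx.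
    have := GE z; rewrite E => /(_ _)/wrap[|[->]//].
    by apply: r1D; apply: sub_disk zr; rewrite ge_min lexx orbT.
  have hn z : disk u d z -> disk u r1 z -> h z != 0 /\ G0 z = (h z)^-1.
    move=> /dH[_ E] /r1D /GE; rewrite E /=; case: eqVneq => // _ [<-] //.
  have ud := disk_center u d0.
  have [/cderivableP[l Hl] _] := dH u ud.
  have [h0 _] := hn u ud (disk_center u r10).
  exists (- l / h u ^+ 2).
  apply: (@cder_ext _ (fun z => (h z)^-1) _ _ _ (Num.min d r1)); last exact: cderV.
    by rewrite lt_min d0.
  move=> z zr; have [||_ ->//] := hn z.
    by apply: sub_disk zr; rewrite ge_min lexx.
  by apply: sub_disk zr; rewrite ge_min lexx orbT.
- by move=> u ur; have [_] := Gv u ur; rewrite GE //= => -[].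
- by rewrite /G0 Gw.
Qed.

Lemma dv_inv_neq0 f G c r x : 0 < r -> hol (disk c r) G -> cder f x (dv f x) -> G c = x ->
  (forall u, disk c r u -> f (G u) = u) -> dv f x != 0.
Proof.
move=> r0 HG Hf Gc fG; have [l Hl] := HG c (disk_center c r0).
rewrite -Gc in Hf; have := cder_comp Hf Hl.
have H1 : cder (f \o G) c 1.
  by apply: (@cder_ext _ id _ _ _ r) => // [w wr|]; [rewrite /= fG|exact: cder_id].
move=> /(cder_unique H1) /eqP; rewrite Gc; apply: contraTneq => ->.
by rewrite mul0r oner_eq0.
Qed.

Lemma locally_injective A f x : open A -> hol A f -> A x -> dv f x != 0 ->
  exists2 r, 0 < r & disk x r `<=` A /\
    forall y z, disk x r y -> disk x r z -> f y = f z -> y = z.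
Proof.
move=> oA Hf Ax D0.
have [r1 r10 r1A] := (open_diskP A).1 oA x Ax.
have Dm : 0 < cmod (dv f x) / 2 by rewrite divr_gt0 ?cmod_gt0.
have [r2 r20 H2] := hol_cont (dv_hol oA Hf) Ax Dm.
exists (Num.min r1 r2); first by rewrite lt_min r10.
split=> [z zr|y z yr zr E]; first by apply: r1A; apply: sub_disk zr; rewrite ge_min lexx.
have K t : 0 <= t <= 1 -> disk x (Num.min r1 r2) (cseg z y t) by move=> *; exact: disk_cseg.
have := @cseg_bound _ f (dv f) z y (dv f x) (cmod (dv f x) / 2).
rewrite E subrr sub0r cmodN cmodM => /(_ _)/wrap[].
  move=> t /K Kt; apply: hol_dv Hf _; apply: r1A; apply: sub_disk Kt.
  by rewrite ge_min lexx.
move=> /(_ _)/wrap[].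
  move=> t /K Kt; apply/ltW/H2; apply: sub_disk Kt.
  by rewrite ge_min lexx orbT.
move=> H; apply/eqP; rewrite -subr_eq0 -cmod_eq0 eq_le cmod_ge0 andbT.
rewrite -(@pmulr_rle0 _ (cmod (dv f x))) ?cmod_gt0 //.
by move: H; rewrite [X in _ <= X -> _]mulrAC; lra.
Qed.

Lemma regular_locally_injective f x : hol setT f -> ~ singular_values f (f x) ->
  exists2 r, 0 < r & forall y z, disk x r y -> disk x r z -> f y = f z -> y = z.
Proof.
move=> Hf /regular_branch[r r0 H].
have [G [HG fG Gx]] := H x (f x) (disk_center (f x) r0) erefl.
have D0 : dv f x != 0 by apply: (dv_inv_neq0 r0 HG _ Gx fG); exact: hol_dv Hf _.
have [r' r'0 [_ inj]] := locally_injective openT Hf (I : setT x) D0.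
by exists r'.
Qed.

(** Where two lifts agree they agree nearby, by local injectivity over regular values; where they
    differ they differ nearby, by continuity. *)
Lemma lift_unique f S h k a : hol setT f -> connected S ->
  (forall z, S z -> [/\ ccont h z, ccont k z, f (h z) = f (k z) &
     ~ singular_values f (f (h z))]) ->
  S a -> h a = k a -> forall z, S z -> h z = k z.
Proof.
move=> Hf cS H Sa E z Sz.
apply: (connected_chain (P := fun z => h z = k z) cS _ Sa Sz E) => {z Sz} z Sz.
have [hc kc fhk reg] := H z Sz.
have [hk|hk] := eqVneq (h z) (k z); last first.
  have m0 : 0 < cmod (h z - k z) / 2 by rewrite divr_gt0 ?cmod_gt0 ?subr_eq0.
  have [d1 d10 H1] := hc _ m0; have [d2 d20 H2] := kc _ m0.
  exists (Num.min d1 d2); first by rewrite lt_min d10.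
  move=> x y _ _ xr _ Ex; exfalso.
  have := H1 x; have := H2 x; move: xr; rewrite /disk /= lt_min => /andP[x1 x2].
  move=> /(_ x2) h2 /(_ x1) h1; rewrite Ex in h1.
  have := cmod_triang (h z) (k x) (k z); rewrite (cmodBC (h z) (k x)).
  by move: h1 h2; clear; lra.
have [r r0 inj] := regular_locally_injective Hf reg.
have [d1 d10 H1] := hc _ r0; have [d2 d20 H2] := kc _ r0.
exists (Num.min d1 d2); first by rewrite lt_min d10.
move=> x y Sx Sy _; rewrite /disk /= lt_min => /andP[y1 y2] _.
have [_ _ fy _] := H y Sy.
apply: inj => //; first exact: H1.
by rewrite hk; exact: H2.
Qed.

Lemma real_chain (P : R -> Prop) :
  (forall t, 0 <= t <= 1 -> exists2 d, 0 < d & forall s s', 0 <= s <= 1 -> 0 <= s' <= 1 ->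
     `|s - t| < d -> `|s' - t| < d -> P s -> P s') -> P 0 -> P 1.
Proof.
move=> H P0.
pose S : set R[i] := [set z | complex.Im z = 0 /\ 0 <= complex.Re z <= 1].
have cS : connected S.
  apply: convex_connected => z w t [z0 /andP[z1 z2]] [w0 /andP[w1 w2]] /andP[t0 t1].
  have re : complex.Re (cseg z w t) = (1 - t) * complex.Re z + t * complex.Re w.
    by rewrite /cseg; case: (z) (w) => [? ?] [? ?] /=; ring.
  have im : complex.Im (cseg z w t) = (1 - t) * complex.Im z + t * complex.Im w.
    by rewrite /cseg; case: (z) (w) => [? ?] [? ?] /=; ring.
  split; first by rewrite im z0 w0 !mulr0 addr0.
  rewrite re; have t1' : 0 <= 1 - t by rewrite subr_ge0.
  have a1 := mulr_ge0 t1' z1; have a2 := mulr_ge0 t0 w1.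
  have a3 := ler_wpM2l t1' z2; have a4 := ler_wpM2l t0 w2.
  by apply/andP; split; lra.
have S01 t : 0 <= t <= 1 -> S t%:C by move=> t01; split.
have t00 : 0 <= (0 : R) <= 1 by rewrite lexx ler01.
have t11 : 0 <= (1 : R) <= 1 by rewrite lexx ler01.
apply: (connected_chain (P := fun z => P (complex.Re z)) cS _ (S01 _ t00) (S01 _ t11) P0).
move=> z [z0 z1]; have [d d0 dH] := H _ z1; exists d => // x y [_ x1] [_ y1] xd yd.
apply: dH => //.
  apply: le_lt_trans xd; have := normRe_le (x - z).
  by case: (x) (z) => [? ?] [? ?].
apply: le_lt_trans yd; have := normRe_le (y - z).
by case: (y) (z) => [? ?] [? ?].
Qed.

Definition tube a b t e : set R[i] :=
  [set w | exists2 s, 0 <= s <= t & cmod (w - cseg a b s) < e].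

Lemma tube_open a b t e : open (tube a b t e).
Proof.
apply/open_diskP => z [s st zs]; exists (e - cmod (z - cseg a b s)); first by rewrite subr_gt0.
move=> w wz; exists s => //; apply: (disk_sub _ wz); by rewrite addrC subrK.
Qed.

Lemma tube_convex a b t e z w u : tube a b t e z -> tube a b t e w -> 0 <= u <= 1 ->
  tube a b t e (cseg z w u).
Proof.
move=> [s /andP[s0 s1] zs] [s' /andP[s'0 s'1] ws] u01; have /andP[u0 u1] := u01.
have u1' : 0 <= 1 - u by rewrite subr_ge0.
exists ((1 - u) * s + u * s').
  have a1 := mulr_ge0 u1' s0; have a2 := mulr_ge0 u0 s'0.
  have a3 := ler_wpM2l u1' s1; have a4 := ler_wpM2l u0 s'1.
  by apply/andP; split; lra.
have -> : cseg z w u - cseg a b ((1 - u) * s + u * s') =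
    cseg (z - cseg a b s) (w - cseg a b s') u - 0.
  by rewrite /cseg rmorphD !rmorphM rmorphB rmorph1 /=; ring.
by apply: (@disk_cseg _ 0 e) => //; rewrite /disk /= subr0.
Qed.

Lemma tube_l a b t e : 0 <= t -> 0 < e -> tube a b t e a.
Proof.
move=> t0 e0; exists 0; first by rewrite lexx.
by rewrite /cseg mul0r addr0 subrr cmod0.
Qed.

Lemma tube_at a b t s e : 0 <= s <= t -> 0 < e -> tube a b t e (cseg a b s).
Proof. by move=> st e0; exists s => //; rewrite subrr cmod0. Qed.

Definition segment_convex N := forall z w t, N z -> N w -> 0 <= t <= 1 -> N (cseg z w t).

(** A regular value has a disk over which a branch through every preimage is defined on the whole
    disk, so continuation along a segment never stops. Convexity of [N] makes the segments from [w0]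
    a system of paths on which the continuations fit together. *)
Lemma convex_lift f N h w0 x0 : hol setT f -> open N -> segment_convex N -> hol N h ->
  (forall z, N z -> ~ singular_values f (h z)) -> N w0 -> f x0 = h w0 ->
  exists l, [/\ hol N l, forall z, N z -> f (l z) = h z & l w0 = x0].
Proof.
move=> Hf oN cN Hh reg Nw0 fx0.
have oN' := (open_diskP N).1 oN.
have loc z : N z -> exists2 r, 0 < r & disk z r `<=` N /\ forall y x, disk z r y -> f x = h y ->
    exists G, [/\ hol (disk z r) G, forall u, disk z r u -> f (G u) = h u & G y = x].
  move=> Nz; have [r1 r10 r1N] := oN' z Nz.
  have [r2 r20 H2] := regular_branch (reg z Nz).
  have [r3 r30 H3] := hol_cont Hh Nz r20.
  have s1 : disk z (Num.min r1 r3) `<=` disk z r1 by apply: sub_disk; rewrite ge_min lexx.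
  have s3 : disk z (Num.min r1 r3) `<=` disk z r3 by apply: sub_disk; rewrite ge_min lexx orbT.
  exists (Num.min r1 r3); first by rewrite lt_min r10.
  split=> [|y x yr fx]; first by move=> w /s1 /r1N.
  have [G [HG fG Gy]] := H2 x (h y) (H3 y (s3 _ yr)) fx.
  exists (G \o h); split => //.
    by apply: (hol_comp _ HG) => [|u /s3 /H3//]; apply: hol_sub Hh => w /s1 /r1N.
  by move=> u /s3 /H3 /fG.
pose good v t e l := [/\ 0 < e, hol (tube w0 v t e `&` N) l,
   forall z, (tube w0 v t e `&` N) z -> f (l z) = h z & l w0 = x0].
have tubeN v t e : connected (tube w0 v t e `&` N).
  apply: convex_connected => z w u [z1 z2] [w1 w2] u01.
  by split; [exact: tube_convex|exact: cN].
have otubeN v t e : open (tube w0 v t e `&` N) by apply: openI => //; exact: tube_open.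
have ex v : N v -> exists e l, good v 1 e l.
  move=> Nv; apply: (real_chain (P := fun t => exists e l, good v t e l)) => [t t01|]; last first.
    have [r r0 [rN H]] := loc w0 Nw0.
    have [G [HG fG Gx]] := H w0 x0 (disk_center w0 r0) fx0.
    have sub : tube w0 v 0 r `&` N `<=` disk w0 r.
      move=> z [[s /le_anti <-]]; by rewrite /cseg mul0r addr0.
    by exists r, G; split => // [|z /sub/fG//]; exact: hol_sub HG.
  pose z := cseg w0 v t.
  have Nz : N z by exact: cN.
  have [r r0 [rN H]] := loc z Nz.
  pose L := cmod (v - w0) + 1.
  have L0 : 0 < L by rewrite ltr_wpDl ?cmod_ge0.
  pose d := r / (2 * L).
  have d0 : 0 < d by rewrite divr_gt0 // mulr_gt0.
  have near s : `|s - t| < d -> cmod (cseg w0 v s - z) < r / 2.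
    move=> sd; have -> : cseg w0 v s - z = (s - t)%:C * (v - w0).
      by rewrite /z /cseg rmorphB /=; ring.
    rewrite cmodM cmod_real; apply: (@le_lt_trans _ _ (`|s - t| * L)).
      by rewrite ler_wpM2l // lerDl.
    by rewrite -ltr_pdivlMr // -mulrA -invfM.
  exists d => // s s' s01 s'01 sd s'd [e [l [e0 Hl fl l0]]].
  pose e' := Num.min e (r / 2).
  have [e'0 e'e e'r] : [/\ 0 < e', e' <= e & e' <= r / 2].
    by rewrite /e' lt_min e0 divr_gt0 // !ge_min !lexx orbT.
  have /andP[s0 s1] := s01.
  clearbody e'; have tub t1 t2 : t1 <= t2 -> tube w0 v t1 e' `<=` tube w0 v t2 e.
    move=> t12 w [u /andP[u0 u1] wu]; exists u; first by rewrite u0 (le_trans u1).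
    exact: lt_le_trans e'e.
  have [s's|ss'] := leP s' s.
    exists e', l; split => //; first by apply: hol_sub Hl => w [/(tub _ _ s's)].
    by move=> w [/(tub _ _ s's) ? ?]; exact: fl.
  pose y := cseg w0 v s.
  have Ny : N y by exact: cN.
  have yr : disk z r y by rewrite /disk /=; have := near s sd; move: r0; rewrite /y; clear; lra.
  have yt : tube w0 v s e y by apply: tube_at => //; rewrite s0 lexx.
  have [G [HG fG Gy]] := H y (l y) yr (fl y (conj yt Ny)).
  have agree w : tube w0 v s e w -> disk z r w -> l w = G w.
    move=> wt wr; pose S := tube w0 v s e `&` N `&` disk z r.
    apply: (@lift_unique f S l G y) => //.
    - apply: convex_connected => p q u [[p1 p2] p3] [[q1 q2] q3] u01.
      by split; [split; [exact: tube_convex|exact: cN]|exact: disk_cseg].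
    - move=> p [p1 p2]; rewrite fl // fG //; split => //.
      + exact: hol_cont Hl p1.
      + exact: hol_cont HG p2.
      + by apply: reg; case: p1.
    - by split => //; split => //; exact: rN wr.
  (* The lift on the old tube is continued by the local branch [G], which agrees with it where both
     are defined. *)
  pose l' w := if `[< tube w0 v s e w >] then l w else G w.
  have cover w : tube w0 v s' e' w -> tube w0 v s e' w \/ disk z r w.
    move=> [u /andP[u0 u1] wu]; have [us|su] := leP u s.
      by left; exists u => //; rewrite u0.
    right; have ud : `|u - t| < d.
      move: sd s'd; rewrite !ltr_norml => /andP[? ?] /andP[? ?].
      by apply/andP; split; lra.
    rewrite /disk /=; have := cmod_triang w (cseg w0 v u) z; have := near u ud.
    by move: wu e'r; clear; lra.
  have l'G w : disk z r w -> l' w = G w.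
    by move=> wr; rewrite /l'; case: asboolP => // /agree ->.
  have l'l w : tube w0 v s e w -> l' w = l w.
    by move=> wt; rewrite /l'; case: asboolP.
  exists e', l'; split => //.
  - move=> w [/cover[wt|wr] Nw].
      have wt' : tube w0 v s e w := tub _ _ (lexx s) _ wt.
      apply: (@hol_ext _ (tube w0 v s e `&` N) l) => //; first by move=> p [p1 _]; rewrite l'l.
    apply: (@hol_ext _ (disk z r) G) => //; first exact: disk_open.
    by move=> p pr; rewrite l'G.
  - move=> w [/cover[wt|wr] Nw].
      have wt' : tube w0 v s e w := tub _ _ (lexx s) _ wt.
      by rewrite l'l // fl.
    by rewrite l'G // fG.
  - by rewrite l'l //; exact: tube_l.
have /choice[E HE] : forall v, exists p : R * (R[i] -> R[i]), N v -> good v 1 p.1 p.2.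
  move=> v; have [Nv|nNv] := pselect (N v); last by exists (0, id).
  by have [e [l H]] := ex v Nv; exists (e, l).
have t1 v e : 0 < e -> tube w0 v 1 e v.
  move=> e0; have := @tube_at w0 v 1 1 e; rewrite lexx ler01 /cseg mul1r [w0 + _]addrC subrK.
  exact.
(* The segment to a point [v'] near [v] lies in the tube of [v], and uniqueness along it compares
   the two lifts. So the end values, as functions of [v], are locally a single holomorphic lift. *)
have loc_eq v : N v -> forall v', N v' -> disk v (E v).1 v' -> (E v').2 v' = (E v).2 v'.
  move=> Nv v' Nv' vv'; have [e0 Hl fl l0] := HE v Nv; have [e0' Hl' fl' l0'] := HE v' Nv'.
  pose S := [set w | exists2 s, 0 <= s <= 1 & w = cseg w0 v' s].
  have S1 w : S w -> (tube w0 v' 1 (E v').1 `&` N) w.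
    by move=> [s s1 ->]; split; [exact: tube_at|exact: cN].
  have S2 w : S w -> (tube w0 v 1 (E v).1 `&` N) w.
    move=> [s s1 ->]; split; last exact: cN.
    exists s => //; have -> : cseg w0 v' s - cseg w0 v s = s%:C * (v' - v).
      by rewrite /cseg; ring.
    case/andP: s1 => s0 s1; rewrite cmodM cmod_real0 //; apply: le_lt_trans vv'.
    by rewrite ler_piMl ?cmod_ge0.
  apply: (@lift_unique f S _ _ w0) => //.
  - apply: (@star_connected _ _ w0) => w t [s /andP[s0 s1] ->] /andP[u0 u1].
    exists (t * s); first by rewrite mulr_ge0 //= mulr_ile1.
    by rewrite /cseg rmorphM; ring.
  - move=> w Sw; have w1 := S1 w Sw; have w2 := S2 w Sw; split.
    + exact: hol_cont Hl' w1.
    + exact: hol_cont Hl w2.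
    + by rewrite fl' // fl.
    + by rewrite fl' //; apply: reg; case: w1.
  - by exists 0; [rewrite lexx ler01|rewrite /cseg mul0r addr0].
  - by rewrite l0 l0'.
  - by exists 1; [rewrite lexx ler01|rewrite /cseg mul1r addrC subrK].
exists (fun v => (E v).2 v); split.
- move=> v Nv; have [e0 Hl fl l0] := HE v Nv; have [r r0 rN] := oN' v Nv.
  have [m Hm] := Hl v (conj (t1 v _ e0) Nv).
  exists m; apply: (@cder_ext _ (E v).2 _ _ _ (Num.min r (E v).1)) Hm.
    by rewrite lt_min r0.
  move=> w wr; rewrite (loc_eq v) //.
    by apply: rN; apply: sub_disk wr; rewrite ge_min lexx.
  by apply: sub_disk wr; rewrite ge_min lexx orbT.
- by move=> v Nv; have [e0 Hl fl l0] := HE v Nv; apply: fl; split => //; exact: t1.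
- by have [_ _ _] := HE w0 Nw0.
Qed.

Lemma postsingular_invariant f z : hol setT f -> postsingular_set f z -> postsingular_set f (f z).
Proof.
move=> Hf /closure_diskP Hz; apply/closure_diskP => e e0.
have [d d0 dH] := hol_cont Hf (I : setT z) e0.
have [w [n _ [s Ss <-]] wd] := Hz d d0.
by exists (f (iter n f s)); [exists n.+1 => //; exists s|exact: dH].
Qed.

Lemma singular_postsingular f z : singular_values f z -> postsingular_set f z.
Proof. by move=> Sz; apply: subset_closure; exists 0%N => //; exists z. Qed.

(** Forward invariance of the postsingular set keeps every intermediate lift away from it, so a
    single hypothesis on [h] and [N] serves for all [n]. *)
Lemma convex_lift_iter f n N h w0 x0 : hol setT f -> open N -> segment_convex N -> hol N h ->
  (forall z, N z -> ~ postsingular_set f (h z)) -> N w0 -> iter n f x0 = h w0 ->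
  exists l, [/\ hol N l, forall z, N z -> iter n f (l z) = h z & l w0 = x0].
Proof.
move=> Hf oN cN; elim: n h => [|n IH] h Hh reg Nw0 /= fx0; first by exists h.
have [l1 [Hl1 fl1 l1w]] := convex_lift Hf oN cN Hh (fun z Nz => contra_not (@singular_postsingular f _) (reg z Nz)) Nw0 fx0.
have reg1 z : N z -> ~ postsingular_set f (l1 z).
  by move=> Nz /(postsingular_invariant Hf); rewrite fl1 //; exact: reg.
have [l [Hl fl lw]] := IH l1 Hl1 reg1 Nw0 (esym l1w).
by exists l; split => // z Nz; rewrite fl // fl1.
Qed.

End Lifting.

(** * Fatou components and the escape function *)

Section Limits.
Context {R : realType}.
Implicit Types (f g h : R[i] -> R[i]) (z w zeta : R[i]) (r s t M : R).

Lemma at_left1P (P : R -> Prop) : (\forall r \near (1 : R)^'-, P r) <->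
  exists2 rho : R, rho < 1 & forall r, rho < r -> r < 1 -> P r.
Proof.
rewrite /at_left near_withinE; split => [/nbhs_ballP[e /= e0 H]|[rho rho1 H]].
  exists (1 - e); first by rewrite ltrBlDr ltrDl.
  move=> r r1 r2; apply: H => //; rewrite /ball /= ger0_norm; last by rewrite subr_ge0 ltW.
  by move: r1; lra.
apply/nbhs_ballP; exists (1 - rho) => [|r] /=; first by rewrite subr_gt0.
rewrite /ball /= => h r1; apply: H => //.
by move: h; rewrite ltr_norml => /andP[_]; lra.
Qed.

Lemma cvg_fin_inftyP (h : R -> R[i]) : fin (h t) @[t --> (1 : R)^'-] --> infty <->
  forall M, exists2 rho : R, rho < 1 & forall r, rho < r -> r < 1 -> M < cmod (h r).
Proof.
split=> [H M|H B [C [cC _] CB]].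
  have : nbhs (@infty R) ((Some @` (~` cdisk 0 M)) `|` [set None]).
    exists (cdisk 0 M) => //; split; first exact: cdisk_compact0.
    apply/closed_diskP => z Hz; rewrite /cdisk /= subr0; apply/ler_addgt0Pl => e e0.
    have [w] := Hz e e0; rewrite /cdisk /= subr0 => wM wz.
    have := cmod_le_subD z w; rewrite (cmodBC z w).
    by move: wM wz; rewrite /disk /=; lra.
  move=> /H /at_left1P[rho rho1 K]; exists rho => // r r1 r2.
  by case: (K r r1 r2) => // -[z /= zM [<-]]; rewrite ltNge; apply/negP; rewrite -[z]subr0.
have [M HM] : exists M, forall z, C z -> cmod z <= M.
  have [->|/set0P C0] := eqVneq C set0; first by exists 0.
  have [z _ e e0|z Cz zmax] := @compact_max _ C (@cmod R) cC C0.
    by exists e => // w; apply: le_lt_trans (cmod_dist _ _).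
  by exists (cmod z).
have [rho rho1 K] := H M; apply/at_left1P; exists rho => // r r1 r2; apply: CB.
left; exists (h r) => // /HM; by rewrite leNgt K.
Qed.

Lemma cvg_fin_finP (h : R -> R[i]) z : fin (h t) @[t --> (1 : R)^'-] --> fin z <->
  forall e : R, 0 < e -> exists2 rho : R, rho < 1 & forall r, rho < r -> r < 1 -> disk z e (h r).
Proof.
split=> [H e e0|H B /nbhs_diskP[e e0 eB]].
  have : nbhs (fin z) (Some @` (disk z e)).
    by apply: one_point_compactification_some_nbhs; apply/nbhs_diskP; exists e.
  move=> /H /at_left1P[rho rho1 K]; exists rho => // r r1 r2.
  by have [w wz [<-]] := K r r1 r2.
have [rho rho1 K] := H e e0; apply/at_left1P; exists rho => // r r1 r2.
by apply: eB; exact: K.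
Qed.

Lemma cvg_CP (h : R -> R[i]) z : h t @[t --> (1 : R)^'-] --> z <->
  forall e : R, 0 < e -> exists2 rho : R, rho < 1 & forall r, rho < r -> r < 1 -> disk z e (h r).
Proof.
split=> [H e e0|H B /nbhs_diskP[e e0 eB]].
  have : nbhs z (disk z e) by apply/nbhs_diskP; exists e.
  by move=> /H /at_left1P.
have [rho rho1 K] := H e e0; apply/at_left1P; exists rho => // r r1 r2.
by apply: eB; exact: K.
Qed.

End Limits.

(** * Fatou set and Fatou components *)

Section Fatou.
Context {R : realType}.
Implicit Types (f g h : R[i] -> R[i]) (z w : R[i]) (U : set R[i]).

Lemma chordal_refl (x : Chat R) : chordal x x = 0.
Proof. by case: x => //= a; rewrite subrr cmod0 mulr0 mul0r. Qed.

Lemma fatou_open f : open (fatou_set f).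
Proof.
apply/open_diskP => z [W [oW Wz nW]]; have [r r0 rW] := (open_diskP W).1 oW z Wz.
by exists r => // w /rW Ww; exists W.
Qed.

Lemma homo_ltn_iter (h : nat -> nat) : (forall n, (n <= h n)%N) ->
  {homo (fun j => iter j (h \o succn) (h 0%N)) : m n / (m < n)%N >-> (m < n)%N}.
Proof. by move=> H; apply: homo_ltn => [? ? ?|n]; [exact: ltn_trans|exact: H]. Qed.

(** Iterates near [z] are iterates of one order less near [f z], composed with [f], and [f] maps
    compact sets to compact sets. *)
Lemma fatou_preimage f z : hol setT f -> fatou_set f (f z) -> fatou_set f z.
Proof.
move=> Hf [W [oW Wz nW]].
have cf : continuous f by move=> w; apply/ccontP; exact: hol_cont Hf (I : setT w).
exists (f @^-1` W); split => //.
  by move/continuousP: cf => /(_ W oW).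
move=> u Hu; have /choice[k uE] : forall n, exists k, u n = iter k f.
  by move=> n; have [k _ <-] := Hu n; exists k.
(* The identity is an iterate that does not factor through [f]. If it recurs, it is itself a
   convergent subsequence; otherwise it is discarded with finitely many terms. *)
have [inf0|/existsNP[N0 HN]] := pselect (forall N, exists2 n, (N <= n)%N & k n = 0%N).
  have /choice[h Hh] : forall N, exists n, (N <= n)%N /\ k n = 0%N.
    by move=> N; have [n ? ?] := inf0 N; exists n.
  exists (fun j => iter j (h \o succn) (h 0%N)).
    by apply: homo_ltn_iter => n; case: (Hh n).
  exists fin => K _ _ e e0; exists 0%N => // n _ w _.
  rewrite -[(u \o _) n]/(u (iter n (h \o succn) (h 0%N))) uE.
  have -> : k (iter n (h \o succn) (h 0%N)) = 0%N.
    by case: n => [|n] /=; case: (Hh 0%N) => _ //; case: (Hh (iter n (h \o succn) (h 0%N)).+1).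
  by rewrite -[iter 0 f w]/w chordal_refl.
have kpos n : (N0 <= n)%N -> k n = (k n).-1.+1.
  move=> Nn; case E : (k n) => //; exfalso; apply: HN; by exists n.
have [|s hs [l Hl]] := nW (fun n => iter (k (N0 + n)%N).-1 f).
  by move=> n; exists (k (N0 + n)%N).-1.
exists (fun n => (N0 + s n)%N).
  by move=> m n mn; rewrite ltn_add2l; exact: hs.
exists (l \o f) => K cK KW e e0.
have cfK : compact (f @` K) by apply: continuous_compact => //; exact: continuous_subspaceT.
have fKW : f @` K `<=` W by move=> _ [w Kw <-]; exact: KW.
have := Hl _ cfK fKW e e0; apply: filterS => n H w Kw.
rewrite -[(u \o _) n]/(u (N0 + s n)%N) uE kpos ?leq_addr // iterSr.
by apply: H; exists w.
Qed.

Lemma disk_connected z r : connected (@disk R z r).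
Proof. by apply: convex_connected => a b t *; exact: disk_cseg. Qed.

Lemma component_absorbs f U (B : set R[i]) w : fatou_component f U -> connected B ->
  B `<=` fatou_set f -> B w -> U w -> B `<=` U.
Proof.
move=> [z0 Fz0 ->] cB BF Bw Uw z Bz.
have Fw := BF w Bw.
apply: (connected_component_trans Uw).
by apply: connected_component_max Bz.
Qed.

Lemma component_closure f U z : fatou_component f U -> closure U z -> fatou_set f z -> U z.
Proof.
move=> Uc /closure_diskP clz Fz.
have [r r0 rF] := (open_diskP _).1 (@fatou_open f) z Fz.
have [w Uw wz] := clz r r0.
apply: (component_absorbs Uc (@disk_connected z r) rF wz Uw).
exact: disk_center.
Qed.

Lemma component_sub f U : fatou_component f U -> U `<=` fatou_set f.
Proof. by move=> [z _ ->]; exact: connected_component_sub. Qed.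

(** A point that [f] maps into [U] is in the Fatou set, and a component contains every point of its
    closure that lies in the Fatou set. *)
Lemma component_preimage f U z : hol setT f -> fatou_component f U -> closure U z -> U (f z) -> U z.
Proof.
move=> Hf Uc clz Ufz; apply: (component_closure Uc clz).
apply: fatou_preimage => //; exact: component_sub Uc _ Ufz.
Qed.

End Fatou.

(** * A positive harmonic function that detects infinity *)

Section Escape.
Context {R : realType}.
Implicit Types (z w : R[i]) (U : set R[i]) (phi : R[i] -> R[i]).

Local Notation DD := (@unit_disk R).

Lemma riemann_facts U phi : riemann_map U phi -> [/\ hol DD phi, forall z, DD z -> U (phi z),
  forall z w, DD z -> DD w -> phi z = phi w -> z = w & forall w, U w -> exists2 z, DD z & phi z = w].
Proof.
move=> [/holP Hphi [fU inj sur]]; split => //.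
by move=> z w Dz Dw; apply: inj; exact/mem_set.
Qed.

(** Otherwise the inverse of [phi] would be a bounded entire function that is not constant. *)
Lemma omitted_value U phi : riemann_map U phi -> exists a, ~ U a.
Proof.
move=> /riemann_facts[Hphi phiU inj sur]; apply: contrapT => /forallNP H.
have /choice[K HK] : forall w, exists z, DD z /\ phi z = w.
  by move=> w; have [|z Dz E] := sur w; [exact: contrapT (H w)|exists z].
have KK z : DD z -> K (phi z) = z by move=> Dz; have [D1 E] := HK (phi z); apply: inj.
have HolK : hol setT K.
  move=> w _; have [Dz <-] := HK w; eexists.
  by apply: (inverse_cder _ Hphi inj KK Dz); exact: unit_disk_open.
have K1 w : cmod (K w) <= 1 by have [/unit_diskE/ltW] := HK w.
have E := liouville HolK K1.
have D0 : DD 0 by apply/unit_diskE; rewrite cmod0 ltr01.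
have Dh : DD (2^-1 : R)%:C by apply/unit_diskE; rewrite cmod_real0 ?invr_ge0 //; lra.
have := E (phi 0); rewrite -(E (phi (2^-1 : R)%:C)) !KK // => /esym/eqP.
by rewrite realC_eq0 invr_eq0 pnatr_eq0.
Qed.

(* The square root trick of the Riemann mapping theorem produces, from a value
   omitted by [phi], a positive harmonic function [Re F] that tends to infinity
   exactly when [phi] does. *)
Lemma escape_function U phi : riemann_map U phi -> exists F, [/\ hol DD F,
  forall z, DD z -> 0 <= complex.Re (F z),
  forall K : R, exists M : R, forall z, DD z -> M < cmod (phi z) -> K < complex.Re (F z) &
  forall M : R, exists K : R, forall z, DD z -> K < complex.Re (F z) -> M < cmod (phi z)].
Proof.
move=> phiR; have [a Ua] := omitted_value phiR.
have [Hphi phiU inj sur] := riemann_facts phiR.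
have D0 : DD 0 by apply/unit_diskE; rewrite cmod0 ltr01.
have [L HL EL] : exists2 L, hol DD L & forall z, DD z -> cexp (L z) = phi z - a.
  apply: log_disk => //; first by apply: holB => //; exact: hol_cst.
  by move=> z /phiU Uz; rewrite subr_eq0; apply: contra_notN Ua => /eqP <-.
pose q z := cexp (L z / 2).
have q2 z : DD z -> q z ^+ 2 = phi z - a.
  by move=> Dz; rewrite -EL // expr2 -cexpD; congr cexp; field.
have Hq : hol DD q by apply: hol_cexp; apply: holM => //; exact: hol_cst.
have qn z : q z != 0 by exact: cexp_neq0.
have qphi z w : DD z -> DD w -> q z ^+ 2 = q w ^+ 2 -> z = w.
  by move=> Dz Dw; rewrite !q2 // => /addIr; exact: inj.
have qinj z w : DD z -> DD w -> q z = q w -> z = w.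
  by move=> Dz Dw E; apply: qphi => //; rewrite E.
have [d d0 dH] := injective_open unit_disk_open Hq qinj D0 (@ltr01 R).
(* [q] is a square root of the injective map [phi - a], so it never takes two opposite values; as it
   covers a disk about [q 0], it omits the opposite disk. This makes the real part of the logarithm
   [F] nonnegative. *)
have qfar z : DD z -> d <= cmod (q z + q 0).
  move=> Dz; rewrite leNgt; apply/negP => h.
  have [|w [Dw _] qw] := dH (- q z); first by rewrite /disk /= -opprD cmodN.
  have zw : w = z by apply: qphi => //; rewrite qw sqrrN.
  move: qw; rewrite zw => /eqP; rewrite -addr_eq0 -mulr2n -mulr_natr mulf_eq0 (negPf (qn z)).
  by rewrite pnatr_eq0.
have dC0 : d%:C != 0 by rewrite realC_eq0 gt_eqF.
have [F HF EF] : exists2 F, hol DD F & forall z, DD z -> cexp (F z) = (q z + q 0) / d%:C.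
  apply: log_disk => //.
    by apply: hol_div => //; [apply: holD => //|]; exact: hol_cst.
  move=> z /qfar h; rewrite mulf_neq0 ?invr_eq0 // -cmod_gt0; exact: lt_le_trans h.
have EF' z : DD z -> expR (complex.Re (F z)) * d = cmod (q z + q 0).
  by move=> Dz; rewrite -cmod_cexp EF // cmodf cmod_real0 ?(ltW d0) // divfK // gt_eqF.
have qle z : DD z -> cmod (q z) ^+ 2 <= cmod (phi z) + cmod a.
  by move=> Dz; rewrite -cmodX q2 //; exact: cmodB.
have qge z : DD z -> cmod (phi z) <= cmod (q z) ^+ 2 + cmod a.
  by move=> Dz; rewrite -cmodX q2 //; exact: cmod_le_subD.
exists F; split => //.
- move=> z Dz; rewrite -ler_expR expR0 -(ler_pM2r d0) mul1r EF' //; exact: qfar.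
- move=> K; pose T := d * expR K + cmod (q 0).
  have T0 : 0 <= T by rewrite addr_ge0 ?cmod_ge0 // mulr_ge0 ?expR_ge0 // ltW.
  exists (T ^+ 2 + cmod a) => z Dz zM.
  have qT : T < cmod (q z).
    rewrite -(@ltr_pXn2r _ 2) ?nnegrE ?cmod_ge0 //; have := qge z Dz; move: zM; clear; lra.
  rewrite -ltr_expR -(ltr_pM2r d0) EF' //.
  have := cmod_le_subD (q z) (- q 0); rewrite opprK cmodN.
  by move: qT; rewrite /T [d * _]mulrC; lra.
- move=> M; pose T := cmod (q 0) + 1 + `|M| + cmod a.
  have T0 : 0 < T by rewrite /T; have := cmod_ge0 (q 0); have := cmod_ge0 a; have := normr_ge0 M; lra.
  exists (ln (T / d)) => z Dz.
  rewrite -ltr_expR lnK ?posrE ?divr_gt0 // ltr_pdivrMr // EF' // => h.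
  have h2 := cmodD (q z) (q 0).
  have q1 : 1 + `|M| + cmod a < cmod (q z) by move: h h2; rewrite /T; lra.
  have q3 : cmod (q z) <= cmod (q z) ^+ 2.
    rewrite expr2 ler_peMl ?cmod_ge0 //.
    by have := cmod_ge0 a; have := normr_ge0 M; move: q1; lra.
  have := qle z Dz; have := ler_norm M; move: q1 q3; lra.
Qed.

End Escape.

(** * Sets along which a harmonic function escapes *)

Section Approach.
Context {R : realType}.
Implicit Types (z w zeta t : R[i]) (r d M rho : R) (S T W X : set R[i]).

Local Notation DD := (@unit_disk R).

Lemma real1B (x : R) : (1 - x)%:C = 1 - x%:C.
Proof. by rewrite rmorphB rmorph1. Qed.

Lemma hol_image_connected S (A : set R[i]) (h : R[i] -> R[i]) : hol A h -> S `<=` A ->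
  connected S -> connected (h @` S).
Proof.
move=> Hh SA cS; apply: connected_continuous_connected => //.
by apply: continuous_in_subspaceT => z /set_mem /SA Az; apply/ccontP; exact: hol_cont Hh Az.
Qed.

Lemma exists_geometric_lt (e : R) : 0 < e -> exists k : nat, 2 ^- k < e.
Proof.
move=> e0; have : (2^-1 : R) ^+ n @[n --> \oo] --> (0 : R).
  by apply: cvg_expr; rewrite ger0_norm ?invr_ge0 //; lra.
move=> /cvgrPdist_lt /(_ e e0)[n _ /(_ n (leqnn n))].
rewrite /= sub0r normrN ger0_norm ?exprn_ge0 ?invr_ge0 // exprVn => h.
by exists n.
Qed.

(** Uniform over [X], and vacuous when [X] stays away from the circle. *)
Definition escapes_on (V : R[i] -> R) X := forall M, exists2 rho : R, rho < 1 &
  forall z, DD z -> X z -> rho < cmod z -> M < V z.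

Context (F : R[i] -> R[i]) (HF : hol DD F) (F0 : forall z, DD z -> 0 <= complex.Re (F z)).

Local Notation V := (fun z => complex.Re (F z)).

(** The automorphism [J] sends [r%:C * zeta] to 0, [t0] close to [-1] and [s] close to 1, and
    [crossing] applies to [cexp (- F)] read in this coordinate. The bound [rho] depends on [t0] and
    [M] but not on [zeta] or [S], which [cones_escape] needs. *)
Lemma approach X t0 M : escapes_on V X -> DD t0 -> exists2 rho : R, rho < 1 &
  forall zeta r s S, unit_circle zeta -> rho < r -> r < 1 -> connected S -> S `<=` X `&` DD ->
    S t0 -> S s -> cmod (s - zeta) < (1 - r) / 10 -> M < V (r%:C * zeta).
Proof.
move=> good Dt0.
(* [crossing] will bound [expR (- V) ^+ 2] at [r%:C * zeta] by [2 ^- k]; this [k] turns that into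
   [M < V]. *)
have [k kM] := exists_geometric_lt (expR_gt0 (- M * 2)).
have k4 : 0 < 4 ^- k :> R by rewrite invr_gt0 exprn_gt0.
have [rho0 rho01 H0] := good (- ln (4 ^- k : R)).
have t01 : cmod t0 < 1 by apply/unit_diskE.
(* The first bound keeps [r] nonnegative and the denominators in [J] away from 0, the second puts
   [J t0] within 1/5 of [-1], and the third keeps the points of [S] not sent near [-1] beyond radius
   [rho0]. *)
pose m := Num.min (1 / 10) (Num.min ((1 - cmod t0) / 20) ((1 - rho0) / 40)).
have [m0 m1 m2 m3] : [/\ 0 < m, m <= 1 / 10, m <= (1 - cmod t0) / 20 & m <= (1 - rho0) / 40].
  rewrite /m !lt_min !ge_min !lexx !orbT; split => //.
  by apply/and3P; split; rewrite divr_gt0 // subr_gt0.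
clearbody m; exists (1 - m); first by rewrite ltrBlDr ltrDl.
move=> zeta r s S zeta1 r1 r2 cS SX St0 Ss sz.
have zC : conjc zeta * zeta = 1 by rewrite mulrC conjcM_cmod zeta1 expr1n.
have r0 : 0 <= r by move: r1 m1; lra.
have rC : cmod r%:C < 1 by rewrite cmod_real0.
have rNC : cmod (- r%:C) < 1 by rewrite cmodN.
have mr (u : R[i]) : mob r%:C u = (u + r%:C) / (1 + r%:C * u) by rewrite /mob conjcR.
have mNr (u : R[i]) : mob (- r%:C) u = (u - r%:C) / (1 - r%:C * u).
  by rewrite /mob conjcN conjcR mulNr.
pose J u := mob (- r%:C) (conjc zeta * u).
have cz1 u : cmod (conjc zeta * u) = cmod u by rewrite cmodM cmod_conj zeta1 mul1r.
have zu1 u : cmod (zeta * u) = cmod u by rewrite cmodM zeta1 mul1r.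
have JD u : DD u -> DD (J u).
  by move=> /unit_diskE u1; apply/unit_diskE/mob_disk => //; rewrite cz1.
have HJ : hol DD J.
  apply: (@hol_comp _ DD DD (fun u => conjc zeta * u) (mob (- r%:C))).
  - by apply: holM; [exact: hol_cst|exact: hol_id].
  - exact: hol_mob.
  - by move=> u /unit_diskE u1; apply/unit_diskE; rewrite cz1.
pose N u := zeta * mob r%:C u.
have ND u : DD u -> DD (N u).
  by move=> /unit_diskE u1; apply/unit_diskE; rewrite zu1; exact: mob_disk.
have NJ u : DD u -> N (J u) = u.
  by move=> /unit_diskE u1; rewrite /N mobN ?cz1 // mulrA [zeta * _]mulrC zC mul1r.
have HN : hol DD N by apply: holM; [exact: hol_cst|exact: hol_mob].
pose psi u := cexp (- F (N u)).
have Hpsi : hol DD psi.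
  apply: hol_cexp; apply: holN; apply: (@hol_comp _ DD DD N F) => //.
have ReN u : complex.Re (- F u) = - complex.Re (F u) by case: (F u).
have psiE u : cmod (psi u) = expR (- V (N u)) by rewrite /psi cmod_cexp ReN.
have den u : DD u -> 1 - r <= cmod (1 - r%:C * (conjc zeta * u)).
  move=> /unit_diskE u1; have := cmod_sub_ge 1 (r%:C * (conjc zeta * u)).
  rewrite cmod1 cmodM cz1 cmod_real0 //; apply: le_trans; rewrite lerD2l lerN2.
  by rewrite ler_piMr // ltW.
have den0 u : DD u -> 1 - r%:C * (conjc zeta * u) != 0.
  by move=> /den h; rewrite -cmod_gt0; apply: lt_le_trans h; rewrite subr_gt0.
have psi1 u : DD u -> cmod (psi u) <= 1.
  by move=> Du; rewrite psiE -expR0 ler_expR oppr_le0; apply/F0/ND.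
have cr1 : cmod (1 - r%:C) = 1 - r.
  have -> : 1 - r%:C = (1 - r)%:C by rewrite rmorphB rmorph1.
  by rewrite cmod_real0 // subr_ge0 ltW.
have crp : cmod (1 + r%:C) = 1 + r.
  have -> : 1 + r%:C = (1 + r)%:C by rewrite rmorphD rmorph1.
  by rewrite cmod_real0 // addr_ge0.
have Ds : DD s by have [] := SX _ Ss.
have := @crossing _ psi k (J @` S) (J t0) (J s) Hpsi psi1
  (hol_image_connected HJ (fun u Su => (SX u Su).2) cS).
have c1 : J @` S `<=` DD by move=> _ [u /SX[_ Du] <-]; exact: JD.
have c2 : disk (-1) (1 / 5) (J t0).
  rewrite /disk /= /J mNr opprK.
  have -> : (conjc zeta * t0 - r%:C) / (1 - r%:C * (conjc zeta * t0)) + 1 =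
    (1 - r%:C) * (1 + conjc zeta * t0) / (1 - r%:C * (conjc zeta * t0)).
    by field; exact: den0.
  have a0 : 1 - cmod t0 <= cmod (1 - r%:C * (conjc zeta * t0)).
    have := cmod_sub_ge 1 (r%:C * (conjc zeta * t0)).
    rewrite cmod1 cmodM cz1 cmod_real0 //; apply: le_trans; rewrite lerD2l lerN2.
    by rewrite ler_piMl ?cmod_ge0 // ltW.
  have a1 : 0 < 1 - cmod t0 by rewrite subr_gt0.
  have a2 : cmod (1 + conjc zeta * t0) <= 2.
    by apply: le_trans (cmodD _ _) _; rewrite cmod1 cz1; move: t01; lra.
  rewrite cmodf cmodM cr1 ltr_pdivrMr; last exact: lt_le_trans a0.
  apply: (@le_lt_trans _ _ ((1 - r) * 2)).
    by rewrite ler_wpM2l // subr_ge0 ltW.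
  by move: r1 m2 a0 a1; clear; lra.
have c3 : disk 1 (1 / 5) (J s).
  rewrite /disk /= /J mNr.
  have -> : (conjc zeta * s - r%:C) / (1 - r%:C * (conjc zeta * s)) - 1 =
    (1 + r%:C) * (conjc zeta * (s - zeta)) / (1 - r%:C * (conjc zeta * s)).
    by rewrite mulrBr zC; field; exact: den0.
  have a0 := den s Ds; have a1 : 0 < 1 - r by rewrite subr_gt0.
  rewrite cmodf !cmodM cmod_conj zeta1 mul1r crp ltr_pdivrMr; last exact: lt_le_trans a0.
  apply: (@le_lt_trans _ _ (2 * cmod (s - zeta))).
    by rewrite ler_wpM2r ?cmod_ge0 //; move: r2; lra.
  by move: sz a0; clear; lra.
move=> /(_ c1 (ex_intro2 _ _ t0 St0 erefl) (ex_intro2 _ _ s Ss erefl) c2 c3) H.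
have {H} : cmod (psi 0) ^+ 2 <= 2 ^- k.
  apply: H => _ [u Su <-]; have [Xu Du] := SX u Su.
  have [far|near] := leP (1 / 5) (cmod (J u - (-1))); last exact: Or32.
  apply: Or31; rewrite psiE NJ //.
  have u1 : rho0 < cmod u.
    have E : u - zeta = (1 - r%:C) * (zeta * (J u - 1)) / (1 + r%:C * J u).
      have d0 : 1 + r%:C * J u != 0.
        have := @mob_den _ r%:C (J u) rC; rewrite conjcR; apply.
        by apply/ltW/unit_diskE/JD.
      by rewrite -{1}(NJ u Du) /N mr; field.
    have a1 : 1 / 10 <= cmod (1 + r%:C * J u).
      have -> : 1 + r%:C * J u = (J u - (-1)) - (1 - r%:C) * J u by ring.
      apply: le_trans (cmod_sub_ge _ _); rewrite cmodM cr1.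
      have : (1 - r) * cmod (J u) <= 1 - r.
        by rewrite ler_piMr ?subr_ge0 ?(ltW r2) //; apply/ltW/unit_diskE/JD.
      by move: far r1 m1; clear; lra.
    have a2 : cmod (u - zeta) <= 20 * (1 - r).
      rewrite E cmodf !cmodM zeta1 mul1r cr1 ler_pdivrMr; last first.
        by apply: lt_le_trans a1; rewrite divr_gt0.
      have a3 : cmod (J u - 1) <= 2.
        apply: le_trans (cmodB _ _) _; rewrite cmod1.
        by have /unit_diskE := JD u Du; lra.
      have a4 : 0 <= 1 - r by rewrite subr_ge0 ltW.
      apply: (@le_trans _ _ ((1 - r) * 2)); first exact: ler_wpM2l.
      by have := ler_wpM2l a4 a1; lra.
    have := cmod_le_subD zeta u; rewrite (cmodBC zeta) zeta1.
    by move: a2 r1 m3 rho01; clear; lra.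
  by rewrite -[ltRHS](@lnK _ (4 ^- k)) ?posrE // ltr_expR ltrNl; exact: H0.
rewrite psiE => h.
have N0 : N 0 = r%:C * zeta by rewrite /N mr mulr0 addr0 add0r divr1 mulrC.
rewrite N0 in h; have := le_lt_trans h kM.
by rewrite -expRM_natr ltr_expR; lra.
Qed.

Lemma approach_radial X t0 zeta : escapes_on V X -> DD t0 -> unit_circle zeta ->
  (forall e, 0 < e -> exists s S, [/\ connected S, S `<=` X `&` DD, S t0, S s & cmod (s - zeta) < e]) ->
  forall M, exists2 rho : R, rho < 1 & forall r, rho < r -> r < 1 -> M < V (r%:C * zeta).
Proof.
move=> good Dt0 zeta1 H M; have [rho rho1 K] := approach M good Dt0.
exists rho => // r r1 r2; have e0 : 0 < (1 - r) / 10 by rewrite divr_gt0 // subr_gt0.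
by have [s [S [cS SX St0 Ss sz]]] := H _ e0; exact: (K zeta r s S).
Qed.

(* The union of the convex hulls of [disk 0 (1 / 2)] and the points of [W]:
   star-shaped about every point of that disk. *)
Definition cones W : set R[i] :=
  [set w | exists t s, [/\ W t, 0 <= s <= 1 & cmod (w - s%:C * t) <= (1 - s) / 2]].

(** A point of a cone close to the circle is close to the apex [t] of that cone. There [approach]
    makes [V] large at a point of the radius through [t] whose distance to the circle is comparable,
    and Harnack's inequality transfers this to [w]. *)
Lemma cones_escape W t0 : connected W -> W `<=` DD -> W t0 -> escapes_on V W ->
  escapes_on V (cones W).
Proof.
move=> cW WD Wt0 good M.
have [k k0 Hk] := @harnack_comparable R 1 45 ltr01 (ltr0n _ _).
have [rho' rho'1 Ha] := approach (M / k) good (WD _ Wt0).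
pose m := Num.min (1 / 50) ((1 - rho') / 50).
have [m0 m1 m2] : [/\ 0 < m, m <= 1 / 50 & m <= (1 - rho') / 50].
  by rewrite /m lt_min !ge_min !lexx !orbT !divr_gt0 // subr_gt0.
clearbody m; exists (1 - m); first by rewrite ltrBlDr ltrDl.
move=> w Dw [t [s [Wt /andP[s0 s1] wst]]] wm.
pose d := 1 - cmod w.
have w1 : cmod w < 1 by apply/unit_diskE.
have d0 : 0 < d by rewrite subr_gt0.
have dm : d < m by move: wm; rewrite /d; lra.
have t1 : cmod t < 1 by apply/unit_diskE/WD.
have wst' : cmod w <= (1 - s) / 2 + s * cmod t.
  apply: le_trans (cmod_le_subD w (s%:C * t)) _.
  by rewrite [cmod (_ * _)]cmodM cmod_real0 // lerD2r.
have st : s * cmod t <= s by rewrite ler_piMr // ltW.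
have s2 : 1 - s <= 2 * d by move: wst' st; rewrite /d; lra.
have t2 : 1 - cmod t <= 2 * d.
  have h : s * (1 - cmod t) <= d by move: wst'; rewrite mulrBr mulr1 /d; lra.
  have h2 : 1 / 2 * (1 - cmod t) <= s * (1 - cmod t).
    by rewrite ler_wpM2r ?subr_ge0 ?(ltW t1) //; move: s2 dm m1; lra.
  by move: h h2; clear; lra.
have tpos : 0 < cmod t by move: t2 dm m1; lra.
pose tau := t / (cmod t)%:C.
have tC0 : (cmod t)%:C != 0 by rewrite realC_eq0 gt_eqF.
have tau1 : unit_circle tau.
  by rewrite /unit_circle /= /tau cmodf cmod_real0 ?(ltW tpos) // divff // gt_eqF.
have ttau : cmod (t - tau) = 1 - cmod t.
  have -> : t - tau = - ((1 - cmod t)%:C * tau) by rewrite /tau real1B; field.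
  by rewrite cmodN cmodM tau1 mulr1 cmod_real0 // subr_ge0 ltW.
(* [approach] asks for an apex within [(1 - r) / 10 = 4 * d] of the circle point [tau], and it is
   within [2 * d]. Then [45 = 40 + 2 + 3] bounds the distance from [w] to [r%:C * tau], in units of
   [d]. *)
pose r := 1 - 40 * d.
have r0 : 0 <= r by rewrite /r; move: dm m1; lra.
have r1 : r < 1 by rewrite /r; move: d0; lra.
have rt : cmod (r%:C * tau) = r by rewrite cmodM tau1 mulr1 cmod_real0.
have K : M / k < V (r%:C * tau).
  apply: (Ha tau r t W) => //.
  - by rewrite /r; move: dm m2; lra.
  - by move=> u Wu; split => //; exact: WD.
  - by rewrite ttau /r; move: t2 d0; lra.
have wz : cmod (w - r%:C * tau) <= 45 * d.
  have e1 : cmod (w - t) <= 3 * d.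
    have := cmod_triang w (s%:C * t) t.
    have -> : s%:C * t - t = - ((1 - s)%:C * t) by rewrite (real1B s) mulrBl mul1r opprB.
    rewrite cmodN cmodM cmod_real0 ?subr_ge0 //.
    have : (1 - s) * cmod t <= 1 - s by rewrite ler_piMr ?subr_ge0 // ltW.
    by move: wst s2; clear; lra.
  have e2 : cmod (tau - r%:C * tau) = 40 * d.
    have -> : tau - r%:C * tau = (1 - r)%:C * tau by rewrite (real1B r) mulrBl mul1r.
    by rewrite cmodM tau1 mulr1 cmod_real0 /r; move: d0; lra.
  have := cmod_triang w t (r%:C * tau); have := cmod_triang t tau (r%:C * tau).
  by move: e1 e2 ttau t2; clear; lra.
have := Hk F HF F0 (r%:C * tau) w d d0.
rewrite !mul1r rt => H; apply: lt_le_trans (H _ _ _ wz); last first.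
- by rewrite /r; move: d0; lra.
- by [].
- by rewrite /r; move: d0; lra.
by rewrite mulrC -ltr_pdivrMr.
Qed.

Definition gauge_set W w : set R := [set rho | 0 < rho /\ cones W (w / rho%:C)].
(** The Minkowski functional of [cones W]. *)
Definition gauge W w : R := inf (gauge_set W w).

Lemma gauge_set_has_inf W t0 w : W t0 -> has_inf (gauge_set W w).
Proof.
move=> Wt0; split; last by exists 0 => x [/ltW].
exists (2 * cmod w + 1); have p : 0 < 2 * cmod w + 1.
  by rewrite ltr_wpDl // mulr_ge0 ?cmod_ge0.
split=> //; exists t0, 0; split; rewrite ?lexx ?ler01 //.
rewrite mul0r subr0 cmodf cmod_real0 ?(ltW p) // ler_pdivrMr //; lra.
Qed.

Lemma cones_star W w s : W `<=` DD -> cones W w -> 0 <= s <= 1 -> cones W (s%:C * w).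
Proof.
move=> WD [t [u [Wt /andP[u0 u1] h]]] /andP[s0 s1]; exists t, (s * u); split => //.
  by rewrite mulr_ge0 //= mulr_ile1.
have -> : s%:C * w - (s * u)%:C * t = s%:C * (w - u%:C * t) by rewrite rmorphM /=; ring.
rewrite cmodM cmod_real0 //; apply: le_trans (ler_wpM2l s0 h) _; lra.
Qed.

Lemma gauge_le W w rho : gauge_set W w rho -> gauge W w <= rho.
Proof. by move=> h; apply: ge_inf => //; exists 0 => x [/ltW]. Qed.

Lemma gauge_lt W t0 w rho : W `<=` DD -> W t0 -> gauge W w < rho -> gauge_set W w rho.
Proof.
move=> WD Wt0 h; have e0 : 0 < rho - gauge W w by rewrite subr_gt0.
have [x [x0 cx] xl] := inf_adherent e0 (@gauge_set_has_inf W t0 w Wt0).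
rewrite -/(gauge W w) addrC subrK in xl.
have rho0 := lt_trans x0 xl; split => //.
have -> : w / rho%:C = (x / rho)%:C * (w / x%:C).
  by rewrite fmorph_div /=; field; rewrite !realC_eq0 !gt_eqF.
apply: cones_star => //; rewrite divr_ge0 ?(ltW x0) ?(ltW rho0) //=.
by rewrite ler_pdivrMr // mul1r ltW.
Qed.

(** A displacement of length [dl] is [2 * dl] times a point of the closed disk of radius 1/2, and
    every cone is convex and contains that disk; so it costs at most [2 * dl] in the gauge. *)
Lemma gauge_lipschitz W t0 w w' : W `<=` DD -> W t0 -> gauge W w' - gauge W w <= 2 * cmod (w' - w).
Proof.
move=> WD Wt0; rewrite lerBlDr; apply/ler_addgt0Pr => e e0.
have [rho0 [t [s [Wt /andP[s0 s1] h]]]] := gauge_lt WD Wt0 (ltr_pwDr e0 (lexx (gauge W w))).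
set rho := gauge W w + e in rho0 h; set dl := cmod (w' - w).
have dl0 : 0 <= dl by exact: cmod_ge0.
have -> : 2 * dl + gauge W w + e = rho + 2 * dl by rewrite /rho; ring.
apply: gauge_le; have p : 0 < rho + 2 * dl by rewrite ltr_pwDl // mulr_ge0.
split=> //; exists t, (rho * s / (rho + 2 * dl)); split => //.
  have rs := mulr_ge0 (ltW rho0) s0.
  rewrite divr_ge0 ?(ltW p) //= ler_pdivrMr // mul1r.
  by have := ler_piMr (ltW rho0) s1; lra.
have rC : rho%:C != 0 by rewrite realC_eq0 gt_eqF.
have pC : (rho + 2 * dl)%:C != 0 by rewrite realC_eq0 gt_eqF.
have -> : w' / (rho + 2 * dl)%:C - (rho * s / (rho + 2 * dl))%:C * t =
  (rho%:C * (w / rho%:C - s%:C * t) + (w' - w)) / (rho + 2 * dl)%:C.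
  rewrite fmorph_div (rmorphM _ rho s) /=; move: (rho%:C) rC ((rho + 2 * dl)%:C) pC => a a0 b b0.
  by field; rewrite a0 b0.
rewrite cmodf cmod_real0 ?(ltW p) // ler_pdivrMr //.
have -> : (1 - rho * s / (rho + 2 * dl)) / 2 * (rho + 2 * dl) = rho * ((1 - s) / 2) + dl.
  by field; rewrite gt_eqF.
apply: le_trans (cmodD _ _) _; rewrite cmodM cmod_real0 ?(ltW rho0) // lerD2r.
by rewrite ler_wpM2l // ltW.
Qed.

Lemma gauge_scale W t0 w s : W `<=` DD -> W t0 -> 0 < s -> gauge W (s%:C * w) = s * gauge W w.
Proof.
move=> WD Wt0.
have le1 v u : 0 < u -> gauge W (u%:C * v) <= u * gauge W v.
  move=> u0; apply/ler_addgt0Pr => e e0; have eu : 0 < e / u by rewrite divr_gt0.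
  have [x0 cx] := gauge_lt WD Wt0 (ltr_pwDr eu (lexx (gauge W v))).
  apply: gauge_le; have E : u * gauge W v + e = u * (gauge W v + e / u).
    by field; rewrite gt_eqF.
  rewrite E; split; first by rewrite mulr_gt0.
  move: (gauge W v + e / u) x0 cx => q q0.
  have -> // : u%:C * v / (u * q)%:C = v / q%:C.
  by rewrite rmorphM /=; field; rewrite !realC_eq0 !gt_eqF.
move=> s0; apply/le_anti; rewrite le1 //=.
have s'0 : 0 < s^-1 by rewrite invr_gt0.
have := le1 (s%:C * w) s^-1 s'0.
have -> : (s^-1)%:C * (s%:C * w) = w by rewrite mulrA -rmorphM /= mulVf ?gt_eqF // mul1r.
by rewrite mulrC ler_pdivlMr // mulrC.
Qed.

(** Openness leaves room to push [w] outward by a factor [1 + e] within [W]. *)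
Lemma gauge_lt1 W w : open W -> W `<=` DD -> W w -> gauge W w < 1.
Proof.
move=> /open_diskP oW WD Ww; have [d d0 dW] := oW w Ww.
pose e := d / (cmod w + 1).
have e0 : 0 < e by rewrite divr_gt0 // ltr_wpDl ?cmod_ge0.
have p : 0 < 1 + e by rewrite addr_gt0.
apply: (@le_lt_trans _ _ (1 + e)^-1); last by rewrite invf_lt1 // ltrDl.
apply: gauge_le; split; first by rewrite invr_gt0.
exists ((1 + e)%:C * w), 1; split; rewrite ?ler01 ?lexx //.
  apply: dW; rewrite /disk /=.
  have -> : (1 + e)%:C * w - w = e%:C * w by rewrite rmorphD rmorph1; ring.
  rewrite cmodM cmod_real0 ?(ltW e0) // /e mulrAC ltr_pdivrMr ?ltr_wpDl ?cmod_ge0 //.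
  by rewrite ltr_pM2l // ltrDl.
by rewrite fmorphV /= invrK mul1r [w * _]mulrC subrr cmod0 subrr mul0r.
Qed.

Lemma gauge_half W t0 w : W t0 -> cmod w <= 1 / 2 -> gauge W w <= 1.
Proof.
move=> Wt0 w2; apply: gauge_le; split => //; exists t0, 0; split; rewrite ?lexx ?ler01 //.
by rewrite mul0r subr0 rmorph1 divr1 subr0.
Qed.

(** The infimum in the gauge may not be attained, so a point with gauge at most 1 is first shrunk
    slightly into [cones W]. Continuity of [F] makes this cost less than 1, whence the bound [M + 1]
    for the cones. *)
Lemma gauge_escapes W t0 : connected W -> W `<=` DD -> W t0 -> escapes_on V W ->
  escapes_on V [set w | gauge W w <= 1].
Proof.
move=> cW WD Wt0 good M.
have [rho rho1 H] := cones_escape cW WD Wt0 good (M + 1).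
exists (Num.max rho 0); first by rewrite gt_max rho1 ltr01.
move=> w Dw gw; rewrite gt_max => /andP[wr w0].
have [d d0 dH] := hol_cont HF Dw (@ltr01 R).
pose e := Num.min d (cmod w - rho) / 2 / (cmod w + 1).
have q0 : 0 < cmod w + 1 by rewrite ltr_wpDl ?cmod_ge0.
have [e0 ed er] : [/\ 0 < e, e * (cmod w + 1) < d & e * (cmod w + 1) < cmod w - rho].
  rewrite /e divfK ?gt_eqF //.
  have mn : 0 < Num.min d (cmod w - rho) by rewrite lt_min d0 subr_gt0.
  have m1 : Num.min d (cmod w - rho) <= d by rewrite ge_min lexx.
  have m2 : Num.min d (cmod w - rho) <= cmod w - rho by rewrite ge_min lexx orbT.
  by rewrite !divr_gt0 //; split => //; lra.
clearbody e.
have p : 0 < 1 + e by rewrite addr_gt0.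
have ge : gauge W w < 1 + e by apply: le_lt_trans gw _; rewrite ltrDl.
have [_ cw] := gauge_lt WD Wt0 ge.
have pC : (1 + e)%:C != 0 by rewrite realC_eq0 gt_eqF.
have E : w / (1 + e)%:C - w = - (e%:C * w) / (1 + e)%:C.
  by move: pC; rewrite (_ : (1 + e)%:C = 1 + e%:C) ?rmorphD ?rmorph1 // => pC; field.
have near : cmod (w / (1 + e)%:C - w) <= e * cmod w.
  rewrite E cmodf cmodN cmodM !cmod_real0 ?(ltW e0) ?(ltW p) // ler_pdivrMr //.
  by rewrite ler_peMr ?mulr_ge0 ?cmod_ge0 ?(ltW e0) // lerDl ltW.
have ew : e * cmod w < e * (cmod w + 1) by rewrite ltr_pM2l // ltrDl.
have cm : cmod (w / (1 + e)%:C) = cmod w / (1 + e) by rewrite cmodf cmod_real0 // ltW.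
have D1 : DD (w / (1 + e)%:C).
  apply/unit_diskE; rewrite cm ltr_pdivrMr // mul1r.
  by move/unit_diskE: Dw; move: e0; lra.
have h1 : rho < cmod (w / (1 + e)%:C).
  have := cmod_le_subD w (w / (1 + e)%:C); rewrite (cmodBC w).
  by move: near ew er; clear; lra.
have h2 := H _ D1 cw h1.
have := dH (w / (1 + e)%:C) (lt_trans (le_lt_trans near ew) ed).
have := Re_le_cmod (F (w / (1 + e)%:C) - F w).
have -> : complex.Re (F (w / (1 + e)%:C) - F w) = V (w / (1 + e)%:C) - V w.
  by rewrite /=; case: (F _) (F w) => [? ?] [? ?].
by move: h2 => /=; lra.
Qed.

End Approach.

(** * Radial escape happens only on a null set *)

Section NullSet.
Context {R : realType}.
Implicit Types (z w zeta : R[i]) (r s t M : R) (F : R[i] -> R[i]).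

Local Notation DD := (@unit_disk R).
Local Notation mu := (@lebesgue_measure R).

Lemma Re_circle_integral F r : hol DD F -> 0 < r -> r < 1 ->
  (\int[mu]_(t in `[0%R, (2 * pi)%R]) (complex.Re (F (circ 0 r t)))%:E)%E =
     (complex.Re (F 0) * (2 * pi))%:E.
Proof.
move=> HF r0 r1.
have p0 : 0 < 2 * pi :> R by rewrite mulr_gt0 // pi_gt0.
have cD t : DD (circ 0 r t).
  by apply/unit_diskE; rewrite -[circ 0 r t]subr0 circ_dist // ltW.
have Fc t := hol_cont HF (cD t).
have E := cauchy_mean r0 r1 HF.
have cont (e : R -> R[i]) (a b : R) : (forall t, rccont e t) ->
    forall t, {for t, continuous (fun t => complex.Re (e t))}.
  move=> ec t; apply/cvgrPdist_lt => ep ep0; have [d d0 dH] := ec t ep ep0.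
  apply/nbhs_ballP; exists d => //= s; rewrite /ball /= distrC => /dH.
  apply: le_lt_trans; rewrite distrC; have := normRe_le (e s - e t).
  by case: (e s) (e t) => [? ?] [? ?].
(* A primitive on a larger interval, so that it is continuous from both sides at 0 and at
   [2 * pi]. *)
have [P HP] := @cint_prim_exists _ (fun t => F (circ 0 r t)) (- 1) (2 * pi + 1)
  (fun t _ => rccont_circ (Fc t)).
have HP' t : -1 <= t <= 2 * pi + 1 -> rcder P t (F (circ 0 r t)).
  by move=> h; apply: HP; rewrite betweenP //; move: p0; lra.
have HPre t : -1 <= t <= 2 * pi + 1 ->
    is_derive t (1 : R) (fun s => complex.Re (P s)) (complex.Re (F (circ 0 r t))).
  by move=> /HP' /rcder_is_derive[].
have E2 : P (2 * pi) - P 0 = F 0 * (2 * pi)%:C.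
  rewrite -E /circint (@cint_prim _ _ _ _ P) // => t; rewrite betweenP ?(ltW p0) // => /andP[? ?].
  by apply: HP'; apply/andP; split; lra.
have Pc t : -1 <= t <= 2 * pi + 1 -> {for t, continuous (fun s => complex.Re (P s))}.
  by move=> /HPre[/derivable1_diffP /differentiable_continuous].
rewrite (@continuous_FTC2 _ _ (fun s => complex.Re (P s)) _ _ p0).
- rewrite -EFinB; congr EFin.
  move: E2 => /(congr1 (@complex.Re R)).
  by case: (P _) (P 0) (F 0) => [a b] [c d] [x y] /= ->; ring.
- apply/continuous_subspaceT => t; apply: (cont (fun t => F (circ 0 r t)) 0 0) => s.
  exact: rccont_circ.
- split.
  + move=> t; rewrite in_itv /= => /andP[? ?].
    by have [] := HPre t; first by apply/andP; split; lra.
  + by apply: cvg_at_right_filter; apply: Pc; apply/andP; split; move: p0; lra.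
  + by apply: cvg_at_left_filter; apply: Pc; apply/andP; split; move: p0; lra.
- move=> t; rewrite in_itv /= => /andP[? ?]; rewrite derive1E.
  by have [] := HPre t; first by apply/andP; split; lra.
Qed.

(* Fatou's lemma: the circle means of [Re F] are all [Re (F 0)]. *)
Lemma escape_negligible F : hol DD F -> (forall z, DD z -> 0 <= complex.Re (F z)) ->
  circle_negligible [set zeta | forall M, exists2 rho : R, rho < 1 &
    forall r, rho < r -> r < 1 -> M < complex.Re (F (r%:C * zeta))].
Proof.
move=> HF F0.
(* With [n.+2] all radii are positive, including the one for [n = 0]. *)
pose rn (n : nat) : R := 1 - (n.+2%:R)^-1.
have rn0 n : 0 < rn n by rewrite subr_gt0 invf_lt1 // ltr1n.
have rn1 n : rn n < 1 by rewrite ltrBlDr ltrDl invr_gt0.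
pose D : set R := `[0, 2 * pi]%classic.
pose u (n : nat) (t : R) : \bar R := (complex.Re (F (circ 0 (rn n) t)))%:E.
have cD n t : DD (circ 0 (rn n) t).
  by apply/unit_diskE; rewrite -[circ 0 _ t]subr0 circ_dist // ltW.
have u0 n t : D t -> (0 <= u n t)%E by move=> _; rewrite lee_fin; exact: F0.
have mD : measurable D by exact: measurable_itv.
have mu_ n : measurable_fun D (u n).
  apply/measurable_EFinP; apply: measurable_funS (measurableT) _ _ => //.
  apply: continuous_measurable_fun => t; apply/cvgrPdist_lt => ep ep0.
  have [d d0 dH] := rccont_circ (hol_cont HF (cD n t)) ep0.
  apply/nbhs_ballP; exists d => //= s; rewrite /ball /= distrC => /dH.
  apply: le_lt_trans; rewrite distrC; have := normRe_le (F (circ 0 (rn n) s) - F (circ 0 (rn n) t)).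
  by case: (F _) (F (circ 0 (rn n) t)) => [? ?] [? ?].
pose h t := limn_einf (u^~ t).
have mh : measurable_fun D h.
  apply: (@emeasurable_fun_cvg _ _ _ _ (fun n t => einfs (u^~ t) n)).
    by move=> n; exact: measurable_fun_einfs.
  by move=> t _; rewrite /h limn_einf_lim; exact: is_cvg_einfs.
have h0 t : D t -> (0 <= h t)%E.
  move=> Dt; rewrite /h limn_einf_lim; apply: lime_ge; first exact: is_cvg_einfs.
  by apply: nearW => n; apply: le_ereal_inf_tmp => _ [m /= _ <-]; exact: u0.
have ih : mu.-integrable D h.
  apply/integrableP; split => //.
  have -> : (\int[mu]_(x in D) `|h x| = \int[mu]_(x in D) h x)%E.
    by apply: eq_integral => t /set_mem Dt; rewrite gee0_abs // h0.
  apply: (@le_lt_trans _ _ (complex.Re (F 0) * (2 * pi))%:E); last exact: ltry.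
  apply: le_trans (fatou mu mD mu_ u0) _.
  rewrite (_ : (fun n => _) = (fun=> (complex.Re (F 0) * (2 * pi))%:E)); last first.
    by apply/funext => n; exact: Re_circle_integral.
  have cst : ((fun=> (complex.Re (F 0) * (2 * pi))%:E) : nat -> \bar R) @ \oo -->
      (complex.Re (F 0) * (2 * pi))%:E by exact: cvg_cst.
  by rewrite is_cvg_limn_einfE ?(cvg_lim _ cst) //; apply/cvg_ex; eexists; exact: cst.
rewrite /circle_negligible; have mD' : @measurable _ (measurableTypeR R) D by exact: measurable_itv.
have /negligibleS := integrable_ae mD' ih; apply => t /= [tD H] /=.
have Dt : D t.
  by move: tD; rewrite /D /= !in_itv /= => /andP[-> /ltW].
move=> /(_ Dt); suff -> : h t = +oo%E by [].
rewrite /h is_cvg_limn_einfE; [apply/cvg_lim => //|apply/cvg_ex; exists +oo%E].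
all: apply/cvgeyPge => M; have [rho rho1 K] := H M;
  have e0 : 0 < 1 - rho by rewrite subr_gt0.
all: have : (fun n : nat => (n.+2%:R)^-1 : R) @ \oo --> (0 : R)
  by have := @cvg_harmonic R; rewrite -(cvg_shiftS).
all: move=> /cvgrPdist_lt /(_ _ e0); apply: filterS => n.
all: rewrite sub0r normrN ger0_norm ?invr_ge0 // => hn; rewrite lee_fin /circ add0r.
all: by apply/ltW/K => //; rewrite /rn ltrBrDr addrC -ltrBrDr.
Qed.

End NullSet.

(** * Reflection principle *)

Section ReflectBox.
Context {R : realType}.
Implicit Types (f g k F H : R[i] -> R[i]) (z w c a b : R[i]) (r s t M : R) (A : set R[i]).

Lemma le0_all_eps (x C : R) (d : R) : 0 < d -> (forall e, 0 < e -> e < d -> x <= C * e) -> x <= 0.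
Proof.
move=> d0 H; rewrite leNgt; apply/negP => x0.
pose e := Num.min (d / 2) (x / (2 * (`|C| + 1))).
have C1 : 0 < `|C| + 1 by rewrite ltr_wpDl.
have [e0 ed ex] : [/\ 0 < e, e < d & (`|C| + 1) * e <= x / 2].
  have m1 : e <= d / 2 by rewrite ge_min lexx.
  have m2 : e <= x / (2 * (`|C| + 1)) by rewrite ge_min lexx orbT.
  split; first by rewrite lt_min !divr_gt0 // mulr_gt0.
    by apply: le_lt_trans m1 _; lra.
  by move: m2; rewrite invfM mulrA ler_pdivlMr // mulrC.
have := H e e0 ed; have := ler_norm C.
move=> h1 h2; have := ler_wpM2r (ltW e0) h1; lra.
Qed.

Lemma rbd_shift f (s L d : R) x1 x2 y1 y2 : 0 < d ->
  (forall z, crect x1 x2 y1 y2 z -> ccont f z) ->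
  (forall z e, crect x1 x2 y1 y2 z -> 0 < e -> e < d -> exists l, cder f (z + Complex 0 (s * e)) l) ->
  (forall z e, crect x1 x2 y1 y2 z -> 0 < e -> e < d ->
     cmod (f z - f (z + Complex 0 (s * e))) <= L * e) -> rbd f x1 x2 y1 y2 = 0.
Proof.
move=> d0 fc fh fL; apply/eqP; rewrite -cmod_eq0; apply/eqP/le_anti; rewrite cmod_ge0 andbT.
apply: (@le0_all_eps _ (2 * L * (`|x2 - x1| + `|y2 - y1|)) d d0) => e e0 ed.
pose h z := f (z + Complex 0 (s * e)).
have hh z : crect x1 x2 y1 y2 z -> exists l, cder h z l.
  move=> zr; have [l fl] := fh z e zr e0 ed; exists l.
  have := cderD (cder_id z) (cder_cst (Complex 0 (s * e)) z); rewrite addr0 => sh.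
  by have := @cder_comp _ (fun w => w + Complex 0 (s * e)) f z 1 l fl sh; rewrite mulr1.
have := @rbd_dist _ f h x1 x2 y1 y2 (L * e) fc.
rewrite (goursat hh) subr0 => H; apply: le_trans (H _ _) _.
- by move=> z /hh[l /cder_cont].
- by move=> z zr; exact: fL.
by rewrite le_eqVlt; apply/orP; left; apply/eqP; ring.
Qed.

Lemma crect_le x1 x2 y1 y2 (a b c d : R) : x1 <= a <= x2 -> x1 <= b <= x2 -> y1 <= c <= y2 ->
  y1 <= d <= y2 -> crect a b c d `<=` crect x1 x2 y1 y2.
Proof.
move=> /andP[a1 a2] /andP[b1 b2] /andP[c1 c2] /andP[d1 d2] z [].
rewrite /crect /= /between !ge_min !le_max => /andP[zx1 zx2] /andP[zy1 zy2].
have [le1 le2] : x1 <= complex.Re z /\ complex.Re z <= x2.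
  by split; [case/orP: zx1|case/orP: zx2] => h; lra.
have [le3 le4] : y1 <= complex.Im z /\ complex.Im z <= y2.
  by split; [case/orP: zy1|case/orP: zy2] => h; lra.
by rewrite le1 le2 le3 le4 !orbT.
Qed.

(* Morera: translating a rectangle off the axis changes the integral by [O(e)]. *)
Lemma hol_across_axis f (b L : R) : 0 < b ->
  (forall z, disk 0 b z -> ccont f z) ->
  (forall z, disk 0 (2 * b) z -> complex.Im z != 0 -> exists l, cder f z l) ->
  (forall z e, disk 0 b z -> 0 <= complex.Im z -> 0 < e -> e < b ->
     cmod (f z - f (z + Complex 0 e)) <= L * e) ->
  (forall z e, disk 0 b z -> complex.Im z <= 0 -> 0 < e -> e < b ->
     cmod (f z - f (z + Complex 0 (- e))) <= L * e) ->
  hol (disk 0 b) f.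
Proof.
move=> b0 fc fh fU fD.
have inD z (e : R) : disk 0 b z -> `|e| < b -> disk 0 (2 * b) (z + Complex 0 e).
  rewrite /disk /= !subr0 => h1 h2; apply: le_lt_trans (cmodD _ _) _.
  have : cmod (Complex 0 e) = `|e| by rewrite cmodE /= expr0n add0r sqrtr_sqr.
  by move=> ->; lra.
have ImD z (e : R) : complex.Im (z + Complex 0 e) = complex.Im z + e by case: z.
have up x1 x2 y1 y2 : crect x1 x2 y1 y2 `<=` disk 0 b -> 0 <= y1 -> 0 <= y2 -> rbd f x1 x2 y1 y2 = 0.
  move=> sD h1 h2.
  have im0 z : crect x1 x2 y1 y2 z -> 0 <= complex.Im z.
    by move=> [_] /andP[+ _]; rewrite ge_min => /orP[] h; [exact: le_trans h1 h|exact: le_trans h2 h].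
  apply: (@rbd_shift _ 1 L b) => // [z /sD/fc //|z e zr e0 eb|z e zr e0 eb].
    apply: fh; first by apply: inD; [exact: sD|rewrite mul1r gtr0_norm].
    by rewrite ImD mul1r gt_eqF // ltr_wpDl // im0.
  by rewrite mul1r; apply: fU => //; [exact: sD|exact: im0].
have dn x1 x2 y1 y2 : crect x1 x2 y1 y2 `<=` disk 0 b -> y1 <= 0 -> y2 <= 0 -> rbd f x1 x2 y1 y2 = 0.
  move=> sD h1 h2.
  have im0 z : crect x1 x2 y1 y2 z -> complex.Im z <= 0.
    by move=> [_] /andP[_]; rewrite le_max => /orP[] h; [exact: le_trans h h1|exact: le_trans h h2].
  apply: (@rbd_shift _ (-1) L b) => // [z /sD/fc //|z e zr e0 eb|z e zr e0 eb].
    apply: fh; first by apply: inD; [exact: sD|rewrite mulN1r normrN gtr0_norm].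
    by rewrite ImD mulN1r lt_eqF //; have := im0 z zr; lra.
  by rewrite mulN1r; apply: fD => //; [exact: sD|exact: im0].
have all0 x1 x2 y1 y2 : x1 <= x2 -> y1 <= y2 -> crect x1 x2 y1 y2 `<=` disk 0 b -> rbd f x1 x2 y1 y2 = 0.
  move=> x12 y12 sD; have [y10|y10] := leP 0 y1; first by apply: up => //; exact: le_trans y12.
  have [y20|y20] := leP y2 0; first by apply: dn => //; exact: ltW.
  have xx : x1 <= x1 <= x2 by rewrite lexx.
  have xx2 : x1 <= x2 <= x2 by rewrite lexx x12.
  have yy : y1 <= 0 <= y2 by rewrite !ltW.
  have yy1 : y1 <= y1 <= y2 by rewrite lexx.
  have yy2 : y1 <= y2 <= y2 by rewrite lexx y12.
  (* Only the cut along the axis is wanted: the vertical cut is placed at [x1], so that two of the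
     four rectangles are degenerate. *)
  rewrite (@rbd_quarter _ f x1 x1 x2 y1 0 y2) => // [|z /sD/fc //].
  have S (p q p' q' : R) h1 h2 h3 h4 := subset_trans (@crect_le x1 x2 y1 y2 p q p' q' h1 h2 h3 h4) sD.
  rewrite (dn _ _ _ _ (S _ _ _ _ xx xx yy1 yy)) ?(ltW y10) ?lexx //.
  rewrite (dn _ _ _ _ (S _ _ _ _ xx xx2 yy1 yy)) ?(ltW y10) ?lexx //.
  rewrite (up _ _ _ _ (S _ _ _ _ xx xx yy yy2)) ?(ltW y20) ?lexx //.
  by rewrite (up _ _ _ _ (S _ _ _ _ xx xx2 yy yy2)) ?(ltW y20) ?lexx // !addr0.
have [P HP] : exists P : R[i] -> R[i], forall z, disk 0 b z -> cder P z (f z).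
  apply: (@morera_boxed _ _ _ 0) => //; [exact: disk_open|exact: boxed_disk|].
  move=> x1 x2 y1 y2.
  wlog x12 : x1 x2 / x1 <= x2 => [W H|].
    case: (leP x1 x2) => [/W|/ltW /W W']; first exact.
    rewrite rbd_swapx W' ?oppr0 // => z [zx zy]; apply: H; split => //.
    by rewrite betweenC.
  wlog y12 : y1 y2 / y1 <= y2 => [W H|].
    case: (leP y1 y2) => [/W|/ltW /W W']; first exact.
    rewrite rbd_swapy W' ?oppr0 // => z [zx zy]; apply: H; split => //.
    by rewrite betweenC.
  exact: all0.
apply: (@hol_ext _ _ (dv P)); first exact: disk_open.
  by move=> z /HP /dvE.
by apply: dv_hol; [exact: disk_open|move=> z /HP; eexists; eassumption].
Qed.

End ReflectBox.

(** * Boundary estimates in a half-disk *)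

Section HalfDisk.
Context {R : realType}.
Implicit Types (z w u p : R[i]) (x y e d L : R).

Definition hdisk (a : R) : set R[i] := [set w | disk 0 a w /\ 0 < complex.Im w].

Lemma hdisk_open a : open (hdisk a).
Proof.
apply/open_diskP => w [wa w0]; exists (Num.min (a - cmod w) (complex.Im w)).
  by rewrite lt_min w0 andbT subr_gt0; move: wa; rewrite /disk /= subr0.
move=> u; rewrite /disk /= lt_min => /andP[u1 u2]; split.
  by rewrite /disk /= subr0; have := cmod_le_subD u w; move: u1; lra.
have := normIm_le (u - w); have := ler_norm (- complex.Im (u - w)); rewrite normrN.
have -> : complex.Im (u - w) = complex.Im u - complex.Im w by case: (u) (w) => [? ?] [? ?].
by move: u2; lra.
Qed.

Lemma expR_le1D (e : R) : 0 < e -> exists2 d, 0 < d & forall t, t <= d -> expR t <= 1 + e.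
Proof.
move=> e0; exists (ln (1 + e)); first by rewrite ln_gt0 // ltrDl.
by move=> t td; rewrite -[leRHS](@lnK _ (1 + e)) ?ler_expR // posrE addr_gt0.
Qed.

Lemma cder_le (f : R[i] -> R[i]) z l L d : 0 < d -> cder f z l ->
  (forall u, disk z d u -> cmod (f u - f z) <= L * cmod (u - z)) -> cmod l <= L.
Proof.
move=> d0 fl fL; apply/ler_addgt0Pr => e e0; have [d1 d10 dH] := fl e e0.
pose t := Num.min d d1 / 2.
have [t0 td td1] : [/\ 0 < t, t < d & t < d1].
  have m0 : 0 < Num.min d d1 by rewrite lt_min d0.
  have m1 : Num.min d d1 <= d by rewrite ge_min lexx.
  have m2 : Num.min d d1 <= d1 by rewrite ge_min lexx orbT.
  by rewrite /t; split; lra.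
clearbody t; have tE : z + t%:C - z = t%:C by rewrite addrC addKr.
have ct : cmod (z + t%:C - z) = t by rewrite tE cmod_real0 // ltW.
have := dH (z + t%:C); rewrite ct => /(_ td1) h1.
have := fL (z + t%:C); rewrite /disk /= ct => /(_ td) h2.
have := cmod_le_subD (l * (z + t%:C - z)) (f (z + t%:C) - f z).
rewrite cmodM ct cmodBC => h3; rewrite -(ler_pM2r t0); lra.
Qed.

(** Schwarz's lemma for [k], rescaled to the unit disk and followed by the automorphism that sends
    [k w] to 0. Staying in half the radius lets the hyperbolic bound become a Euclidean one, linear
    in [1 - cmod (k w)]. *)
Lemma schwarz_pick_local k w y : 0 < y -> hol (disk w y) k -> (forall u, disk w y u -> cmod (k u) < 1) ->
  forall u, cmod (u - w) <= y / 2 -> cmod (k u - k w) <= 4 * ((1 - cmod (k w)) / y) * cmod (u - w).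
Proof.
move=> y0 Hk k1 u uw.
have kw1 : cmod (- k w) < 1 by rewrite cmodN; apply: k1; exact: disk_center.
pose A t := w + y%:C * t.
have AD t : @unit_disk R t -> disk w y (A t).
  move=> /unit_diskE t1; rewrite /disk /A /= addrC addKr cmodM cmod_real0 ?(ltW y0) //.
  by rewrite gtr_pMr.
pose j t := mob (- k w) (k (A t)).
have Hj : hol (@unit_disk R) j.
  apply: (@hol_comp _ _ (@unit_disk R) (fun t => k (A t)) (mob (- k w))).
  - apply: (@hol_comp _ _ (disk w y) A k) => //.
    by apply: holD; [exact: hol_cst|apply: holM; [exact: hol_cst|exact: hol_id]].
  - exact: hol_mob.
  - by move=> t /AD/k1/unit_diskE.
have j1 t : @unit_disk R t -> cmod (j t) <= 1.
  by move=> /AD/k1 h; apply/ltW/mob_disk.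
have j0 : j 0 = 0 by rewrite /j /A mulr0 addr0 /mob addrN mul0r.
have yC : y%:C != 0 by rewrite realC_eq0 gt_eqF.
pose t := (u - w) / y%:C.
have tE : A t = u by rewrite /A /t mulrC divfK // addrC subrK.
have tc : cmod t = cmod (u - w) / y by rewrite /t cmodf cmod_real0 // ltW.
have t1 : @unit_disk R t.
  by apply/unit_diskE; rewrite tc ltr_pdivrMr // mul1r; move: uw; lra.
have := schwarz Hj j1 j0 t1; rewrite /j tE tc /mob cmodf conjcN mulNr.
have den : cmod (1 - conjc (k w) * k u) <= 2 * (1 - cmod (k w)) + cmod (k u - k w).
  have -> : 1 - conjc (k w) * k u = (1 - cmod (k w) ^+ 2)%:C - conjc (k w) * (k u - k w).
    have -> : (1 - cmod (k w) ^+ 2)%:C = 1 - k w * conjc (k w).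
      by rewrite conjcM_cmod rmorphB rmorph1.
    by ring.
  apply: le_trans (cmodB _ _) _; rewrite cmodM cmod_conj cmodN in kw1 *.
  have c0 := cmod_ge0 (k w).
  rewrite cmod_real0; last by rewrite subr_ge0 expr_le1 // ltW.
  have h1 : cmod (k w) * cmod (k u - k w) <= cmod (k u - k w) by rewrite ler_piMl ?cmod_ge0 // ltW.
  have h2 : 1 - cmod (k w) ^+ 2 <= 2 * (1 - cmod (k w)).
    by have := sqr_ge0 (1 - cmod (k w)); rewrite sqrrB expr1n mul1r; lra.
  lra.
have den0 : 0 < cmod (1 - conjc (k w) * k u).
  have := mob_den kw1 (ltW (k1 u _)); rewrite conjcN mulNr cmod_gt0; apply.
  by rewrite -tE; exact: AD.
rewrite ler_pdivrMr // => h; move: den uw h.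
move: (cmod (k u - k w)) (cmod_ge0 (k u - k w)) (cmod _) den0 (cmod (u - w)) (cmod_ge0 (u - w)).
move: (cmod (k w)) => q D D0 E E0 s s0 dE sy h.
have h1 : D * y <= s * E.
  by have := ler_wpM2r (ltW y0) h; rewrite mulrAC divfK ?gt_eqF.
have h2 : s * E <= s * (2 * (1 - q) + D) by rewrite ler_wpM2l.
have h3 : s * D <= y / 2 * D by rewrite ler_wpM2r.
rewrite -(ler_pM2r y0); have -> : 4 * ((1 - q) / y) * s * y = 4 * (1 - q) * s by field; rewrite gt_eqF.
have h4 : D * y <= s * (2 * (1 - q)) + y / 2 * D by apply: (le_trans h1); apply: (le_trans h2); rewrite mulrDr; lra.
lra.
Qed.

Section Barrier.
Context (a : R) (a0 : 0 < a) (k F : R[i] -> R[i]).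
Hypotheses (Hk : hol (hdisk a) k) (HF : hol (hdisk a) F).
Hypothesis F0 : forall w, hdisk a w -> 0 <= complex.Re (F w).
Hypothesis k2 : forall w, hdisk a w -> 1 / 2 < cmod (k w).
Hypothesis k1 : forall w, hdisk a w -> cmod (k w) < 1.
(** A substitute for [cmod (k w)] tending to 1 at the axis: an exception is tolerated where the real
    part of [F] is large, at a price that can be made arbitrarily cheap through [e]. *)
Hypothesis weak : forall e, 0 < e -> exists2 d, 0 < d & forall w, hdisk a w ->
  complex.Im w < d -> (cmod (k w))^-1 <= expR (e * (1 + complex.Re (F w))).

(* Maximum principle on a rectangle of size [rho] above [Re w] for [1 / k] damped by
   the barrier [Re ((u - x)^2 / rho^2 - 3 i (u - x) / rho)], which is at least 1 on the
   sides and the top and at least 0 on the base. *)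
Lemma half_bound w : hdisk (a / 4) w -> expR (- (12 / a) * complex.Im w) <= cmod (k w).
Proof.
move=> [wa w0]; rewrite /disk /= subr0 in wa.
pose x := complex.Re w; pose rho := a / 4; have rho0 : 0 < rho by rewrite divr_gt0.
have xa : `|x| < a / 4 by apply: le_lt_trans wa; exact: normRe_le.
have wrho : complex.Im w < rho by apply: le_lt_trans (Im_le_cmod w) wa.
pose B : set R[i] := [set u | [/\ `|complex.Re u - x| < rho, 0 < complex.Im u & complex.Im u < rho]].
have Bw : B w by rewrite /B /= /x subrr normr0.
have BH u : B u -> hdisk a u.
  move=> [u1 u2 u3]; split=> //; rewrite /disk /= subr0.
  apply: le_lt_trans (cmod_le_add u) _; rewrite (gtr0_norm u2).
  have := ler_normD (complex.Re u - x) x; rewrite subrK.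
  by move: u1 u3 xa; rewrite /rho; lra.
have ReB (v u : R[i]) : complex.Re (v - u) = complex.Re v - complex.Re u by case: v u => [? ?] [? ?].
have ImB (v u : R[i]) : complex.Im (v - u) = complex.Im v - complex.Im u by case: v u => [? ?] [? ?].
have dx v u : complex.Re v - complex.Re u <= cmod (v - u) /\ complex.Re u - complex.Re v <= cmod (v - u).
  have := normRe_le (v - u); rewrite ReB; have := ler_norm (complex.Re v - complex.Re u).
  by have := ler_norm (- (complex.Re v - complex.Re u)); rewrite normrN; split; lra.
have dy v u : complex.Im v - complex.Im u <= cmod (v - u) /\ complex.Im u - complex.Im v <= cmod (v - u).
  have := normIm_le (v - u); rewrite ImB; have := ler_norm (complex.Im v - complex.Im u).
  by have := ler_norm (- (complex.Im v - complex.Im u)); rewrite normrN; split; lra.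
have oB : open B.
  apply/open_diskP => u [u1 u2 u3].
  pose m := Num.min (rho - `|complex.Re u - x|) (Num.min (complex.Im u) (rho - complex.Im u)).
  exists m; first by rewrite /m !lt_min u2 !subr_gt0 u1.
  move=> v; rewrite /disk /= /m !lt_min => /and3P[v1 v2 v3].
  have [dx1 dx2] := dx v u; have [dy1 dy2] := dy v u; split.
  - apply: le_lt_trans (_ : cmod (v - u) + `|complex.Re u - x| < _); last by move: v1; lra.
    have := ler_normD (complex.Re v - complex.Re u) (complex.Re u - x); rewrite addrA subrK.
    by have := normRe_le (v - u); rewrite ReB; lra.
  - by move: v2; lra.
  - by move: v3; lra.
pose be u := ((complex.Re u - x) ^+ 2 - complex.Im u ^+ 2) / rho ^+ 2 + 3 * complex.Im u / rho.
pose bar u := (u - x%:C) ^+ 2 * (rho ^- 2)%:C - Complex 0 (3 / rho) * (u - x%:C).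
have Rebar u : complex.Re (bar u) = be u.
  by rewrite /bar /be; case: u => p q /=; rewrite expr2 /=; field; rewrite gt_eqF.
have Hbar (A : set R[i]) : hol A bar.
  apply: holB; apply: holM; first apply: holX; try exact: hol_cst.
    by apply: holB; [exact: hol_id|exact: hol_cst].
  by apply: holB; [exact: hol_id|exact: hol_cst].
have k0 u : B u -> 0 < cmod (k u) by move=> /BH/k2; apply: lt_trans; lra.
(* The damping factor has two parts: the barrier handles the sides and the top of [B], and
   [e%:C * (1 + F)] handles the base, through [weak]. *)
have main e : 0 < e -> (cmod (k w))^-1 <= expR (be w + e * (1 + complex.Re (F w))).
  move=> e0.
  pose j u := (k u)^-1 * cexp (- bar u - e%:C * (1 + F u)).
  have jE u : cmod (j u) = (cmod (k u))^-1 * expR (- be u - e * (1 + complex.Re (F u))).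
    rewrite /j cmodM cmodV cmod_cexp -Rebar; congr (_ * expR _).
    by case: (bar u) (F u) => [? ?] [? ?] /=; ring.
  have Hj : hol B j.
    apply: holM; first by apply: holV; [exact: hol_sub Hk|move=> u /k0; rewrite cmod_gt0].
    apply: hol_cexp; apply: holB; first exact/holN/Hbar.
    by apply: holM; [exact: hol_cst|apply: holD; [exact: hol_cst|exact: hol_sub HF]].
  have j1 u : B u -> cmod (j u) <= expR (1 - be u).
    move=> Bu; rewrite jE; apply: le_trans (_ : expR 1 * expR (- be u) <= _); last by rewrite -expRD.
    apply: ler_pM; rewrite ?invr_ge0 ?cmod_ge0 ?expR_ge0 //.
      apply: le_trans (expR_ge1Dx (1 : R)).
      by rewrite -(ler_pM2r (k0 u Bu)) mulVf ?gt_eqF ?k0 //; have := k2 (BH u Bu); lra.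
    rewrite ler_expR gerBl mulr_ge0 ?(ltW e0) //.
    by have := F0 (BH u Bu); lra.
  have be0 u : B u -> 0 <= be u - (complex.Re u - x) ^+ 2 / rho ^+ 2 - 2 * complex.Im u / rho.
    move=> [_ u2 u3]; have -> : be u - (complex.Re u - x) ^+ 2 / rho ^+ 2 - 2 * complex.Im u / rho =
      complex.Im u * (rho - complex.Im u) / rho ^+ 2 by rewrite /be; field; rewrite gt_eqF.
    by rewrite divr_ge0 ?mulr_ge0 ?sqr_ge0 // ?subr_ge0 ltW.
  have jb : forall z, closure B z -> ~ B z -> forall e', 0 < e' -> exists2 d, 0 < d &
     forall u, B u -> disk z d u -> cmod (j u) <= 1 + e'.
    move=> z /closure_diskP cz nBz e' e'0.
    have [t t0 tH] := expR_le1D e'0.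
    (* Within [m] of the sides or the top the barrier is at least [1 - t], so [cmod (j u)] is at
       most [expR t], hence at most [1 + e']. *)
    pose m := t * rho / 2; have m0 : 0 < m by rewrite !divr_gt0 // mulr_gt0.
    have zx : `|complex.Re z - x| <= rho.
      apply/ler_addgt0Pr => s s0; have [u [u1 _ _] uz] := cz s s0.
      have := ler_normD (complex.Re z - complex.Re u) (complex.Re u - x); rewrite addrA subrK.
      by have := normRe_le (u - z); rewrite ReB distrC; move: uz; rewrite /disk /=; lra.
    have zy0 : 0 <= complex.Im z.
      rewrite -oppr_le0; apply/ler_addgt0Pr => s s0; have [u [_ u2 _] uz] := cz s s0.
      by have [_ +] := dy u z; have [+ _] := dy u z; move: uz; rewrite /disk /=; lra.
    have zy1 : complex.Im z <= rho.
      apply/ler_addgt0Pr => s s0; have [u [_ _ u3] uz] := cz s s0.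
      by have [_ +] := dy u z; move: uz; rewrite /disk /=; lra.
    have far u : B u -> rho - m <= `|complex.Re u - x| \/ rho - m <= complex.Im u -> cmod (j u) <= 1 + e'.
      move=> Bu far; apply: le_trans (j1 u Bu) _; apply: tH.
      have := be0 u Bu; have [u1 u2 u3] := Bu.
      have X0 : 0 <= (complex.Re u - x) ^+ 2 / rho ^+ 2 by rewrite divr_ge0 ?sqr_ge0.
      have Y0 : 0 <= 2 * complex.Im u / rho by apply: divr_ge0; [apply: mulr_ge0 => //|]; exact: ltW.
      case: far => far.
        have : 1 - t <= (complex.Re u - x) ^+ 2 / rho ^+ 2.
          rewrite ler_pdivlMr ?exprn_gt0 // -(real_normK (num_real (complex.Re u - x))).
          have : 2 * (rho * `|complex.Re u - x|) <= rho ^+ 2 + `|complex.Re u - x| ^+ 2.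
            by have := sqr_ge0 (rho - `|complex.Re u - x|); rewrite sqrrB; lra.
          have := ler_wpM2l (ltW rho0) far; rewrite mulrBr /m.
          have -> : (1 - t) * rho ^+ 2 = rho * rho - 2 * (rho * (t * rho / 2)) by field.
          by rewrite expr2; lra.
        lra.
      have : 2 - t <= 2 * complex.Im u / rho.
        by rewrite ler_pdivlMr //; move: far; rewrite /m; lra.
      lra.
    (* A boundary point lies on a side, on the top or on the base; [weak] is used only on the
       base. *)
    have [zx1|zx1] := eqVneq `|complex.Re z - x| rho.
      exists m => // u Bu uz; apply: far => //; left.
      have := ler_normD (complex.Re z - complex.Re u) (complex.Re u - x); rewrite addrA subrK zx1.
      by have := normRe_le (u - z); rewrite ReB distrC; move: uz; rewrite /disk /=; lra.
    have [zy2|zy2] := eqVneq (complex.Im z) rho.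
      exists m => // u Bu uz; apply: far => //; right.
      by have [_ +] := dy u z; move: uz; rewrite /disk /=; lra.
    have zy : complex.Im z = 0.
      apply/eqP; rewrite eq_sym; apply/negPn/negP => zy3; apply: nBz.
      by split; rewrite lt_neqAle ?zx1 ?zy2 ?zy3.
    have [d d0 dH] := weak e0.
    exists d => // u Bu; rewrite /disk /= => uz; have Hu := BH u Bu.
    have ud : complex.Im u < d by have [+ _] := dy u z; rewrite zy subr0; lra.
    rewrite jE; apply: le_trans (_ : 1 <= _); last by rewrite lerDl ltW.
    apply: le_trans (ler_wpM2r (expR_ge0 _) (dH u Hu ud)) _.
    rewrite -expRD -expR0 ler_expR.
    have X0 : 0 <= (complex.Re u - x) ^+ 2 / rho ^+ 2 by rewrite divr_ge0 ?sqr_ge0.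
    have Y0 : 0 <= 2 * complex.Im u / rho.
      by have [_ u2 _] := Bu; apply: divr_ge0; [apply: mulr_ge0 => //|]; exact: ltW.
    by have := be0 u Bu; lra.
  have Bb : B `<=` cdisk 0 a by move=> u /BH[+ _]; rewrite /disk /cdisk /= subr0 => /ltW.
  have := max_principle oB Bb Hj jb Bw; rewrite jE => h.
  rewrite -(ler_pM2r (expR_gt0 (- (be w + e * (1 + complex.Re (F w)))))) -expRD addrN expR0.
  by rewrite opprD.
(* Above its centre [x] the barrier is at most its linear part, of slope [3 / rho = 12 / a]. *)
have bew : be w <= 12 / a * complex.Im w.
  have -> : 12 / a * complex.Im w = be w + complex.Im w ^+ 2 / rho ^+ 2.
    by rewrite /be /x /rho subrr expr0n /=; field; rewrite gt_eqF.
  by rewrite lerDl divr_ge0 ?sqr_ge0.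
have kw := k0 w Bw.
suff : ln (cmod (k w))^-1 - be w <= 0.
  rewrite lnV ?posrE // => h.
  by rewrite -[leRHS](lnK (_ : _ \in Num.pos)) ?posrE // ler_expR; lra.
(* [F w] is a fixed number, so letting [e] tend to 0 removes it from the bound. *)
apply: (@le0_all_eps _ _ (1 + complex.Re (F w)) 1 ltr01) => e e0 _.
have := main e e0; rewrite -[X in X <= _](lnK (_ : _ \in Num.pos)) ?posrE ?invr_gt0 // ler_expR.
by lra.
Qed.

End Barrier.
End HalfDisk.

(** * Reflection across the real axis *)

Section ReflectHalfDisk.
Context {R : realType}.
Implicit Types (z w u p : R[i]) (x y e d L b : R).

Lemma ReB (v u : R[i]) : complex.Re (v - u) = complex.Re v - complex.Re u.
Proof. by case: v u => [? ?] [? ?]. Qed.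

Lemma ImB (v u : R[i]) : complex.Im (v - u) = complex.Im v - complex.Im u.
Proof. by case: v u => [? ?] [? ?]. Qed.

Lemma ImC (z : R[i]) : complex.Im (conjc z) = - complex.Im z.
Proof. by case: z. Qed.

Lemma conjcB (z w : R[i]) : conjc (z - w) = conjc z - conjc w.
Proof. by case: z w => [? ?] [? ?]; apply/eqP; rewrite eq_complex /= opprD !eqxx. Qed.

Lemma cmod_Im (y : R) : 0 <= y -> cmod (Complex 0 y) = y.
Proof. by move=> y0; rewrite cmodE /= expr0n add0r sqrtr_sqr ger0_norm. Qed.

Lemma hdisk_cseg b u w t : hdisk b u -> hdisk b w -> 0 <= t <= 1 -> hdisk b (cseg u w t).
Proof.
move=> [ub u0] [wb w0] t01; split; first exact: disk_cseg.
have -> : complex.Im (cseg u w t) = (1 - t) * complex.Im u + t * complex.Im w.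
  by rewrite /cseg; case: (u) (w) => [? ?] [? ?] /=; ring.
have [/andP[t0 t1]] := t01; have [->|t1'] := eqVneq t 1; first by rewrite subrr mul0r add0r mul1r.
by rewrite ltr_pwDl ?mulr_ge0 ?(ltW w0) // mulr_gt0 // subr_gt0 lt_neqAle t1'.
Qed.

Section Extension.
Context (b L : R) (b0 : 0 < b) (L0 : 0 <= L) (k : R[i] -> R[i]).
Hypothesis k1 : forall w, hdisk b w -> cmod (k w) < 1.
Hypothesis kL : forall u w, hdisk b u -> hdisk b w -> cmod (k u - k w) <= L * cmod (u - w).

Let above x : disk 0 b x%:C -> exists2 d, 0 < d & forall s, 0 < s -> s < d -> hdisk b (x%:C + Complex 0 s).
Proof.
rewrite /disk /= subr0 => xb; exists (b - cmod x%:C); first by rewrite subr_gt0.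
move=> s s0 sd; split; last by rewrite /= add0r.
rewrite /disk /= subr0; apply: le_lt_trans (cmodD _ _) _; rewrite (cmod_Im (ltW s0)).
by move: sd; lra.
Qed.

(** A cluster value of [k] along a vertical sequence; the Lipschitz bound makes it the limit from
    all directions. *)
Let axis_limit x : disk 0 b x%:C -> exists l, forall w, hdisk b w -> cmod (k w - l) <= L * cmod (w - x%:C).
Proof.
move=> xb; have [d d0 dH] := above xb.
pose v (n : nat) := x%:C + Complex 0 (d / 2 * 2 ^- n).
have vs n : [/\ 0 < d / 2 * 2 ^- n & d / 2 * 2 ^- n < d].
  have p : 0 < (2 ^- n : R) by rewrite invr_gt0 exprn_gt0.
  split; first by rewrite mulr_gt0 // divr_gt0.
  have p1 : (2 ^- n : R) <= 1 by rewrite invf_le1 ?exprn_gt0 // exprn_ege1 // ler1n.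
  have := ler_wpM2l (ltW d0) p1; lra.
have vH n : hdisk b (v n) by have [h1 h2] := vs n; exact: dH.
have vx n : cmod (v n - x%:C) = d / 2 * 2 ^- n.
  by rewrite /v addrC addKr cmod_Im //; have [/ltW] := vs n.
have [l lP] := @bounded_cluster _ (k \o v) 1 (fun n => ltW (k1 (vH n))).
exists l => w wb; apply/ler_addgt0Pr => e e0.
have e1 : 0 < e / 2 by rewrite divr_gt0.
have e2 : 0 < e / 2 / (L + 1) / (d / 2) by rewrite !divr_gt0 // ltr_wpDl.
have [N hN] := exists_geometric_lt e2; have [n Nn ln] := lP _ N e1.
have vn : L * cmod (v n - x%:C) <= e / 2.
  have h : d / 2 * 2 ^- n <= e / 2 / (L + 1).
    rewrite mulrC -ler_pdivlMr ?divr_gt0 //; apply: ltW; apply: le_lt_trans hN.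
    by rewrite lef_pV2 ?posrE ?exprn_gt0 // ler_eXn2l // ltr1n.
  rewrite vx; apply: le_trans (ler_wpM2l L0 h) _.
  rewrite mulrA ler_pdivrMr ?ltr_wpDl // mulrC ler_wpM2l ?ltW //; lra.
have h1 := cmod_triang (k w) (k (v n)) l.
have h2 := kL wb (vH n); have h3 := ler_wpM2l L0 (cmod_triang w x%:C (v n)).
move: ln; rewrite /disk /= => ln; rewrite (cmodBC x%:C) mulrDr in h3.
by move: h1 h2 h3 vn ln; clear; lra.
Qed.

Lemma half_extension : exists ku : R[i] -> R[i], (forall w, hdisk b w -> ku w = k w) /\
  forall z w, disk 0 b z -> disk 0 b w -> 0 <= complex.Im z -> 0 <= complex.Im w ->
    cmod (ku z - ku w) <= L * cmod (z - w).
Proof.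
have /choice[l lP] : forall x : R, exists l, disk 0 b x%:C ->
    forall w, hdisk b w -> cmod (k w - l) <= L * cmod (w - x%:C).
  move=> x; have [/axis_limit[l lP]|n] := pselect (disk 0 b x%:C); first by exists l.
  by exists 0.
pose ku z := if 0 < complex.Im z then k z else l (complex.Re z).
exists ku; split=> [w [_ w0]|]; first by rewrite /ku w0.
have real z : ~~ (0 < complex.Im z) -> 0 <= complex.Im z -> z = (complex.Re z)%:C.
  by case: z => x y /=; rewrite -leNgt => h1 h2; rewrite (le_anti (_ : y <= 0 <= y)) // h1.
have A z w : disk 0 b z -> 0 <= complex.Im z -> hdisk b w -> cmod (k w - ku z) <= L * cmod (w - z).
  rewrite /ku => zb z0 wb; case: ifPn => [z1|z1]; first exact: kL.
  by rewrite {2}(real z z1 z0); apply: lP => //; rewrite -real.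
move=> z w zb wb z0 w0.
have [w1|w1] := boolP (0 < complex.Im w).
  by rewrite cmodBC (cmodBC z) {1}/ku w1; apply: A.
apply/ler_addgt0Pr => e e0; have wE := real w w1 w0.
have [d d0 dH] : exists2 d, 0 < d & forall s, 0 < s -> s < d -> hdisk b (w + Complex 0 s).
  by rewrite wE; apply: above; rewrite -wE.
pose s := Num.min (d / 2) (e / (2 * (L + 1))).
have L1 : 0 < L + 1 by rewrite ltr_wpDl.
have [s0 sd se] : [/\ 0 < s, s < d & 2 * (L * s) <= e].
  have m1 : s <= d / 2 by rewrite ge_min lexx.
  have m2 : s <= e / (2 * (L + 1)) by rewrite ge_min lexx orbT.
  have s0 : 0 < s by rewrite lt_min !divr_gt0 // mulr_gt0.
  split=> //; first by apply: le_lt_trans m1 _; lra.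
  move: m2; rewrite ler_pdivlMr ?mulr_gt0 // mulrDr mulr1 => h.
  by apply: le_trans h; rewrite -subr_ge0; have := ltW s0; rewrite mulrDr mulrCA; lra.
have vb := dH s s0 sd; clearbody s.
have h1 := A _ _ zb z0 vb; have h2 := A _ _ wb w0 vb.
have vw : cmod (w + Complex 0 s - w) = s by rewrite addrC addKr cmod_Im // ltW.
have h3 := cmod_triang (ku z) (k (w + Complex 0 s)) (ku w).
have h4 := ler_wpM2l L0 (cmod_triang (w + Complex 0 s) w z).
rewrite vw in h2 h4; rewrite (cmodBC w) mulrDr in h4; rewrite (cmodBC (ku z) (k _)) in h3.
by move: h1 h2 h3 h4 se; clear; lra.
Qed.

Hypothesis Hk : hol (hdisk b) k.
Hypothesis k2 : forall w, hdisk b w -> 1 / 2 < cmod (k w).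
Hypothesis kI : forall w, hdisk b w -> 1 - cmod (k w) <= L * complex.Im w.

(** The function glued from [k], its boundary values and its reflection is Lipschitz, and
    [hol_across_axis] asks for no more at the axis. Halving the radius leaves room for the vertical
    translations there. *)
Lemma reflect_hdisk : exists f, [/\ hol (disk 0 (b / 2)) f,
  forall z, disk 0 (b / 2) z -> 0 < complex.Im z -> f z = k z,
  forall z, disk 0 (b / 2) z -> complex.Im z = 0 -> cmod (f z) = 1 &
  forall z, disk 0 (b / 2) z -> complex.Im z < 0 -> f z = (conjc (k (conjc z)))^-1].
Proof.
have [ku [kuE kuL]] := half_extension.
have near x e : disk 0 b x%:C -> 0 < e -> exists w, [/\ hdisk b w, cmod (w - x%:C) = complex.Im w & complex.Im w < e].
  move=> /above[d d0 dH] e0; pose s := Num.min d e / 2.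
  have m0 : 0 < Num.min d e by rewrite lt_min d0.
  have m1 : Num.min d e <= d by rewrite ge_min lexx.
  have m2 : Num.min d e <= e by rewrite ge_min lexx orbT.
  have [s0 sd se] : [/\ 0 < s, s < d & s < e] by rewrite /s; split; lra.
  exists (x%:C + Complex 0 s); split; first exact: dH.
    by rewrite addrC addKr cmod_Im ?ltW //= add0r.
  by rewrite /= add0r.
have real z : complex.Im z = 0 -> z = (complex.Re z)%:C by case: z => x y /= ->.
have ku1 z : disk 0 b z -> complex.Im z = 0 -> cmod (ku z) = 1.
  move=> zb z0; have zr := real z z0; apply/eqP; rewrite eq_le; apply/andP; split.
    rewrite -subr_le0; apply: (@le0_all_eps _ _ L 1 ltr01) => e e0 _.
    have [w [wb wz we]] := near (complex.Re z) e (eq_ind _ _ zb _ zr) e0; rewrite -zr in wz.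
    have h1 := kuL z w zb wb.1; rewrite z0 (kuE w wb) (cmodBC z) wz in h1.
    have h2 := h1 (lexx _) (ltW wb.2); have h3 := cmod_le_subD (ku z) (k w).
    have := k1 wb; have := ler_wpM2l L0 (ltW we); lra.
  rewrite -subr_le0; apply: (@le0_all_eps _ _ (2 * L) 1 ltr01) => e e0 _.
  have [w [wb wz we]] := near (complex.Re z) e (eq_ind _ _ zb _ zr) e0; rewrite -zr in wz.
  have h1 := kuL z w zb wb.1; rewrite z0 (kuE w wb) (cmodBC z) wz in h1.
  have h2 := h1 (lexx _) (ltW wb.2); have h3 := cmod_le_subD (k w) (ku z); rewrite cmodBC in h3.
  have := kI wb; have := ler_wpM2l L0 (ltW we); lra.
have ku2 z : disk 0 b z -> 0 <= complex.Im z -> 1 / 2 <= cmod (ku z).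
  move=> zb; rewrite le_eqVlt => /orP[/eqP/esym z0|z0]; first by rewrite ku1 //; lra.
  by rewrite kuE //; apply/ltW/k2.
pose kd z := (conjc (ku (conjc z)))^-1.
have cb z : disk 0 b z -> disk 0 b (conjc z) by rewrite /disk /= !subr0 cmod_conj.
have kdL z w : disk 0 b z -> disk 0 b w -> complex.Im z <= 0 -> complex.Im w <= 0 ->
    cmod (kd z - kd w) <= 4 * L * cmod (z - w).
  move=> /cb zb /cb wb; rewrite -oppr_ge0 -ImC => z0; rewrite -oppr_ge0 -ImC => w0.
  have := kuL _ _ zb wb z0 w0; have z2 := ku2 _ zb z0; have w2 := ku2 _ wb w0.
  rewrite -conjcB cmod_conj => h; rewrite /kd.
  have q0 u : 1 / 2 <= cmod u -> conjc u != 0 by move=> h'; rewrite -cmod_gt0 cmod_conj; lra.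
  have -> : (conjc (ku (conjc z)))^-1 - (conjc (ku (conjc w)))^-1 =
     conjc (ku (conjc w) - ku (conjc z)) / (conjc (ku (conjc z)) * conjc (ku (conjc w))).
    by rewrite conjcB; field; rewrite !q0.
  rewrite cmodf cmodM !cmod_conj cmodBC.
  have c0 : 1 / 4 <= cmod (ku (conjc z)) * cmod (ku (conjc w)).
    by apply: le_trans (ler_pM _ _ z2 w2) => //; lra.
  rewrite ler_pdivrMr; last by apply: lt_le_trans c0; lra.
  apply: le_trans h _; have := ler_wpM2l (mulr_ge0 L0 (cmod_ge0 (z - w))) c0; lra.
pose f z := if 0 <= complex.Im z then ku z else kd z.
have fU z : 0 <= complex.Im z -> f z = ku z by rewrite /f => ->.
have fD z : disk 0 b z -> complex.Im z <= 0 -> f z = kd z.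
  rewrite /f; case: ifP => // h1 zb h2; have z0 : complex.Im z = 0 by lra.
  have zc : conjc z = z by rewrite [z]real // conjcR.
  rewrite /kd zc; have := conjcM_cmod (ku z); rewrite ku1 // expr1n rmorph1 => h.
  have n0 : ku z != 0 by rewrite -cmod_gt0 ku1.
  have c0 : conjc (ku z) != 0 by rewrite -cmod_gt0 cmod_conj ku1.
  by rewrite -[RHS]mul1r -h mulfK.
(* Passing through the projection [x] of [z] to the axis costs [L] above and [4 * L * 2] below,
   since reflection multiplies the constant by 4 and [x] is within [2 * cmod (z - w)] of [w]. *)
have axis z w : disk 0 b z -> disk 0 b w -> 0 <= complex.Im z -> complex.Im w <= 0 ->
    cmod (f z - f w) <= 10 * L * cmod (z - w).
  move=> zb wb z0 w0; pose x := (complex.Re z)%:C.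
  have xb : disk 0 b x.
    move: zb; rewrite /disk /= !subr0; apply: le_lt_trans.
    by rewrite cmod_real; exact: normRe_le.
  have h1 := kuL z x zb xb z0 (lexx _); have h2 := kdL x w xb wb (lexx _) w0.
  have zx : cmod (z - x) = complex.Im z.
    by rewrite /x; case: (z) z0 => p q /= q0; rewrite -[RHS](cmod_Im q0); congr cmod;
       apply/eqP; rewrite eq_complex /= subrr subr0 !eqxx.
  have zw : complex.Im z <= cmod (z - w).
    by have := Im_le_cmod (z - w); rewrite ImB; lra.
  have h3 := cmod_triang (f z) (f x) (f w); have h4 := cmod_triang x z w.
  have fx : f x = ku x := fU x (lexx _); have fx2 : f x = kd x := fD x xb (lexx _).
  rewrite -(fU z z0) -fx in h1; rewrite -fx2 -(fD w wb w0) in h2.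
  rewrite (cmodBC x z) zx in h4; rewrite zx in h1.
  have h5 : 4 * L * cmod (x - w) <= 4 * L * (complex.Im z + cmod (z - w)).
    by rewrite ler_wpM2l ?mulr_ge0.
  have h6 := ler_wpM2l L0 zw; rewrite mulrDr in h5.
  by move: h1 h2 h3 h5 h6 (mulr_ge0 L0 (cmod_ge0 (z - w))); lra.
have fL z w : disk 0 b z -> disk 0 b w -> cmod (f z - f w) <= 10 * L * cmod (z - w).
  move=> zb wb; have P0 := mulr_ge0 L0 (cmod_ge0 (z - w)).
  have [z0|z0] := leP 0 (complex.Im z); have [w0|w0] := leP 0 (complex.Im w).
  - rewrite !fU //; apply: le_trans (kuL z w zb wb z0 w0) _.
    by rewrite -[10 * L * _]mulrA ler_peMl //; lra.
  - by apply: axis => //; exact: ltW.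
  - by rewrite cmodBC (cmodBC z); apply: axis => //; exact: ltW.
  - rewrite (fD z zb (ltW z0)) (fD w wb (ltW w0)); apply: le_trans (kdL z w zb wb (ltW z0) (ltW w0)) _.
    by rewrite -!mulrA ler_wpM2r //; lra.
have oneside (A : set R[i]) h : open A -> A `<=` disk 0 b -> (forall z, A z -> f z = h z) -> hol A h -> hol A f.
  by move=> oA sA E; apply: hol_ext => // z Az; rewrite E.
have hE : b = 2 * (b / 2) by field.
have oL : open [set z : R[i] | hdisk b (conjc z)].
  apply/open_diskP => z zb; have [d d0 dH] := (open_diskP _).1 (@hdisk_open _ b) _ zb.
  by exists d => // w wz; apply: dH; rewrite /disk /= -conjcB cmod_conj.
have holU : hol (hdisk b) f.
  apply: (hol_ext (@hdisk_open _ b)) Hk => z [zb z0]; by rewrite (fU z (ltW z0)) kuE.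
have holD : hol [set z : R[i] | hdisk b (conjc z)] f.
  have H : hol [set z : R[i] | hdisk b (conjc z)] (fun z => (conjc (k (conjc z)))^-1).
    apply: holV => [z zb|z /k2 h]; last by rewrite -cmod_gt0 cmod_conj; lra.
    by have [l kl] := Hk zb; exists (conjc l); exact: cder_conj.
  apply: (hol_ext oL) H => z [zb z0]; rewrite ImC oppr_gt0 in z0.
  have zb' : disk 0 b z by have := cb _ zb; rewrite conjcK.
  by rewrite (fD z zb' (ltW z0)) /kd kuE //; split => //; rewrite ImC oppr_gt0.
have half z : disk 0 (b / 2) z -> disk 0 b z by apply: sub_disk; move: b0; lra.
have b2 : 0 < b / 2 by rewrite divr_gt0.
have shift z s : disk 0 (b / 2) z -> `|s| < b / 2 -> disk 0 b (z + Complex 0 s).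
  rewrite /disk /= !subr0 => h1 h2; apply: le_lt_trans (cmodD _ _) _.
  have -> : cmod (Complex 0 s) = `|s| by rewrite cmodE /= expr0n add0r sqrtr_sqr.
  by move: b2 h1 h2; lra.
have dz z s : cmod (z - (z + Complex 0 s)) = `|s|.
  rewrite (_ : z - (z + Complex 0 s) = - Complex 0 s); last by ring.
  by rewrite cmodN cmodE /= expr0n add0r sqrtr_sqr.
exists f; split.
- apply: (@hol_across_axis _ f _ (10 * L) b2).
  + move=> z /half zb e e0.
    have [d d0 dH] := (open_diskP _).1 (@disk_open _ 0 b) z zb.
    have L1 : 0 < 10 * L + 1 by rewrite ltr_wpDl // mulr_ge0.
    exists (Num.min d (e / (10 * L + 1))) => [|w]; first by rewrite lt_min d0 divr_gt0.
    rewrite lt_min => /andP[wd we]; apply: le_lt_trans (fL w z (dH w wd) zb) _.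
    apply: le_lt_trans (_ : (10 * L + 1) * cmod (w - z) < _).
      by rewrite ler_wpM2r ?cmod_ge0 //; lra.
    by rewrite mulrC -ltr_pdivlMr.
  + move=> z; rewrite -hE => zb z0; have [z1|z1] := ltP 0 (complex.Im z).
      by apply: holU; split.
    by apply: holD; split; [exact: cb|rewrite ImC oppr_gt0 lt_neqAle z0].
  + move=> z e zb z0 e0 eb; have ae : `|e| = e by rewrite gtr0_norm.
    have sh : disk 0 b (z + Complex 0 e) by apply: shift; rewrite ?ae.
    by have := fL z _ (half z zb) sh; rewrite dz ae.
  + move=> z e zb z0 e0 eb; have ae : `|- e| = e by rewrite normrN gtr0_norm.
    have sh : disk 0 b (z + Complex 0 (- e)) by apply: shift; rewrite ?ae.
    by have := fL z _ (half z zb) sh; rewrite dz ae.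
- by move=> z /half zb z0; rewrite (fU z (ltW z0)) kuE.
- by move=> z /half zb z0; rewrite fU ?z0 ?lexx // ku1.
- move=> z /half zb z0; rewrite (fD z zb (ltW z0)) /kd kuE //; split; first exact: cb.
  by rewrite ImC oppr_gt0.
Qed.

End Extension.
End ReflectHalfDisk.

(** * Reflection across the unit circle *)

Section Reflect.
Context {R : realType}.
Implicit Types (z w u zeta : R[i]) (r s e : R).

Local Notation DD := (@unit_disk R).

Lemma reflect_chart a (k F : R[i] -> R[i]) : 0 < a -> hol (hdisk a) k -> hol (hdisk a) F ->
  (forall w, hdisk a w -> 0 <= complex.Re (F w)) ->
  (forall w, hdisk a w -> 1 / 2 < cmod (k w)) -> (forall w, hdisk a w -> cmod (k w) < 1) ->
  (forall e, 0 < e -> exists2 d, 0 < d & forall w, hdisk a w ->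
     complex.Im w < d -> (cmod (k w))^-1 <= expR (e * (1 + complex.Re (F w)))) ->
  exists b f, [/\ 0 < b <= a, hol (disk 0 b) f,
    forall z, disk 0 b z -> 0 < complex.Im z -> f z = k z,
    forall z, disk 0 b z -> complex.Im z = 0 -> cmod (f z) = 1 &
    forall z, disk 0 b z -> complex.Im z < 0 -> f z = (conjc (k (conjc z)))^-1].
Proof.
move=> a0 Hk HF F0 k2 k1 weak; pose C := 12 / a; have C0 : 0 < C by rewrite divr_gt0.
have a4 : 0 < a / 4 by rewrite divr_gt0.
have sub b : b <= a -> hdisk b `<=` hdisk a.
  by move=> ba w [wb w0]; split => //; apply: sub_disk wb.
have sub4 : hdisk (a / 4) `<=` hdisk a by apply: sub; lra.
have low w : hdisk (a / 4) w -> 1 - cmod (k w) <= C * complex.Im w.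
  move=> wb; have := half_bound a0 Hk HF F0 k2 weak wb.
  by have := expR_ge1Dx (- (12 / a) * complex.Im w); rewrite /C; lra.
have der w : hdisk (a / 4) w -> cmod (dv k w) <= 4 * C.
  move=> wb; have wa := sub4 w wb; have [wb1 y0] := wb; set y := complex.Im w in y0.
  have disk_in : disk w y `<=` hdisk a.
    move=> u uy; split; last first.
      have := normIm_le (u - w); have := ler_norm (- complex.Im (u - w)); rewrite normrN ImB.
      by move: uy; rewrite /disk /= -/y; lra.
    move: wb1 uy; rewrite /disk /= !subr0; have := Im_le_cmod w; have := cmod_le_subD u w.
    by rewrite -/y; lra.
  have y2 : 0 < y / 2 by rewrite divr_gt0.
  apply: (cder_le y2 (hol_dv Hk wa)) => u uw.
  apply: le_trans (@schwarz_pick_local _ k w y y0 (hol_sub disk_in Hk)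
    (fun u uy => k1 u (disk_in u uy)) u (ltW uw)) _.
  rewrite ler_wpM2r ?cmod_ge0 // ler_wpM2l // ler_pdivrMr //; exact: low.
have lip u w : hdisk (a / 4) u -> hdisk (a / 4) w -> cmod (k u - k w) <= 4 * C * cmod (u - w).
  move=> ub wb; have := @cseg_bound _ k (dv k) w u 0 (4 * C).
  rewrite mul0r subr0; apply=> t t01; have tb := hdisk_cseg wb ub t01.
    by apply: hol_dv Hk _; exact: sub4.
  by rewrite subr0; exact: der.
have L0 : 0 <= 4 * C by rewrite mulr_ge0 // ltW.
have kI w : hdisk (a / 4) w -> 1 - cmod (k w) <= 4 * C * complex.Im w.
  move=> wb; have [_ w0] := wb; apply: le_trans (low w wb) _.
  by rewrite ler_wpM2r ?(ltW w0) //; lra.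
have [f [h1 h2 h3 h4]] := @reflect_hdisk _ (a / 4) (4 * C) a4 L0 k
   (fun w wb => k1 w (sub4 w wb)) lip (hol_sub sub4 Hk) (fun w wb => k2 w (sub4 w wb)) kI.
exists (a / 4 / 2), f; split => //; first by apply/andP; split; lra.
Qed.

(** Outside the circle [H] is prescribed by reflection, so that it agrees with [maximal_extension h]
    on the whole disk; the nonvanishing clause keeps these values finite. *)
Definition mirror_extension (h : R[i] -> R[i]) zeta (H : R[i] -> R[i]) r :=
  [/\ 0 < r, hol (disk zeta r) H,
      forall z, disk zeta r z -> DD z -> H z = h z,
      forall z, disk zeta r z -> cmod z = 1 -> cmod (H z) = 1 &
      forall z, disk zeta r z -> 1 < cmod z ->
        h (conjc z)^-1 != 0 /\ H z = (conjc (h (conjc z)^-1))^-1].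

Lemma conjcM z w : conjc (z * w) = conjc z * conjc w.
Proof. exact: (rmorphM (@conjc R)). Qed.

Lemma cexp_conj z : conjc (cexp z) = cexp (conjc z).
Proof.
rewrite /cexp; case: z => x y /=; rewrite /cis cosN sinN.
by apply/eqP; rewrite eq_complex /=; apply/andP; split; apply/eqP; ring.
Qed.

(** The coordinate [w] with [z = zeta * cexp (ii * w)] turns the circle into the real axis, the unit
    disk into the upper half-plane, and inversion in the circle into conjugation. *)
Lemma reflection_principle zeta h F r : unit_circle zeta -> 0 < r -> hol (DD `&` disk zeta r) h ->
  hol DD F -> (forall z, DD z -> 0 <= complex.Re (F z)) ->
  (forall z, DD z -> disk zeta r z -> 1 / 2 < cmod (h z) < 1) ->
  (forall e, 0 < e -> exists2 rho : R, rho < 1 & forall z, DD z -> disk zeta r z ->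
    rho < cmod z -> (cmod (h z))^-1 <= expR (e * (1 + complex.Re (F z)))) ->
  exists H s, mirror_extension h zeta H s.
Proof.
move=> zeta1 r0 Hh HF F0 h2 weak.
pose ii : R[i] := Complex 0 1.
pose c w := zeta * cexp (ii * w).
have z0 : zeta != 0 by rewrite -cmod_gt0 zeta1.
have cc w : cmod (c w) = expR (- complex.Im w).
  by rewrite /c cmodM zeta1 mul1r cmod_cexp; case: w => x y /=; congr expR; ring.
have Hc (A : set R[i]) : hol A c.
  apply: holM; first exact: hol_cst.
  by apply: hol_cexp; apply: holM; [exact: hol_cst|exact: hol_id].
have c0 : c 0 = zeta by rewrite /c mulr0 cexp0 mulr1.
have [a a0 aH] : exists2 a, 0 < a & forall w, disk 0 a w -> disk zeta r (c w).
  by have [a a0 aH] := hol_cont (Hc setT) (I : setT (0 : R[i])) r0; exists a => // w /aH; rewrite c0.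
have cD w : 0 < complex.Im w -> DD (c w).
  by move=> w0; apply/unit_diskE; rewrite cc -expR0 ltr_expR oppr_lt0.
have cA w : hdisk a w -> (DD `&` disk zeta r) (c w).
  by move=> [wa w0]; split; [exact: cD|exact: aH].
have [||||||b [f [/andP[b0 ba] Hf fU f1 fD]]] := @reflect_chart a (h \o c) (F \o c) a0.
- exact: (@hol_comp _ _ _ c h (Hc _) Hh cA).
- by apply: (@hol_comp _ _ _ c F (Hc _) HF) => w [_ /cD].
- by move=> w [_ /cD]; exact: F0.
- by move=> w /cA[w1 w2]; have /andP[] := h2 _ w1 w2.
- by move=> w /cA[w1 w2]; have /andP[] := h2 _ w1 w2.
- move=> e /weak[rho rho1 H]; exists (1 - rho); first by rewrite subr_gt0.
  move=> w /cA[w1 w2] wd; apply: H => //; rewrite cc.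
  by have := expR_ge1Dx (- complex.Im w); move: wd; lra.
have z1 (z : R[i]) : disk zeta 1 z -> z / zeta != 0.
  move=> zz; rewrite mulf_neq0 ?invr_eq0 // -cmod_gt0.
  by have := cmod_le_subD zeta z; rewrite cmodBC zeta1; move: zz; rewrite /disk /=; lra.
have [L HL LE] := @log_disk _ (fun z => z / zeta) zeta 1 ltr01
  (holM (@hol_id _ _) (@hol_cst _ _ _)) z1.
(* The local inverse of the chart [c], normalised to send [zeta] to 0. *)
pose W z := - ii * (L z - L zeta).
have iW z : ii * W z = L z - L zeta.
  have ii2 : ii * - ii = 1 by apply/eqP; rewrite eq_complex /=; apply/andP; split; apply/eqP; ring.
  by rewrite /W mulrA ii2 mul1r.
have cW z : disk zeta 1 z -> c (W z) = z.
  move=> zz; rewrite /c iW cexpB !LE ?divff //; last exact: disk_center.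
  by rewrite divr1 mulrC divfK.
have HW : hol (disk zeta 1) W.
  by apply: holM; [exact: hol_cst|apply: holB => //; exact: hol_cst].
have W0 : W zeta = 0 by rewrite /W subrr mulr0.
have [s [s0 s1 sH]] : exists s, [/\ 0 < s, s <= 1 & forall z, disk zeta s z -> disk 0 b (W z)].
  have [d d0 dH] := hol_cont HW (disk_center zeta ltr01) b0.
  exists (Num.min d 1); rewrite lt_min d0 ltr01 ge_min lexx orbT; split => // z.
  by rewrite /disk /= lt_min => /andP[/dH + _]; rewrite W0.
have in1 z : disk zeta s z -> disk zeta 1 z by exact: sub_disk.
have sign z : disk zeta s z -> cmod z = expR (- complex.Im (W z)) by move=> /in1/cW {1}<-.
have conjW w : c (conjc w) = (conjc (c w))^-1.
  have E : conjc (c w) * c (conjc w) = 1.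
    rewrite /c conjcM cexp_conj mulrACA -cexpD conjcM.
    have -> : conjc zeta * zeta = 1 by rewrite mulrC conjcM_cmod zeta1 expr1n.
    rewrite (_ : conjc ii = - ii) ?mulNr ?addNr ?cexp0 ?mulr1 //.
    by apply/eqP; rewrite eq_complex /= oppr0 !eqxx.
  have n0 : conjc (c w) != 0 by rewrite -cmod_gt0 cmod_conj cc expR_gt0.
  by rewrite -[LHS](mulKf n0) E mulr1.
exists (f \o W), s; split => //.
- by apply: (@hol_comp _ _ (disk 0 b)) => //; exact: hol_sub HW.
- move=> z zs /unit_diskE; rewrite (sign z zs) -expR0 ltr_expR oppr_lt0 => w0.
  by rewrite -[in RHS](cW z (in1 z zs)); exact: fU (sH z zs) w0.
- move=> z zs; rewrite (sign z zs) -[RHS]expR0 => /expR_inj/eqP; rewrite oppr_eq0 => /eqP w0 /=.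
  by apply: f1 => //; exact: sH.
move=> z zs; rewrite (sign z zs) -expR0 ltr_expR oppr_gt0 => w0.
rewrite [(f \o W) z](fD _ (sH z zs) w0); have E : c (conjc (W z)) = (conjc z)^-1 by rewrite conjW cW //; exact: in1.
rewrite [(h \o c) _](congr1 h E); split => //.
have [] := cA (conjc (W z)).
  split; last by rewrite ImC oppr_gt0.
  by apply: (sub_disk ba); move: (sH z zs); rewrite /disk /= !subr0 cmod_conj.
by rewrite E => w1 w2; have /andP[+ _] := h2 _ w1 w2; rewrite -cmod_gt0; lra.
Qed.

End Reflect.

(** * Symmetric continuations and their local inverses *)

Section Mirror.
Context {R : realType}.
Implicit Types (z w u v zeta : R[i]) (r s t e : R) (h g G H K : R[i] -> R[i]).

Local Notation DD := (@unit_disk R).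

Lemma radial_dist zeta t : unit_circle zeta -> t <= 1 -> cmod (t%:C * zeta - zeta) = 1 - t.
Proof.
move=> z1 t1; have -> : t%:C * zeta - zeta = - ((1 - t)%:C * zeta).
  by rewrite real1B mulrBl mul1r opprB.
by rewrite cmodN cmodM z1 mulr1 cmod_real0 // subr_ge0.
Qed.

Lemma radial_disk zeta t : unit_circle zeta -> 0 <= t -> t < 1 -> DD (t%:C * zeta).
Proof. by move=> z1 t0 t1; apply/unit_diskE; rewrite cmodM z1 mulr1 cmod_real0. Qed.

Lemma ccont_radial f zeta : unit_circle zeta -> ccont f zeta -> forall e, 0 < e ->
  exists2 rho : R, rho < 1 & forall t, rho < t -> t < 1 -> cmod (f (t%:C * zeta) - f zeta) < e.
Proof.
move=> z1 fc e /fc[d d0 dH]; exists (1 - d); first by rewrite ltrBlDr ltrDl.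
by move=> t t1 t2; apply: dH; rewrite radial_dist ?ltW //; lra.
Qed.

Lemma radial_unique f zeta (a b : R[i]) : (forall e, 0 < e -> exists2 rho : R, rho < 1 &
    forall t, rho < t -> t < 1 -> cmod (f (t%:C * zeta) - a) < e) ->
  (forall e, 0 < e -> exists2 rho : R, rho < 1 &
    forall t, rho < t -> t < 1 -> cmod (f (t%:C * zeta) - b) < e) -> a = b.
Proof.
move=> fa fb; apply/eqP; rewrite -subr_eq0 -cmod_eq0; apply/eqP/le_anti; rewrite cmod_ge0 andbT.
apply: (@le0_all_eps _ _ 2 1 ltr01) => e e0 _.
have [p p1 pH] := fa e e0; have [q q1 qH] := fb e e0.
pose t := (1 + Num.max p q) / 2.
have m1 : Num.max p q < 1 by rewrite gt_max p1.
have m2 : p <= Num.max p q by rewrite le_max lexx.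
have m3 : q <= Num.max p q by rewrite le_max lexx orbT.
have [t1 t2 t3] : [/\ p < t, q < t & t < 1] by rewrite /t; split; lra.
have := cmod_triang a (f (t%:C * zeta)) b; rewrite (cmodBC a (f _)).
by have := pH t t1 t3; have := qH t t2 t3; lra.
Qed.

Lemma continues_radial h zeta H : unit_circle zeta -> continues_at h zeta H ->
  forall e, 0 < e -> exists2 rho : R, rho < 1 &
    forall t, rho < t -> t < 1 -> cmod (h (t%:C * zeta) - H zeta) < e.
Proof.
move=> z1 [r r0 [/holP HH E]] e e0.
have [rho rho1 P] := ccont_radial z1 (hol_cont HH (disk_center zeta r0)) e0.
exists (Num.max rho (Num.max 0 (1 - r))); first by rewrite !gt_max rho1 ltr01 ltrBlDr ltrDl.
move=> t; rewrite !gt_max => /and3P[t1 t2 t3] t4.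
rewrite -E; [exact: P| |apply: radial_disk => //; exact: ltW].
by rewrite /disk /= radial_dist ?ltW //; lra.
Qed.

(** The value at [zeta] of any continuation is the radial limit of [h], so all continuations share
    it. *)
Lemma boundary_valueE h zeta H : unit_circle zeta -> continues_at h zeta H ->
  boundary_value h zeta = H zeta.
Proof.
move=> z1 cH; rewrite /boundary_value; case: xgetP => [_ -> [H' cH' <-]|].
  exact: radial_unique (continues_radial z1 cH') (continues_radial z1 cH).
by move=> /(_ (H zeta)) []; exists H.
Qed.

(** Inversion in the circle divides the distance of [z] to [zeta] by [cmod z]. *)
Lemma mirror_point zeta z r : unit_circle zeta -> disk zeta r z -> 1 < cmod z ->
  DD (conjc z)^-1 /\ disk zeta r (conjc z)^-1.
Proof.
move=> z1 zr zgt; have z0 : 0 < cmod z by exact: lt_trans zgt.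
have cz : conjc z != 0 by rewrite -cmod_gt0 cmod_conj.
split; first by apply/unit_diskE; rewrite cmodV cmod_conj invf_lt1.
have E : (conjc z)^-1 - zeta = - zeta * conjc (z - zeta) / conjc z.
  have h : zeta * conjc zeta = 1 by rewrite conjcM_cmod z1 expr1n rmorph1.
  have -> : - zeta * conjc (z - zeta) = 1 - zeta * conjc z by rewrite conjcB -h; ring.
  by field.
rewrite /disk /= E cmodf cmodM cmodN !cmod_conj z1 mul1r ltr_pdivrMr //.
have r0 : 0 <= r by apply/ltW/(le_lt_trans _ zr)/cmod_ge0.
by apply: lt_le_trans zr _; rewrite ler_peMr // ltW.
Qed.

Section Extension.
Context (h : R[i] -> R[i]) (zeta : R[i]) (H : R[i] -> R[i]) (r : R).
Hypothesis z1 : unit_circle zeta.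
Hypothesis mH : mirror_extension h zeta H r.

Lemma mirror_continues z : unit_circle z -> disk zeta r z -> continues_at h z H.
Proof.
move=> u1 zr; have [r0 HH HD _ _] := mH.
have [d d0 dH] := (open_diskP _).1 (@disk_open _ zeta r) z zr.
by exists d => //; split => [|w /dH]; [apply/holP; exact: hol_sub HH|exact: HD].
Qed.

Lemma mirror_maximal z : disk zeta r z ->
  maximal_domain h (fin z) /\ maximal_extension h (fin z) = fin (H z).
Proof.
move=> zr; have [r0 HH HD H1 Hout] := mH; split.
  by move=> [w [w1 nw] [E]]; apply: nw; exists H; rewrite E in w1 *; exact: mirror_continues.
rewrite /maximal_extension /=; case: ltP => [zl|zl]; first by rewrite HD //; exact/unit_diskE.
case: eqVneq => [zE|zn]; first by rewrite (boundary_valueE _ (mirror_continues zE zr)).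
have zgt : 1 < cmod z by rewrite lt_neqAle eq_sym zn.
have [h0 ->] := Hout z zr zgt.
have c0 : conjc z != 0 by rewrite -cmod_gt0 cmod_conj; exact: lt_trans zgt.
have ch0 : conjc (h (conjc z)^-1) != 0 by rewrite -cmod_gt0 cmod_conj cmod_gt0.
by rewrite /reflection /sphere_inv /= (negbTE c0) /= (negbTE ch0).
Qed.

Lemma mirror_shrink s : 0 < s -> s <= r -> mirror_extension h zeta H s.
Proof.
move=> s0 sr; have [r0 HH HD H1 Hout] := mH; have S : disk zeta s `<=` disk zeta r := sub_disk sr.
split=> // [|z /S|z /S|z /S]; [exact: hol_sub HH|exact: HD|exact: H1|exact: Hout].
Qed.

End Extension.

Lemma mirror_comp h g zeta H K r s : unit_circle zeta -> (forall z, DD z -> DD (h z)) ->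
  mirror_extension h zeta H r -> mirror_extension g (H zeta) K s ->
  exists e, mirror_extension (g \o h) zeta (K \o H) e.
Proof.
move=> z1 hD [r0 HH HD H1 Hout] [s0 HK KD K1 Kout].
have [d d0 dH] := hol_cont HH (disk_center zeta r0) s0.
have [e [e0 er ed]] : exists e, [/\ 0 < e, e <= r & e <= d].
  by exists (Num.min r d); rewrite lt_min r0 d0 !ge_min !lexx orbT.
have S : disk zeta e `<=` disk zeta r := sub_disk er.
have T z : disk zeta e z -> disk (H zeta) s (H z) by move=> ze; apply: dH; apply: lt_le_trans ze ed.
exists e; split => //.
- by apply: (@hol_comp _ _ (disk (H zeta) s)) => //; exact: hol_sub HH.
- move=> z ze Dz; have E := HD z (S z ze) Dz; rewrite /= -E; apply: KD; first exact: T.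
  by rewrite E; exact: hD.
- by move=> z ze zE /=; apply: K1; [exact: T|apply: H1 => //; exact: S].
move=> z ze zgt; have [h0 E] := Hout z (S z ze) zgt.
have [Dz _] := mirror_point z1 (S z ze) zgt.
have hz := hD _ Dz; have := T z ze; have ch : 0 < cmod (h (conjc z)^-1) by rewrite cmod_gt0.
have inv : (conjc (H z))^-1 = h (conjc z)^-1 by rewrite E (fmorphV (@conjc R)) /= conjcK invrK.
move=> /Kout[|k0 kE]; first by rewrite E cmodV cmod_conj invf_gt1 //; exact/unit_diskE.
by rewrite inv in k0 kE.
Qed.

(* Hopf's boundary lemma, through a disk internally tangent to the circle at [v]. *)
Lemma boundary_deriv_neq0 H v r : unit_circle v -> 0 < r -> hol (disk v r) H ->
  (forall z, disk v r z -> DD z -> DD (H z)) -> cmod (H v) = 1 -> dv H v != 0.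
Proof.
move=> v1 r0 HH HD Hv; apply/negP => /eqP dv0.
have [s [s0 s1 sr]] : exists s, [/\ 0 < s, s <= 1 & 2 * s <= r].
  exists (Num.min 1 (r / 2)); rewrite lt_min ltr01 divr_gt0 // ge_min lexx; split => //.
  by rewrite mulrC -ler_pdivlMr // ge_min lexx orbT.
pose A (t : R[i]) := v * ((1 - s)%:C + s%:C * t).
have Av (t : R[i]) : A t - v = v * (s%:C * (t - 1)) by rewrite /A real1B; ring.
have AD (t : R[i]) : DD t -> DD (A t) /\ disk v r (A t).
  move=> /unit_diskE t1; split.
    apply/unit_diskE; rewrite cmodM v1 mul1r; apply: le_lt_trans (cmodD _ _) _.
    rewrite cmodM !cmod_real0 ?subr_ge0 ?(ltW s0) //.
    have : s * cmod t < s * 1 by rewrite ltr_pM2l.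
    by lra.
  rewrite /disk /= Av cmodM v1 mul1r cmodM cmod_real0 ?(ltW s0) //.
  apply: lt_le_trans sr; rewrite [2 * s]mulrC ltr_pM2l //.
  by apply: le_lt_trans (cmodB _ _) _; rewrite cmod1; lra.
have HA (B : set R[i]) : hol B A.
  apply: holM; first exact: hol_cst.
  by apply: holD; [exact: hol_cst|apply: holM; [exact: hol_cst|exact: hol_id]].
have [k k0 kH] := @one_sub_norm_lower _ (H \o A)
  (@hol_comp _ DD _ A H (HA _) HH (fun (t : R[i]) Dt => (AD t Dt).2))
  (fun (t : R[i]) Dt => HD _ (AD t Dt).2 (AD t Dt).1).
have e0 : 0 < k / (2 * s) by rewrite divr_gt0 // mulr_gt0.
have [d d0 dH] := hol_dv HH (disk_center v r0) e0.
have [x [x0 x1 xd]] : exists x, [/\ 0 < x, x < 1 & s * x < d].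
  exists (Num.min (1 / 2) (d / (2 * s))).
  have m1 : Num.min (1 / 2) (d / (2 * s)) <= 1 / 2 by rewrite ge_min lexx.
  have m2 : Num.min (1 / 2) (d / (2 * s)) <= d / (2 * s) by rewrite ge_min lexx orbT.
  split; first by rewrite lt_min !divr_gt0 // mulr_gt0.
    by apply: le_lt_trans m1 _; lra.
  by move: m2; rewrite ler_pdivlMr ?mulr_gt0 //; lra.
have tx : DD (1 - x)%:C by apply/unit_diskE; rewrite cmod_real0; lra.
have Ax : cmod (A (1 - x)%:C - v) = s * x.
  rewrite Av cmodM v1 mul1r cmodM cmod_real0 ?(ltW s0) // real1B addrAC subrr add0r.
  by rewrite cmodN cmod_real0 // ltW.
have := dH (A (1 - x)%:C); rewrite Ax dv0 mul0r subr0 => /(_ xd) h1.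
have := kH _ tx; rewrite cmod_real0 /=; last by lra.
have := cmod_le_subD (H v) (H (A (1 - x)%:C)); rewrite Hv cmodBC => h2 h3.
have h4 : k / (2 * s) * (s * x) = k * x / 2 by field; rewrite gt_eqF.
have := mulr_gt0 k0 x0; rewrite h4 in h1; lra.
Qed.

(** The derivative of the continuation [H] of [G] is nonzero at [v] by Hopf's lemma, so [H] has a
    local inverse [K]. Since [G] inverts [h] on the right, [K] agrees with [h] inside the disk and
    thus continues [h] at [H v]. *)
Lemma boundary_inverse h G v H r : unit_circle v ->
  (forall z, DD z -> disk v r z -> DD (G z) /\ h (G z) = z) -> mirror_extension G v H r ->
  unit_circle (H v) /\ exists2 K, continues_at h (H v) K & K (H v) = v.
Proof.
move=> v1 GD [r0 HH HG H1 Hout]; have vr := disk_center v r0.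
have Hv : cmod (H v) = 1 by exact: H1.
have dv0 : dv H v != 0.
  by apply: (boundary_deriv_neq0 v1 r0 HH) => // z zr Dz; rewrite HG //; have [] := GD z Dz zr.
have [s s0 [sr inj]] := locally_injective (@disk_open _ v r) HH vr dv0.
have oS : open (disk v s) := @disk_open _ v s.
have HS : hol (disk v s) H := hol_sub sr HH.
pose K u := xget v [set z | disk v s z /\ H z = u].
have KH z : disk v s z -> K (H z) = z.
  move=> zs; rewrite /K; case: xgetP => [_ -> [? ?]|]; first exact: inj.
  by move=> /(_ z) [].
have [d d0 dH] := injective_open oS HS inj (disk_center v s0) s0.
split=> //; exists K; last by apply: KH; exact: disk_center.
exists d => //; split.
  apply/holP => u /dH[z [zs [_ <-]]]; eexists; exact: inverse_cder oS HS inj KH z zs.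
move=> u /dH[z [zs [_ <-]]]; rewrite KH // => /unit_diskE u1.
have zr := sr z zs.
(* By symmetry [H] sends points of the circle to the circle and exterior points to exterior points,
   so a value [u] inside comes from a point inside. *)
have Dz : DD z.
  apply/unit_diskE; rewrite ltNge le_eqVlt; apply/negP => /orP[/eqP zE|zgt].
    by move: u1; rewrite H1 // ltxx.
  have [Dz' zr'] := mirror_point v1 zr zgt.
  have [/unit_diskE G1 _] := GD _ Dz' zr'; have [G0 E] := Hout z zr zgt.
  move: u1; rewrite E cmodV cmod_conj invf_lt1 ?cmod_gt0 //.
  by move=> /(lt_trans G1); rewrite ltxx.
by rewrite HG //; have [_ ->] := GD z Dz zr.
Qed.

End Mirror.

(** * The associated inner function *)

Section Associated.
Context {R : realType}.
Implicit Types (z w u p : R[i]) (r s t e M : R) (N S X : set R[i]).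

Local Notation DD := (@unit_disk R).

Lemma hol_iter (A : set R[i]) h n : hol A h -> (forall z, A z -> A (h z)) -> hol A (iter n h).
Proof.
move=> Hh hA; suff [] : hol A (iter n h) /\ forall z, A z -> A (iter n h z) by [].
elim: n => [|n [H1 H2]]; first by split=> //; exact: hol_id.
by split=> [|z Az]; [exact: (@hol_comp _ _ A (iter n h) h)|exact/hA/H2].
Qed.

(** Peels off the outermost [f]: [lift_unique] makes the lifts agree after [n] iterations instead of
    [n.+1], and forward invariance keeps the hypothesis on the postsingular set. *)
Lemma lift_unique_iter f n S h k a : hol setT f -> connected S ->
  (forall z, S z -> [/\ ccont h z, ccont k z, iter n f (h z) = iter n f (k z) &
     ~ postsingular_set f (iter n f (h z))]) ->
  S a -> h a = k a -> forall z, S z -> h z = k z.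
Proof.
move=> Hf cS; elim: n => [|n IH] H Sa hk; first by move=> z /H[].
have Hn : hol setT (iter n f) by exact: hol_iter.
have E : forall z, S z -> iter n f (h z) = iter n f (k z).
  apply: (@lift_unique _ f S (iter n f \o h) (iter n f \o k) a) => //= [z /H[hc kc E nP]|]; last by rewrite hk.
  split => //.
  - by apply: ccont_comp => //; exact: hol_cont Hn I.
  - by apply: ccont_comp => //; exact: hol_cont Hn I.
  - by apply: contra_not nP; exact: singular_postsingular.
suff H' z : S z -> [/\ ccont h z, ccont k z, iter n f (h z) = iter n f (k z) &
    ~ postsingular_set f (iter n f (h z))] by exact: IH H' Sa hk.
move=> Sz; have [hc kc _ nP] := H z Sz; split; [exact: hc|exact: kc|exact: E|].
by move=> Pz; apply: nP; exact: (postsingular_invariant Hf Pz).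
Qed.

Lemma fatou_preimage_iter f n z : hol setT f -> fatou_set f (iter n f z) -> fatou_set f z.
Proof. by move=> Hf; elim: n => [//|n IH] /= /(fatou_preimage Hf). Qed.

Context (f phi : R[i] -> R[i]) (U : set R[i]).
Hypotheses (Hf : hol setT f) (fatU : fatou_component f U) (inv : invariant_component f U).
Hypothesis rm : riemann_map U phi.

Local Notation g := (associated_map f phi).

Lemma inverse_riemann : exists ps : R[i] -> R[i], [/\ hol U ps, forall z, DD z -> ps (phi z) = z,
  (forall w, U w -> DD (ps w) /\ phi (ps w) = w) & forall z, DD z -> g z = ps (f (phi z))].
Proof.
have [Hphi phiU phi_inj phi_surj] := riemann_facts rm.
exists ('pinv_(fun=> 0) DD phi).
have K z : DD z -> 'pinv_(fun=> 0) DD phi (phi z) = z.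
  move=> Dz; apply: pinvKV; last exact/mem_set.
  by move=> x y /set_mem Dx /set_mem Dy; exact: phi_inj.
split => // [w /phi_surj[z Dz <-]|w /phi_surj[z Dz <-]]; last by rewrite K.
eexists; exact: inverse_cder unit_disk_open Hphi phi_inj K z Dz.
Qed.

Lemma associatedE z : DD z -> DD (g z) /\ phi (g z) = f (phi z).
Proof.
have [ps [_ _ psU gE]] := inverse_riemann => Dz; rewrite gE //.
have [_ phiU _ _] := riemann_facts rm.
by apply: psU; apply: inv; exists (phi z) => //; exact: phiU.
Qed.

Lemma associated_hol : hol DD g.
Proof.
have [ps [Hps _ _ gE]] := inverse_riemann; have [Hphi phiU _ _] := riemann_facts rm.
apply: (@hol_ext _ _ (ps \o (f \o phi))); first exact: unit_disk_open.
  by move=> z Dz; rewrite gE.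
apply: (@hol_comp _ _ U (f \o phi) ps) => //.
  by apply: (@hol_comp _ _ setT phi f).
by move=> z Dz; apply: inv; exists (phi z) => //; exact: phiU.
Qed.

Lemma associated_iterE n z : DD z -> DD (iter n g z) /\ phi (iter n g z) = iter n f (phi z).
Proof.
move=> Dz; elim: n => [//|n [D1 E]] /=; have [D2 ->] := associatedE D1.
by rewrite E.
Qed.

(** Lift [phi] through the iterate of [f] on [N]. The image of the lift is connected, lies in the
    Fatou set and meets [U], so it stays in [U] and can be pulled back by [phi]. *)
Lemma associated_branch n N z : open N -> segment_convex N -> N `<=` DD ->
  (forall w, N w -> ~ postsingular_set f (phi w)) -> DD z -> N (iter n g z) ->
  exists G, [/\ hol N G, forall w, N w -> DD (G w) /\ iter n g (G w) = w & G (iter n g z) = z].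
Proof.
move=> oN cN ND NP Dz Nz.
have [ps [Hps psK psU _]] := inverse_riemann; have [Hphi phiU phi_inj _] := riemann_facts rm.
have [l [Hl lE l0]] := convex_lift_iter Hf oN cN (hol_sub ND Hphi) NP Nz
  (esym (associated_iterE n Dz).2).
have lU w : N w -> U (l w).
  move=> Nw; apply: (@component_absorbs _ f U (l @` N) (phi z) fatU) => //.
  - by apply: (@hol_image_connected _ _ N) => //; exact: convex_connected.
  - move=> _ [v Nv <-]; apply: (@fatou_preimage_iter f n) => //.
    by rewrite lE //; apply: (component_sub fatU); exact/phiU/ND.
  - by exists (iter n g z).
  - exact: phiU.
exists (ps \o l); split.
- by apply: (@hol_comp _ _ U).
- move=> w Nw; have [D1 E1] := psU _ (lU w Nw); split=> //=.
  have [D2 E2] := associated_iterE n D1; apply: phi_inj => //; first exact: ND.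
  by rewrite E2 E1 lE.
- by rewrite /= l0 psK.
Qed.

Lemma branch_unique n S h k a : connected S -> S `<=` DD ->
  (forall z, S z -> [/\ ccont h z, ccont k z, DD (h z) /\ DD (k z),
     iter n g (h z) = iter n g (k z) & ~ postsingular_set f (phi (iter n g (h z)))]) ->
  S a -> h a = k a -> forall z, S z -> h z = k z.
Proof.
move=> cS SD H Sa hk z Sz; have [Hphi phiU phi_inj _] := riemann_facts rm.
have [_ _ [D1 D2] _ _] := H z Sz; apply: phi_inj => //.
apply: (@lift_unique_iter f n S (phi \o h) (phi \o k) a) => //=; last by rewrite hk.
move=> w /H[hc kc [Dh Dk] E nP]; split.
- by apply: ccont_comp => //; exact: hol_cont Hphi Dh.
- by apply: ccont_comp => //; exact: hol_cont Hphi Dk.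
- by have [_ <-] := associated_iterE n Dh; have [_ <-] := associated_iterE n Dk; rewrite E.
- by have [_ <-] := associated_iterE n Dh.
Qed.

Context (F : R[i] -> R[i]) (HF : hol DD F) (F0 : forall z, DD z -> 0 <= complex.Re (F z)).
Hypothesis F1 : forall K : R, exists M : R, forall z, DD z -> M < cmod (phi z) -> K < complex.Re (F z).
Hypothesis F2 : forall M : R, exists K : R, forall z, DD z -> K < complex.Re (F z) -> M < cmod (phi z).

Local Notation V := (fun z => complex.Re (F z)).

(** If escape fails, some sequence in [X] tends to the circle with [phi] bounded. A cluster value of
    [phi] in [U] would, by continuity of the inverse of [phi], keep points of the sequence away from
    the circle. *)
Lemma escapes_of_cluster X :
  (forall p, (forall e, 0 < e -> exists z, [/\ DD z, X z & cmod (phi z - p) < e]) -> U p) ->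
  escapes_on V X.
Proof.
move=> H M; apply: contrapT => nM.
have [ps [Hps psK psU _]] := inverse_riemann; have [Hphi phiU phi_inj phi_surj] := riemann_facts rm.
have /choice[u uP] : forall n : nat, exists z, [/\ DD z, X z, 1 - 2 ^- n < cmod z & V z <= M].
  move=> n; apply: contrapT => nz; apply: nM; exists (1 - 2 ^- n).
    by rewrite ltrBlDr ltrDl invr_gt0 exprn_gt0.
  move=> z Dz Xz zn; rewrite ltNge; apply/negP => zM; apply: nz; by exists z.
have [K HK] := F1 M.
have bd n : cmod ((phi \o u) n) <= K.
  rewrite leNgt; apply/negP => h; have [Du _ _] := uP n.
  by rewrite leNgt (HK _ Du h).
have [p pP] := bounded_cluster bd.
have Up : U p.
  apply: H => e e0; have [n _ h] := pP e 0%N e0; have [Du Xu _ _] := uP n.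
  by exists (u n).
have [Dp pE] := psU p Up.
have p1 : 0 < (1 - cmod (ps p)) / 2 by rewrite divr_gt0 // subr_gt0; exact/unit_diskE.
have [d d0 dH] := hol_cont Hps Up p1.
have [N hN] := exists_geometric_lt p1; have [n Nn h] := pP d N d0.
have [Du _ un _] := uP n; have := dH _ h; rewrite /= psK // => h2.
have := cmod_le_subD (u n) (ps p).
have : (2 ^- n : R) <= 2 ^- N by rewrite lef_pV2 ?posrE ?exprn_gt0 // ler_eXn2l // ltr1n.
by move: hN un h2; lra.
Qed.

Lemma cluster_of_escapes X p : escapes_on V X ->
  (forall e, 0 < e -> exists z, [/\ DD z, X z & cmod (phi z - p) < e]) ->
  exists z, DD z /\ phi z = p.
Proof.
move=> eX H; have [Hphi phiU _ _] := riemann_facts rm.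
have [K HK] := F2 (cmod p + 1); have [rho rho1 Hrho] := eX K.
have /choice[u uP] : forall n : nat, exists z, [/\ DD z, X z & cmod (phi z - p) < 2 ^- n].
  by move=> n; apply: H; rewrite invr_gt0 exprn_gt0.
have bd n : cmod (u n) <= Num.max rho 0.
  have [Du Xu un] := uP n; rewrite leNgt; apply/negP; rewrite gt_max => /andP[h _].
  have := HK _ Du (Hrho _ Du Xu h); have := cmod_le_subD (phi (u n)) p.
  have : (2 ^- n : R) <= 1 by rewrite invf_le1 ?exprn_gt0 // exprn_ege1 // ler1n.
  by move: un; lra.
have [z zP] := bounded_cluster bd.
have Dz : DD z.
  apply/unit_diskE; have m1 : Num.max rho 0 < 1 by rewrite gt_max rho1 ltr01.
  have e0 : 0 < (1 - Num.max rho 0) by rewrite subr_gt0.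
  have [n _ h] := zP _ 0%N e0; have := bd n; have := cmod_le_subD z (u n).
  by move: h; rewrite /disk /= cmodBC; lra.
exists z; split => //; apply/eqP; rewrite -subr_eq0 -cmod_eq0; apply/eqP/le_anti.
rewrite cmod_ge0 andbT; apply: (@le0_all_eps _ _ 2 1 ltr01) => e e0 _.
have [d d0 dH] := hol_cont Hphi Dz e0; have [N hN] := exists_geometric_lt e0.
have [n Nn h] := zP d N d0; have := dH _ h; have [_ _ un] := uP n.
have : (2 ^- n : R) <= 2 ^- N by rewrite lef_pV2 ?posrE ?exprn_gt0 // ler_eXn2l // ltr1n.
have := cmod_triang (phi z) (phi (u n)) p; rewrite (cmodBC (phi z) (phi _)).
by move: un hN; lra.
Qed.

(** Let [p] be a finite limit of [phi] along the preimage. Then [f p] is a finite limit of [phi]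
    along [X], hence a value of [phi], hence in [U]; as [p] is in the closure of [U], it is in [U]
    too. *)
Lemma escapes_preimage X : X `<=` DD -> escapes_on V X -> escapes_on V [set z | DD z /\ X (g z)].
Proof.
move=> XD eX; have [Hphi phiU _ _] := riemann_facts rm.
apply: escapes_of_cluster => p H; apply: (component_preimage Hf fatU).
  by apply/closure_diskP => r r0; have [z [Dz _ h]] := H r r0; exists (phi z) => //; exact: phiU.
have [|z [Dz <-]] := @cluster_of_escapes X (f p) eX; last exact: phiU.
move=> e e0; have [d d0 dH] := hol_cont Hf (I : setT p) e0.
have [z [Dz [_ Xz] h]] := H d d0; have [Dg gE] := associatedE Dz.
by exists (g z); split => //; rewrite gE; exact: dH.
Qed.

End Associated.

(** * Lifting the radial slide through the inner function *)

Section Separated.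
Context {R : realType}.
Implicit Types (z w u p zeta : R[i]) (r s t e M : R) (N S X : set R[i]).

Local Notation DD := (@unit_disk R).

(** Compactness of the segment, through a cluster point of the parameters of points that would leave
    [O]. *)
Lemma segment_thick (O : set R[i]) a b : open O -> (forall t, 0 <= t <= 1 -> O (cseg a b t)) ->
  exists2 e, 0 < e & tube a b 1 e `<=` O.
Proof.
move=> /open_diskP oO sO; apply: contrapT => nO.
have /choice[q qP] : forall n : nat, exists q : R * R[i],
    [/\ 0 <= q.1 <= 1, cmod (q.2 - cseg a b q.1) < 2 ^- n & ~ O q.2].
  move=> n; apply: contrapT => nq; apply: nO; exists (2 ^- n); first by rewrite invr_gt0 exprn_gt0.
  by move=> w [s s01 ws]; apply: contrapT => nw; apply: nq; exists (s, w).
have bd n : cmod ((q n).1%:C) <= 1.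
  by have [/andP[h1 h2] _ _] := qP n; rewrite cmod_real0.
have [p pP] := bounded_cluster bd.
have near n : `|(q n).1 - complex.Re p| <= cmod ((q n).1%:C - p).
  by have := normRe_le ((q n).1%:C - p); rewrite ReB.
have t01 : 0 <= complex.Re p <= 1.
  apply/andP; split; apply/ler_addgt0Pr => e e0; have [n _ h] := pP e 0%N e0.
    have [/andP[h1 h2] _ _] := qP n; have := near n; have := ler_norm ((q n).1 - complex.Re p).
    by move: h; rewrite /disk /=; lra.
  have [/andP[h1 h2] _ _] := qP n; have := near n.
  have := ler_norm (- ((q n).1 - complex.Re p)); rewrite normrN.
  by move: h; rewrite /disk /=; lra.
have [r r0 rO] := oO _ (sO _ t01).
have e0 : 0 < r / 2 / (cmod (b - a) + 1) by rewrite !divr_gt0 // ltr_wpDl ?cmod_ge0.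
have r2 : 0 < r / 2 by rewrite divr_gt0.
have [K hK] := exists_geometric_lt r2; have [n Kn h] := pP _ K e0.
have [_ h2 nO2] := qP n; apply: nO2; apply: rO; rewrite /disk /=.
apply: le_lt_trans (cmod_triang _ (cseg a b (q n).1) _) _.
have -> : cseg a b (q n).1 - cseg a b (complex.Re p) = ((q n).1 - complex.Re p)%:C * (b - a).
  by rewrite /cseg rmorphB /=; ring.
rewrite cmodM cmod_real.
have h3 : `|(q n).1 - complex.Re p| * cmod (b - a) <= r / 2.
  apply: le_trans (ler_wpM2r (cmod_ge0 _) (le_trans (near n) (ltW h))) _.
  rewrite mulrAC ler_pdivrMr ?ltr_wpDl ?cmod_ge0 //.
  by rewrite ler_wpM2l ?(ltW r2) // lerDl.
have : (2 ^- n : R) <= 2 ^- K by rewrite lef_pV2 ?posrE ?exprn_gt0 // ler_eXn2l // ltr1n.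
by move: h2 h3 hK; lra.
Qed.

Context (f phi : R[i] -> R[i]) (U : set R[i]).
Hypotheses (Hf : hol setT f) (fatU : fatou_component f U) (inv : invariant_component f U).
Hypothesis rm : riemann_map U phi.

Context (F : R[i] -> R[i]) (HF : hol DD F) (F0 : forall z, DD z -> 0 <= complex.Re (F z)).
Hypothesis F1 : forall K : R, exists M : R, forall z, DD z -> M < cmod (phi z) -> K < complex.Re (F z).
Hypothesis F2 : forall M : R, exists K : R, forall z, DD z -> K < complex.Re (F z) -> M < cmod (phi z).

Context (A : set R[i]) (domA : domain A) (AU : closure A `<=` U)
  (PA : postsingular_set f `&` U `<=` A).

Local Notation V := (fun z => complex.Re (F z)).
Local Notation g := (associated_map f phi).

(** The set called [W] in the overview. *)
Definition pull : set R[i] := [set z | DD z /\ A (phi z)].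

Lemma pull_open : open pull.
Proof.
have [Hphi _ _ _] := riemann_facts rm; have [/open_diskP oA _ _] := domA.
apply/open_diskP => z [Dz Az]; have [e e0 eA] := oA _ Az.
have [d d0 dH] := hol_cont Hphi Dz e0.
have [d1 d10 dD] := (open_diskP _).1 (@unit_disk_open R) z Dz.
exists (Num.min d d1) => [|w]; first by rewrite lt_min d0.
by rewrite /disk /= lt_min => /andP[w1 w2]; split; [exact: dD|exact/eA/dH].
Qed.

Lemma pull_sub : pull `<=` DD.
Proof. by move=> z []. Qed.

Lemma pull_connected : connected pull.
Proof.
have [ps [Hps psK psU _]] := inverse_riemann f rm.
have [_ _ cA] := domA; have SA : A `<=` U by apply: subset_trans AU; exact: subset_closure.
suff -> : pull = ps @` A by exact: hol_image_connected Hps SA cA.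
apply/seteqP; split => [z [Dz Az]|_ [w Aw <-]]; first by exists (phi z) => //; exact: psK.
by have [h1 h2] := psU w (SA w Aw); split => //; rewrite h2.
Qed.

Lemma pull_neq0 : exists z, pull z.
Proof.
have [_ _ _ phi_surj] := riemann_facts rm; have [_ [w Aw] _] := domA.
by have [z Dz E] := phi_surj w (AU (subset_closure Aw)); exists z; split => //; rewrite E.
Qed.

Lemma pull_escapes : escapes_on V pull.
Proof.
apply: (escapes_of_cluster f rm F1) => p H; apply: AU; apply/closure_diskP => r r0.
by have [z [_ [_ Az] h]] := H r r0; exists (phi z).
Qed.

Lemma pull_avoid w : DD w -> ~ pull w -> ~ postsingular_set f (phi w).
Proof.
have [_ phiU _ _] := riemann_facts rm.
by move=> Dw nW Pw; apply: nW; split => //; apply: PA; split => //; exact: phiU.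
Qed.

Lemma regular_open : open [set w | DD w /\ ~ postsingular_set f (phi w)].
Proof.
have [Hphi _ _ _] := riemann_facts rm.
have /open_diskP oP : open (~` postsingular_set f) by apply: closed_openC; exact: closed_closure.
apply/open_diskP => z [Dz nz]; have [e e0 eP] := oP _ nz; have [d d0 dH] := hol_cont Hphi Dz e0.
have [d1 d10 dD] := (open_diskP _).1 (@unit_disk_open R) z Dz.
exists (Num.min d d1) => [|w]; first by rewrite lt_min d0.
by rewrite /disk /= lt_min => /andP[w1 w2]; split; [exact: dD|apply: eP; exact: dH].
Qed.

Local Notation gg := (gauge pull).

(** Radial projection onto the set where the gauge is at most 1, on which it is the identity. *)
Definition radial_retract w := (Num.max 1 (gg w))^-1%:C * w.

Let gg_lip w w' : `|gg w' - gg w| <= 2 * cmod (w' - w).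
Proof.
have [t0 Wt0] := pull_neq0; rewrite ler_norml; apply/andP; split.
  by rewrite lerNl opprB cmodBC; exact: gauge_lipschitz pull_sub Wt0.
exact: gauge_lipschitz pull_sub Wt0.
Qed.

Lemma radial_retract_lip w w' : DD w -> cmod (radial_retract w - radial_retract w') <= 3 * cmod (w - w').
Proof.
move=> /unit_diskE w1; rewrite /radial_retract.
have m1 (x : R) : 1 <= Num.max 1 x by rewrite le_max lexx.
have m0 (x : R) : 0 < Num.max 1 x by apply: lt_le_trans (m1 x).
set a := Num.max 1 (gg w); set b := Num.max 1 (gg w').
have ab : `|a - b| <= 2 * cmod (w - w').
  apply: le_trans (gg_lip w' w); rewrite /a /b.
  by case: (leP 1 (gg w)) => h1; case: (leP 1 (gg w')) => h2;
    rewrite ?subrr ?normr0 ?normr_ge0 // !ler_norml; case: (ger0P (gg w - gg w')); lra.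
have -> : a^-1%:C * w - b^-1%:C * w' = (a^-1 - b^-1)%:C * w + b^-1%:C * (w - w').
  by rewrite rmorphB /=; ring.
apply: le_trans (cmodD _ _) _; rewrite !cmodM !cmod_real.
have b1 : `|b^-1| <= 1 by rewrite ger0_norm ?invr_ge0 ?(ltW (m0 _)) // invf_le1 ?m0 // m1.
have h1 : `|a^-1 - b^-1| <= 2 * cmod (w - w').
  have -> : a^-1 - b^-1 = (b - a) / (a * b) by field; rewrite !gt_eqF ?m0.
  rewrite normrM distrC; apply: le_trans ab; rewrite ler_piMr //.
  rewrite ger0_norm ?invr_ge0 ?mulr_ge0 ?(ltW (m0 _)) // invf_le1 ?mulr_gt0 ?m0 //.
  by rewrite -[1]mulr1 ler_pM // m1.
have h2 : `|a^-1 - b^-1| * cmod w <= `|a^-1 - b^-1| by rewrite ler_piMr // ltW.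
have h3 : `|b^-1| * cmod (w - w') <= cmod (w - w') by rewrite ler_piMl ?cmod_ge0.
lra.
Qed.

Lemma radial_retract_id w : gg w <= 1 -> radial_retract w = w.
Proof. by move=> h; rewrite /radial_retract max_l // invr1 mul1r. Qed.

(** The domain is part of the data and contains both ends of the slide of [g z]. Its convexity makes
    the common domain of two branches connected, so that their values can be compared. *)
Definition is_branch z N (G : R[i] -> R[i]) :=
  [/\ open N, segment_convex N, N `<=` DD & forall w, N w -> ~ postsingular_set f (phi w)] /\
  [/\ hol N G, forall w, N w -> DD (G w) /\ g (G w) = w, N (g z), N (radial_retract (g z)) &
      G (g z) = z].

(** Along the slide the gauge decreases from its value at [g z] to 1, while it is below 1 on [pull];
    so the slide, and by compactness a tube around it, avoids the postsingular set. *)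
Lemma is_branch_exists z : DD z -> 1 <= gg (g z) -> exists N G, is_branch z N G.
Proof.
move=> Dz p1; have [Dg _] := associatedE inv rm Dz; have [t0 Wt0] := pull_neq0.
set w := g z in Dg p1 *; set a := radial_retract w.
have p0 : 0 < gg w by apply: lt_le_trans p1.
have q1 : (gg w)^-1 <= 1 by rewrite invf_le1.
have aE : a = (gg w)^-1%:C * w by rewrite /a /radial_retract max_r.
have sE t : cseg a w t = ((gg w)^-1 + t * (1 - (gg w)^-1))%:C * w.
  by rewrite aE /cseg rmorphD rmorphM rmorphB rmorph1 /=; ring.
have st t : 0 <= t <= 1 -> (gg w)^-1 <= (gg w)^-1 + t * (1 - (gg w)^-1) <= 1.
  move=> /andP[h0 h1]; have h2 : 0 <= 1 - (gg w)^-1 by rewrite subr_ge0.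
  by have := mulr_ge0 h0 h2; have := ler_piMl h2 h1; move=> h3 h4; apply/andP; split; lra.
have i0 : 0 < (gg w)^-1 by rewrite invr_gt0.
have [e e0 eO] : exists2 e, 0 < e & tube a w 1 e `<=` [set w | DD w /\ ~ postsingular_set f (phi w)].
  apply: segment_thick; first exact: regular_open.
  move=> t /st; rewrite sE; move: (_ + _ * _) => s /andP[s1 s2].
  have s0 : 0 < s by apply: lt_le_trans s1.
  have Ds : DD (s%:C * w).
    apply/unit_diskE; rewrite cmodM cmod_real0 ?(ltW s0) //.
    by apply: le_lt_trans (ler_piMl (cmod_ge0 _) s2) _; exact/unit_diskE.
  split => //; apply: pull_avoid => // /(gauge_lt1 pull_open pull_sub).
  rewrite (gauge_scale _ pull_sub Wt0 s0) ltNge => /negP; apply.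
  by rewrite -ler_pdivrMr // div1r.
pose N := tube a w 1 e.
have Nw : N w.
  have <- : cseg a w 1 = w by rewrite /cseg rmorph1 mul1r addrC subrK.
  by apply: tube_at => //; rewrite ler01 lexx.
have [G [HG GE G0]] := @associated_branch _ f phi U Hf fatU inv rm 1 N z (@tube_open _ a w 1 e)
  (fun x y t => @tube_convex _ a w 1 e x y t) (fun x Nx => (eO x Nx).1) (fun x Nx => (eO x Nx).2) Dz Nw.
exists N, G; split; split => //.
- exact: tube_open.
- by move=> x y t; exact: tube_convex.
- by move=> x /eO[].
- by move=> x /eO[].
- exact: tube_l.
Qed.

Lemma branch_values_unique z N G N' G' v : is_branch z N G -> is_branch z N' G' -> N v -> N' v -> G v = G' v.
Proof.
move=> [[oN cN ND NP] [HG GE Ng _ G0]] [[oN' cN' ND' NP'] [HG' GE' Ng' _ G0']] Nv Nv'.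
apply: (@branch_unique _ f phi U Hf inv rm 1 (N `&` N') G G' (g z)) => //.
- apply: convex_connected => x y t [x1 x2] [y1 y2] t01.
  by split; [exact: cN|exact: cN'].
- by move=> x [/ND].
- move=> x [Nx Nx'] /=; have [D1 E1] := GE x Nx; have [D2 E2] := GE' x Nx'; split => //.
  + exact: hol_cont HG Nx.
  + exact: hol_cont HG' Nx'.
  + by rewrite E1 E2.
  + by rewrite E1; exact: NP.
- by rewrite G0 G0'.
Qed.

(* Move [z] so that [g z] slides radially to the set where the gauge is at most 1. *)
Definition retracts_to z y := (gg (g z) < 1 /\ y = z) \/
  (1 <= gg (g z) /\ exists N G, is_branch z N G /\ y = G (radial_retract (g z))).

Lemma retraction_exists : exists rho : R[i] -> R[i], forall z, DD z -> retracts_to z (rho z).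
Proof.
have /choice[rho rhoP] : forall z, exists y, DD z -> retracts_to z y.
  move=> z; have [Dz|nD] := pselect (DD z); last by exists z.
  have [p1|p1] := ltP (gg (g z)) 1; first by exists z; left.
  have [N [G B]] := is_branch_exists Dz p1; exists (G (radial_retract (g z))) => _; right.
  by split => //; exists N, G.
by exists rho.
Qed.

Lemma retracts_to_id z y : gg (g z) <= 1 -> retracts_to z y -> y = z.
Proof.
move=> p1 [[_ //]|[p2 [N [G [[_ [_ _ _ _ G0]] ->]]]]].
by rewrite radial_retract_id.
Qed.

Lemma retracts_to_image z y : DD z -> retracts_to z y -> DD y /\ gg (g y) <= 1.
Proof.
move=> Dz [[p1 ->]|[p2 [N [G [[_ [HG GE _ Nr G0]] ->]]]]]; first by split=> //; exact: ltW.
have [D1 ->] := GE _ Nr; split => //; have [t0 Wt0] := pull_neq0.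
have p0 : 0 < gg (g z) by apply: lt_le_trans p2.
by rewrite /radial_retract max_r // (gauge_scale _ pull_sub Wt0) ?invr_gt0 // mulVf ?gt_eqF.
Qed.

(** Where the gauge of [g z0] is below 1 the map is locally the identity. Otherwise the branch
    chosen for [z0] also serves nearby points, as [G (g z) = z] there by uniqueness, so [rho] is
    locally [G] after [radial_retract] after [g]. *)
Lemma retraction_cont (rho : R[i] -> R[i]) z0 : (forall z, DD z -> retracts_to z (rho z)) ->
  DD z0 -> ccont rho z0.
Proof.
move=> rhoP D0; have Hg := associated_hol Hf inv rm.
have [d1 d10 dD] := (open_diskP _).1 (@unit_disk_open R) z0 D0.
have [p1|p1] := ltP (gg (g z0)) 1.
  have e1 : 0 < (1 - gg (g z0)) / 2 by rewrite divr_gt0 // subr_gt0.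
  have [d d0 dH] := hol_cont Hg D0 e1.
  have E z : disk z0 (Num.min d d1) z -> rho z = z.
    rewrite /disk /= lt_min => /andP[zd zd1]; apply: (@retracts_to_id z); last exact/rhoP/dD.
    have := gg_lip (g z0) (g z); have := ler_norm (gg (g z) - gg (g z0)).
    by have := dH z zd; lra.
  have m0 : 0 < Num.min d d1 by rewrite lt_min d0.
  move=> e e0; exists (Num.min e (Num.min d d1)) => [|z]; first by rewrite lt_min e0.
  by rewrite lt_min => /andP[ze zd]; rewrite !E //; exact: disk_center.
have [N [G B]] := is_branch_exists D0 p1.
have [[oN cN ND NP] [HG GE Ng Nr G0]] := B.
have [e1 e10 eN] := (open_diskP _).1 oN _ Ng.
have [e2 e20 eN2] := (open_diskP _).1 oN _ Nr.
have [d2 d20 dH2] := hol_cont Hg D0 e10.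
have e3 : 0 < e2 / 3 by rewrite divr_gt0.
have [d3 d30 dH3] := hol_cont Hg D0 e3.
have [d [d0 dd1 dd2 dd3]] : exists d, [/\ 0 < d, d <= d1, d <= d2 & d <= d3].
  exists (Num.min d1 (Num.min d2 d3)); rewrite !lt_min d10 d20 d30 !ge_min !lexx !orbT; split => //.
have inN z : disk z0 d z -> [/\ DD z, N (g z) & N (radial_retract (g z))].
  move=> zd; have Dz : DD z by apply: dD; apply: lt_le_trans zd dd1.
  split => //; first by apply: eN; apply: dH2; apply: lt_le_trans zd dd2.
  have [Dgz _] := associatedE inv rm Dz.
  apply: eN2; rewrite /disk /=; apply: le_lt_trans (radial_retract_lip _ Dgz) _.
  by have := dH3 z (lt_le_trans zd dd3); lra.
have Gg : forall z, disk z0 d z -> G (g z) = z.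
  apply: (@branch_unique _ f phi U Hf inv rm 1 (disk z0 d) (G \o g) id z0) => //=.
  - exact: disk_connected.
  - by move=> z /inN[].
  - move=> z /inN[Dz Nz _]; have [D1 E1] := GE _ Nz; split => //.
    + by apply: ccont_comp; [exact: hol_cont Hg Dz|exact: hol_cont HG Nz].
    + by move=> e e0; exists e.
    + by rewrite E1; exact: NP.
  - exact: disk_center.
have E z : disk z0 d z -> rho z = G (radial_retract (g z)).
  move=> zd; have [Dz Nz Nrz] := inN z zd.
  have Bz : is_branch z N G by split => //; split => //; exact: Gg.
  have [[q1 ->]|[q1 [N' [G' [B' ->]]]]] := rhoP z Dz.
    by rewrite radial_retract_id ?Gg // ltW.
  by have [_ [_ _ _ Nr' _]] := B'; exact: branch_values_unique B' Bz Nr' Nrz.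
move=> e e0; have [s s0 sH] := hol_cont HG Nr e0.
have s3 : 0 < s / 3 by rewrite divr_gt0.
have [d4 d40 dH4] := hol_cont Hg D0 s3.
exists (Num.min d d4) => [|z]; first by rewrite lt_min d0.
rewrite lt_min => /andP[zd zd4]; rewrite !E //; last exact: disk_center.
have [Dz _ _] := inN z zd; have [Dgz _] := associatedE inv rm Dz.
apply: sH; apply: le_lt_trans (radial_retract_lip _ Dgz) _.
by have := dH4 z zd4; lra.
Qed.

Lemma not_radial_large zeta : unit_circle zeta ->
  ~ (forall M, exists2 rho : R, rho < 1 & forall r, rho < r -> r < 1 -> M < V (r%:C * zeta)) ->
  exists2 r, 0 < r & forall z, DD z -> disk zeta r z -> 1 / 2 < cmod (g z).
Proof.
move=> zeta1 nrad; apply: contrapT => nr; apply: nrad.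
have small e : 0 < e -> exists z, [/\ DD z, disk zeta e z & cmod (g z) <= 1 / 2].
  move=> e0; apply: contrapT => ne; apply: nr; exists e => // z Dz ze.
  by rewrite ltNge; apply/negP => h; apply: ne; exists z.
have [t0 Wt0] := pull_neq0; have [rho rhoP] := retraction_exists.
have eX : escapes_on V [set z | DD z /\ (DD (g z) /\ gg (g z) <= 1)].
  apply: (escapes_preimage Hf fatU inv rm F1 F2 (X := [set w | DD w /\ gg w <= 1])); first by move=> w [].
  have H := gauge_escapes HF F0 pull_connected pull_sub Wt0 pull_escapes.
  by move=> M; have [q q1 Hq] := H M; exists q => // z Dz [_ pz]; exact: Hq.
have [z1 [D1 _ g1]] := small 1 ltr01.
(* The gauge is at most 1 on the closed disk of radius 1/2, so the points furnished by [small] do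
   not move. *)
have fixed z : DD z -> cmod (g z) <= 1 / 2 -> rho z = z.
  by move=> Dz gz; apply: retracts_to_id (rhoP z Dz); exact: gauge_half Wt0 gz.
apply: (approach_radial HF F0 eX D1 zeta1) => e e0.
have [z2 [D2 z2e g2]] := small e e0.
(* The retraction carries the segment from [z1] to [z2] to a connected set with the same end points,
   on which [V] escapes. *)
pose S0 : set R[i] := [set cseg z1 z2 t | t in [set t : R | 0 <= t <= 1]].
have inS t : 0 <= t <= 1 -> S0 (cseg z1 z2 t) by move=> t01; exists t.
have S0D : S0 `<=` DD by move=> _ [t t01 <-]; exact: disk_cseg.
exists z2, (rho @` S0); split => //.
- apply: connected_continuous_connected.
    apply: convex_connected => _ _ u [s /andP[s0 s1] <-] [t /andP[t0' t1] <-] /andP[u0 u1].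
    exists (s + u * (t - s)); last by rewrite /cseg rmorphD rmorphM rmorphB /=; ring.
    have -> : s + u * (t - s) = (1 - u) * s + u * t by ring.
    have u2 : 0 <= 1 - u by rewrite subr_ge0.
    apply/andP; split; first by rewrite addr_ge0 ?mulr_ge0.
    by have := ler_wpM2l u2 s1; have := ler_wpM2l u0 t1; lra.
  by apply: continuous_in_subspaceT => z /set_mem /S0D Dz; apply/ccontP; exact: retraction_cont.
- move=> _ [z /S0D Dz <-]; have [h1 h2] := retracts_to_image Dz (rhoP z Dz).
  by split => //; split => //; split => //; have [] := associatedE inv rm h1.
- exists z1; last exact: fixed.
  have <- : cseg z1 z2 0 = z1 by rewrite /cseg rmorph0 mul0r addr0.
  by apply: inS; rewrite lexx ler01.
- exists z2; last exact: fixed.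
  have <- : cseg z1 z2 1 = z2 by rewrite /cseg rmorph1 mul1r addrC subrK.
  by apply: inS; rewrite lexx ler01.
Qed.

Lemma not_radial_avoid zeta : unit_circle zeta ->
  ~ (forall M, exists2 rho : R, rho < 1 & forall r, rho < r -> r < 1 -> M < V (r%:C * zeta)) ->
  exists2 r, 0 < r & forall z, disk zeta r z -> ~ pull z.
Proof.
move=> zeta1 nrad; apply: contrapT => nr; apply: nrad; have [t0 Wt0] := pull_neq0.
apply: (approach_radial HF F0 pull_escapes (pull_sub Wt0) zeta1) => e e0.
have [s [Ws se]] : exists z, pull z /\ disk zeta e z.
  apply: contrapT => ns; apply: nr; exists e => // z ze Wz; by apply: ns; exists z.
exists s, pull; split => //; first exact: pull_connected.
by move=> z Wz; split => //; exact: pull_sub.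
Qed.

End Separated.

(** * Reflection on the sphere and maximal extensions *)

Section ReflectionSphere.
Context {R : realType}.
Implicit Types (z w u v a zeta : R[i]) (r t e : R) (h g G K : R[i] -> R[i]) (x : Chat R).

Local Notation DD := (@unit_disk R).

Lemma conjc0 : conjc 0 = 0 :> R[i].
Proof. by apply/eqP; rewrite eq_complex /= oppr0 !eqxx. Qed.

Lemma reflection0 : reflection (fin 0) = infty :> Chat R.
Proof. by rewrite /reflection /omap /obind /oapp /fin /sphere_inv conjc0 eqxx. Qed.

Lemma reflectionK x : reflection (reflection x) = x.
Proof.
case: x => [z|]; last exact: reflection0.
have [->|z0] := eqVneq z 0; first by rewrite [reflection (Some 0)]reflection0.
rewrite /reflection /=; have c0 : conjc z != 0 by rewrite -cmod_gt0 cmod_conj cmod_gt0.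
rewrite (negbTE c0) /= (fmorphV (@conjc R)) /= conjcK invr_eq0 (negbTE z0).
by rewrite invrK.
Qed.

Lemma reflection_fin z : z != 0 -> reflection (fin z) = fin (conjc z)^-1.
Proof.
by move=> z0; rewrite /reflection /= (negbTE (_ : conjc z != 0)) // -cmod_gt0 cmod_conj cmod_gt0.
Qed.

Lemma maximal_inside h z : DD z -> maximal_domain h (fin z) /\ maximal_extension h (fin z) = fin (h z).
Proof.
move=> /unit_diskE z1; split; last by rewrite /maximal_extension /= z1.
by move=> [w [w1 _] [E]]; move: z1; rewrite -E w1 ltxx.
Qed.

Lemma maximal_reflection h z : DD z -> maximal_domain h (reflection (fin z)) /\
  maximal_extension h (reflection (fin z)) = reflection (fin (h z)).
Proof.
move=> /unit_diskE z1; have [z0|z0] := eqVneq z 0.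
  by rewrite z0 reflection0; split; [move=> [w _]|].
have gt1 : 1 < cmod (conjc z)^-1 by rewrite cmodV cmod_conj invf_gt1 // cmod_gt0.
rewrite reflection_fin //; split.
  by move=> [w [w1 _] [E]]; move: gt1; rewrite -E w1 ltxx.
rewrite /maximal_extension /= ltNge (ltW gt1) gt_eqF //= -[in LHS]reflection_fin // reflectionK.
by [].
Qed.

Lemma maximal_outside h z : 1 < cmod z ->
  maximal_extension h (fin z) = reflection (fin (h (conjc z)^-1)).
Proof.
move=> z1; rewrite /maximal_extension /= ltNge (ltW z1) gt_eqF //= reflection_fin //.
by rewrite -cmod_gt0; exact: lt_trans z1.
Qed.

Lemma maximal_boundary h z : unit_circle z -> maximal_domain h (fin z) ->
  exists H, continues_at h z H /\ maximal_extension h (fin z) = fin (H z).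
Proof.
move=> z1 dz; have [H cH] : exists H, continues_at h z H.
  by apply: contrapT => nH; apply: dz; exists z.
exists H; split => //; rewrite /maximal_extension /= z1 ltxx eqxx.
by rewrite (boundary_valueE z1 cH).
Qed.

Lemma radial_inverse_limit h K a w : unit_circle a -> ccont K w ->
  (forall e, 0 < e -> exists2 rho : R, rho < 1 &
    forall t, rho < t -> t < 1 -> cmod (h (t%:C * a) - w) < e) ->
  (exists2 rho : R, rho < 1 & forall t, rho < t -> t < 1 -> K (h (t%:C * a)) = t%:C * a) ->
  K w = a.
Proof.
move=> a1 Kc hw [rho rho1 E]; apply: (@radial_unique _ (K \o h) a) => e e0.
  by have [d d0 dH] := Kc e e0; have [q q1 qH] := hw d d0; exists q => // t t1 t2; exact/dH/qH.
exists (Num.max rho (1 - e)); first by rewrite gt_max rho1 ltrBlDr ltrDl.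
by move=> t; rewrite gt_max => /andP[t1 t2] t3 /=; rewrite E // radial_dist ?ltW //; lra.
Qed.

End ReflectionSphere.

(** * The inner function and its inverse branches at the circle *)

Section BoundaryDynamics.
Context {R : realType}.
Implicit Types (z w u v a zeta : R[i]) (r s t e M : R) (G H K : R[i] -> R[i]).

Local Notation DD := (@unit_disk R).

Context (f phi : R[i] -> R[i]) (U : set R[i]).
Hypotheses (Hf : hol setT f) (fatU : fatou_component f U) (inv : invariant_component f U).
Hypothesis rm : riemann_map U phi.

Context (F : R[i] -> R[i]) (HF : hol DD F) (F0 : forall z, DD z -> 0 <= complex.Re (F z)).
Hypothesis F1 : forall K : R, exists M : R, forall z, DD z -> M < cmod (phi z) -> K < complex.Re (F z).
Hypothesis F2 : forall M : R, exists K : R, forall z, DD z -> K < complex.Re (F z) -> M < cmod (phi z).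

Context (A : set R[i]) (domA : domain A) (AU : closure A `<=` U)
  (PA : postsingular_set f `&` U `<=` A).

Local Notation V := (fun z => complex.Re (F z)).
Local Notation g := (associated_map f phi).

Definition radially_escaping zeta := forall M, exists2 rho : R, rho < 1 &
  forall r, rho < r -> r < 1 -> M < V (r%:C * zeta).

Lemma Theta_inftyP zeta : unit_circle zeta -> Theta_infty phi zeta <-> radially_escaping zeta.
Proof.
move=> z1; have D rho : rho < 1 -> exists2 q : R, q < 1 & forall r, q < r -> r < 1 -> rho < r /\ DD (r%:C * zeta).
  move=> rho1; exists (Num.max rho 0); first by rewrite gt_max rho1 ltr01.
  by move=> r; rewrite gt_max => /andP[r1 r2] r3; split => //; apply: radial_disk => //; exact: ltW.
split=> [[_ /cvg_fin_inftyP H] M|H].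
  have [K HK] := F1 M; have [rho rho1 P] := H K; have [q q1 Q] := D rho rho1.
  by exists q => // r r1 r2; have [h1 h2] := Q r r1 r2; apply: HK => //; exact: P.
split=> //; apply/cvg_fin_inftyP => M; have [K HK] := F2 M; have [rho rho1 P] := H K.
have [q q1 Q] := D rho rho1; exists q => // r r1 r2; have [h1 h2] := Q r r1 r2.
by apply: HK => //; exact: P.
Qed.

Lemma Theta_CP zeta : Theta_C phi zeta <-> unit_circle zeta /\ ~ radially_escaping zeta.
Proof.
split=> [[z1 n]|[z1 n]]; split=> //; by apply: contra_not n => /(Theta_inftyP z1).
Qed.

Lemma associated_mirror zeta : Theta_C phi zeta -> exists H s, mirror_extension g zeta H s.
Proof.
move=> /Theta_CP[z1 nrad].
have [r r0 large] := not_radial_large Hf fatU inv rm HF F0 F1 F2 domA AU PA z1 nrad.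
apply: (@reflection_principle _ zeta g F r) => //.
- by apply: hol_sub (associated_hol Hf inv rm) => z [].
- move=> z Dz zr; rewrite large //=; apply/unit_diskE.
  by have [] := associatedE inv rm Dz.
move=> e e0.
(* Vacuous, as this disk stays away from the circle; but its preimage by [g] then escapes too. So
   near the circle either [cmod (g z)] is at least [expR (- e)] or [e * V z] exceeds 1, and the
   lower bound 1/2 on [g] suffices in the second case. *)
have eY : escapes_on V [set w | DD w /\ cmod w < expR (- e)].
  move=> M; exists (expR (- e)); first by rewrite -expR0 ltr_expR oppr_lt0.
  by move=> z _ [_ h1] /(lt_trans h1); rewrite ltxx.
have [rho rho1 H] := escapes_preimage Hf fatU inv rm F1 F2 (fun w (h : _ /\ _) => h.1) eY e^-1.
exists rho => // z Dz zr zrho; have lg := large z Dz zr.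
have g0 : 0 < cmod (g z) by lra.
have [gs|gl] := ltP (cmod (g z)) (expR (- e)).
  have Vz : e^-1 < V z by apply: H => //; split => //; split => //; have [] := associatedE inv rm Dz.
  apply: (@le_trans _ _ (expR 1)).
    apply: le_trans (expR_ge1Dx (1 : R)).
    by rewrite -(ler_pM2r g0) mulVf ?gt_eqF //; lra.
  rewrite ler_expR mulrDr mulr1; have : 1 <= e * V z by rewrite mulrC -ler_pdivrMr // div1r ltW.
  by lra.
apply: (@le_trans _ _ (expR e)).
  by rewrite -[leRHS]invrK -expRN lef_pV2 ?posrE ?expR_gt0.
by rewrite ler_expR mulrDr mulr1 lerDl mulr_ge0 ?(ltW e0) // F0.
Qed.

(** If [V] escaped radially at [H zeta], then also along [g (r%:C * zeta)], which is at bounded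
    hyperbolic distance from [r%:C * H zeta]. So [f (phi (r%:C * zeta))] would tend to infinity, and
    since [f] is bounded on bounded sets, so would [phi], against the choice of [zeta]. *)
Lemma associated_boundary zeta H s : Theta_C phi zeta -> mirror_extension g zeta H s ->
  Theta_C phi (H zeta).
Proof.
move=> TC [s0 HH HD H1 _]; have /Theta_CP[z1 nrad] := TC.
have zs := disk_center zeta s0; have w1 : unit_circle (H zeta) by exact: H1.
apply/Theta_CP; split => // esc; have [_] := TC; apply.
have [k k0 kH] := one_sub_norm_lower (associated_hol Hf inv rm)
  (fun z Dz => (associatedE inv rm Dz).1).
have [d d0 dH] := hol_dv HH zs (@ltr01 R).
set C := cmod (dv H zeta) + 1.
have C0 : 0 < C by rewrite ltr_wpDl ?cmod_ge0.
have HC z : disk zeta d z -> cmod (H z - H zeta) <= C * cmod (z - zeta).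
  move=> /dH h; have := cmod_le_subD (H z - H zeta) (dv H zeta * (z - zeta)).
  by rewrite cmodM; rewrite mul1r in h; rewrite /C mulrDl mul1r; move: h; lra.
pose c := Num.min 1 k.
have [c0 c1 ck] : [/\ 0 < c, c <= 1 & c <= k] by rewrite /c lt_min ltr01 k0 !ge_min !lexx orbT.
clearbody c.
have [q q0 qH] := @harnack_comparable R c (C + 1) c0 (addr_gt0 C0 ltr01).
split => //; apply/cvg_fin_inftyP => M.
have [B HB] : exists B : R, forall p, cmod p <= M -> cmod (f p) <= B.
  have cf (x : R[i]) e : 0 < e -> exists2 d', 0 < d' & forall w, disk x d' w -> `|cmod (f w) - cmod (f x)| < e.
    by move=> e0; exact: (cmod_cont_hol Hf (I : setT x) e0).
  have [M0|M0] := leP 0 M; last first.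
    by exists 0 => p pM; have := cmod_ge0 p; lra.
  have c00 : cdisk 0 M (0 : R[i]) by rewrite /cdisk /= subrr cmod0.
  have [x _ xm] := @compact_max _ (cdisk 0 M) (fun p => cmod (f p)) (@cdisk_compact0 _ M)
    (ex_intro _ _ c00) (fun x _ => cf x).
  by exists (cmod (f x)) => p pM; apply: xm; rewrite /cdisk /= subr0.
have [L HL] := F2 B; have [rho rho1 P] := esc (L / q).
have m1 : Num.max rho (Num.max 0 (Num.max (1 - s) (1 - d))) < 1.
  by rewrite !gt_max rho1 ltr01 !ltrBlDr !ltrDl s0 d0.
exists (Num.max rho (Num.max 0 (Num.max (1 - s) (1 - d)))) => // r.
rewrite !gt_max => /and4P[r1 r2 r3 r4] r5.
have Dr : DD (r%:C * zeta) by apply: radial_disk => //; exact: ltW.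
have dist := radial_dist z1 (ltW r5).
have Hg : H (r%:C * zeta) = g (r%:C * zeta).
  by apply: HD => //; rewrite /disk /= dist; move: r3; lra.
rewrite ltNge; apply/negP => /HB; have [Dg <-] := associatedE inv rm Dr.
rewrite leNgt => /negP; apply; apply: HL => //.
have Vr := P r r1 r5.
have cw : cmod (r%:C * H zeta) = r by rewrite cmodM w1 mulr1 cmod_real0 // ltW.
have cz : cmod (r%:C * zeta) = r by rewrite cmodM z1 mulr1 cmod_real0 // ltW.
have e0 : 0 < 1 - r by rewrite subr_gt0.
have hg : cmod (g (r%:C * zeta) - H zeta) <= C * (1 - r).
  by rewrite -Hg -dist; apply: HC; rewrite /disk /= dist; move: r4; lra.
apply: lt_le_trans (qH F HF F0 (r%:C * H zeta) (g (r%:C * zeta)) (1 - r) e0 _ _ _ _).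
- by rewrite mulrC -ltr_pdivrMr.
- by rewrite cw ler_piMl // ltW.
- by apply: le_trans (kH _ Dr); rewrite cz ler_wpM2r // ltW.
- by rewrite cw ler_peMl ?(ltW e0) // lerDr ltW.
apply: le_trans (cmod_triang _ (H zeta) _) _; rewrite (cmodBC (H zeta)) radial_dist ?(ltW r5) //.
by rewrite mulrDl mul1r lerD2r.
Qed.

Lemma iter_mirror n zeta : Theta_C phi zeta -> exists H s,
  mirror_extension (iter n g) zeta H s /\ Theta_C phi (H zeta).
Proof.
move=> TC; elim: n => [|n [H [s [mH TH]]]].
  exists id, 1; split => //; split => //; first exact: hol_id.
  move=> z _ z1 /=; have z0 : z != 0 by rewrite -cmod_gt0; exact: lt_trans z1.
  have cz : conjc z != 0 by rewrite -cmod_gt0 cmod_conj cmod_gt0.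
  by rewrite invr_eq0 cz (fmorphV (@conjc R)) /= conjcK invrK.
have [K [q mK]] := associated_mirror TH; have [z1 _] := TC.
have [e me] := mirror_comp z1 (fun z Dz => (associated_iterE inv rm n Dz).1) mH mK.
by exists (K \o H), e; split => //; exact: associated_boundary TH mK.
Qed.

Section Branches.
Context (n : nat) (zeta : R[i]) (r : R) (z1 : unit_circle zeta).
Hypothesis avoid : forall z, disk zeta r z -> ~ pull phi A z.

Local Notation h := (iter n g).
Local Notation N := (DD `&` disk zeta r).

Let N_open : open N.
Proof. by apply: openI; [exact: unit_disk_open|exact: disk_open]. Qed.

Let N_convex : segment_convex N.
Proof. by move=> z w t [z1' z2] [w1 w2] t01; split; exact: disk_cseg. Qed.

Let N_avoid w : N w -> ~ postsingular_set f (phi w).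
Proof. by move=> [Dw wr]; apply: (pull_avoid rm PA) => //; exact: avoid. Qed.

Let branch z : DD z -> N (h z) -> exists G,
  [/\ hol N G, forall w, N w -> DD (G w) /\ h (G w) = w & G (h z) = z].
Proof.
by move=> Dz Nz; apply: (associated_branch Hf fatU inv rm) => // w [].
Qed.

(** The branch is fixed at one point of the radius; uniqueness of lifts along the end of the radius
    makes it recover every later point. *)
Lemma radial_branch a w : unit_circle a -> disk zeta r w ->
  (forall e, 0 < e -> exists2 rho : R, rho < 1 &
    forall t, rho < t -> t < 1 -> cmod (h (t%:C * a) - w) < e) ->
  exists G, [/\ hol N G, forall w, N w -> DD (G w) /\ h (G w) = w &
    exists2 rho : R, rho < 1 & forall t, rho < t -> t < 1 -> N (h (t%:C * a)) /\ G (h (t%:C * a)) = t%:C * a].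
Proof.
move=> a1 wr hw; have e0 : 0 < r - cmod (w - zeta) by rewrite subr_gt0.
have [q q1 qH] := hw _ e0; pose rho := Num.max q 0.
have [rho0 rho1 qrho] : [/\ 0 <= rho, rho < 1 & q <= rho].
  by rewrite /rho le_max lexx orbT gt_max q1 ltr01 le_max lexx.
have DN t : rho < t -> t < 1 -> DD (t%:C * a) /\ N (h (t%:C * a)).
  move=> t1 t2; have Dt : DD (t%:C * a) by apply: radial_disk => //; exact/ltW/(le_lt_trans rho0).
  split => //; split; first by have [] := associated_iterE inv rm n Dt.
  have := qH t (le_lt_trans qrho t1) t2; have := cmod_triang (h (t%:C * a)) w zeta.
  by rewrite /disk /=; lra.
have [t0 [t01 t02]] : exists t, rho < t /\ t < 1 by exists ((1 + rho) / 2); split; lra.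
have [D0 N0] := DN _ t01 t02; have [G [HG GE G0]] := branch D0 N0.
exists G; split => //; exists rho => // t t1 t2; have [Dt Nt] := DN t t1 t2; split => //.
pose S : set R[i] := [set x%:C * a | x in [set x : R | rho < x < 1]].
have SE z : S z -> DD z /\ N (h z) by move=> [x /andP[x1 x2] <-]; exact: DN.
apply: (@branch_unique _ f phi U Hf inv rm n S (G \o h) id (t0%:C * a)) => //=.
- apply: convex_connected => _ _ u [x /andP[x1 x2] <-] [y /andP[y1 y2] <-] /andP[u0 u1].
  exists (x + u * (y - x)); last by rewrite /cseg rmorphD rmorphM rmorphB /=; ring.
  have -> : x + u * (y - x) = (1 - u) * x + u * y by ring.
  have [->|u1'] := eqVneq u 1; first by rewrite /= subrr mul0r add0r mul1r y1.
  have u2 : 0 < 1 - u by rewrite subr_gt0 lt_neqAle u1'.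
  have b1 : (1 - u) * rho < (1 - u) * x by rewrite ltr_pM2l.
  have b2 : (1 - u) * x < (1 - u) * 1 by rewrite ltr_pM2l.
  have b3 := ler_wpM2l u0 (ltW y1); have b4 := ler_wpM2l u0 (ltW y2).
  by apply/andP; split; lra.
- by move=> z /SE[].
- move=> z /SE[Dz Nz]; have [D1 E1] := GE _ Nz; split => //.
  + apply: ccont_comp; last exact: hol_cont HG Nz.
    apply: (hol_cont _ Dz); apply: hol_iter; first exact: associated_hol Hf inv rm.
    by move=> x Dx; have [] := associatedE inv rm Dx.
  + by move=> e e1; exists e.
  + by rewrite E1; exact: N_avoid.
- by exists t0 => //; rewrite /= t01.
- by exists t => //; rewrite /= t1.
Qed.

(** As [h] inverts [G], [one_sub_norm_lower] for [h] gives [k * (1 - cmod (G z)) <= 1 - cmod z]. So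
    [cmod (G z)] really tends to 1 at the circle, and the reflection principle applies with
    [F = 0]. *)
Lemma branch_mirror G v : hol N G -> (forall w, N w -> DD (G w) /\ h (G w) = w) ->
  unit_circle v -> disk zeta r v -> exists H s, mirror_extension G v H s /\ disk v s `<=` disk zeta r.
Proof.
move=> HG GE v1 vr.
have Hh : hol DD h.
  apply: hol_iter; first exact: associated_hol Hf inv rm.
  by move=> x Dx; have [] := associatedE inv rm Dx.
have [k k0 kH] := one_sub_norm_lower Hh (fun z Dz => (associated_iterE inv rm n Dz).1).
have [d d0 dH] := (open_diskP _).1 (@disk_open _ zeta r) v vr.
have G1 z : N z -> k * (1 - cmod (G z)) <= 1 - cmod z.
  by move=> /GE[Dg E]; rewrite -{2}E; exact: kH.
have [s [s0 sd sk]] : exists s, [/\ 0 < s, s <= d & s <= k / 2].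
  by exists (Num.min d (k / 2)); rewrite lt_min d0 divr_gt0 // !ge_min !lexx orbT.
have S z : DD z -> disk v s z -> N z by move=> Dz zs; split => //; apply: dH; apply: lt_le_trans zs sd.
have [H [q mH]] : exists H s, mirror_extension G v H s.
  apply: (@reflection_principle _ v G (fun=> 0) s) => //.
  - by apply: hol_sub HG => z [Dz zs]; exact: S.
  - exact: hol_cst.
  - move=> z Dz zs; have Nz := S z Dz zs; have [/unit_diskE Dg _] := GE z Nz.
    rewrite Dg andbT; have := G1 z Nz; have := cmod_le_subD v z; rewrite v1 cmodBC.
    have zk : cmod (z - v) < k / 2 by apply: lt_le_trans zs sk.
    move=> b1 b2; have b3 : k * (1 - cmod (G z)) < k * (1 / 2) by lra.
    by rewrite ltr_pM2l // in b3; lra.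
  - move=> e e0; have x1 : expR (- e) < 1 by rewrite -expR0 ltr_expR oppr_lt0.
    exists (1 - k * (1 - expR (- e))); first by rewrite ltrBlDr ltrDl mulr_gt0 // subr_gt0.
    move=> z Dz zs zl; have b := G1 z (S z Dz zs).
    have b3 : k * (1 - cmod (G z)) < k * (1 - expR (- e)) by lra.
    rewrite ltr_pM2l // in b3; have gx : expR (- e) <= cmod (G z) by lra.
    rewrite addr0 mulr1 -[leRHS]invrK -expRN lef_pV2 ?posrE ?expR_gt0 //.
    by apply: lt_le_trans gx; exact: expR_gt0.
have [q0 _ _ _ _] := mH; have m0 : 0 < Num.min q s by rewrite lt_min q0.
exists H, (Num.min q s); split; first by apply: (mirror_shrink mH) => //; rewrite ge_min lexx.
by move=> z zq; apply: dH; apply: lt_le_trans zq _; rewrite ge_min sd orbT.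
Qed.

Lemma branch_extension G : hol N G -> (forall w, N w -> DD (G w) /\ h (G w) = w) ->
  sphere_holomorphic_on (disk zeta r) (fun v => maximal_extension G (fin v)) /\
  forall v, disk zeta r v -> maximal_domain h (maximal_extension G (fin v)) /\
    maximal_extension h (maximal_extension G (fin v)) = fin v.
Proof.
move=> HG GE; split=> v vr; have [v1|v1|v1] := ltgtP (cmod v) 1.
- have Nv : N v by split => //; exact/unit_diskE.
  have [d d0 dH] := (open_diskP _).1 N_open v Nv.
  exists G; left; apply/near_diskP; exists d => // w /dH Nw; split; last exact: (maximal_inside G Nw.1).2.
  exact: ((holP _ _).2 HG).
- have oO : open [set w : R[i] | disk zeta r w /\ 1 < cmod w].
    apply/open_diskP => w [wr w1]; have [d d0 dH] := (open_diskP _).1 (@disk_open _ zeta r) w wr.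
    exists (Num.min d (cmod w - 1)); first by rewrite lt_min d0 subr_gt0.
    move=> u; rewrite /disk /= lt_min => /andP[ud uw]; split; first exact: dH.
    by have := cmod_le_subD w u; rewrite cmodBC; lra.
  have [d d0 dH] := (open_diskP _).1 oO v (conj vr v1).
  (* The chart at infinity is needed here: the extension is infinite where the reflected branch
     vanishes. *)
  exists (fun z => conjc (G (conjc z)^-1)); right; apply/near_diskP; exists d => // w /dH[wr w1].
  split; last by rewrite maximal_outside.
  have w0 : conjc w != 0 by rewrite -cmod_gt0 cmod_conj; exact: lt_trans w1.
  have [l Gl] := HG _ (mirror_point z1 wr w1).
  apply/cderivableP; eexists.
  exact: (@cder_conj _ (G \o (fun u => u^-1)) w _ (cder_comp Gl (cder_inv w0))).
- have [H [s [mH sr]]] := branch_mirror HG GE v1 vr; have [s0 HH _ _ _] := mH.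
  exists H; left; apply/near_diskP; exists s => // w ws; split; first exact: ((holP _ _).2 HH).
  exact: (mirror_maximal mH ws).2.
- have Nv : N v by split => //; exact/unit_diskE.
  have [Dg gE] := GE v Nv; rewrite (maximal_inside G Nv.1).2.
  by have [h1 ->] := maximal_inside h Dg; rewrite gE.
- have Nv := mirror_point z1 vr v1; have [Dg gE] := GE _ Nv.
  have v0 : (conjc v)^-1 != 0 by rewrite invr_eq0 -cmod_gt0 cmod_conj; exact: lt_trans v1.
  rewrite maximal_outside //; have [h1 ->] := maximal_reflection h Dg; split => //.
  by rewrite gE reflection_fin // (fmorphV (@conjc R)) /= conjcK invrK.
- have [H [s [mH sr]]] := branch_mirror HG GE v1 vr; have [s0 HH _ _ _] := mH.
  have [H1 [K cK KE]] := @boundary_inverse _ h G v H s v1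
    (fun z Dz zs => GE z (conj Dz (sr z zs))) mH.
  rewrite (mirror_maximal mH (disk_center v s0)).2; split.
    by move=> [w [_ nw] [E]]; apply: nw; exists K; rewrite E.
  by rewrite /maximal_extension /= H1 ltxx eqxx (boundary_valueE H1 cK) KE.
Qed.

Lemma inverse_branches : inverse_branches_defined (maximal_domain h) (maximal_extension h) (disk zeta r).
Proof.
have use G x w : hol N G -> (forall w, N w -> DD (G w) /\ h (G w) = w) ->
    maximal_extension G (fin w) = x -> exists G : R[i] -> Chat R,
      [/\ sphere_holomorphic_on (disk zeta r) G,
          forall v, disk zeta r v -> maximal_domain h (G v) /\ maximal_extension h (G v) = fin v &
          G w = x].
  move=> HG GE E; have [h1 h2] := branch_extension HG GE.
  by exists (fun v => maximal_extension G (fin v)).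
(* Treats exterior preimages and the preimage infinity together: both are reflections of points [a]
   of the disk. *)
have outer a w : DD a -> disk zeta r w -> maximal_extension h (reflection (fin a)) = fin w ->
    exists2 G, hol N G /\ (forall w, N w -> DD (G w) /\ h (G w) = w) &
      maximal_extension G (fin w) = reflection (fin a).
  move=> Da wr; have [_ ->] := maximal_reflection h Da; have [Dh _] := associated_iterE inv rm n Da.
  have [h0|h0] := eqVneq (h a) 0.
    by rewrite h0 reflection0.
  rewrite reflection_fin // => -[E].
  have hE : (conjc w)^-1 = h a by rewrite -E (fmorphV (@conjc R)) /= conjcK invrK.
  have w1 : 1 < cmod w.
    by rewrite -E cmodV cmod_conj invf_gt1 ?cmod_gt0 //; exact/unit_diskE.
  have Nw := mirror_point z1 wr w1; rewrite hE in Nw.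
  have [G [HG GE G0]] := branch Da Nw.
  by exists G => //; rewrite maximal_outside // hE G0.
move=> x w Xx wr xw; case: x Xx xw => [a|] Xa aw.
  have [a1|a1|a1] := ltgtP (cmod a) 1.
  - have Da : DD a by exact/unit_diskE.
    have [_ E] := maximal_inside h Da; rewrite E in aw; case: aw => aw.
    have [Dh _] := associated_iterE inv rm n Da.
    have [|G [HG GE G0]] := branch Da; first by split => //; rewrite aw.
    apply: (use G) => //; rewrite aw in Dh G0.
    by have [_ ->] := maximal_inside G Dh; rewrite G0.
  - have a0 : a != 0 by rewrite -cmod_gt0; exact: lt_trans a1.
    have rE : reflection (fin (conjc a)^-1) = fin a by rewrite -reflection_fin // reflectionK.
    have Da : DD (conjc a)^-1 by apply/unit_diskE; rewrite cmodV cmod_conj invf_lt1 // cmod_gt0.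
    have [|G [HG GE] E] := outer _ w Da wr; first by rewrite rE.
    by apply: (use G) => //; rewrite E rE.
  - have [H [cH E]] := maximal_boundary a1 Xa; rewrite E in aw; case: aw => Hw.
    have hw := continues_radial a1 cH; rewrite Hw in hw.
    have [G [HG GE [rho rho1 rad]]] := radial_branch a1 wr hw.
    have rad2 : exists2 rho : R, rho < 1 & forall t, rho < t -> t < 1 -> G (h (t%:C * a)) = t%:C * a.
      by exists rho => // t t1 t2; have [] := rad t t1 t2.
    (* [w] is a radial limit of a self-map of the disk. *)
    have w1 : cmod w <= 1.
      apply/ler_addgt0Pr => e e0; have [q q1 qH] := hw e e0.
      pose t := (1 + Num.max q rho) / 2; have m1 : Num.max q rho < 1 by rewrite gt_max q1.
      have m2 : q <= Num.max q rho by rewrite le_max lexx.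
      have m3 : rho <= Num.max q rho by rewrite le_max lexx orbT.
      have [t1 t2 t3] : [/\ q < t, rho < t & t < 1] by rewrite /t; split; lra.
      have := qH t t1 t3; have [[/unit_diskE b _] _] := rad t t2 t3.
      by have := cmod_le_subD w (h (t%:C * a)); rewrite cmodBC; lra.
    move: w1; rewrite le_eqVlt => /orP[/eqP w1|w1].
      have [K [s [mK sr]]] := branch_mirror HG GE w1 wr; have [s0 HK KD _ _] := mK.
      apply: (use G) => //; have ws := disk_center w s0; rewrite (mirror_maximal mK ws).2; congr fin.
      apply: (@radial_inverse_limit _ h K a w) => //; first exact: hol_cont HK ws.
      have [q q1 qH] := hw s s0; exists (Num.max q rho); first by rewrite gt_max q1.
      move=> t; rewrite gt_max => /andP[t1 t2] t3; have [[Dt _] E'] := rad t t2 t3.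
      by rewrite KD //; exact: qH.
    (* A boundary preimage of an interior point is impossible: the branch [G] would take the value
       [a], of modulus 1, at [w]. *)
    have Nw : N w by split => //; exact/unit_diskE.
    have Gw : G w = a by apply: (@radial_inverse_limit _ h G a w) => //; exact: hol_cont HG Nw.
    by have [/unit_diskE + _] := GE w Nw; rewrite Gw a1 ltxx.
have D0 : DD 0 by apply/unit_diskE; rewrite cmod0.
have [|G [HG GE] E] := outer 0 w D0 wr; first by rewrite reflection0.
by apply: (use G) => //; rewrite E reflection0.
Qed.

End Branches.
End BoundaryDynamics.

(** * Exceptional sets, singularities and radial limits *)

Section Assembly.
Context {R : realType}.
Implicit Types (z w u v a zeta : R[i]) (r s t e M : R) (G H K : R[i] -> R[i]).

Local Notation DD := (@unit_disk R).

Lemma extension_of_mirror h zeta H s : mirror_extension h zeta H s ->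
  extension_holomorphic_on h (disk zeta s).
Proof.
move=> mH; have [s0 HH _ _ _] := mH; exists H; first exact/holP.
by move=> z; exact: (mirror_maximal mH).
Qed.

Lemma Sing_not_mirror h zeta H s : unit_circle zeta -> mirror_extension h zeta H s -> ~ Sing h zeta.
Proof.
move=> z1 mH [_]; apply; exists H; have [s0 _ _ _ _] := mH.
by apply: (mirror_continues mH) => //; exact: disk_center.
Qed.

Context (f phi : R[i] -> R[i]) (U : set R[i]).
Hypotheses (Hf : hol setT f) (fatU : fatou_component f U) (inv : invariant_component f U).
Hypothesis rm : riemann_map U phi.

Context (F : R[i] -> R[i]) (HF : hol DD F) (F0 : forall z, DD z -> 0 <= complex.Re (F z)).
Hypothesis F1 : forall K : R, exists M : R, forall z, DD z -> M < cmod (phi z) -> K < complex.Re (F z).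
Hypothesis F2 : forall M : R, exists K : R, forall z, DD z -> K < complex.Re (F z) -> M < cmod (phi z).

Context (A : set R[i]) (domA : domain A) (AU : closure A `<=` U)
  (PA : postsingular_set f `&` U `<=` A).

Local Notation g := (associated_map f phi).

Lemma Theta_infty_negligible (B : set R[i]) : (forall zeta, Theta_C phi zeta -> ~ B zeta) ->
  circle_negligible B.
Proof.
have := escape_negligible HF F0; rewrite /circle_negligible => /negligibleS nS CB.
apply: nS => t [t01 Bt]; split => //=; have z1 : unit_circle (cis t) := cmod_cis t.
apply: contrapT => nr; apply: (CB (cis t)) => //.
by apply/(Theta_CP F1 F2); split.
Qed.

Lemma Sing_Theta_infty n zeta : Sing (iter n g) zeta -> Theta_infty phi zeta.
Proof.
move=> Sz; have [z1 _] := Sz; apply: contrapT => nT.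
have [H [s [mH _]]] := iter_mirror Hf fatU inv rm HF F0 F1 F2 domA AU PA n (conj z1 nT).
exact: Sing_not_mirror z1 mH Sz.
Qed.

Lemma inner_radial_limit zeta l : unit_circle zeta -> radial_limit g zeta l ->
  exists2 a, l = fin a & cmod a <= 1 /\ forall e, 0 < e -> exists2 rho : R, rho < 1 &
    forall t, rho < t -> t < 1 -> cmod (g (t%:C * zeta) - a) < e.
Proof.
move=> z1 rl.
have g1 t : 0 < t -> t < 1 -> cmod (g (t%:C * zeta)) < 1.
  move=> t0 t1; apply/unit_diskE; have Dt : DD (t%:C * zeta) by apply: radial_disk => //; exact: ltW.
  by have [] := associatedE inv rm Dt.
have mid (p : R) : p < 1 -> exists t, [/\ p < t, 0 < t & t < 1].
  move=> p1; exists ((1 + Num.max p 0) / 2).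
  have m1 : Num.max p 0 < 1 by rewrite gt_max p1 ltr01.
  have m2 : p <= Num.max p 0 by rewrite le_max lexx.
  have m3 : 0 <= Num.max p 0 by rewrite le_max lexx orbT.
  by split; lra.
case: l rl => [a|] rl; last first.
  have [p p1 pH] := (cvg_fin_inftyP _).1 rl 1; have [t [t1 t0 t2]] := mid p p1.
  by have := pH t t1 t2; have := g1 t t0 t2; lra.
exists a => //; have lim := (cvg_fin_finP _ _).1 rl; split; last exact: lim.
apply/ler_addgt0Pr => e e0; have [p p1 pH] := lim e e0; have [t [t1 t0 t2]] := mid p p1.
have := pH t t1 t2; rewrite /disk /= => h; have := g1 t t0 t2.
by have := cmod_le_subD a (g (t%:C * zeta)); rewrite cmodBC; lra.
Qed.

(** The asymptotic curve is the image by [phi] of the radius at [zeta]; along it [f] equals [phi]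
    after [g]. *)
Lemma asymptotic_of_limit zeta a : Theta_infty phi zeta -> DD a ->
  (forall e, 0 < e -> exists2 rho : R, rho < 1 &
    forall t, rho < t -> t < 1 -> cmod (g (t%:C * zeta) - a) < e) -> asymptotic_value f (phi a).
Proof.
move=> [z1 esc] Da lim; have [Hphi _ _ _] := riemann_facts rm.
exists (fun t => phi (t%:C * zeta)); split; first split => //.
  apply: continuous_in_subspaceT => t /set_mem /=; rewrite in_itv /= => /andP[t0 t1].
  apply/cvgrPdist_lt => e e0.
  have Dt : DD (t%:C * zeta) by apply: radial_disk.
  have ep : 0 < complex.Re e by move: e0; rewrite ltcE /= => /andP[].
  have eE : e = (complex.Re e)%:C by move: e0; rewrite ltcE /= => /andP[/eqP e1 _]; case: (e) e1 => x y /= ->.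
  have [d d0 dH] := hol_cont Hphi Dt ep.
  apply/nbhs_ballP; exists d => //= s; rewrite /ball /= distrC => sd.
  rewrite normC_cmod eE ltcR cmodBC; apply: dH.
  by rewrite -mulrBl -rmorphB cmodM z1 mulr1 cmod_real.
apply/cvg_CP => e e0; have [d d0 dH] := hol_cont Hphi Da e0; have [q q1 qH] := lim d d0.
exists (Num.max q 0); first by rewrite gt_max q1 ltr01.
move=> t; rewrite gt_max => /andP[t1 t2] t3.
have Dt : DD (t%:C * zeta) by apply: radial_disk => //; exact: ltW.
have [_ <-] := associatedE inv rm Dt; rewrite /disk /=; apply: dH; exact: qH.
Qed.

(** If [a] were in [Theta_C], the branch of the inverse of [g] that follows the radius at [zeta]
    would extend across the circle at [a], with value [zeta]. The local inverse of this extension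
    would continue [g] at [zeta]. *)
Lemma singular_limit_Theta_infty zeta a : Sing g zeta -> unit_circle a ->
  (forall e, 0 < e -> exists2 rho : R, rho < 1 &
    forall t, rho < t -> t < 1 -> cmod (g (t%:C * zeta) - a) < e) -> Theta_infty phi a.
Proof.
move=> [z1 nS] a1 lim; apply: contrapT => nT; apply: nS.
have /(Theta_CP F1 F2)[_ nrad] : Theta_C phi a by [].
have [r r0 avoid] := not_radial_avoid f rm HF F0 F1 domA AU a1 nrad.
have [G [HG GE rad]] := @radial_branch _ f phi U Hf fatU inv rm A PA 1 a r avoid
  zeta a z1 (disk_center a r0) lim.
have [H [s [mH sr]]] := branch_mirror Hf inv rm HG GE a1 (disk_center a r0).
have [s0 HH HD _ _] := mH; have as_ := disk_center a s0.
have [H1 [K cK KE]] := @boundary_inverse _ g G a H s a1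
    (fun z Dz zs => GE z (conj Dz (sr z zs))) mH.
have E : H a = zeta.
  apply: (@radial_inverse_limit _ g H zeta a) => //; first exact: hol_cont HH as_.
  have [p p1 pH] := rad; have [q q1 qH] := lim s s0.
  exists (Num.max p q); first by rewrite gt_max p1.
  move=> t; rewrite gt_max => /andP[t1 t2] t3; have [[Dt _] E] := pH t t1 t3.
  by rewrite HD //; exact: qH.
by exists K; rewrite -E.
Qed.

End Assembly.

Unset Implicit Arguments.
Set Strict Implicit.
Set Printing Implicit Defensive.

Theorem theoremC (R : realType) (f : R[i] -> R[i]) (U : set R[i])
    (phi : R[i] -> R[i])
    (f_transcendental : transcendental_entire f)
    (U_component : fatou_component f U)
    (U_invariant : invariant_component f U)
    (U_accessible : infty_accessible U)
    (phi_riemann : riemann_map U phi)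
    (U_separated : postsingularly_separated f U) :
  let g := associated_map f phi in
  [/\ (* (a) *)
      forall zeta, unit_circle zeta ->
        (Theta_C phi zeta ->
           ~ Sing g zeta /\
           exists2 w, maximal_extension g (fin zeta) = fin w & Theta_C phi w) /\
        (forall n, (1 <= n)%N -> Sing (iter n g) zeta -> Theta_infty phi zeta),
      (* (b) *)
      ae_circle (fun zeta =>
        exists2 r : R, 0 < r & extension_holomorphic_on g (disk zeta r)) /\
      circle_negligible (Sing g),
      (* (c) *)
      ae_circle (fun zeta =>
        (exists2 r : R, 0 < r & forall n,
           inverse_branches_defined (maximal_domain (iter n g))
             (maximal_extension (iter n g)) (disk zeta r)) /\
        (forall n, (1 <= n)%N -> exists2 rho : R, 0 < rho &
           extension_holomorphic_on (iter n g) (disk zeta rho))) &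
      (* (d) *)
      forall zeta, Sing g zeta -> forall l : Chat R, radial_limit g zeta l ->
        exists2 a, l = fin a &
          (unit_disk a /\ U (phi a) /\ asymptotic_value f (phi a)) \/
          Theta_infty phi a].
Proof.
move=> g; have Hf : hol setT f by case: f_transcendental => /holP.
have [F [HF F0 F1 F2]] := escape_function phi_riemann.
have [A [domA AU PA]] := U_separated.
have mir n zeta := @iter_mirror _ f phi U Hf U_component U_invariant phi_riemann F HF F0 F1 F2
  A domA AU PA n zeta.
have null := @Theta_infty_negligible _ phi F HF F0 F1 F2.
have sing n zeta := @Sing_Theta_infty _ f phi U Hf U_component U_invariant phi_riemann F HF F0 F1 F2
  A domA AU PA n zeta.
have ext n zeta : Theta_C phi zeta -> exists2 r : R, 0 < r & extension_holomorphic_on (iter n g) (disk zeta r).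
  move=> /(mir n)[H [s [mH _]]]; exists s; first by have [] := mH.
  exact: extension_of_mirror mH.
split.
- move=> zeta z1; split; last by move=> n _; exact: sing.
  move=> TC; have [H [s [mH TH]]] := mir 1%N zeta TC; split.
    by move=> Sz; have [_] := TC; apply; exact: (sing 1%N).
  exists (H zeta) => //; have [s0 _ _ _ _] := mH.
  by have [_] := mirror_maximal mH (disk_center zeta s0).
- split; first by apply: null => zeta /(ext 1%N)[r r0 E] /= nE; apply: nE; exists r.
  by apply: null => zeta [_ nT] /(sing 1%N).
- apply: null => zeta TC nE; apply: nE; split; last by move=> n _; exact: ext.
  have [z1 nrad] := (Theta_CP F1 F2 zeta).1 TC.
  (* This disk is chosen before [n], and missing [pull] is all that branches of every order require
     of it. *)
  have [r r0 avoid] := not_radial_avoid f phi_riemann HF F0 F1 domA AU z1 nrad.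
  exists r => // n.
  exact (@inverse_branches _ f phi U Hf U_component U_invariant phi_riemann A PA n zeta r z1 avoid).
- move=> zeta Sz l rl; have [z1 _] := Sz.
  have [a -> [a1 lim]] := inner_radial_limit U_invariant phi_riemann z1 rl.
  (* A singularity lies in [Theta_infty], so [phi] maps its radius to a curve tending to infinity,
     as an asymptotic value requires. *)
  exists a => //; have Tz : Theta_infty phi zeta by exact: (sing 1%N).
  move: a1; rewrite le_eqVlt => /orP[/eqP a1|a1].
    right; exact (@singular_limit_Theta_infty _ f phi U Hf U_component U_invariant phi_riemann
      F HF F0 F1 F2 A domA AU PA zeta a Sz a1 lim).
  have Da : unit_disk a by exact/unit_diskE.
  left; split => //; split; first by have [_ phiU _ _] := riemann_facts phi_riemann; exact: phiU.
  exact (@asymptotic_of_limit _ f phi U U_invariant phi_riemann zeta a Tz Da lim).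
Qed.
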